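(* Let $c\colon Q\to G$ be a continuous homomorphism of an $r$-discrete Hausdorff groupoid $Q$ into a discrete group $G$, let $N=c^{-1}(e)$, and let $\delta$ be the coaction of $G$ on $C^*(Q)$ determined by $\delta(f)=f\otimes s$ whenever $s\in G$ and $f\in C_c(Q)$ satisfies $\operatorname{supp} f\subseteq c^{-1}(s)$. Assume that the natural map $i\colon C^*(N)\to C^*(Q)$ is faithful. Then $$C^*(Q)\times_\delta G\cong C^*(Q\times_c G),$$ equivariantly for the dual action $\widehat\delta$ of $G$ on $C^*(Q)\times_\delta G$ and the action $\beta$ of $G$ on $C^*(Q\times_cG)$ determined by $\beta_s(f)(x,t)=f(x,ts)$ for $s,t\in G$, $f\in C_c(Q\times_cG)$, $x\in Q$.
   Context: Groupoids are locally compact topological groupoids. A groupoid $Q$ is $r$-discrete if its range map $r$ is a local homeomorphism onto the unit space $Q^0$ (so counting measures on the sets $Q^u=r^{-1}(u)$ give a Haar system). $C_c(Q)$ is a $^*$-algebra with $(fg)(x)=\sum_{r(y)=r(x)}f(y)g(y^{-1}x)$ and $f^*(x)=\overline{f(x^{-1})}$, and $C^*(Q)$, the full groupoid $C^*$-algebra, is the enveloping $C^*$-algebra of $C_c(Q)$. Given a continuous homomorphism $c\colon Q\to G$ into a discrete group with identity $e$, $N=c^{-1}(e)$ is an open $r$-discrete subgroupoid of $Q$, and $i\colon C^*(N)\to C^*(Q)$ is the homomorphism extending the inclusion (by zero) of $C_c(N)$ in $C_c(Q)$. The skew-product groupoid $Q\times_cG$ is the set $Q\times G$ with the product topology and operations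 $(x,c(y)s)(y,s)=(xy,s)$ for composable $(x,y)$ and $s\in G$, and $(x,s)^{-1}=(x^{-1},c(x)s)$; it is $r$-discrete. $G$ acts on it by $s\cdot(x,t)=(x,ts^{-1})$, and $\beta$ is the induced action on $C^*(Q\times_cG)$. For a discrete group $G$, $C^*(G)$ is the full group $C^*$-algebra, with elements of $G$ identified with their canonical unitaries. A coaction of $G$ on a $C^*$-algebra $A$ is an injective nondegenerate homomorphism $\delta\colon A\to A\otimes C^*(G)$ (spatial tensor product) with $(\delta\otimes\mathrm{id})\circ\delta=(\mathrm{id}\otimes\delta_G)\circ\delta$, where $\delta_G(t)=t\otimes t$ for $t\in G$. (A coaction on $C^*(Q)$ with the stated values exists, and is clearly unique.) A covariant representation of $(A,G,\delta)$ is a pair $(\pi,\mu)$ of nondegenerate homomorphisms of $A$ and $C_0(G)$ into a multiplier algebra $M(B)$ with $(\pi\otimes\mathrm{id})(\delta(a))=(\mu\otimes\mathrm{id})(w_G)(\pi(a)\otimes1)(\mu\otimes\mathrm{id})(w_G)^*$ for $a\in A$, where $w_G\in M(C_0(G)\otimes C^*(G))$ is the function $s\mapsto s$. The crossed product $A\times_\delta G$ is the universal $C^*$-algebra generated by a covariant representation $(j_A,j_G)$ of $(A,G,\delta)$; it is densely spanned by the products $j_A(a)j_G(g)$. The dual action $\widehat\delta$ is given by $\widehat\delta_s(j_A(a)j_G(\chi_{\{u\}}))=j_A(a)j_G(\chi_{\{us^{-1}\}})$ for $s,u\in G$, $a\in A$, where $\chi_K$ denotes the characteristic function of $K$. ''Equivariantly''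 means that there is an isomorphism intertwining the two actions of $G$. *)

(* Defs.v *)
From HB Require Import structures.
From mathcomp Require Import all_boot all_order all_algebra.
From mathcomp Require Import all_classical all_reals all_analysis.
From mathcomp Require Import complex.

Set Implicit Arguments.
Unset Strict Implicit.
Unset Printing Implicit Defensive.

Import Order.TTheory GRing.Theory Num.Theory numFieldNormedType.Exports.

Local Open Scope classical_set_scope.
Local Open Scope ring_scope.

(* MathComp, MathComp-Analysis and real-closed.  The complex numbers are
   R[i] for a realType R; norms take their (real) values in R[i]. *)
Definition Cplx (R : realType) : numClosedFieldType := complex R.

(** * C*-algebras *)

Record cstarAlgebra (R : realType) := CStarAlgebra {
  cs_car :> completeNormedModType (Cplx R);
  cs_mul : cs_car -> cs_car -> cs_car;
  cs_star : cs_car -> cs_car;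
  cs_mulA : associative cs_mul;
  cs_mulDl : left_distributive cs_mul +%R;
  cs_mulDr : right_distributive cs_mul +%R;
  cs_mulZl : forall (k : Cplx R) x y, cs_mul (k *: x) y = k *: cs_mul x y;
  cs_mulZr : forall (k : Cplx R) x y, cs_mul x (k *: y) = k *: cs_mul x y;
  cs_starK : involutive cs_star;
  cs_starD : {morph cs_star : x y / x + y};
  cs_starZ : forall (k : Cplx R) x, cs_star (k *: x) = k^* *: cs_star x;
  cs_starM : forall x y, cs_star (cs_mul x y) = cs_mul (cs_star y) (cs_star x);
  cs_normM : forall x y, `|cs_mul x y| <= `|x| * `|y|;
  cs_normS : forall x, `|cs_mul (cs_star x) x| = `|x| ^+ 2
}.

(* A *-algebra given as the subset sa_dom of a vector space (in practice a
   space of functions), closed under sa_mul and sa_star; the values of the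
   operations outside sa_dom are irrelevant. *)
Record starAlgebra (R : realType) := StarAlgebra {
  sa_car :> lmodType (Cplx R);
  sa_dom : set sa_car;
  sa_mul : sa_car -> sa_car -> sa_car;
  sa_star : sa_car -> sa_car
}.

Definition cs_starAlgebra (R : realType) (A : cstarAlgebra R) : starAlgebra R :=
  @StarAlgebra R (cs_car A) setT (@cs_mul R A) (@cs_star R A).
Coercion cs_starAlgebra : cstarAlgebra >-> starAlgebra.

Definition dense_span (R : realType) (V : normedModType (Cplx R))
    (E : set V) : Prop :=
  closure [set v : V | exists (n : nat) (k : 'I_n -> Cplx R) (e : 'I_n -> V),
    (forall i, E (e i)) /\ v = \sum_(i < n) k i *: e i] = setT.

Definition is_star_hom (R : realType) (S : starAlgebra R) (B : cstarAlgebra R)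
    (phi : S -> B) : Prop :=
  [/\ forall (k : Cplx R) x y, sa_dom x -> sa_dom y ->
        phi (k *: x + y) = k *: phi x + phi y,
      forall x y, sa_dom x -> sa_dom y ->
        phi (sa_mul x y) = cs_mul (phi x) (phi y)
    & forall x, sa_dom x -> phi (sa_star x) = cs_star (phi x)].

(** ** Multipliers *)

(* M(B) is the algebra of adjointable operators on the Hilbert B-module B,
   whose inner product is <a, b> = a^* b. *)
Record multiplier (R : realType) (B : cstarAlgebra R) := Multiplier {
  mult_fun :> B -> B;
  mult_adj : B -> B;
  mult_adjP : forall a b,
    cs_mul (cs_star (mult_fun a)) b = cs_mul (cs_star a) (mult_adj b)
}.

Definition is_mult_hom (R : realType) (S : starAlgebra R) (B : cstarAlgebra R)
    (phi : S -> multiplier B) : Prop :=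
  [/\ forall (k : Cplx R) x y b, sa_dom x -> sa_dom y ->
        phi (k *: x + y) b = k *: phi x b + phi y b,
      forall x y b, sa_dom x -> sa_dom y -> phi (sa_mul x y) b = phi x (phi y b)
    & forall x b, sa_dom x -> phi (sa_star x) b = mult_adj (phi x) b].

Definition nondegenerate (R : realType) (S : starAlgebra R)
    (B : cstarAlgebra R) (phi : S -> multiplier B) : Prop :=
  dense_span [set b : B | exists x c, sa_dom x /\ b = phi x c].

(** ** Representations on Hilbert spaces *)

Record hilbert (R : realType) := Hilbert {
  h_car :> completeNormedModType (Cplx R);
  ip : h_car -> h_car -> Cplx R;
  ip_linear : forall (k : Cplx R) x y z,
    ip (k *: x + y) z = k * ip x z + ip y z;
  ip_conj : forall x y, ip y x = (ip x y)^*;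
  ip_norm : forall x, `|x| ^+ 2 = ip x x
}.

Definition is_rep (R : realType) (S : starAlgebra R) (H : hilbert R)
    (pi : S -> H -> H) : Prop :=
  [/\ forall x, sa_dom x -> linear (pi x) /\ continuous (pi x),
      forall (k : Cplx R) x y h, sa_dom x -> sa_dom y ->
        pi (k *: x + y) h = k *: pi x h + pi y h,
      forall x y h, sa_dom x -> sa_dom y -> pi (sa_mul x y) h = pi x (pi y h)
    & forall x h k, sa_dom x -> ip (pi x h) k = ip h (pi (sa_star x) k)].

(* The enveloping C*-algebra: the (Hausdorff) completion of S for the
   seminorm f |-> sup {|pi(f)| : pi a *-representation of S}. *)
Record enveloping (R : realType) (S : starAlgebra R) := Enveloping {
  env_alg :> cstarAlgebra R;
  env_map : S -> env_alg;
  env_hom : is_star_hom env_map;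
  env_dense : closure [set env_map f | f in @sa_dom R S] = setT;
  env_ub : forall (H : hilbert R) (pi : S -> H -> H), is_rep pi ->
    forall f h, sa_dom f -> `|pi f h| <= `|env_map f| * `|h|;
  env_lub : forall f (eps : Cplx R), sa_dom f -> 0 < eps ->
    exists (H : hilbert R) (pi : S -> H -> H) (h : H),
      [/\ is_rep pi, `|h| <= 1 & `|env_map f| - eps < `|pi f h|]
}.

(** ** Spatial tensor products *)

(* Squared norm of the sum of the h (x) k, for (h, k) in s, in the Hilbert
   space tensor product of H and K. *)
Definition tensor_normsq (R : realType) (H K : hilbert R) (s : seq (H * K)) :
    Cplx R :=
  \sum_(p <- s) \sum_(q <- s) ip p.1 q.1 * ip p.2 q.2.

(* The operator \sum_((a, b) <- s) pi(a) (x) sigma(b) on the Hilbert space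
   tensor product of H and K has norm at most M. *)
Definition tensor_op_le (R : realType) (A B : cstarAlgebra R) (H K : hilbert R)
    (pi : A -> H -> H) (sigma : B -> K -> K) (s : seq (A * B)) (M : Cplx R) :
    Prop :=
  forall h : seq (H * K),
    tensor_normsq [seq (pi p.1 q.1, sigma p.2 q.2) | p <- s, q <- h]
      <= M ^+ 2 * tensor_normsq h.

(* The norm of \sum_i a_i (x) b_i is the norm of \sum_i pi(a_i) (x) sigma(b_i)
   for a pair of faithful representations pi and sigma, and this is the largest
   of these operator norms over all pairs of representations. *)
Record tensorProduct (R : realType) (A B : cstarAlgebra R) := TensorProduct {
  tp_alg :> cstarAlgebra R;
  tens : A -> B -> tp_alg;
  tens_linearl : forall (k : Cplx R) a a' b,
    tens (k *: a + a') b = k *: tens a b + tens a' b;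
  tens_linearr : forall (k : Cplx R) a b b',
    tens a (k *: b + b') = k *: tens a b + tens a b';
  tens_mul : forall a a' b b',
    tens (cs_mul a a') (cs_mul b b') = cs_mul (tens a b) (tens a' b');
  tens_star : forall a b, tens (cs_star a) (cs_star b) = cs_star (tens a b);
  tens_dense : dense_span [set x : tp_alg | exists a b, x = tens a b];
  tens_norm_ub : forall (H K : hilbert R) (pi : A -> H -> H)
      (sigma : B -> K -> K), @is_rep R A H pi -> @is_rep R B K sigma ->
    forall s : seq (A * B),
      tensor_op_le pi sigma s `|\sum_(p <- s) tens p.1 p.2|;
  tens_norm_attained : exists (H K : hilbert R) (pi : A -> H -> H)
      (sigma : B -> K -> K),
    [/\ @is_rep R A H pi /\ injective pi,
        @is_rep R B K sigma /\ injective sigma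
      & forall (s : seq (A * B)) (M : Cplx R), 0 <= M ->
          tensor_op_le pi sigma s M -> `|\sum_(p <- s) tens p.1 p.2| <= M]
}.

(** * Groupoids *)

(* g_mul is total; only its values on composable pairs matter. *)
Record groupoidData (Q : Type) := GroupoidData {
  g_comp : Q -> Q -> Prop;
  g_mul : Q -> Q -> Q;
  g_inv : Q -> Q
}.

Definition is_groupoid (Q : Type) (D : groupoidData Q) : Prop :=
  [/\ involutive (g_inv D),
      forall x y z, g_comp D x y -> g_comp D y z ->
        [/\ g_comp D (g_mul D x y) z, g_comp D x (g_mul D y z)
          & g_mul D (g_mul D x y) z = g_mul D x (g_mul D y z)],
      forall x, g_comp D (g_inv D x) x /\ g_comp D x (g_inv D x),
      forall x y, g_comp D x y -> g_mul D (g_inv D x) (g_mul D x y) = y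
    & forall z x, g_comp D z x -> g_mul D (g_mul D z x) (g_inv D x) = z].

Definition g_range (Q : Type) (D : groupoidData Q) (x : Q) : Q :=
  g_mul D x (g_inv D x).

Definition g_units (Q : Type) (D : groupoidData Q) : set Q :=
  range (g_range D).

Definition is_topological_groupoid (Q : topologicalType) (D : groupoidData Q) :
    Prop :=
  [/\ is_groupoid D, continuous (g_inv D)
    & {within [set p : Q * Q | g_comp D p.1 p.2],
        continuous (fun p : Q * Q => g_mul D p.1 p.2)}].

(* f is a local homeomorphism of X onto the subspace Y of Z. *)
Definition local_homeo_onto (X Z : topologicalType) (f : X -> Z) (Y : set Z) :
    Prop :=
  [/\ range f = Y, continuous f
    & forall x, exists U : set X,
        [/\ open U, U x, {in U &, injective f}
          & forall W : set X, open W -> W `<=` U ->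
              exists2 V : set Z, open V & f @` W = V `&` Y]].

Definition r_discrete (Q : topologicalType) (D : groupoidData Q) : Prop :=
  [/\ is_topological_groupoid D, locally_compact [set: Q]
    & local_homeo_onto (g_range D) (g_units D)].

Definition supp (R : realType) (Q : topologicalType) (f : Q -> Cplx R) : set Q :=
  closure [set x | f x != 0].

Definition conv (R : realType) (Q : topologicalType) (D : groupoidData Q)
    (f g : Q -> Cplx R) (x : Q) : Cplx R :=
  \sum_(y \in [set y | g_range D y = g_range D x])
    f y * g (g_mul D (g_inv D y) x).

Definition Cc (R : realType) (Q : topologicalType) (D : groupoidData Q) :
    starAlgebra R :=
  @StarAlgebra R (Q -> Cplx R)
    [set f | continuous f /\ compact (supp f)]
    (conv D) (fun f x => (f (g_inv D x))^*).

Notation groupoidCstar R D := (enveloping (Cc R D)).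

Definition is_groupoid_hom (Q : topologicalType) (D : groupoidData Q)
    (G : groupType) (c : Q -> G) : Prop :=
  forall x y, g_comp D x y -> c (g_mul D x y) = (c x * c y)%g.

(* The subgroupoid carried by the subset A, with the subspace topology on the
   subtype A.  The default value in insubd is used only when A fails to be
   closed under the operations, or for non-composable pairs. *)
Definition subgroupoid (Q : topologicalType) (D : groupoidData Q) (A : set Q) :
    groupoidData A :=
  @GroupoidData A
    (fun x y => g_comp D (val x) (val y))
    (fun x y => insubd x (g_mul D (val x) (val y)))
    (fun x => insubd x (g_inv D (val x))).

Definition extend0 (R : realType) (Q : Type) (A : set Q) (f : A -> Cplx R)
    (x : Q) : Cplx R :=
  oapp f 0 (insub x).

(* (x, t)(y, s) is defined when x and y are composable and t = c(y) s. *)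
Definition skew_product (Q : topologicalType) (D : groupoidData Q)
    (G : groupType) (c : Q -> G) :
    groupoidData (Q * discrete_topology G)%type :=
  @GroupoidData (Q * discrete_topology G)%type
    (fun p q => g_comp D p.1 q.1 /\ p.2 = (c q.1 * (q.2 : G))%g)
    (fun p q => (g_mul D p.1 q.1, q.2))
    (fun p => (g_inv D p.1, (c p.1 * (p.2 : G))%g)).

(** * Coactions of discrete groups *)

Definition group_algebra (R : realType) (G : groupType) : starAlgebra R :=
  @StarAlgebra R (G -> Cplx R)
    [set f | finite_set [set s | f s != 0]]
    (fun f g s => \sum_(t \in [set: G]) f t * g (t^-1 * s)%g)
    (fun f s => (f s^-1%g)^*).

Notation groupCstar R G := (enveloping (group_algebra R G)).

Definition chi (R : realType) (G : groupType) (u : G) : G -> Cplx R :=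
  fun t => (t == u)%:R.

Definition unitary (R : realType) (G : groupType) (CG : groupCstar R G)
    (s : G) : CG :=
  env_map CG (chi R s).

Definition C0 (R : realType) (G : groupType) (V : normedModType (Cplx R))
    (mul : V -> V -> V) (star : V -> V) : starAlgebra R :=
  @StarAlgebra R (G -> V)
    [set F | forall eps : Cplx R, 0 < eps ->
      finite_set [set s | eps <= `|F s|]]
    (fun F F' s => mul (F s) (F' s)) (fun F s => star (F s)).

Definition C0G (R : realType) (G : groupType) : starAlgebra R :=
  C0 G (V := Cplx R) *%R Num.conj.

(* C_0(G, B), which is identified with the tensor product of C_0(G) and B. *)
Definition C0GB (R : realType) (G : groupType) (B : cstarAlgebra R) :
    starAlgebra R :=
  C0 G (V := cs_car B) (@cs_mul R B) (@cs_star R B).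

(* In the coaction identity, d1 is delta (x) id and d2 is id (x) delta_G, with
   A (x) (C*(G) (x) C*(G)) identified with (A (x) C*(G)) (x) C*(G). *)
Definition is_coaction (R : realType) (G : groupType) (CG : groupCstar R G)
    (A : cstarAlgebra R) (T : tensorProduct A CG) (delta : A -> T) : Prop :=
  [/\ @is_star_hom R A T delta,
      injective delta,
      dense_span [set x : T | exists a y, x = cs_mul (delta a) y]
    & exists (T2 : tensorProduct T CG) (d1 d2 : T -> T2),
        [/\ @is_star_hom R T T2 d1,
            forall a z, d1 (tens T a z) = tens T2 (delta a) z,
            @is_star_hom R T T2 d2,
            forall a s, d2 (tens T a (unitary CG s)) =
              tens T2 (tens T a (unitary CG s)) (unitary CG s)
          & forall a, d1 (delta a) = d2 (delta a)]].

(* Phi is pi (x) id on A (x) C*(G) and Psi is mu (x) id on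
   C_0(G) (x) C*(G) = C_0(G, C*(G)), both with values in M(B (x) C*(G)).
   W is (mu (x) id)(w_G) for the canonical extension of Psi to multipliers:
   w_G is the multiplier F |-> (s |-> s F(s)) of C_0(G, C*(G)).
   P a is pi(a) (x) 1. *)
Definition is_covariant (R : realType) (G : groupType) (CG : groupCstar R G)
    (A : cstarAlgebra R) (T : tensorProduct A CG) (delta : A -> T)
    (B : cstarAlgebra R) (pi : A -> multiplier B)
    (mu : (G -> Cplx R) -> multiplier B) : Prop :=
  [/\ @is_mult_hom R A B pi /\ @nondegenerate R A B pi,
      @is_mult_hom R (C0G R G) B mu /\ @nondegenerate R (C0G R G) B mu
    & exists (TB : tensorProduct B CG)
        (Phi : T -> multiplier TB) (Psi : (G -> CG) -> multiplier TB)
        (W : multiplier TB) (P : A -> multiplier TB),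
        [/\ @is_mult_hom R T TB Phi /\
              (forall a z b y, Phi (tens T a z) (tens TB b y) =
                 tens TB (pi a b) (cs_mul z y)),
            @is_mult_hom R (C0GB G CG) TB Psi /\
              (forall g z b y, @sa_dom R (C0G R G) g ->
                 Psi (fun s => g s *: z) (tens TB b y) =
                 tens TB (mu g b) (cs_mul z y)),
            forall F x, @sa_dom R (C0GB G CG) F ->
              W (Psi F x) = Psi (fun s => cs_mul (unitary CG s) (F s)) x,
            forall a b y, P a (tens TB b y) = tens TB (pi a b) y
          & forall a x, Phi (delta a) x = W (P a (mult_adj W x))]].

(* The multiplier m n of D belongs to D, where it is the element d. *)
Definition prod_is (R : realType) (D : cstarAlgebra R) (m n : multiplier D)
    (d : D) : Prop :=
  forall x, m (n x) = cs_mul d x.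

(* In the universal property, the two equations say that the canonical
   extension of Phi to M(D) maps cp_A to pi and cp_G to mu. *)
Record crossedProduct (R : realType) (G : groupType) (CG : groupCstar R G)
    (A : cstarAlgebra R) (T : tensorProduct A CG) (delta : A -> T) :=
  CrossedProduct {
  cp_alg :> cstarAlgebra R;
  cp_A : A -> multiplier cp_alg;
  cp_G : (G -> Cplx R) -> multiplier cp_alg;
  cp_covariant : is_covariant delta cp_A cp_G;
  cp_in : forall a g, @sa_dom R (C0G R G) g ->
    exists d : cp_alg, prod_is (cp_A a) (cp_G g) d;
  cp_dense : dense_span [set d : cp_alg | exists a g,
    @sa_dom R (C0G R G) g /\ prod_is (cp_A a) (cp_G g) d];
  cp_universal : forall (B : cstarAlgebra R) (pi : A -> multiplier B)
      (mu : (G -> Cplx R) -> multiplier B), is_covariant delta pi mu ->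
    exists Phi : cp_alg -> multiplier B,
      [/\ @is_mult_hom R cp_alg B Phi, @nondegenerate R cp_alg B Phi,
          forall a d b, Phi (cp_A a d) b = pi a (Phi d b)
        & forall g d b, @sa_dom R (C0G R G) g ->
            Phi (cp_G g d) b = mu g (Phi d b)]
}.

Definition is_action (R : realType) (G : groupType) (A : cstarAlgebra R)
    (alpha : G -> A -> A) : Prop :=
  [/\ forall s, @is_star_hom R A A (alpha s),
      forall a, alpha 1%g a = a
    & forall s t a, alpha (s * t)%g a = alpha s (alpha t a)].

Definition is_dual_action (R : realType) (G : groupType) (CG : groupCstar R G)
    (A : cstarAlgebra R) (T : tensorProduct A CG) (delta : A -> T)
    (D : crossedProduct delta) (alpha : G -> D -> D) : Prop :=
  is_action alpha /\
  forall s u a d d',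
    prod_is (cp_A D a) (cp_G D (chi R u)) d ->
    prod_is (cp_A D a) (cp_G D (chi R (u * s^-1)%g)) d' ->
    alpha s d = d'.

Definition equivariantly_isomorphic (R : realType) (G : groupType)
    (A B : cstarAlgebra R) (alpha : G -> A -> A) (beta : G -> B -> B) : Prop :=
  exists theta : A -> B,
    [/\ @is_star_hom R A B theta, bijective theta
      & forall s a, theta (alpha s a) = beta s (theta a)].

(* Main.v *)
Require Import Defs.
From HB Require Import structures.
From mathcomp Require Import all_boot all_order all_algebra.
From mathcomp Require Import all_classical all_reals all_analysis.
From mathcomp Require Import complex.
From mathcomp Require Import ring lra.

Set Implicit Arguments.
Unset Strict Implicit.
Unset Printing Implicit Defensive.

Import Order.TTheory GRing.Theory Num.Theory numFieldNormedType.Exports.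

Local Open Scope classical_set_scope.
Local Open Scope ring_scope.

(* The algebra Cc(Q x_c G) is the algebra of finitely supported G x G matrices
   over Cc(Q) whose (r, v) entry has degree r v^-1 for the grading given by c.
   Cc(Q) acts on these matrices by left convolution and C_0(G) by multiplying
   rows.  Both actions are bounded on C*(Q x_c G) and form a covariant pair, so
   they induce Phi from the crossed product to M(C*(Q x_c G)); it maps
   j_A(f) j_G(chi_v) to left multiplication by the matrix whose column v is f.

   Conversely, covariance forces j_G(chi_u) j_A(f) = j_A(f) j_G(chi_(s^-1 u))
   when f has degree s, so the elements j_A(f) j_G(chi_v) multiply like matrices
   with one column and define a *-homomorphism D from Cc(Q x_c G) onto a dense
   subalgebra of the crossed product.  As Phi (D F) is left multiplication by F,
   |F| <= |D F|.  For the other inequality, the representations of Cc(Q x_c G)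
   on l^2(G) (x) H bound each entry of F by |F|, hence |D F| <= n^2 |F| when
   F is supported in an n x n block; the powers of F^* F lie in the same block,
   and the C*-identity removes the constant.

   States are not available to produce representations of an abstract
   C*-algebra.  Norm estimates come instead from square roots: for self-adjoint
   a with |a| < 1 there is r commuting with a such that (1 - r)^2 = 1 - a^2, and
   then a + i (1 - r) acts isometrically wherever a acts by a *-homomorphism. *)

(** * Real-valued norms *)

(** All four C*-algebras are abstract and known only through norm bounds and universal properties,
    so every map out of them is built on generators: a norm inequality between formal linear
    combinations both defines it and bounds it. The square root is what makes such inequalities
    provable: for commuting self-adjoint a and r with (1 - r)^2 = 1 - a^2, the element a + i (1 - r)
    is unitary in the sense that a^2 + (1 - r)^2 = 1.

    Covariance of a pair into M(B) involves a spatial tensor product of B with C*(G), which has to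
    be constructed for B = C*(Q x_c G). This is possible because enveloping algebras are separated
    by representations by their very definition.

    The action of Cc(Q) on matrices is first shown to be bounded by some constant: an element of
    degree s maps rows to rows injectively, and beta makes its norm the same on all rows. Being then
    a representation, it is bounded by the norm of C*(Q).

    The relation between j_G and j_A is rigid because distinct group elements have distinct
    unitaries: between row w and row u, covariance says that an elementary tensor z (x) s equals z
    (x) u w^-1. *)

Section RealScalars.
Variable R : realType.
Notation K := (Cplx R).

Definition rc (r : R) : K := real_complex R r.
Definition cre (z : K) : R := complex.Re z.

Lemma rcK : cancel rc cre. Proof. by []. Qed.
Lemma rc0 : rc 0 = 0. Proof. exact: rmorph0. Qed.
Lemma rc1 : rc 1 = 1. Proof. exact: rmorph1. Qed.
Lemma rcD x y : rc (x + y) = rc x + rc y. Proof. exact: rmorphD. Qed.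
Lemma rcN x : rc (- x) = - rc x. Proof. exact: rmorphN. Qed.
Lemma rcB x y : rc (x - y) = rc x - rc y. Proof. exact: rmorphB. Qed.
Lemma rcM x y : rc (x * y) = rc x * rc y. Proof. exact: rmorphM. Qed.
Lemma rcX x n : rc (x ^+ n) = rc x ^+ n. Proof. exact: rmorphXn. Qed.
Lemma rcV x : rc x^-1 = (rc x)^-1. Proof. exact: fmorphV. Qed.
Lemma rc_nat n : rc n%:R = n%:R. Proof. exact: rmorph_nat. Qed.
Lemma rc_le x y : (rc x <= rc y) = (x <= y). Proof. exact: lecR. Qed.
Lemma rc_lt x y : (rc x < rc y) = (x < y). Proof. exact: ltcR. Qed.
Lemma rc_inj : injective rc. Proof. exact: can_inj rcK. Qed.
Lemma rc_conj x : (rc x)^* = rc x. Proof. by apply/CrealP; apply/complex_realP; exists x. Qed.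

Lemma creK z : 0 <= z -> rc (cre z) = z.
Proof. by move=> /ger0_real zr; rewrite /rc /cre RRe_real. Qed.

End RealScalars.

Section Nm.
Variable R : realType.
Notation K := (Cplx R).
(** Norms are valued in [Cplx R], whose order is only partial. Their real parts live in [R], where
    infima, square roots and linear arithmetic are available. *)
Definition nm (V : normedZmodType K) (x : V) : R := cre `|x|.
Variable V : normedZmodType K.
Implicit Types x y : V.

Lemma nmE x : `|x| = rc (nm x). Proof. by rewrite creK. Qed.
Lemma nm_ge0 x : 0 <= nm x. Proof. by rewrite -rc_le rc0 -nmE. Qed.
Lemma nm0 : nm (0 : V) = 0. Proof. by apply: rc_inj; rewrite -nmE normr0 rc0. Qed.
Lemma nm_eq0 x : nm x = 0 -> x = 0.
Proof. by move=> h; apply/normr0_eq0; rewrite nmE h rc0. Qed.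
Lemma nmD x y : nm (x + y) <= nm x + nm y.
Proof. by rewrite -rc_le rcD -!nmE ler_normD. Qed.
Lemma nmN x : nm (- x) = nm x. Proof. by rewrite /nm normrN. Qed.
Lemma nmBC x y : nm (x - y) = nm (y - x). Proof. by rewrite /nm distrC. Qed.
Lemma nmB x y : nm (x - y) <= nm x + nm y.
Proof. by rewrite (le_trans (nmD _ _))// nmN. Qed.
Lemma nm_tri y x z : nm (x - z) <= nm (x - y) + nm (y - z).
Proof. by rewrite (le_trans _ (nmD _ _))// addrA subrK. Qed.
Lemma nm_sub x y : nm x - nm y <= nm (x - y).
Proof. by rewrite lerBlDr (le_trans _ (nmD _ _))// subrK. Qed.
Lemma nm_sum (I : Type) (s : seq I) (F : I -> V) :
  nm (\sum_(i <- s) F i) <= \sum_(i <- s) nm (F i).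
Proof.
elim: s => [|a s IH]; first by rewrite !big_nil nm0.
by rewrite !big_cons (le_trans (nmD _ _))// lerD2l.
Qed.
End Nm.

Lemma nmZ (R : realType) (V : normedModType (Cplx R)) (k : Cplx R) (x : V) :
  nm (k *: x) = nm k * nm x.
Proof. by apply: rc_inj; rewrite rcM -!nmE normrZ. Qed.
Lemma nmM (R : realType) (k l : Cplx R) : nm (k * l) = nm k * nm l.
Proof. by apply: rc_inj; rewrite rcM -!nmE normrM. Qed.
Lemma nm_rc (R : realType) (r : R) : 0 <= r -> nm (rc r) = r.
Proof. by move=> r0; rewrite /nm ger0_norm ?rcK// -(rc0 R) rc_le. Qed.
Lemma nm_conj (R : realType) (k : Cplx R) : nm k^* = nm k.
Proof. by rewrite /nm norm_conjC. Qed.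
Lemma nm1 (R : realType) : nm (1 : Cplx R) = 1.
Proof. by rewrite -rc1 nm_rc. Qed.

Section Limits.
Variables (R : realType) (V : normedModType (Cplx R)).

Lemma nbhs_nmP (x : V) (A : set V) :
  nbhs x A <-> exists2 e : R, 0 < e & forall y, nm (x - y) < e -> A y.
Proof.
split.
  move=> /nbhs_ballP[e /= e0 h]; exists (cre e).
    by rewrite -rc_lt rc0 creK// ltW.
  move=> y hy; apply: h; rewrite -ball_normE /ball_ /= nmE.
  by rewrite -(creK (ltW e0)) rc_lt.
move=> [e e0 h]; apply/nbhs_ballP; exists (rc e); first by rewrite /= -(rc0 R) rc_lt.
by move=> y; rewrite -ball_normE /ball_ /= nmE rc_lt; exact: h.
Qed.

Lemma closure_nmP (E : set V) (x : V) :
  closure E x <-> forall e : R, 0 < e -> exists2 y, E y & nm (x - y) < e.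
Proof.
split=> [cl e e0|h A /nbhs_nmP[e /h[y Ey xy] hA]]; last by exists y; split => //; exact: hA.
have [|y [Ey hy]] := cl [set y | nm (x - y) < e]; last by exists y.
by apply/nbhs_nmP; exists e.
Qed.

Lemma dense_nmP (E : set V) :
  closure E = setT <-> forall (x : V) (e : R), 0 < e -> exists2 y, E y & nm (x - y) < e.
Proof.
split=> [h x|h]; first by apply/closure_nmP; rewrite h.
by apply/seteqP; split => // x _; apply/closure_nmP; exact: h.
Qed.

Definition tends (u : nat -> V) (l : V) := forall e : R, 0 < e ->
  exists N, forall n, (N <= n)%N -> nm (u n - l) < e.
Definition cauchyseq (u : nat -> V) := forall e : R, 0 < e ->
  exists N, forall n m, (N <= n)%N -> (N <= m)%N -> nm (u n - u m) < e.



End Limits.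

Lemma complete_seq (R : realType) (V : completeNormedModType (Cplx R)) (u : nat -> V) :
  cauchyseq u -> exists l, tends u l.
Proof.
move=> cu; have : cvg (u @ \oo).
  apply/cauchy_cvgP/cauchy_exP => e e0.
  have e0' : 0 < cre e by rewrite -rc_lt rc0 creK// ltW.
  have [N hN] := cu _ e0'; exists (u N); exists N => // n /= Nn.
  by rewrite -ball_normE /ball_ /= nmE -(creK (ltW e0)) rc_lt hN.
move=> /cvg_ex[l /cvgrPdist_lt hl]; exists l => e e0.
have [|N _ hN] := hl (rc e); first by rewrite -(rc0 R) rc_lt.
by exists N => n /hN; rewrite nmE rc_lt nmBC.
Qed.

Lemma bounded_continuous (R : realType) (V W : normedModType (Cplx R)) (f : V -> W) (C : R) :
  (forall x y, nm (f x - f y) <= C * nm (x - y)) -> continuous f.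
Proof.
move=> h x A /nbhs_nmP[e e0 hA]; apply/nbhs_nmP.
exists (e / (`|C| + 1)); first by rewrite divr_gt0// ltr_wpDl.
move=> y hy; apply: hA; apply: le_lt_trans (h _ _) _.
have C1 : 0 < `|C| + 1 by rewrite ltr_wpDl.
apply: le_lt_trans (_ : (`|C| + 1) * nm (x - y) < _).
  by rewrite ler_wpM2r ?nm_ge0// (le_trans (ler_norm _))// lerDl.
by rewrite -ltr_pdivlMl// mulrC.
Qed.

(** * Completions *)

(** A Cauchy filter contains a ball of radius 1/(n+1) for every n. Two members of a proper filter
    meet, so the centres form a Cauchy sequence, and its limit is the limit of the filter. *)
Lemma seq_complete (R : realType) (V : normedModType (Cplx R)) :
  (forall u : nat -> V, cauchyseq u -> exists l, tends u l) ->
  forall F : set_system V, ProperFilter F -> cauchy F -> cvg F.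
Proof.
move=> seqV F FF Fc.
have /choice[u hu] : forall n : nat, exists x : V, F [set y | nm (x - y) < n.+1%:R^-1].
  move=> n; have /cauchyP/(_ (rc n.+1%:R^-1))[|x hx] := Fc.
    by rewrite -(rc0 R) rc_lt invr_gt0 ltr0n.
  exists x; apply: filterS hx => y.
  by rewrite -ball_normE /ball_ /= nmE rc_lt.
have hn (e : R) : 0 < e -> exists N, forall n, (N <= n)%N -> n.+1%:R^-1 < e.
  move=> e0; have [N hN] := ltr_add_invr e0; exists N => n Nn.
  rewrite add0r in hN; apply: le_lt_trans hN.
  by rewrite lef_pV2 ?posrE ?ltr0n// ler_nat ltnS.
have uu n m : nm (u n - u m) < n.+1%:R^-1 + m.+1%:R^-1.
  have [y [h1 h2]] := filter_ex (filterI (hu n) (hu m)).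
  have := nm_tri y (u n) (u m); rewrite (nmBC y); move: h1 h2 => /=.
  by move: (n.+1%:R^-1) (m.+1%:R^-1) => a b; lra.
have [|l hl] := seqV u.
  move=> e e0; have [N hN] := hn _ (divr_gt0 e0 (@ltr0n R 2)).
  exists N => n m /hN h1 /hN h2; have := uu n m; move: h1 h2.
  by move: (n.+1%:R^-1) (m.+1%:R^-1) => a b; lra.
apply/cvg_ex; exists l => A /nbhs_nmP[e e0 hA].
have [N hN] := hl _ (divr_gt0 e0 (@ltr0n R 2)).
have [M hM] := hn _ (divr_gt0 e0 (@ltr0n R 2)).
apply: filterS (hu (maxn N M)) => y /= hy; apply: hA.
have := hN _ (leq_maxl N M); have := hM _ (leq_maxr N M).
have := nm_tri (u (maxn N M)) l y; rewrite (nmBC l (u _)); move: hy.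
by move: (_.+1%:R^-1) => a; lra.
Qed.

(** The laws are only required on a subset of the vector space: the function algebras are given as
    subsets of all functions, and no subtype has to carry the structure. *)
Record seminormed (R : realType) := Seminormed {
  sn_car :> lmodType (Cplx R);
  sn_dom : set sn_car;
  sn_norm : sn_car -> R;
  sn_dom0 : sn_dom 0;
  sn_domP : forall (k : Cplx R) x y, sn_dom x -> sn_dom y -> sn_dom (k *: x + y);
  sn_normD : forall x y, sn_dom x -> sn_dom y ->
    sn_norm (x + y) <= sn_norm x + sn_norm y;
  sn_normZ : forall (k : Cplx R) x, sn_dom x -> sn_norm (k *: x) = nm k * sn_norm x
}.

Section Completion.
Variables (R : realType) (S : seminormed R).
Notation K := (Cplx R).
Notation q := (@sn_norm R S).
Notation D := (@sn_dom R S).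
Implicit Types x y z : nat -> S.

Let DD a b : D a -> D b -> D (a + b).
Proof. by move=> ha hb; rewrite -(scale1r a); exact: sn_domP. Qed.
Let DZ k a : D a -> D (k *: a).
Proof. by move=> ha; rewrite -[_ *: _]addr0; apply: sn_domP => //; exact: sn_dom0. Qed.
Let DN a : D a -> D (- a).
Proof. by move=> ha; rewrite -scaleN1r; exact: DZ. Qed.
Let DB a b : D a -> D b -> D (a - b).
Proof. by move=> ha hb; apply: DD => //; exact: DN. Qed.
Let q0 : q 0 = 0.
Proof. by rewrite -(scale0r (0 : S)) sn_normZ ?nm0 ?mul0r//; exact: sn_dom0. Qed.
Let qN a : D a -> q (- a) = q a.
Proof. by move=> ha; rewrite -scaleN1r sn_normZ// nmN nm1 mul1r. Qed.
Let qB a b : D a -> D b -> q (a - b) = q (b - a).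
Proof. by move=> ha hb; rewrite -qN ?opprB//; exact: DB. Qed.
Let q_ge0 a : D a -> 0 <= q a.
Proof. by move=> ha; have := sn_normD ha (DN ha); rewrite subrr q0 qN//; lra. Qed.
Let qtri b a c : D a -> D b -> D c -> q (a - c) <= q (a - b) + q (b - c).
Proof.
move=> ha hb hc; apply: le_trans (sn_normD (DB ha hb) (DB hb hc)).
by rewrite addrA subrK.
Qed.

Definition cseq x := (forall n, D (x n)) /\ forall e : R, 0 < e ->
  exists N, forall n m, (N <= n)%N -> (N <= m)%N -> q (x n - x m) < e.
Definition nullseq x := forall e : R, 0 < e ->
  exists N, forall n, (N <= n)%N -> q (x n) < e.
Definition cclass x : set (nat -> S) := [set y | cseq y /\ nullseq (x - y)].

(** Points are equivalence classes stored as sets of sequences, so that equality of points is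
    equality of sets and no quotient type is needed. *)
Record compl := Compl {
  cset : set (nat -> S); csetP : exists x, cseq x /\ cset = cclass x }.

Lemma cseq_cst a : D a -> cseq (fun=> a).
Proof. by move=> ha; split => // e e0; exists 0%N => n m _ _; rewrite subrr q0. Qed.

Lemma cseqP k x y : cseq x -> cseq y -> cseq (k *: x + y).
Proof.
move=> [dx cx] [dy cy]; split => [n|e e0]; first exact: sn_domP.
have k0 : 0 < nm k + 1 by have := nm_ge0 k; lra.
have [N hN] := cx (e / 2 / (nm k + 1)) (divr_gt0 (divr_gt0 e0 (@ltr0n R 2)) k0).
have [M hM] := cy _ (divr_gt0 e0 (@ltr0n R 2)).
exists (maxn N M) => n m; rewrite !geq_max => /andP[nN nM] /andP[mN mM].
have -> : (k *: x + y) n - (k *: x + y) m = k *: (x n - x m) + (y n - y m).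
  by rewrite scalerBr opprD addrACA.
apply: le_lt_trans (sn_normD (DZ _ (DB _ _)) (DB _ _)) _ => //.
rewrite sn_normZ; last exact: DB.
have := hM _ _ nM mM; have := hN _ _ nN mN; rewrite ltr_pdivlMr//.
have := q_ge0 (DB (dx n) (dx m)); nra.
Qed.

Lemma null_sum x y z : cseq x -> cseq y -> cseq z ->
  nullseq (x - y) -> nullseq (y - z) -> nullseq (x - z).
Proof.
move=> [dx _] [dy _] [dz _] h1 h2 e e0.
have [N hN] := h1 _ (divr_gt0 e0 (@ltr0n R 2)).
have [M hM] := h2 _ (divr_gt0 e0 (@ltr0n R 2)).
exists (maxn N M) => n; rewrite geq_max => /andP[/hN a1 /hM a2].
by have := qtri (dx n) (dy n) (dz n); move: a1 a2; rewrite !fctE /=; lra.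
Qed.

Lemma null_sym x y : cseq x -> cseq y -> nullseq (x - y) -> nullseq (y - x).
Proof. by move=> [dx _] [dy _] h e /h[N hN]; exists N => n /hN; rewrite qB. Qed.

Lemma null_refl x : nullseq (x - x).
Proof. by move=> e e0; exists 0%N => n _; rewrite subrr q0. Qed.

Lemma null_lin k x y x' y' : cseq x -> cseq y -> cseq x' -> cseq y' ->
  nullseq (x - x') -> nullseq (y - y') -> nullseq (k *: x + y - (k *: x' + y')).
Proof.
move=> [dx _] [dy _] [dx' _] [dy' _] h1 h2 e e0.
have k0 : 0 < nm k + 1 by have := nm_ge0 k; lra.
have [N hN] := h1 (e / 2 / (nm k + 1)) (divr_gt0 (divr_gt0 e0 (@ltr0n R 2)) k0).
have [M hM] := h2 _ (divr_gt0 e0 (@ltr0n R 2)).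
exists (maxn N M) => n; rewrite geq_max => /andP[/hN a1 /hM a2].
have -> : (k *: x + y - (k *: x' + y')) n = k *: (x n - x' n) + (y n - y' n).
  by rewrite scalerBr addrACA -opprD.
apply: le_lt_trans (sn_normD (DZ _ (DB _ _)) (DB _ _)) _ => //.
rewrite sn_normZ; last exact: DB.
move: a1 a2; rewrite ltr_pdivlMr// => a1 a2.
have := q_ge0 (DB (dx n) (dx' n)); move: a1 a2; rewrite !fctE /=; nra.
Qed.

Lemma cclass_eq x y : cseq x -> cseq y -> nullseq (x - y) -> cclass x = cclass y.
Proof.
move=> hx hy h; apply/seteqP; split => z [hz h']; split => //.
  by apply: (@null_sum _ x) => //; exact: null_sym.
exact: (@null_sum _ y).
Qed.

Lemma cseq0 : cseq 0. Proof. exact/cseq_cst/sn_dom0. Qed.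

(** Sequences that are not Cauchy get the class of 0, which makes [mk] total. *)
Definition mk x : compl :=
  match pselect (cseq x) with
  | left h => @Compl (cclass x) (ex_intro _ x (conj h erefl))
  | right _ => @Compl (cclass 0) (ex_intro _ 0 (conj cseq0 erefl))
  end.
Definition rep (c : compl) : nat -> S := sval (cid (csetP c)).

Lemma rep_cseq c : cseq (rep c). Proof. by rewrite /rep; case: cid => x []. Qed.

Lemma compl_ext (c d : compl) : cset c = cset d -> c = d.
Proof.
by case: c d => c hc [d hd] /= cd; subst d; congr Compl; exact: Prop_irrelevance.
Qed.

Lemma mk_rep c : mk (rep c) = c.
Proof.
apply: compl_ext; rewrite /mk; case: pselect => [h|]; last by case; exact: rep_cseq.
by rewrite /= /rep; case: cid => x /= [hx].
Qed.

Lemma mk_eq x y : cseq x -> cseq y -> nullseq (x - y) -> mk x = mk y.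
Proof.
move=> hx hy h; apply: compl_ext; rewrite /mk.
by case: pselect => // hx'; case: pselect => // hy' /=; exact: cclass_eq.
Qed.

Lemma rep_mk x : cseq x -> nullseq (x - rep (mk x)).
Proof.
move=> hx; rewrite /rep; case: cid => y /= [hy].
rewrite /mk; case: pselect => //= hx' e.
have : cclass y y by split => //; exact: null_refl.
by rewrite -e => -[].
Qed.

Lemma mkP c : exists2 x, cseq x & c = mk x.
Proof. by exists (rep c); [exact: rep_cseq|rewrite mk_rep]. Qed.

(** Sum, multiple and opposite are all special cases of this one operation, so independence of
    representatives is proved once. *)
Definition clin (k : K) (a b : compl) := mk (k *: rep a + rep b).

Lemma clinE k x y : cseq x -> cseq y -> clin k (mk x) (mk y) = mk (k *: x + y).
Proof.
move=> hx hy; apply/esym/mk_eq; [exact: cseqP| |].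
  by apply: cseqP; exact: rep_cseq.
by apply: null_lin => //; try exact: rep_cseq; exact: rep_mk.
Qed.

Definition c0 := mk 0.
Definition cadd a b := clin 1 a b.
Definition cscale k a := clin k a c0.
Definition copp a := clin (-1) a c0.

Lemma caddE x y : cseq x -> cseq y -> cadd (mk x) (mk y) = mk (x + y).
Proof. by move=> hx hy; rewrite /cadd clinE// scale1r. Qed.
Lemma cscaleE k x : cseq x -> cscale k (mk x) = mk (k *: x).
Proof. by move=> hx; rewrite /cscale clinE// ?addr0//; exact: cseq0. Qed.
Lemma coppE x : cseq x -> copp (mk x) = mk (- x).
Proof. by move=> hx; rewrite /copp clinE// ?addr0 ?scaleN1r//; exact: cseq0. Qed.
Lemma cseqD x y : cseq x -> cseq y -> cseq (x + y).
Proof. by move=> hx hy; rewrite -[x]scale1r; exact: cseqP. Qed.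
Lemma cseqZ k x : cseq x -> cseq (k *: x).
Proof. by move=> hx; rewrite -[_ *: _]addr0; apply: cseqP => //; exact: cseq0. Qed.
Lemma cseqN x : cseq x -> cseq (- x).
Proof. by rewrite -scaleN1r; exact: cseqZ. Qed.

Hint Resolve cseqD cseqZ cseqN cseq0 : core.

HB.instance Definition _ := gen_eqMixin compl.
HB.instance Definition _ := gen_choiceMixin compl.

Lemma caddA : associative cadd.
Proof.
move=> a b c; have [x hx ->] := mkP a; have [y hy ->] := mkP b; have [z hz ->] := mkP c.
by rewrite !caddE ?addrA; auto.
Qed.
Lemma caddC : commutative cadd.
Proof.
move=> a b; have [x hx ->] := mkP a; have [y hy ->] := mkP b.
by rewrite !caddE ?(addrC x); auto.
Qed.
Lemma cadd0 : left_id c0 cadd.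
Proof. by move=> a; have [x hx ->] := mkP a; rewrite caddE ?add0r; auto. Qed.
Lemma caddN : left_inverse c0 copp cadd.
Proof. by move=> a; have [x hx ->] := mkP a; rewrite coppE// caddE ?addNr; auto. Qed.
HB.instance Definition _ := GRing.isZmodule.Build compl caddA caddC cadd0 caddN.

Lemma cscaleA k l a : cscale k (cscale l a) = cscale (k * l) a.
Proof. by have [x hx ->] := mkP a; rewrite !cscaleE ?scalerA; auto. Qed.
Lemma cscale1 : left_id 1 cscale.
Proof. by move=> a; have [x hx ->] := mkP a; rewrite cscaleE ?scale1r. Qed.
Lemma cscaleDr : right_distributive cscale +%R.
Proof.
move=> k a b; have [x hx ->] := mkP a; have [y hy ->] := mkP b.
change (cscale k (cadd (mk x) (mk y)) = cadd (cscale k (mk x)) (cscale k (mk y))).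
by rewrite caddE// !cscaleE ?caddE ?scalerDr; auto.
Qed.
Lemma cscaleDl v : {morph cscale^~ v : a b / a + b}.
Proof.
move=> k l; have [x hx ->] := mkP v.
change (cscale (k + l) (mk x) = cadd (cscale k (mk x)) (cscale l (mk x))).
by rewrite !cscaleE// caddE ?scalerDl; auto.
Qed.
HB.instance Definition _ :=
  GRing.Zmodule_isLmodule.Build K compl cscaleA cscale1 cscaleDr cscaleDl.

Definition slim x : R := limn (fun n => q (x n) : R).

Lemma slimP x : cseq x -> forall e : R, 0 < e ->
  exists N, forall n, (N <= n)%N -> `|q (x n) - slim x| < e.
Proof.
move=> [dx cx] e e0.
have dq n m : `|q (x n) - q (x m)| <= q (x n - x m).
  have h a b : D a -> D b -> q a - q b <= q (a - b).
    by move=> ha hb; have := sn_normD (DB ha hb) hb; rewrite subrK; lra.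
  by rewrite ler_norml h// lerNl opprB qB// h.
have : cvgn (fun n => q (x n) : R).
  apply/cauchy_cvgP/cauchy_exP => d d0; have [N hN] := cx _ d0.
  exists (q (x N)); exists N => // n /= Nn.
  by rewrite -ball_normE /ball_ /=; apply: le_lt_trans (dq _ _) (hN _ _ _ _).
move=> /cvgrPdist_lt/(_ _ e0)[N _ hN]; exists N => n /hN /=.
by rewrite distrC.
Qed.

Lemma slim_null x y : cseq x -> cseq y -> nullseq (x - y) -> slim x = slim y.
Proof.
have H x' y' : cseq x' -> cseq y' -> nullseq (x' - y') -> slim x' <= slim y'.
  move=> hx hy h; apply/ler_addgt0Pr => e e0.
  have [N hN] := slimP hx (divr_gt0 e0 (@ltr0n R 3)).
  have [M hM] := slimP hy (divr_gt0 e0 (@ltr0n R 3)).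
  have [L hL] := h _ (divr_gt0 e0 (@ltr0n R 3)).
  have := hN (maxn N (maxn M L)); have := hM (maxn N (maxn M L)).
  have := hL (maxn N (maxn M L)); rewrite !leq_max !leqnn !orbT /=.
  move: (maxn _ _) => n /(_ isT) a1 /(_ isT) a2 /(_ isT) a3.
  have := sn_normD (DB (hx.1 n) (hy.1 n)) (hy.1 n); rewrite subrK.
  by move: a1 a2 a3; rewrite !fctE !ltr_norml /=; lra.
move=> hx hy h; apply/eqP; rewrite eq_le !H//; exact: null_sym.
Qed.

Definition cnorm (c : compl) : K := rc (slim (rep c)).
Lemma cnormE x : cseq x -> cnorm (mk x) = rc (slim x).
Proof.
move=> hx; congr rc; apply: slim_null => //; first exact: rep_cseq.
apply: null_sym => //; [exact: rep_cseq|exact: rep_mk].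
Qed.

Lemma cnormD a b : cnorm (a + b) <= cnorm a + cnorm b.
Proof.
have [x hx ->] := mkP a; have [y hy ->] := mkP b.
change (cnorm (cadd (mk x) (mk y)) <= cnorm (mk x) + cnorm (mk y)).
rewrite caddE// !cnormE; auto; rewrite -rcD rc_le.
apply/ler_addgt0Pr => e e0.
have [N hN] := slimP hx (divr_gt0 e0 (@ltr0n R 3)).
have [M hM] := slimP hy (divr_gt0 e0 (@ltr0n R 3)).
have [L hL] := slimP (cseqD hx hy) (divr_gt0 e0 (@ltr0n R 3)).
have := hN (maxn N (maxn M L)); have := hM (maxn N (maxn M L)).
have := hL (maxn N (maxn M L)); rewrite !leq_max !leqnn !orbT /=.
move: (maxn _ _) => n /(_ isT) a1 /(_ isT) a2 /(_ isT) a3.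
have := sn_normD (hx.1 n) (hy.1 n).
by move: a1 a2 a3; rewrite !fctE !ltr_norml /=; lra.
Qed.

Lemma cnormZ (k : K) a : cnorm (k *: a) = `|k| * cnorm a.
Proof.
have [x hx ->] := mkP a; change (cnorm (cscale k (mk x)) = `|k| * cnorm (mk x)).
rewrite cscaleE// !cnormE; auto.
rewrite nmE -rcM; congr rc; apply/eqP; rewrite -subr_eq0 -normr_eq0.
rewrite eq_le normr_ge0 andbT; apply/ler_addgt0Pr => e e0; rewrite add0r.
have k0 : 0 < nm k + 1 by have := nm_ge0 k; lra.
have [N hN] := slimP hx (divr_gt0 (divr_gt0 e0 (@ltr0n R 2)) k0).
have [M hM] := slimP (cseqZ k hx) (divr_gt0 e0 (@ltr0n R 2)).
have := hM _ (leq_maxr N M); have := hN _ (leq_maxl N M).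
move: (maxn N M) => n; rewrite [(k *: x) n]/(k *: x n) sn_normZ; last exact: hx.1.
rewrite ltr_pdivlMr// => a2 a1.
have -> : slim (k *: x) - nm k * slim x =
  - (nm k * q (x n) - slim (k *: x)) + nm k * (q (x n) - slim x) by ring.
rewrite (le_trans (ler_normD _ _))// normrN normrM (ger0_norm (nm_ge0 k)).
have := nm_ge0 k; have := normr_ge0 (q (x n) - slim x); nra.
Qed.

Lemma cnorm0 a : cnorm a = 0 -> a = 0.
Proof.
have [x hx ->] := mkP a; rewrite cnormE// -(rc0 R) => /rc_inj h.
apply: mk_eq => // e e0; have [N hN] := slimP hx e0; exists N => n /hN.
by rewrite h !subr0 ltr_norml => /andP[].
Qed.

HB.instance Definition _ := Lmodule_isNormed.Build K compl cnormD cnormZ cnorm0.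

Definition cin (a : S) : compl := mk (fun=> a).

Lemma nm_mk x : cseq x -> nm (mk x) = slim x.
Proof. by move=> hx; apply: rc_inj; rewrite -nmE -[LHS]/(cnorm _) cnormE. Qed.

Lemma slim_cst a : D a -> slim (fun=> a) = q a.
Proof.
move=> ha; apply/esym/eqP; rewrite -subr_eq0 -normr_eq0 eq_le normr_ge0 andbT.
apply/ler_addgt0Pr => e e0; rewrite add0r.
by have [N /(_ _ (leqnn _))/ltW] := slimP (cseq_cst ha) e0.
Qed.

Lemma nm_cin a : D a -> nm (cin a) = q a.
Proof. by move=> ha; rewrite nm_mk ?slim_cst//; exact: cseq_cst. Qed.

Lemma cin_linear (k : K) a b : D a -> D b -> cin (k *: a + b) = k *: cin a + cin b.
Proof.
move=> ha hb; change (cin (k *: a + b) = cadd (cscale k (cin a)) (cin b)).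
rewrite cscaleE; last exact: cseq_cst.
by rewrite caddE//; [exact/cseqZ/cseq_cst|exact: cseq_cst].
Qed.

Lemma mkB x y : cseq x -> cseq y -> mk x - mk y = mk (x - y).
Proof.
move=> hx hy; change (cadd (mk x) (copp (mk y)) = mk (x - y)); rewrite coppE// caddE//; auto.
Qed.

Lemma cin_tends x : cseq x -> tends (fun n => cin (x n)) (mk x).
Proof.
move=> hx e e0; have [N hN] := hx.2 _ (divr_gt0 e0 (@ltr0n R 3)).
exists N => n Nn; rewrite mkB//; last exact/cseq_cst/hx.1.
have hc : cseq ((fun=> x n) - x) by auto using cseq_cst, hx.1.
rewrite nm_mk//; have [M hM] := slimP hc (divr_gt0 e0 (@ltr0n R 3)).
have := hM _ (leq_maxr N M); have := hN _ (maxn N M) Nn (leq_maxl N M).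
by rewrite /= ltr_norml => a1 /andP[]; move: a1; rewrite fctE /=; lra.
Qed.

Lemma compl_complete (F : set_system compl) : ProperFilter F -> cauchy F -> cvg F.
Proof.
apply: seq_complete => u cu.
have hn (e : R) : 0 < e -> exists N, forall n, (N <= n)%N -> n.+1%:R^-1 < e.
  move=> e0; have [N hN] := ltr_add_invr e0; exists N => n Nn.
  rewrite add0r in hN; apply: le_lt_trans hN.
  by rewrite lef_pV2 ?posrE ?ltr0n// ler_nat ltnS.
(* Diagonal argument: each [u n] is replaced by a constant class within 1/(n+1), and the chosen
   elements form a Cauchy sequence that represents the limit. *)
have /choice[z hz] : forall n : nat, exists a : S, D a /\ nm (cin a - u n) < n.+1%:R^-1.
  move=> n; have [x hx ->] := mkP (u n).
  have [|N /(_ _ (leqnn N)) hN] := cin_tends hx (e := n.+1%:R^-1).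
    by rewrite invr_gt0 ltr0n.
  by exists (x N); split => //; exact: hx.1.
have cz : cseq z.
  split => [n|e e0]; first exact: (hz n).1.
  have [N hN] := cu _ (divr_gt0 e0 (@ltr0n R 3)).
  have [M hM] := hn _ (divr_gt0 e0 (@ltr0n R 3)).
  exists (maxn N M) => n m; rewrite !geq_max => /andP[n1 n2] /andP[m1 m2].
  have [dn an] := hz n; have [dm am] := hz m.
  have -> : q (z n - z m) = nm (cin (z n) - cin (z m)).
    rewrite -nm_cin; last exact: DB.
    by rewrite -scaleN1r addrC cin_linear// scaleN1r addrC.
  have := nm_tri (u n) (cin (z n)) (cin (z m)); have := nm_tri (u m) (u n) (cin (z m)).
  rewrite (nmBC (u m)); have := hM _ n2; have := hM _ m2; have := hN _ _ n1 m1.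
  by move: an am; move: (n.+1%:R^-1) (m.+1%:R^-1) => a b; lra.
exists (mk z) => e e0.
have [N hN] := cin_tends cz (divr_gt0 e0 (@ltr0n R 2)).
have [M hM] := hn _ (divr_gt0 e0 (@ltr0n R 2)).
exists (maxn N M) => n; rewrite geq_max => /andP[/hN a1 /hM a2].
have := (hz n).2; have := nm_tri (cin (z n)) (u n) (mk z).
by rewrite (nmBC (u n) (cin _)); move: a2; move: (n.+1%:R^-1) => a; lra.
Qed.
HB.instance Definition _ := Uniform_isComplete.Build compl compl_complete.
End Completion.

Theorem completion_exists (R : realType) (S : seminormed R) :
  exists (V : completeNormedModType (Cplx R)) (j : S -> V),
    [/\ forall (k : Cplx R) a b, sn_dom a -> sn_dom b -> j (k *: a + b) = k *: j a + j b,
        forall a, sn_dom a -> nm (j a) = sn_norm a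
      & closure [set j a | a in @sn_dom R S] = setT].
Proof.
exists (compl S : completeNormedModType (Cplx R)), (@cin R S); split.
- exact: cin_linear.
- exact: nm_cin.
- apply/dense_nmP => x e e0; have [z hz ->] := mkP x.
  have [N /(_ _ (leqnn N)) hN] := cin_tends hz e0.
  by exists (cin (z N)); [exists (z N) => //; exact: hz.1|rewrite nmBC].
Qed.

(** Formal combinations are lists because the families involved are usually linearly dependent; the
    same list can be evaluated in several spaces and its values compared. *)
Definition lc (R : realType) (X : Type) (V : lmodType (Cplx R)) (e : X -> V)
  (s : seq (Cplx R * X)) : V := \sum_(p <- s) p.1 *: e p.2.
Definition lcscale (R : realType) (X : Type) (k : Cplx R) (s : seq (Cplx R * X)) :=
  map (fun p : Cplx R * X => (k * p.1, p.2)) s.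

Section Lc.
Variables (R : realType) (X : Type) (V : lmodType (Cplx R)) (e : X -> V).
Lemma lc_cat s t : lc e (s ++ t) = lc e s + lc e t.
Proof. exact: big_cat. Qed.
Lemma lc_scale k s : lc e (lcscale k s) = k *: lc e s.
Proof.
by rewrite /lc /lcscale big_map scaler_sumr; apply: eq_bigr => p _; rewrite scalerA.
Qed.
Lemma lc_lin k s t : lc e (lcscale k s ++ t) = k *: lc e s + lc e t.
Proof. by rewrite lc_cat lc_scale. Qed.
Lemma lc_sub s t : lc e (s ++ lcscale (-1) t) = lc e s - lc e t.
Proof. by rewrite lc_cat lc_scale scaleN1r. Qed.
Lemma lc1 x : lc e [:: (1, x)] = e x.
Proof. by rewrite /lc big_seq1 scale1r. Qed.
Lemma lc_nil : lc e [::] = 0. Proof. exact: big_nil. Qed.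
End Lc.

Definition densefam (R : realType) (X : Type) (V : normedModType (Cplx R)) (e : X -> V) :=
  forall (v : V) (eps : R), 0 < eps -> exists s, nm (v - lc e s) < eps.

Definition lin (R : realType) (V W : lmodType (Cplx R)) (f : V -> W) :=
  forall (k : Cplx R) x y, f (k *: x + y) = k *: f x + f y.
Definition bnd (R : realType) (V W : normedModType (Cplx R)) (f : V -> W) (C : R) :=
  forall x, nm (f x) <= C * nm x.

Section Lin.
Variables (R : realType) (V W : lmodType (Cplx R)) (f : V -> W).
Hypothesis hf : lin f.
Lemma linD x y : f (x + y) = f x + f y.
Proof. by rewrite -[x in LHS]scale1r hf scale1r. Qed.
Lemma lin0 : f 0 = 0.
Proof. by have := linD 0 0; rewrite addr0 => /eqP; rewrite -[X in X == _]addr0 (inj_eq (addrI _)) => /eqP. Qed.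
Lemma linZ k x : f (k *: x) = k *: f x.
Proof. by rewrite -[_ *: x]addr0 hf lin0 addr0. Qed.
Lemma linN x : f (- x) = - f x.
Proof. by rewrite -scaleN1r linZ scaleN1r. Qed.
Lemma linB x y : f (x - y) = f x - f y.
Proof. by rewrite linD linN. Qed.
Lemma lin_sum (I : Type) (r : seq I) (P : pred I) (F : I -> V) :
  f (\sum_(i <- r | P i) F i) = \sum_(i <- r | P i) f (F i).
Proof. by apply: (big_morph f); [exact: linD|exact: lin0]. Qed.
Lemma lin_lc (X : Type) (e : X -> V) s : f (lc e s) = lc (f \o e) s.
Proof. by rewrite lin_sum; apply: eq_bigr => p _; rewrite linZ. Qed.
End Lin.

Lemma bnd_continuous (R : realType) (V W : normedModType (Cplx R)) (f : V -> W) C :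
  lin f -> bnd f C -> continuous f.
Proof. by move=> lf bf; apply: (@bounded_continuous _ _ _ _ C) => x y; rewrite -linB. Qed.

Lemma le_epsP (R : realType) (x y : R) :
  (forall e : R, 0 < e -> x <= y + e) -> x <= y.
Proof. by move=> h; apply/ler_addgt0Pr. Qed.

Lemma nm_eps (R : realType) (V : normedZmodType (Cplx R)) (x y : V) (C : R) :
  (forall e : R, 0 < e -> nm (x - y) <= C * e) -> x = y.
Proof.
move=> h; apply/eqP; rewrite -subr_eq0; apply/eqP/nm_eq0/eqP.
rewrite eq_le nm_ge0 andbT; apply: le_epsP => e e0; rewrite add0r.
have C1 : 0 < `|C| + 1 by rewrite ltr_wpDl.
apply: le_trans (h _ (divr_gt0 e0 C1)) _.
rewrite mulrA ler_pdivrMr// mulrC ler_wpM2l ?(ltW e0)//.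
by have := ler_norm C; lra.
Qed.

(** The value at v is the limit of t along approximants of v. No linearity is assumed, so that the
    conjugate-linear involution is covered; the absolute value of C spares a sign hypothesis. *)
Lemma lip_extend (R : realType) (X : Type) (V W : normedModType (Cplx R))
    (e : X -> V) (t : X -> W) (C : R) :
  (forall u : nat -> W, cauchyseq u -> exists l, tends u l) ->
  (forall (v : V) (eps : R), 0 < eps -> exists x, nm (v - e x) < eps) ->
  (forall x y, nm (t x - t y) <= C * nm (e x - e y)) ->
  exists T : V -> W, forall v x, nm (T v - t x) <= `|C| * nm (v - e x).
Proof.
move=> cW de h.
pose C' := `|C|.
have hC s s' : nm (t s - t s') <= C' * nm (e s - e s').
  by apply: le_trans (h s s') _; rewrite ler_wpM2r ?nm_ge0// ler_norm.
have C0 : 0 <= C' by exact: normr_ge0.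
suff /choice[T hT] : forall v, exists w, forall s, nm (w - t s) <= C' * nm (v - e s).
  by exists T.
move=> v.
have /choice[u hu] : forall n : nat, exists s, nm (v - e s) < n.+1%:R^-1.
  by move=> n; apply: de; rewrite invr_gt0 ltr0n.
have hn (eps : R) : 0 < eps -> exists N, forall n, (N <= n)%N -> nm (v - e (u n)) < eps.
  move=> e0; have [N hN] := ltr_add_invr e0; exists N => n Nn.
  rewrite add0r in hN; apply: lt_trans (hu n) (le_lt_trans _ hN).
  by rewrite lef_pV2 ?posrE ?ltr0n// ler_nat ltnS.
have C1 : 0 < C' + 1 by lra.
have [|w hw] := cW (fun n => t (u n)).
  move=> eps e0.
  have [N hN] := hn _ (divr_gt0 (divr_gt0 e0 (@ltr0n R 2)) C1).
  exists N => n m /hN h1 /hN h2.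
  apply: le_lt_trans (hC _ _) _.
  have := nm_tri v (e (u n)) (e (u m)); rewrite (nmBC _ v).
  move: h1 h2; rewrite !ltr_pdivlMr//.
  have := nm_ge0 (v - e (u n)); have := nm_ge0 (v - e (u m)); nra.
exists w => s; apply: le_epsP => eps e0.
have [N hN] := hw _ (divr_gt0 e0 (@ltr0n R 2)).
have [M hM] := hn _ (divr_gt0 (divr_gt0 e0 (@ltr0n R 2)) C1).
have := hN _ (leq_maxl N M); have := hM _ (leq_maxr N M).
move: (maxn N M) => n; rewrite ltr_pdivlMr// => a1 a2.
have := nm_tri (t (u n)) w (t s); rewrite (nmBC w (t (u n))).
have := hC (u n) s; have := nm_tri v (e (u n)) (e s); rewrite (nmBC _ v).
have := nm_ge0 (v - e (u n)); have := nm_ge0 (v - e s).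
have := nm_ge0 (e (u n) - e s); nra.
Qed.

Section Dense.
Variables (R : realType) (X : Type) (V : normedModType (Cplx R)) (e : X -> V).
Hypothesis de : densefam e.

Lemma lip_eq (W : normedZmodType (Cplx R)) (f g : V -> W) (C C' : R) :
  (forall x y, nm (f x - f y) <= C * nm (x - y)) ->
  (forall x y, nm (g x - g y) <= C' * nm (x - y)) ->
  (forall s, f (lc e s) = g (lc e s)) -> f =1 g.
Proof.
move=> hf hg h v; apply: (@nm_eps _ _ _ _ (`|C| + `|C'|)) => eps e0.
have [s hs] := de v e0.
have := nm_tri (f (lc e s)) (f v) (g v); rewrite {2}h (nmBC (g _)).
have := hf v (lc e s); have := hg v (lc e s).
have := ler_norm C; have := ler_norm C'; have := nm_ge0 (v - lc e s).
have : `|C| * nm (v - lc e s) <= `|C| * eps by rewrite ler_wpM2l// ltW.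
have : `|C'| * nm (v - lc e s) <= `|C'| * eps by rewrite ler_wpM2l// ltW.
nra.
Qed.

Lemma bnd_eq (W : normedModType (Cplx R)) (f g : V -> W) (C C' : R) :
  lin f -> bnd f C -> lin g -> bnd g C' -> (forall x, f (e x) = g (e x)) -> f =1 g.
Proof.
move=> lf bf lg bg h.
apply: (@lip_eq _ f g C C') => [x y|x y|s]; rewrite -?linB//.
by rewrite (lin_lc lf) (lin_lc lg); apply: eq_bigr => p _ /=; rewrite h.
Qed.

(** Applied to the difference of two combinations, the inequality shows that t respects every linear
    relation of the family, so no separate condition of well-definedness appears. *)
Lemma bnd_extend (W : normedModType (Cplx R)) (t : X -> W) (C : R) :
  (forall u : nat -> W, cauchyseq u -> exists l, tends u l) ->
  (forall s, nm (lc t s) <= C * nm (lc e s)) ->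
  exists T : V -> W, [/\ lin T, bnd T C & forall x, T (e x) = t x].
Proof.
move=> cW h.
have h' s s' : nm (lc t s - lc t s') <= C * nm (lc e s - lc e s').
  by rewrite -!lc_sub.
pose C' := `|C|; have C0 : 0 <= C' by exact: normr_ge0.
have [T hT] := lip_extend cW de h'; rewrite -/C' in hT.
have Tlc s : T (lc e s) = lc t s.
  apply/eqP; rewrite -subr_eq0; apply/eqP/nm_eq0/eqP; rewrite eq_le nm_ge0 andbT.
  by have := hT (lc e s) s; rewrite subrr nm0 mulr0.
have lT : lin T.
  move=> k x y; apply: (@nm_eps _ _ _ _ (C' * (2 * nm k + 2))) => eps e0.
  have [s hs] := de x e0; have [s' hs'] := de y e0.
  have := hT (k *: x + y) (lcscale k s ++ s'); have := hT x s; have := hT y s'.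
  rewrite !lc_lin.
  have -> : k *: x + y - (k *: lc e s + lc e s') = k *: (x - lc e s) + (y - lc e s').
    by rewrite scalerBr opprD addrACA.
  have := nmD (k *: (x - lc e s)) (y - lc e s').
  have := nm_tri (k *: lc t s + lc t s') (T (k *: x + y)) (k *: T x + T y).
  have -> : k *: lc t s + lc t s' - (k *: T x + T y) = - (k *: (T x - lc t s) + (T y - lc t s')).
    by rewrite scalerBr [in RHS]opprD !opprB opprD addrACA.
  have := nmD (k *: (T x - lc t s)) (T y - lc t s').
  rewrite !nmN !nmZ => b1 b2 b3 b4 b5 b6.
  have k0 := nm_ge0 k; have x0 := nm_ge0 (x - lc e s); have y0 := nm_ge0 (y - lc e s').
  have b7 : nm k * nm (T x - lc t s) <= nm k * (C' * eps).
    by rewrite ler_wpM2l// (le_trans b5)// ler_wpM2l// ltW.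
  have b8 : nm (T y - lc t s') <= C' * eps by rewrite (le_trans b4)// ler_wpM2l// ltW.
  have b9 : C' * nm (k *: (x - lc e s) + (y - lc e s')) <= C' * (nm k * eps + eps).
    rewrite ler_wpM2l// (le_trans b3)//.
    have : nm k * nm (x - lc e s) <= nm k * eps by rewrite ler_wpM2l// ltW.
    by move: hs'; lra.
  nra.
exists T; split => // [v|x]; last by have := Tlc [:: (1, x)]; rewrite !lc1.
apply: le_epsP => eps e0.
have C1 : 0 < 2 * C' + 1 by lra.
have [s hs] := de v (divr_gt0 e0 C1).
have : C * (nm (lc e s) - nm v) <= C' * nm (v - lc e s).
  apply: le_trans (ler_norm _) _; rewrite normrM ler_wpM2l// ler_norml.
  by have := nm_sub (lc e s) v; have := nm_sub v (lc e s); rewrite (nmBC _ v); lra.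
have := hT v s; have := h s; have := nm_sub (T v) (lc t s).
move: hs; rewrite ltr_pdivlMr//; have := nm_ge0 (v - lc e s); nra.
Qed.
End Dense.

Lemma densefam_span (R : realType) (V : normedModType (Cplx R)) (X : Type) (e : X -> V) :
  densefam e -> dense_span (range e).
Proof.
move=> de; apply/dense_nmP => v eps e0; have [s hs] := de v eps e0.
exists (lc e s) => //=; exists (size s).
exists (fun i => (tnth (in_tuple s) i).1), (fun i => e (tnth (in_tuple s) i).2).
split; first by move=> i; exists (tnth (in_tuple s) i).2.
by rewrite /lc [LHS]big_tnth.
Qed.

Lemma span_densefam (R : realType) (V : normedModType (Cplx R)) (E : set V) :
  dense_span E -> densefam (fun x : {x | E x} => sval x).
Proof.
move=> /dense_nmP de v eps e0; have [_ [n [k [e [he ->]]]] hv] := de v eps e0.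
exists [seq (k i, exist E (e i) (he i)) | i <- enum 'I_n].
by rewrite /lc big_map big_enum.
Qed.

Lemma dense_spanW (R : realType) (V : normedModType (Cplx R)) (E F : set V) :
  E `<=` F -> dense_span E -> dense_span F.
Proof.
move=> EF /dense_nmP h; apply/dense_nmP => v eps e0.
have [_ [n [k [e [he ->]]]] hv] := h v eps e0.
by eexists; [|exact: hv]; exists n, k, e; split => // i; exact: EF.
Qed.

(** * Hilbert spaces *)

Section Hilbert.
Variables (R : realType) (H : hilbert R).
Notation K := (Cplx R).
Implicit Types x y z : H.

Lemma ipDl x y z : ip (x + y) z = ip x z + ip y z.
Proof. by have := ip_linear 1 x y z; rewrite scale1r mul1r. Qed.
Lemma ip0l z : ip (0 : H) z = 0.
Proof. by have := ip_linear (-1) 0 (0 : H) z; rewrite scaler0 addr0 mulN1r addNr. Qed.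
Lemma ipZl (k : K) x z : ip (k *: x) z = k * ip x z.
Proof. by have := ip_linear k x 0 z; rewrite addr0 ip0l addr0. Qed.
Lemma ipDr x y z : ip z (x + y) = ip z x + ip z y.
Proof. by rewrite ip_conj ipDl rmorphD /= -!ip_conj. Qed.
Lemma ip0r z : ip z (0 : H) = 0.
Proof. by rewrite ip_conj ip0l rmorph0. Qed.
Lemma ipZr (k : K) x z : ip z (k *: x) = k^* * ip z x.
Proof. by rewrite ip_conj ipZl rmorphM /= -ip_conj. Qed.
Lemma ipNl x z : ip (- x) z = - ip x z.
Proof. by rewrite -scaleN1r ipZl mulN1r. Qed.
Lemma ipNr x z : ip z (- x) = - ip z x.
Proof. by rewrite ip_conj ipNl rmorphN /= -ip_conj. Qed.
Lemma ip_suml (I : Type) (r : seq I) (F : I -> H) z :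
  ip (\sum_(i <- r) F i) z = \sum_(i <- r) ip (F i) z.
Proof. by apply: (big_morph (fun x => ip x z)); [move=> x y; exact: ipDl|exact: ip0l]. Qed.
Lemma ip_sumr (I : Type) (r : seq I) (F : I -> H) z :
  ip z (\sum_(i <- r) F i) = \sum_(i <- r) ip z (F i).
Proof. by apply: (big_morph (ip z)); [move=> x y; exact: ipDr|exact: ip0r]. Qed.
Lemma ip_nm x : ip x x = rc (nm x ^+ 2).
Proof. by rewrite -ip_norm nmE rcX. Qed.
Lemma ip_lc (X : Type) (e : X -> H) s t :
  ip (lc e s) (lc e t) = \sum_(p <- s) \sum_(q <- t) p.1 * q.1^* * ip (e p.2) (e q.2).
Proof.
rewrite ip_suml; apply: eq_bigr => p _; rewrite ip_sumr; apply: eq_bigr => q _.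
by rewrite ipZl ipZr mulrA.
Qed.
End Hilbert.

Lemma cre_ge0 (R : realType) (z : Cplx R) : 0 <= z -> 0 <= cre z.
Proof. by move=> z0; rewrite -rc_le rc0 creK. Qed.

Lemma mul_conj_nm (R : realType) (a : Cplx R) : a * a^* = rc (nm a ^+ 2).
Proof. by rewrite -normCK nmE rcX. Qed.

(** The hypothesis is positivity of the 2 x 2 matrix with rows (a, b) and (b^*, c). For u = r and v
    = - t b with real r, t it becomes r^2 a - 2 r t |b|^2 + t^2 |b|^2 c >= 0; take r = c, t = 1 when
    c > 0, and large t to force b = 0 when c = 0. *)
Lemma scalar_CS (R : realType) (a b c : Cplx R) :
  (forall u v : Cplx R, 0 <= u * u^* * a + u * v^* * b + v * u^* * b^* + v * v^* * c) ->
  nm b ^+ 2 <= cre a * cre c.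
Proof.
move=> h.
have a0 : 0 <= a.
  by have := h 1 0; rewrite !rmorph1 !rmorph0 !mulr0 !mul0r !mulr1 !mul1r !addr0.
have c0 : 0 <= c.
  by have := h 0 1; rewrite !rmorph1 !rmorph0 !mulr0 !mul0r !mulr1 !mul1r !add0r.
have {}h (r t : R) : 0 <= r ^+ 2 * cre a - (r * t * nm b ^+ 2 + r * t * nm b ^+ 2) + t ^+ 2 * nm b ^+ 2 * cre c.
  have := h (rc r) (- rc t * b); rewrite !rmorphM !rmorphN /= !rc_conj.
  set l := (X in 0 <= X) => l0.
  suff -> : r ^+ 2 * cre a - (r * t * nm b ^+ 2 + r * t * nm b ^+ 2) + t ^+ 2 * nm b ^+ 2 * cre c = cre l.
    exact: cre_ge0.
  have := mul_conj_nm b; move: (nm b ^+ 2) => B hB.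
  apply: rc_inj; rewrite creK// /l !expr2 !(rcD, rcN, rcM) !creK// -hB; ring.
have := cre_ge0 a0; have := cre_ge0 c0; move: h; move: (cre a) (cre c) => A C h C0 A0.
have [Cp|Cn] := ltP 0 C.
  by rewrite -(ler_pM2l Cp); have := h C 1; lra.
have {}C0 : C = 0 by apply/eqP; rewrite eq_le Cn C0.
rewrite C0 mulr0; rewrite leNgt; apply/negP => b0.
have := h 1 ((A + 1) / nm b ^+ 2); rewrite C0 mulr0 addr0 mul1r divfK ?gt_eqF//.
by rewrite expr1n; lra.
Qed.

Lemma ip_CS (R : realType) (H : hilbert R) (x y : H) : nm (ip x y) <= nm x * nm y.
Proof.
rewrite -ler_sqr ?nnegrE ?mulr_ge0 ?nm_ge0// exprMn.
have -> : nm x ^+ 2 = cre (ip x x) by rewrite ip_nm rcK.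
have -> : nm y ^+ 2 = cre (ip y y) by rewrite ip_nm rcK.
apply: scalar_CS => u v.
suff -> : u * u^* * ip x x + u * v^* * ip x y + v * u^* * (ip x y)^* + v * v^* * ip y y
   = ip (u *: x + v *: y) (u *: x + v *: y).
  by rewrite ip_nm -(rc0 R) rc_le sqr_ge0.
by rewrite -(ip_conj x) !ipDl !ipDr !ipZl !ipZr; ring.
Qed.

Lemma ip_ext (R : realType) (H : hilbert R) (x y : H) :
  (forall z, ip x z = ip y z) -> x = y.
Proof.
move=> h; apply/eqP; rewrite -subr_eq0; apply/eqP/nm_eq0/eqP.
rewrite -sqrf_eq0; apply/eqP/(@rc_inj R).
by rewrite -ip_nm ipDl ipNl h subrr rc0.
Qed.

Lemma nm_sqr (R : realType) (z : Cplx R) : nm z ^+ 2 = cre z ^+ 2 + complex.Im z ^+ 2.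
Proof. by apply: (@rc_inj R); rewrite rcX -nmE -add_Re2_Im2. Qed.
Lemma cre_le_nm (R : realType) (z : Cplx R) : `|cre z| <= nm z.
Proof.
rewrite -[_ <= nm z]ler_sqr ?nnegrE ?normr_ge0 ?nm_ge0// nm_sqr !real_normK ?num_real//.
by rewrite lerDl sqr_ge0.
Qed.
Lemma cim_le_nm (R : realType) (z : Cplx R) : `|complex.Im z| <= nm z.
Proof.
rewrite -[_ <= nm z]ler_sqr ?nnegrE ?normr_ge0 ?nm_ge0// nm_sqr !real_normK ?num_real//.
by rewrite lerDr sqr_ge0.
Qed.
Lemma nm_rc_norm (R : realType) (r : R) : nm (rc r) = `|r|.
Proof.
apply/eqP; rewrite -(@eqrXn2 _ 2) ?nnegrE ?normr_ge0 ?nm_ge0// nm_sqr rcK /= expr0n addr0.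
by rewrite real_normK ?num_real.
Qed.

(** Completeness of the scalars, by real and imaginary parts, is what allows [bnd_extend] to produce
    functionals. *)
Lemma cplx_seq_complete (R : realType) (u : nat -> (Cplx R)^o) :
  cauchyseq u -> exists l, tends u l.
Proof.
move=> cu.
have cplx (z : Cplx R) : nm z <= `|cre z| + `|complex.Im z|.
  rewrite -ler_sqr ?nnegrE ?addr_ge0 ?nm_ge0//.
  have -> : (nm z) ^+ 2 = `|cre z| ^+ 2 + `|complex.Im z| ^+ 2.
    by rewrite !real_normK ?num_real// nm_sqr.
  by rewrite sqrrD; have := normr_ge0 (cre z); have := normr_ge0 (complex.Im z); nra.
have creB (z w : Cplx R) : cre (z - w) = cre z - cre w by case: z w => [? ?] [? ?].
have cimB (z w : Cplx R) : complex.Im (z - w) = complex.Im z - complex.Im w.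
  by case: z w => [? ?] [? ?].
have lim (f : Cplx R -> R) : (forall z w, `|f z - f w| <= nm (z - w)) ->
    exists l : R, forall e : R, 0 < e -> exists N, forall n, (N <= n)%N -> `|f (u n) - l| < e.
  move=> hf; have : cvgn (fun n => f (u n)).
    apply/cauchy_cvgP/cauchy_exP => d d0; have [N hN] := cu _ d0.
    exists (f (u N)); exists N => // n /= Nn.
    by rewrite -ball_normE /ball_ /=; apply: le_lt_trans (hf _ _) (hN _ _ _ _).
  move=> /cvg_ex[l /cvgrPdist_lt hl]; exists l => e e0.
  by have [N _ hN] := hl _ e0; exists N => n /hN /=; rewrite distrC.
have [|a ha] := lim (@cre R); first by move=> z w; rewrite -creB; exact: cre_le_nm.
have [|b hb] := lim (@complex.Im R); first by move=> z w; rewrite -cimB; exact: cim_le_nm.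
exists (Complex a b : Cplx R) => e e0.
have [N hN] := ha _ (divr_gt0 e0 (@ltr0n R 2)).
have [M hM] := hb _ (divr_gt0 e0 (@ltr0n R 2)).
exists (maxn N M) => n; rewrite geq_max => /andP[/hN a1 /hM a2].
apply: le_lt_trans (cplx _) _; rewrite creB cimB /=; move: a1 a2; rewrite /cre/=; lra.
Qed.

(** * Hilbert spaces from positive definite kernels *)

Section Kernel.
Variables (R : realType) (X : Type) (k : X -> X -> Cplx R).
Notation K := (Cplx R).
Hypothesis kC : forall x y, k y x = (k x y)^*.
Definition kform (s t : seq (K * X)) : K :=
  \sum_(p <- s) \sum_(q <- t) p.1 * q.1^* * k p.2 q.2.
Hypothesis kpos : forall s, 0 <= kform s s.

Lemma kform_cat s s' t : kform (s ++ s') t = kform s t + kform s' t.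
Proof. exact: big_cat. Qed.
Lemma kform_scale c s t : kform (lcscale c s) t = c * kform s t.
Proof.
rewrite /kform /lcscale big_map mulr_sumr; apply: eq_bigr => p _.
by rewrite mulr_sumr; apply: eq_bigr => q _ /=; rewrite !mulrA.
Qed.
Lemma kformC s t : kform t s = (kform s t)^*.
Proof.
rewrite /kform exchange_big /= rmorph_sum; apply: eq_bigr => p _ /=.
rewrite rmorph_sum; apply: eq_bigr => q _ /=.
by rewrite !rmorphM /= conjCK -kC [q.1 * _]mulrC.
Qed.

Let kf : X -> (X -> K) := k.
(** The form sees s only through the function that it spans, hence it descends from lists to the
    functions in [kdom]. *)
Lemma kform_lc s t : kform s t = \sum_(q <- t) q.1^* * lc kf s q.2.
Proof.
rewrite /kform exchange_big /=; apply: eq_bigr => q _.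
rewrite /lc fct_sumE mulr_sumr; apply: eq_bigr => p _.
change (p.1 * q.1^* * k p.2 q.2 = q.1^* * (p.1 * k p.2 q.2)); ring.
Qed.

Lemma kform_CS s t : nm (kform s t) ^+ 2 <= cre (kform s s) * cre (kform t t).
Proof.
apply: scalar_CS => u v; apply: le_trans (kpos (lcscale u s ++ lcscale v t)) _.
rewrite !(kform_cat, kform_scale) [kform _ (_ ++ _)]kformC [kform t (_ ++ _)]kformC.
rewrite !(kform_cat, kform_scale) !rmorphD /= !rmorphM /= -!kformC (kformC s t).
by rewrite le_eqVlt; apply/orP; left; apply/eqP; ring.
Qed.

(** A chosen list spanning F, empty by default when F is not spanned. *)
Definition krep (F : X -> K) : seq (K * X) :=
  match pselect (exists s, lc kf s = F) with
  | left h => sval (cid h) | right _ => [::] end.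
Definition kdom : set (X -> K) := range (lc kf).
Definition knorm (F : X -> K) : R := Num.sqrt (cre (kform (krep F) (krep F))).

Lemma krepP s : lc kf (krep (lc kf s)) = lc kf s.
Proof.
rewrite /krep; case: pselect => [h|]; last by case; exists s.
exact: (svalP (cid h)).
Qed.

Lemma kform_rep s : kform (krep (lc kf s)) (krep (lc kf s)) = kform s s.
Proof. by rewrite kform_lc krepP -kform_lc kformC kform_lc krepP -kform_lc -kformC. Qed.

Lemma knorm_lc s : knorm (lc kf s) ^+ 2 = cre (kform s s).
Proof. by rewrite sqr_sqrtr ?kform_rep// cre_ge0. Qed.
Lemma knorm_ge0 F : 0 <= knorm F. Proof. exact: sqrtr_ge0. Qed.

Lemma kform_nm s : kform s s = rc (knorm (lc kf s) ^+ 2).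
Proof. by rewrite knorm_lc creK. Qed.

Lemma kform_le s t : nm (kform s t) <= knorm (lc kf s) * knorm (lc kf t).
Proof.
rewrite -ler_sqr ?nnegrE ?mulr_ge0 ?knorm_ge0 ?nm_ge0// exprMn !knorm_lc.
exact: kform_CS.
Qed.

Lemma knormD F G : kdom F -> kdom G -> knorm (F + G) <= knorm F + knorm G.
Proof.
move=> [s _ <-] [t _ <-]; rewrite -lc_cat -ler_sqr ?nnegrE ?addr_ge0 ?knorm_ge0//.
rewrite knorm_lc; have := kform_le s t; set m := knorm _; set n := knorm _ => h.
have -> : cre (kform (s ++ t) (s ++ t)) = m ^+ 2 + 2 * cre (kform s t) + n ^+ 2.
  rewrite kform_cat [kform s _]kformC [kform t (_ ++ _)]kformC !kform_cat.
  rewrite !rmorphD /= -!kformC (kformC s t) !kform_nm -/m -/n.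
  by case: (kform s t) => a b; rewrite /cre /=; ring.
have h2 := le_trans (ler_norm _) (cre_le_nm (kform s t)).
by rewrite sqrrD; nra.
Qed.

Lemma knormZ (c : K) F : kdom F -> knorm (c *: F) = nm c * knorm F.
Proof.
move=> [s _ <-]; rewrite -lc_scale; apply/eqP.
rewrite -(@eqrXn2 _ 2) ?nnegrE ?mulr_ge0 ?knorm_ge0 ?nm_ge0// exprMn !knorm_lc.
rewrite kform_scale [kform s _]kformC kform_scale rmorphM /= -kformC kform_nm.
by rewrite mulrA mul_conj_nm -rcM !rcK.
Qed.

Let kdom0 : kdom 0. Proof. by exists [::] => //; rewrite lc_nil. Qed.
Let kdomP c F G : kdom F -> kdom G -> kdom (c *: F + G).
Proof. by move=> [s _ <-] [t _ <-]; exists (lcscale c s ++ t) => //; rewrite lc_lin. Qed.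

(** Kolmogorov's construction: complete the span of the functions [k x] for [knorm]. The completion
    is only a normed space, so the inner product is extended afterwards, one variable at a time. *)
Theorem kernel_hilbert : exists (H : hilbert R) (e : X -> H),
  (forall x y, ip (e x) (e y) = k x y) /\ densefam e.
Proof.
have [V [j [jlin jnm jde]]] := completion_exists (Seminormed kdom0 kdomP knormD knormZ).
simpl in j, jlin, jnm, jde.
pose e x := j (k x).
have j0 : j 0 = 0.
  by have := jlin (-1) 0 0 kdom0 kdom0; rewrite scaler0 addr0 scaleN1r addNr.
have jlc s : j (lc kf s) = lc e s.
  elim: s => [|p s IH]; first by rewrite !lc_nil.
  rewrite /lc !big_cons jlin; [|by exists [:: (1, p.2)] => //; rewrite lc1|by exists s].
  by rewrite -/(lc kf s) IH.
have nlc s : nm (lc e s) = knorm (lc kf s) by rewrite -jlc jnm//; exists s.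
have de : densefam e.
  move=> v eps e0; have /dense_nmP/(_ v eps e0)[_ [_ [s _ <-] <-] h] := jde.
  by exists s; rewrite -jlc.
have lck s y : lc (fun x => k x y : K^o) s = kform s [:: (1, y)].
  by rewrite kform_lc big_seq1 rmorph1 mul1r /lc fct_sumE.
(* Pairing with a fixed generator [e y], as a functional of the first variable. *)
have phiP y : exists T : V -> K^o,
    [/\ lin T, bnd T (nm (e y)) & forall x, T (e x) = k x y].
  apply: (bnd_extend de (@cplx_seq_complete R)) => s; rewrite lck mulrC nlc.
  by rewrite -(lc1 e y) nlc; exact: kform_le.
have {phiP}[phi phiP] := choice phiP.
(* Cauchy-Schwarz for an arbitrary v against a combination of generators; it permits the extension
   in the second variable. The conjugate makes the functional [psi v] below linear. *)
have Phi (u : seq (K * X)) v : nm (lc (fun y => (phi y v)^* : K^o) u) <= nm v * nm (lc e u).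
  rewrite -nm_conj.
  have -> : (lc (fun y => (phi y v)^* : K^o) u)^* = \sum_(q <- u) q.1^* * phi q.2 v.
    by rewrite rmorph_sum; apply: eq_bigr => q _; rewrite rmorphM /= conjCK.
  have [T [lT bT hT]] : exists T : V -> K^o,
      [/\ lin T, bnd T (nm (lc e u)) & forall x, T (e x) = kform [:: (1, x)] u].
    apply: (bnd_extend de (@cplx_seq_complete R)) => s.
    have -> : lc (fun x => kform [:: (1, x)] u : K^o) s = kform s u.
      rewrite /lc [RHS]/kform; apply: eq_bigr => p _.
      transitivity (p.1 * kform [:: (1, p.2)] u); first by [].
      rewrite /kform big_seq1 mulr_sumr; apply: eq_bigr => q _.
      by rewrite mul1r mulrA.
    by rewrite !nlc mulrC; exact: kform_le.
  suff <- : T v = \sum_(q <- u) q.1^* * phi q.2 v by rewrite mulrC; exact: bT.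
  move: v; pose C := \sum_(q <- u) nm q.1^* * nm (e q.2).
  apply: (bnd_eq de (C' := C) lT bT) => [c x y|x|x].
  - transitivity (\sum_(q <- u) (c * (q.1^* * phi q.2 x) + q.1^* * phi q.2 y)).
      apply: eq_bigr => q _; have [lp _ _] := phiP q.2.
      rewrite lp; change (q.1^* * (c * phi q.2 x + phi q.2 y) = c * (q.1^* * phi q.2 x) + q.1^* * phi q.2 y).
      by ring.
    by rewrite big_split /= -mulr_sumr.
  - apply: le_trans (nm_sum _ _) _; rewrite mulr_suml ler_sum// => q _.
    rewrite nmM -mulrA ler_wpM2l ?nm_ge0//; by have [_ + _] := phiP q.2; exact.
  - rewrite hT /kform big_seq1; apply: eq_bigr => q _; rewrite mul1r.
    by have [_ _ ->] := phiP q.2.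
have psiP v : exists T : V -> K^o,
    [/\ lin T, bnd T (nm v) & forall y, T (e y) = (phi y v)^*].
  by apply: (bnd_extend de (@cplx_seq_complete R)) => u; exact: Phi.
have {psiP}[psi psiP] := choice psiP.
have psi_lin c v v' w : psi (c *: v + v') w = c^* * psi v w + psi v' w.
  move: w; have [l1 b1 h1] := psiP (c *: v + v').
  have [l2 b2 h2] := psiP v; have [l3 b3 h3] := psiP v'.
  apply: (bnd_eq de (C' := nm c * nm v + nm v') l1 b1) => [d x y|x|y].
  - rewrite l2 l3; change (c^* * (d * psi v x + psi v y) + (d * psi v' x + psi v' y) =
      d * (c^* * psi v x + psi v' x) + (c^* * psi v y + psi v' y)); ring.
  - rewrite (le_trans (nmD _ _))// nmM nm_conj mulrDl -mulrA.
    by rewrite lerD ?b3// ler_wpM2l ?nm_ge0// b2.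
  - have [lp _ _] := phiP y; rewrite h1 h2 h3 lp rmorphD.
    by congr (_ + _); change ((c * phi y v)^* = c^* * (phi y v)^*); rewrite rmorphM.
pose ipV v w : K := (psi v w)^*.
have ipl (c : K) x y z : ipV (c *: x + y) z = c * ipV x z + ipV y z.
  by rewrite /ipV psi_lin rmorphD rmorphM /= conjCK.
have psi_e y v : psi (e y) v = phi y v.
  have [l1 b1 h1] := psiP (e y); have [l2 b2 h2] := phiP y.
  move: v; apply: (bnd_eq de l1 b1 l2 b2) => x.
  by rewrite h1 h2; have [_ _ ->] := phiP x; rewrite -kC.
have ipc x y : ipV y x = (ipV x y)^*.
  rewrite /ipV conjCK; move: y; have [l1 b1 h1] := psiP x.
  apply: (bnd_eq de (C := nm x) (C' := nm x) _ _ l1 b1) => [c v w|v|y].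
  - by rewrite psi_lin rmorphD rmorphM /= conjCK.
  - by rewrite nm_conj mulrC; have [_ b _] := psiP v; exact: b.
  - by rewrite h1 psi_e.
have ipe x y : ipV (e x) (e y) = k x y.
  by rewrite /ipV psi_e; have [_ _ ->] := phiP x; rewrite -kC.
(* True for combinations l by construction of [knorm]; the defect at x is a multiple of |x - l|.
   Taking d <= 1 keeps |l| below |x| + 1. *)
have ipn x : `|x| ^+ 2 = ipV x x.
  rewrite nmE -rcX.
  have ipb v w : nm (ipV v w) <= nm v * nm w.
    by rewrite /ipV nm_conj; have [_ b _] := psiP v; exact: b.
  apply: (@nm_eps _ _ _ _ (2 * (2 * nm x + 1))) => eps e0.
  pose d := Num.min eps 1.
  have d0 : 0 < d by rewrite lt_min e0 ltr01.
  have dle : d <= eps by rewrite ge_min lexx.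
  have d1 : d <= 1 by rewrite ge_min lexx orbT.
  have [s hs] := de x d d0; set l := lc e s in hs *.
  have ll : ipV l l = rc (nm l ^+ 2).
    have ip1 z : ipV l z = \sum_(p <- s) p.1 * ipV (e p.2) z.
      rewrite /l; elim: (s) => [|p t IH].
        by rewrite lc_nil big_nil; have := ipl (-1) 0 0 z; rewrite scaler0 addr0 mulN1r addNr.
      by rewrite /lc !big_cons ipl -/(lc e t) IH.
    rewrite nlc -kform_nm ip1; apply: eq_bigr => p _; rewrite ipc ip1 rmorph_sum mulr_sumr.
    apply: eq_bigr => q _; rewrite rmorphM /= -ipc ipe; ring.
  have -> : rc (nm x ^+ 2) - ipV x x
      = rc (nm x ^+ 2 - nm l ^+ 2) - (ipV (x - l) x + (ipV (x - l) l)^*).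
    have lN y z : ipV (- y) z = - ipV y z.
      by have := ipl (-2) y y z; rewrite -[X in _ + X]scale1r -scalerDl (_ : -2 + 1 = -1 :> K) ?scaleN1r => [->|]; ring.
    have lD y y' z : ipV (y + y') z = ipV y z + ipV y' z.
      by have := ipl 1 y y' z; rewrite scale1r mul1r.
    rewrite !lD !lN rmorphB /= -!ipc ll rcB; ring.
  apply: le_trans (nmB _ _) _; apply: le_trans (lerD (lexx _) (nmD _ _)) _.
  rewrite (nm_conj (ipV (x - l) l)); have := ipb (x - l) x; have := ipb (x - l) l.
  have hlx := nm_sub l x; have hxl := nm_sub x l; rewrite (nmBC l) in hlx.
  have x0 := nm_ge0 x; have l0 := nm_ge0 l; have z0 := nm_ge0 (x - l).
  have : nm (rc (nm x ^+ 2 - nm l ^+ 2)) <= nm (x - l) * (nm x + nm l).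
    rewrite nm_rc_norm subr_sqr normrM (ger0_norm (addr_ge0 x0 l0)) ler_wpM2r ?addr_ge0//.
    by rewrite ler_norml hxl andbT; lra.
  move=> b1 b2 b3.
  have b4 : nm (x - l) * (nm x + nm l) <= eps * (2 * nm x + 1).
    by apply: ler_pM; lra.
  lra.
by exists (@Hilbert R V ipV ipl ipc ipn), e.
Qed.
End Kernel.

(** * Contractivity of *-homomorphisms *)

Lemma exprn_small (R : realType) (q e : R) : 0 <= q < 1 -> 0 < e ->
  exists N, forall n, (N <= n)%N -> q ^+ n < e.
Proof.
move=> /andP[q0 q1] e0.
have : (fun n => q ^+ n : R^o) @ \oo --> (0 : R^o) by apply: cvg_expr; rewrite ger0_norm.
move=> /cvgrPdist_lt/(_ _ e0)[N _ hN]; exists N => n /hN /=.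
by rewrite sub0r normrN ger0_norm// exprn_ge0.
Qed.

Section CStar.
Variables (R : realType) (A : cstarAlgebra R).
Notation K := (Cplx R).
Notation "x ** y" := (cs_mul x y) (at level 40, left associativity).
Implicit Types a b x y : A.

Lemma cs_mull_lin b : lin (fun a => a ** b).
Proof. by move=> k x y; rewrite cs_mulDl cs_mulZl. Qed.
Lemma cs_mulr_lin a : lin (fun b => a ** b).
Proof. by move=> k x y; rewrite cs_mulDr cs_mulZr. Qed.
Lemma cs_mul0l b : 0 ** b = 0. Proof. exact: (lin0 (cs_mull_lin b)). Qed.
Lemma cs_mul0r b : b ** 0 = 0. Proof. exact: (lin0 (cs_mulr_lin b)). Qed.
Lemma cs_mulBl x y b : (x - y) ** b = x ** b - y ** b.
Proof. exact: (linB (cs_mull_lin b)). Qed.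
Lemma cs_mulBr x y b : b ** (x - y) = b ** x - b ** y.
Proof. exact: (linB (cs_mulr_lin b)). Qed.
Lemma cs_mul_suml (I : Type) (r : seq I) (P : pred I) (F : I -> A) b :
  (\sum_(i <- r | P i) F i) ** b = \sum_(i <- r | P i) F i ** b.
Proof. exact: (lin_sum (cs_mull_lin b)). Qed.
Lemma cs_mul_sumr (I : Type) (r : seq I) (P : pred I) (F : I -> A) b :
  b ** (\sum_(i <- r | P i) F i) = \sum_(i <- r | P i) b ** F i.
Proof. exact: (lin_sum (cs_mulr_lin b)). Qed.
Lemma cs_star0 : cs_star (0 : A) = 0.
Proof. by have := cs_starZ 0 (0 : A); rewrite scale0r rmorph0 scale0r. Qed.
Lemma cs_starN x : cs_star (- x) = - cs_star x.
Proof. by rewrite -scaleN1r cs_starZ rmorphN1 scaleN1r. Qed.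
Lemma cs_starB x y : cs_star (x - y) = cs_star x - cs_star y.
Proof. by rewrite cs_starD cs_starN. Qed.
Lemma cs_star_sum (I : Type) (r : seq I) (F : I -> A) :
  cs_star (\sum_(i <- r) F i) = \sum_(i <- r) cs_star (F i).
Proof. by apply: (big_morph (@cs_star R A)); [exact: cs_starD|exact: cs_star0]. Qed.

Lemma nm_mul a b : nm (a ** b) <= nm a * nm b.
Proof. by rewrite -rc_le rcM -!nmE cs_normM. Qed.
Lemma nm_starM a : nm (cs_star a ** a) = nm a ^+ 2.
Proof. by apply: (@rc_inj R); rewrite rcX -!nmE cs_normS. Qed.
Lemma nm_star a : nm (cs_star a) = nm a.
Proof.
have H x : nm x <= nm (cs_star x).
  have [x0|x0] := leP (nm x) 0; first exact: le_trans x0 (nm_ge0 _).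
  by rewrite -(ler_pM2r x0) -expr2 -nm_starM nm_mul.
by apply/eqP; rewrite eq_le H -{2}(cs_starK a) H.
Qed.
Lemma nm_mulS a : nm (a ** cs_star a) = nm a ^+ 2.
Proof. by rewrite -{1}(cs_starK a) nm_starM nm_star. Qed.

(** There may be no unit to test at; b = a^* gives |a|^2 <= C |a|. *)
Lemma nm_le_mul a (C : R) : 0 <= C -> (forall b, nm (a ** b) <= C * nm b) -> nm a <= C.
Proof.
move=> C0 h; have [a0|a0] := leP (nm a) 0; first exact: le_trans C0.
by rewrite -(ler_pM2r a0) -expr2 -nm_mulS (le_trans (h _))// nm_star.
Qed.
Lemma cs_ext a a' : (forall b, a ** b = a' ** b) -> a = a'.
Proof.
move=> h; apply/eqP; rewrite -subr_eq0; apply/eqP/nm_eq0/eqP.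
rewrite eq_le nm_ge0 andbT; apply: nm_le_mul => // b.
by rewrite cs_mulBl h subrr nm0 mul0r.
Qed.
Lemma cs_extr a a' : (forall b, b ** a = b ** a') -> a = a'.
Proof.
move=> h; rewrite -(cs_starK a) -(cs_starK a'); congr cs_star; apply: cs_ext => b.
by rewrite -(cs_starK b) -!cs_starM h.
Qed.

(* [1 - r] is the square root of [1 - a^2]: solve [r = (a^2 + r^2) / 2] by iteration. *)
Lemma cs_sqrt a : cs_star a = a -> nm a < 1 ->
  exists r, [/\ cs_star r = r, a ** r = r ** a & r + r - r ** r = a ** a].
Proof.
move=> sa a1; pose q := nm a; have q0 : 0 <= q by exact: nm_ge0.
pose h : K := 2^-1; have hC : h^* = h by rewrite /h fmorphV rmorph_nat.
have nh : nm h = 2^-1 by rewrite -(nm_rc (r := 2^-1)) ?invr_ge0// rcV rc_nat.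
pose f r := h *: (a ** a + r ** r).
pose u n := iter n f 0.
have uq n : nm (u n) <= q.
  elim: n => [|n IH]; first by rewrite nm0.
  rewrite /= -/(u n) /f nmZ nh; have := nmD (a ** a) (u n ** u n).
  have := nm_mul a a; have := nm_mul (u n) (u n); rewrite -/q.
  by have := nm_ge0 (u n); nra.
(* On the ball of radius q = |a| the map f is q-Lipschitz, so the iterates from 0 converge
   geometrically. *)
have df x y : nm x <= q -> nm y <= q -> nm (f x - f y) <= q * nm (x - y).
  move=> xq yq; rewrite -scalerBr opprD addrACA subrr add0r nmZ nh.
  have -> : x ** x - y ** y = x ** (x - y) + (x - y) ** y.
    by rewrite cs_mulBr cs_mulBl addrA subrK.
  have := nmD (x ** (x - y)) ((x - y) ** y).
  have := nm_mul x (x - y); have := nm_mul (x - y) y; have := nm_ge0 (x - y); nra.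
have uu n k : nm (u (n + k)%N - u n) <= q ^+ n.
  elim: n => [|n IH]; first by rewrite subr0 expr0 (le_trans (uq _))// ltW.
  by rewrite addSn exprS (le_trans (df _ _ (uq _) (uq _)))// ler_wpM2l.
have cu : cauchyseq u.
  have H e : 0 < e -> exists N, forall n k, (N <= n)%N -> nm (u (n + k)%N - u n) < e.
    move=> e0; have [|N hN] := @exprn_small _ q e _ e0; first by rewrite q0.
    by exists N => n k /hN; exact: le_lt_trans.
  move=> e e0; have [N hN] := H _ e0; exists N => n m Nn Nm.
  have [nm'|mn] := leqP n m; first by rewrite nmBC -(subnKC nm') hN.
  by rewrite -(subnKC (ltnW mn)) hN.
have [r hr] := complete_seq cu.
have rq : nm r <= q.
  apply: le_epsP => e e0; have [N /(_ _ (leqnn N)) hN] := hr _ e0.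
  by have := nm_sub r (u N); rewrite nmBC; have := uq N; lra.
have fr : r = f r.
  apply: (@nm_eps _ _ _ _ 2) => e e0.
  have [N hN] := hr _ e0; have h1 := hN _ (leqnn N); have h2 := hN _ (leqnSn N).
  have := nm_tri (u N.+1) r (f r); rewrite (nmBC r (u _)).
  have := df (u N) r (uq _) rq; rewrite [f (u N)]/(u N.+1).
  by have := nm_ge0 (u N - r); nra.
have us n : cs_star (u n) = u n.
  by elim: n => [|n IH]; rewrite ?cs_star0//= /f cs_starZ hC cs_starD !cs_starM sa IH.
have ua n : a ** u n = u n ** a.
  elim: n => [|n IH]; first by rewrite cs_mul0l cs_mul0r.
  change (a ** f (u n) = f (u n) ** a).
  rewrite /f cs_mulZl cs_mulZr cs_mulDl cs_mulDr; congr (_ *: (_ + _)).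
    by rewrite cs_mulA.
  by rewrite cs_mulA IH -!cs_mulA IH.
exists r; split.
- apply: (@nm_eps _ _ _ _ 2) => e e0; have [N /(_ _ (leqnn N)) hN] := hr _ e0.
  have := nm_tri (u N) (cs_star r) r; rewrite -{1}(us N) -cs_starB nm_star (nmBC r (u N)); lra.
- apply: (@nm_eps _ _ _ _ 2) => e e0; have [N /(_ _ (leqnn N)) hN] := hr _ e0.
  have := nm_tri (a ** u N) (a ** r) (r ** a); rewrite {2}ua -cs_mulBr -cs_mulBl.
  have := nm_mul a (r - u N); have := nm_mul (u N - r) a; rewrite -/q (nmBC r).
  have := nm_ge0 (u N - r); nra.
- have e2 : r + r = a ** a + r ** r.
    by rewrite -mulr2n -(scaler_nat 2 r) {1}fr /f scalerA divff ?pnatr_eq0// scale1r.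
  by rewrite e2 addrK.
Qed.
End CStar.

(** Common frame for a Hilbert space with its scalar product and for a C*-algebra with the form y^*
    x valued in itself; the contraction argument is carried out once for both. *)
Record isform (R : realType) (V : normedModType (Cplx R)) (Z : normedModType (Cplx R))
    (f : V -> V -> Z) : Prop := IsForm {
  form_l : forall (k : Cplx R) x y z, f (k *: x + y) z = k *: f x z + f y z;
  form_r : forall (k : Cplx R) x y z, f z (k *: x + y) = k^* *: f z x + f z y;
  form_CS : forall x y, nm (f x y) <= nm x * nm y;
  form_sq : forall x, nm (f x x) = nm x ^+ 2 }.

Section Contraction.
Variables (R : realType) (V Z : normedModType (Cplx R)) (f : V -> V -> Z).
Notation K := (Cplx R).
Hypothesis hf : isform f.
Variables (X : Type) (e : X -> V).

Lemma form_llin z : lin (fun x => f x z).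
Proof. by move=> k x y; exact: form_l. Qed.
Lemma form_rD x y z : f z (x + y) = f z x + f z y.
Proof. by have := form_r hf 1 x y z; rewrite scale1r rmorph1 scale1r. Qed.
Lemma form_r0 z : f z 0 = 0.
Proof. by have := form_rD 0 0 z; rewrite addr0 => /eqP; rewrite -[X in X == _]addr0 (inj_eq (addrI _)) => /eqP. Qed.
Lemma form_rZ k x z : f z (k *: x) = k^* *: f z x.
Proof. by have := form_r hf k x 0 z; rewrite form_r0 !addr0. Qed.
Lemma form_rN x z : f z (- x) = - f z x.
Proof. by rewrite -scaleN1r form_rZ rmorphN1 scaleN1r. Qed.
Lemma form_lc (g h : X -> V) s t :
  f (lc g s) (lc h t) = \sum_(p <- s) \sum_(q <- t) (p.1 * q.1^*) *: f (g p.2) (h q.2).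
Proof.
rewrite [LHS](lin_sum (form_llin _)); apply: eq_bigr => p _.
rewrite (linZ (form_llin _)) /=.
have -> : f (g p.2) (lc h t) = \sum_(q <- t) q.1^* *: f (g p.2) (h q.2).
  elim: t => [|q t IH]; first by rewrite lc_nil big_nil form_r0.
  by rewrite /lc !big_cons form_r// -IH.
by rewrite scaler_sumr; apply: eq_bigr => q _; rewrite scalerA.
Qed.

(** Norms of combinations are determined by the values of the form on pairs of generators. *)
Lemma nm_family_eq (g h : X -> V) :
  (forall x y, f (g x) (g y) = f (h x) (h y)) -> forall s, nm (lc g s) = nm (lc h s).
Proof.
move=> gh s; apply/eqP; rewrite -(@eqrXn2 _ 2) ?nnegrE ?nm_ge0// -!(form_sq hf) !form_lc.
by apply/eqP; congr nm; apply: eq_bigr => p _; apply: eq_bigr => q _; rewrite gh.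
Qed.

(* [y] is the real part of the isometric families [y + iz] and [y - iz]. *)
Lemma nm_family_le (y z : X -> V) :
  (forall x x', f (y x) (y x') + f (z x) (z x') = f (e x) (e x')) ->
  (forall x x', f (y x) (z x') = f (z x) (y x')) ->
  forall s, nm (lc y s) <= nm (lc e s).
Proof.
move=> h1 h2 s.
have iso (k : K) : k * k^* = 1 -> k^* = - k ->
    nm (lc (fun x => k *: z x + y x) s) = nm (lc e s).
  move=> kk kN; apply: nm_family_eq => x x'.
  rewrite (form_l hf) !(form_r hf) scalerDr scalerA kk scale1r h2 kN scaleNr.
  by rewrite -addrA [X in _ + X]addrA subrr add0r addrC h1.
have ii : 'i * ('i : K)^* = 1 by rewrite conjCi mulrN -expr2 sqrCi opprK.
have i1 := iso 'i ii (conjCi _).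
have i2 : nm (lc (fun x => (- 'i) *: z x + y x) s) = nm (lc e s).
  by apply: iso; [rewrite rmorphN mulrNN|rewrite rmorphN /= conjCi].
have -> : lc y s = 2^-1 *: (lc (fun x => 'i *: z x + y x) s + lc (fun x => (- 'i) *: z x + y x) s).
  have e2 x : ('i *: z x + y x) + ((- 'i) *: z x + y x) = 2 *: y x.
    by rewrite addrACA -scalerDl subrr scale0r add0r -mulr2n scaler_nat.
  rewrite /lc -big_split scaler_sumr; apply: eq_bigr => p _ /=.
  rewrite -scalerDr e2 !scalerA; congr (_ *: _).
  by rewrite -mulrA mulrCA mulVf ?mulr1 ?pnatr_eq0.
rewrite nmZ -(rc_nat R 2) -rcV nm_rc ?invr_ge0//.
rewrite ler_pdivrMl// (le_trans (nmD _ _))// i1 i2; lra.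
Qed.

Variables (S : lmodType K) (dom : set S) (mul : S -> S -> S) (star : S -> S).
(** [le a C] reads |a| <= C. As a relation it also covers functions into a C*-algebra, where it is a
    bound at every point. *)
Variable le : S -> R -> Prop.
Hypothesis domP : forall (k : K) a b, dom a -> dom b -> dom (k *: a + b).
Hypothesis domM : forall a b, dom a -> dom b -> dom (mul a b).
Hypothesis domS : forall a, dom a -> dom (star a).
Hypothesis starZ : forall (r : R) a, star (rc r *: a) = rc r *: star a.
Hypothesis starMM : forall a, star (mul (star a) a) = mul (star a) a.
Hypothesis leZ : forall a (r C : R), 0 < r -> le a C -> le (rc r *: a) (r * C).
Hypothesis leM : forall a C, le a C -> le (mul (star a) a) (C ^+ 2).
Hypothesis ssqrt : forall a q, dom a -> star a = a -> le a q -> 0 <= q -> q < 1 ->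
  exists r, [/\ dom r, star r = r, mul a r = mul r a & r + r - mul r r = mul a a].
Variable T : S -> X -> V.
Hypothesis T1 : forall a b x x', dom a -> dom b ->
  f (T a x) (T b x') = f (T (mul (star b) a) x) (e x').
Hypothesis T2 : forall b x x', dom b -> f (e x) (T b x') = f (T (star b) x) (e x').
Hypothesis T3 : forall (k : K) a b x, dom a -> dom b ->
  T (k *: a + b) x = k *: T a x + T b x.

(** For self-adjoint a with |a| < 1 and its r from [ssqrt], the families [T a] and [e - T r] satisfy
    [nm_family_le], because a^2 + (1 - r)^2 = 1. Scaling gives all self-adjoint elements, and the
    general case is |T(a) v|^2 <= |T(a^* a) v| |v|. The hypotheses involve T on generators only, so
    T need not be known to extend beforehand. *)
Lemma contraction a C : dom a -> le a C -> 0 <= C ->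
  forall s, nm (lc (T a) s) <= C * nm (lc e s).
Proof.
move=> da.
have dom0 : dom 0 by have := domP (-1) da da; rewrite scaleN1r addNr.
have domD b c : dom b -> dom c -> dom (b + c).
  by move=> db dc; rewrite -(scale1r b); exact: domP.
have domZ k b : dom b -> dom (k *: b) by move=> db; rewrite -[_ *: _]addr0; exact: domP.
have domN b : dom b -> dom (- b) by move=> db; rewrite -scaleN1r; exact: domZ.
have TD b c x : dom b -> dom c -> T (b + c) x = T b x + T c x.
  by move=> db dc; have := T3 1 x db dc; rewrite !scale1r.
have T0 x : T 0 x = 0.
  by have := TD 0 0 x dom0 dom0; rewrite addr0 => /eqP; rewrite -[X in X == _]addr0 (inj_eq (addrI _)) => /eqP.
have TZ k b x : dom b -> T (k *: b) x = k *: T b x.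
  by move=> db; have := T3 k x db dom0; rewrite T0 !addr0.
have TN b x : dom b -> T (- b) x = - T b x by move=> db; rewrite -scaleN1r TZ// scaleN1r.
have lcTZ k b s : dom b -> lc (T (k *: b)) s = k *: lc (T b) s.
  move=> db; rewrite /lc scaler_sumr; apply: eq_bigr => p _.
  by rewrite TZ// !scalerA mulrC.
have sa1 b q : dom b -> star b = b -> le b q -> 0 <= q -> q < 1 ->
    forall s, nm (lc (T b) s) <= nm (lc e s).
  move=> db sb bq q0 q1; have [r [dr sr br e1]] := ssqrt db sb bq q0 q1.
  apply: (@nm_family_le _ (fun x => e x - T r x)) => x x'.
    have fl := form_llin; rewrite T1// sb -e1 !TD ?TN//; [|by auto..].
    rewrite !(linD (fl _)) (linN (fl _)).
    rewrite !form_rD !form_rN !(linN (fl _)) T2// sr T1// sr.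
    set t := f (T r x) _; set E := f (e x) _; set q' := f _ _.
    have -> : E - t + (- t - - q') = E - (t + t - q').
      by rewrite opprK opprB opprD (addrC _ q') addrACA -addrA.
    by rewrite addrC subrK.
  have fl := form_llin; rewrite form_rD form_rN !(linD (fl _)) !(linN (fl _)).
  by rewrite T2// !T1// sr sb br.
have sa b c : dom b -> star b = b -> le b c -> 0 <= c ->
    forall s, nm (lc (T b) s) <= c * nm (lc e s).
  (* Dividing by c + d with d > 0 makes the norm strictly less than 1; d is chosen so that d |lc e
     s| <= eps. *)
  move=> db sb bc c0 s; apply: le_epsP => eps e0.
  have d0 : 0 < nm (lc e s) + 1 by have := nm_ge0 (lc e s); lra.
  pose d := eps / (nm (lc e s) + 1); have dp : 0 < d by exact: divr_gt0.
  have cd : 0 < c + d by lra.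
  have k0 : 0 < (c + d)^-1 by rewrite invr_gt0.
  have := @sa1 (rc (c + d)^-1 *: b) _ (domZ _ _ db) _ (leZ k0 bc) _ _ s.
  rewrite starZ sb lcTZ// nmZ (nm_rc (ltW k0)) => /(_ erefl) h.
  have {}h : (c + d)^-1 * nm (lc (T b) s) <= nm (lc e s).
    apply: h; first by rewrite mulr_ge0// ltW.
    by rewrite ltr_pdivrMl// mulr1; lra.
  move: h; rewrite ler_pdivrMl// => h; apply: le_trans h _; rewrite mulrDl lerD2l.
  rewrite /d mulrAC ler_pdivrMr// ler_wpM2l ?(ltW e0)//; lra.
move=> aC C0 s.
have [z|z] := leP (nm (lc (T a) s)) 0; first by rewrite (le_trans z)// mulr_ge0// nm_ge0.
rewrite -ler_sqr ?nnegrE ?mulr_ge0 ?nm_ge0// -(form_sq hf).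
have -> : f (lc (T a) s) (lc (T a) s) = f (lc (T (mul (star a) a)) s) (lc e s).
  by rewrite !form_lc; apply: eq_bigr => p _; apply: eq_bigr => q _; rewrite T1.
rewrite (le_trans (form_CS hf _ _))// exprMn [nm (lc e s) ^+ 2]expr2 mulrA.
rewrite ler_wpM2r ?nm_ge0//; apply: sa; [by auto|exact: starMM|exact: leM|exact: sqr_ge0].
Qed.
End Contraction.

Section FormInstances.
Variable R : realType.
Notation K := (Cplx R).

Lemma ip_form (H : hilbert R) : isform (fun x y : H => ip x y : K^o).
Proof.
split=> [k x y z|k x y z|x y|x].
- exact: ip_linear.
- by rewrite ipDr ipZr.
- exact: ip_CS.
- by rewrite ip_nm nm_rc// sqr_ge0.
Qed.

Lemma cs_form (A : cstarAlgebra R) : isform (fun x y : A => cs_mul (cs_star y) x).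
Proof.
split=> [k x y z|k x y z|x y|x].
- exact: cs_mulr_lin.
- by rewrite cs_starD cs_starZ cs_mulDl cs_mulZl.
- by rewrite (le_trans (nm_mul _ _))// nm_star mulrC.
- exact: nm_starM.
Qed.
End FormInstances.

Section CStarContraction.
Variables (R : realType) (A : cstarAlgebra R) (V Z : normedModType (Cplx R)) (f : V -> V -> Z).
Notation K := (Cplx R).
Hypothesis hf : isform f.
Variables (X : Type) (e : X -> V).

Lemma cs_contraction (T : A -> X -> V) :
  (forall a b x x', f (T a x) (T b x') = f (T (cs_mul (cs_star b) a) x) (e x')) ->
  (forall b x x', f (e x) (T b x') = f (T (cs_star b) x) (e x')) ->
  (forall (k : K) a b x, T (k *: a + b) x = k *: T a x + T b x) ->
  forall a s, nm (lc (T a) s) <= nm a * nm (lc e s).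
Proof.
move=> T1 T2 T3 a s.
apply: (@contraction R V Z f hf X e A setT (@cs_mul R A) (@cs_star R A)
  (fun a C => nm a <= C) _ _ _ _ _ _ _ _ T) => //.
- by move=> r b; rewrite cs_starZ rc_conj.
- by move=> b; rewrite cs_starM cs_starK.
- by move=> b r C r0 bC; rewrite nmZ (nm_rc (ltW r0)) ler_pM2l.
- by move=> b C bC; rewrite nm_starM lerXn2r ?nnegrE ?nm_ge0// (le_trans _ bC)// nm_ge0.
- move=> b q _ sb bq _ q1; have [|r [? ? ?]] := cs_sqrt sb; first exact: le_lt_trans q1.
  by exists r.
- exact: nm_ge0.
Qed.

(** The function F acts on the generator x through its value at [gr x]. Generators of different
    grades are orthogonal, so adjointness is needed only within a grade, and square roots are taken
    pointwise. *)
Lemma diag_contraction (G : Type) (gr : X -> G) (T : A -> X -> V) :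
  (forall a b x x', gr x = gr x' ->
    f (T a x) (T b x') = f (T (cs_mul (cs_star b) a) x) (e x')) ->
  (forall b x x', gr x = gr x' -> f (e x) (T b x') = f (T (cs_star b) x) (e x')) ->
  (forall a b x x', gr x <> gr x' ->
    [/\ f (T a x) (T b x') = 0, f (T a x) (e x') = 0 & f (e x) (T a x') = 0]) ->
  (forall (k : K) a b x, T (k *: a + b) x = k *: T a x + T b x) ->
  forall (F : G -> A) C, (forall u, nm (F u) <= C) -> 0 <= C ->
  forall s, nm (lc (fun x => T (F (gr x)) x) s) <= C * nm (lc e s).
Proof.
move=> T1 T2 T0 T3 F C FC C0 s.
pose T' (F : G -> A) x := T (F (gr x)) x.
apply: (@contraction R V Z f hf X e (G -> A) setT (fun F F' u => cs_mul (F u) (F' u))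
  (fun F u => cs_star (F u)) (fun F C => forall u, nm (F u) <= C) _ _ _ _ _ _ _ _ T') => //.
- by move=> r F'; apply/funext => u; rewrite [LHS]cs_starZ rc_conj.
- by move=> F'; apply/funext => u; rewrite cs_starM cs_starK.
- by move=> b r c r0 bC u; change (nm (rc r *: b u) <= r * c); rewrite nmZ (nm_rc (ltW r0)) ler_pM2l.
- by move=> b c bC u; rewrite nm_starM lerXn2r ?nnegrE ?nm_ge0// (le_trans _ (bC u))// nm_ge0.
- move=> b q _ sb bq _ q1.
  have /choice[r hr] : forall u, exists r, [/\ cs_star r = r, cs_mul (b u) r = cs_mul r (b u)
      & r + r - cs_mul r r = cs_mul (b u) (b u)].
    by move=> u; apply: cs_sqrt; [rewrite -[in RHS]sb|exact: le_lt_trans q1].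
  by exists r; split => //; apply/funext => u; have [] := hr u.
- move=> a b x x' _ _; rewrite /T'; have [g|g] := pselect (gr x = gr x').
    by rewrite T1// g.
  by have [-> _ _] := T0 (a (gr x)) (b (gr x')) _ _ g; have [_ -> _] := T0 (cs_mul (cs_star (b (gr x))) (a (gr x))) 0 _ _ g.
- move=> b x x' _; rewrite /T'; have [g|g] := pselect (gr x = gr x').
    by rewrite T2// g.
  by have [_ _ ->] := T0 (b (gr x')) 0 _ _ g; have [_ -> _] := T0 (cs_star (b (gr x))) 0 _ _ g.
- by move=> k a b x _ _; rewrite /T' -T3.
Qed.
End CStarContraction.

(** * Multipliers *)

Lemma simple_densefam (R : realType) (X : Type) (V : normedModType (Cplx R)) (e : X -> V) :
  (forall (v : V) (eps : R), 0 < eps -> exists x, nm (v - e x) < eps) -> densefam e.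
Proof. by move=> h v eps /(h v)[x hx]; exists [:: (1, x)]; rewrite lc1. Qed.

Section Multipliers.
Variables (R : realType) (B : cstarAlgebra R).
Notation "x ** y" := (cs_mul x y) (at level 40, left associativity).
Implicit Types (m : multiplier B) (a b : B).

Lemma mult_adjPl m a b : cs_star (mult_adj m a) ** b = cs_star a ** m b.
Proof. by rewrite -[LHS]cs_starK cs_starM cs_starK -mult_adjP cs_starM cs_starK. Qed.

Lemma cs_star_ext a b : (forall c, cs_star c ** a = cs_star c ** b) -> a = b.
Proof. by move=> h; apply: cs_extr => c; rewrite -(cs_starK c). Qed.

(** Linearity, like compatibility with right multiplication below, is forced by the existence of an
    adjoint. *)
Lemma mult_lin m : lin m.
Proof.
move=> k x y; apply: cs_star_ext => c.
by rewrite -mult_adjPl !cs_mulr_lin -!mult_adjPl.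
Qed.
Lemma mult_mul m a b : m (a ** b) = m a ** b.
Proof. by apply: cs_star_ext => c; rewrite -mult_adjPl !cs_mulA mult_adjPl. Qed.

Definition mult_comp m m' : multiplier B.
Proof.
exists (m \o m') (mult_adj m' \o mult_adj m) => a b /=.
by rewrite mult_adjP mult_adjP.
Defined.
Definition mult_star m : multiplier B.
Proof. by exists (mult_adj m) m => a b; exact: mult_adjPl. Defined.

(** Multipliers are not known to be bounded; but c^* m(b) = m^*(c)^* b is bounded in b for each
    fixed c, and density can be used there. *)
Lemma mult_eq_dense (X : Type) (e : X -> B) m m' : densefam e ->
  (forall x, m (e x) = m' (e x)) -> forall b, m b = m' b.
Proof.
move=> de h b; apply: cs_star_ext => c; rewrite -!mult_adjPl.
move: b; apply: (bnd_eq de (C := nm (mult_adj m c)) (C' := nm (mult_adj m' c))).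
- exact: cs_mulr_lin.
- by move=> x; rewrite (le_trans (nm_mul _ _))// nm_star.
- exact: cs_mulr_lin.
- by move=> x; rewrite (le_trans (nm_mul _ _))// nm_star.
- by move=> x; rewrite !mult_adjPl h.
Qed.

Lemma cs_dense_ext (X : Type) (e : X -> B) a b : densefam e ->
  (forall x, cs_star (e x) ** a = cs_star (e x) ** b) -> a = b.
Proof.
move=> de h; rewrite -(cs_starK a) -(cs_starK b); congr cs_star; apply: cs_ext.
apply: (bnd_eq de (C := nm a) (C' := nm b)); try exact: cs_mulr_lin.
- by move=> x; rewrite (le_trans (nm_mul _ _))// nm_star.
- by move=> x; rewrite (le_trans (nm_mul _ _))// nm_star.
- by move=> x; rewrite -(cs_starK (e x)) -!cs_starM h.
Qed.

Lemma mult_extend (X : Type) (e t t' : X -> B) (C : R) : densefam e ->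
  (forall x y, cs_star (t x) ** e y = cs_star (e x) ** t' y) ->
  (forall s, nm (lc t s) <= C * nm (lc e s)) ->
  exists m, [/\ forall x, m (e x) = t x, forall x, mult_adj m (e x) = t' x & bnd m C].
Proof.
move=> de tt' tC.
have [T [Tl Tb Te]] := bnd_extend de (@complete_seq R B) tC.
have adj1 y (x : B) : cs_star (T x) ** e y = cs_star x ** t' y.
  rewrite -[LHS]cs_starK -[RHS]cs_starK; congr cs_star; rewrite !cs_starM !cs_starK.
  move: x; apply: (bnd_eq de (C := C * nm (e y)) (C' := nm (t' y))).
  - by move=> k u v; rewrite Tl cs_mulr_lin.
  - move=> u; rewrite (le_trans (nm_mul _ _))// nm_star mulrC mulrAC ler_wpM2r ?nm_ge0//.
  - exact: cs_mulr_lin.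
  - by move=> u; rewrite (le_trans (nm_mul _ _))// nm_star.
  - by move=> u; rewrite Te; have := congr1 (@cs_star R B) (tt' u y); rewrite !cs_starM !cs_starK.
have adj2 s (x : B) : cs_star (T x) ** lc e s = cs_star x ** lc t' s.
  rewrite (lin_lc (cs_mulr_lin _)) (lin_lc (cs_mulr_lin _)).
  by apply: eq_bigr => p _ /=; rewrite adj1.
(* The adjoint inherits the bound: for y = lc t' s one has y^* y = T(y)^* lc e s. *)
have t'C s : nm (lc t' s) <= C * nm (lc e s).
  set y := lc t' s; have [y0|y0] := leP (nm y) 0.
    by apply: le_trans y0 _; apply: le_trans (tC s); exact: nm_ge0.
  rewrite -(ler_pM2r y0) -expr2 -nm_starM -adj2 (le_trans (nm_mul _ _))// nm_star.
  rewrite mulrAC; apply: ler_wpM2r; [exact: nm_ge0|exact: Tb].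
have [T' [T'l T'b T'e]] := bnd_extend de (@complete_seq R B) t'C.
have adj a b : cs_star (T a) ** b = cs_star a ** T' b.
  move: b; apply: (bnd_eq de (C := nm (T a)) (C' := nm a * C)).
  - exact: cs_mulr_lin.
  - by move=> u; rewrite (le_trans (nm_mul _ _))// nm_star.
  - by move=> k u v; rewrite T'l cs_mulr_lin.
  - by move=> u; rewrite (le_trans (nm_mul _ _))// nm_star -mulrA ler_wpM2l ?nm_ge0.
  - by move=> u; rewrite adj1 T'e.
by exists (Multiplier adj); split.
Qed.
End Multipliers.

Section Contractive.
Variables (R : realType) (A B : cstarAlgebra R).
Notation "x ** y" := (cs_mul x y) (at level 40, left associativity).

Lemma mult_hom_le (phi : A -> multiplier B) : @is_mult_hom R A B phi ->
  forall a b, nm (phi a b) <= nm a * nm b.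
Proof.
move=> [hl hm hs] a b.
have := @cs_contraction R A B B _ (cs_form B) B id (fun a x => phi a x) _ _ _ a [:: (1, b)].
rewrite !lc1; apply=> //.
- move=> c d x x' /=; rewrite mult_adjP; congr (_ ** _).
  by rewrite -hs// -hm.
- by move=> d x x'; rewrite mult_adjP hs.
- by move=> k c d x; rewrite hl.
Qed.

Lemma star_hom_le (phi : A -> B) : @is_star_hom R A B phi ->
  forall a, nm (phi a) <= nm a.
Proof.
move=> [hl hm hs] a; apply: nm_le_mul => [|b]; first exact: nm_ge0.
have := @cs_contraction R A B B _ (cs_form B) B id (fun a x => phi a ** x) _ _ _ a [:: (1, b)].
rewrite !lc1; apply=> //.
- by move=> c d x x' /=; rewrite hm// hs// cs_starM !cs_mulA.
- by move=> d x x'; rewrite hs// cs_starM !cs_mulA.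
- by move=> k c d x; rewrite hl// cs_mulDl cs_mulZl.
Qed.

Lemma rep_le (H : hilbert R) (phi : A -> H -> H) : @is_rep R A H phi ->
  forall a h, nm (phi a h) <= nm a * nm h.
Proof.
move=> [_ hl hm hs] a h.
have := @cs_contraction R A H _ _ (ip_form H) H id phi _ _ _ a [:: (1, h)].
have hs' x k y : ip k (phi x y) = ip (phi (cs_star x) k) y.
  by rewrite ip_conj hs// -ip_conj.
rewrite !lc1; apply=> //.
- by move=> c d x x' /=; rewrite hs' -hm.
- by move=> k c d x; rewrite hl.
Qed.

Lemma rep_lin (H : hilbert R) (phi : A -> H -> H) a : @is_rep R A H phi -> lin (phi a).
Proof. by move=> [h _ _ _] k x y; have [l _] := h a I; rewrite -l. Qed.

Lemma star_hom_lin (phi : A -> B) : @is_star_hom R A B phi -> lin phi.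
Proof. by move=> [h _ _] k x y; rewrite h. Qed.

Lemma rep_adj (H : hilbert R) (phi : A -> H -> H) a x y : @is_rep R A H phi ->
  ip x (phi a y) = ip (phi (cs_star a) x) y.
Proof. by move=> [_ _ _ hs]; rewrite ip_conj hs// -ip_conj. Qed.
End Contractive.

Lemma re_im_decomposition (R : realType) (V : lmodType (Cplx R)) (x y : V) :
  x = 2^-1 *: (x + y) + (- 2^-1 * 'i) *: ('i *: (x - y)).
Proof.
rewrite scalerA -mulrA -expr2 sqrCi mulrN1 opprK -scalerDr addrACA subrr addr0.
by rewrite -mulr2n -(scaler_nat 2 x) scalerA mulVf ?pnatr_eq0// scale1r.
Qed.

(** * Density of products without an approximate unit *)

Section DenseProducts.
Variables (R : realType) (A : cstarAlgebra R).
Notation K := (Cplx R).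
Notation "x ** y" := (cs_mul x y) (at level 40, left associativity).

(* With [N x = (1 - a^2) x], a contraction, the averages of [N^k a] over [k < n] tend
   to [0] because the averages of [N^k a^2] telescope; and [a - N^k a] lies in [a A]. *)
Lemma cs_selfadj_mul (a : A) (eps : R) : cs_star a = a -> nm a < 1 -> 0 < eps ->
  exists v, nm (a - a ** v) < eps.
Proof.
move=> sa a1 e0; have [r [sr ar e1]] := cs_sqrt sa a1.
pose N (x : A) := x - a ** (a ** x).
have Nlin : lin N.
  by move=> k x y; rewrite /N !cs_mulr_lin scalerBr opprD addrACA.
(* N is the square of the operator x - r x because (1 - r)^2 = 1 - a^2, and that operator is a
   contraction by [nm_family_le]. *)
have ZE x : x - r ** x - r ** (x - r ** x) = N x.
  have -> : N x = x - (r ** x + r ** x - r ** (r ** x)).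
    by rewrite /N cs_mulA -e1 cs_mulBl cs_mulDl cs_mulA.
  by rewrite cs_mulBr !opprB opprD addrACA -addrA.
have star_Z x' w : cs_star (x' - r ** x') ** w = cs_star x' ** (w - r ** w).
  by rewrite cs_starB cs_mulBl cs_starM sr -cs_mulA -cs_mulBr.
have star_a x' w : cs_star (a ** x') ** w = cs_star x' ** (a ** w).
  by rewrite cs_starM sa cs_mulA.
have Zle x : nm (x - r ** x) <= nm x.
  have := @nm_family_le R A A _ (cs_form A) A id (fun x => x - r ** x) (fun x => a ** x).
  move=> /(_ _ _ [:: (1, x)]); rewrite !lc1; apply=> y y' /=.
    by rewrite star_Z star_a ZE -cs_mulDr subrK.
  by rewrite star_Z star_a cs_mulBr !cs_mulA ar.
have Nle x : nm (N x) <= nm x by rewrite -ZE (le_trans (Zle _)).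
have Nsym x y : cs_star (N x) ** y = cs_star x ** N y.
  by rewrite -!ZE !star_Z.
have Nmul x y : N (x ** y) = N x ** y by rewrite /N cs_mulBl !cs_mulA.
pose S n x := \sum_(k < n) iter k N x.
have Slin n : lin (S n).
  move=> c x y; rewrite /S scaler_sumr -big_split; apply: eq_bigr => k _ /=.
  by elim: (k : nat) => //= j ->; rewrite Nlin.
have iterle k x : nm (iter k N x) <= nm x.
  by elim: k => //= k IH; apply: le_trans (Nle _) IH.
have Sle n x : nm (S n x) <= n%:R * nm x.
  apply: le_trans (nm_sum _ _) _.
  have -> : n%:R * nm x = \sum_(k < n) nm x by rewrite sumr_const card_ord mulr_natl.
  by apply: ler_sum => k _; exact: iterle.
have Ssym n x y : cs_star (S n x) ** y = cs_star x ** S n y.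
  rewrite cs_star_sum cs_mul_suml cs_mul_sumr; apply: eq_bigr => k _.
  by elim: (k : nat) y => //= j IH y; rewrite Nsym IH -iterSr.
have Smul n x y : S n (x ** y) = S n x ** y.
  rewrite cs_mul_suml; apply: eq_bigr => k _.
  by elim: (k : nat) => //= j ->; rewrite Nmul.
have Stel n x : S n (a ** (a ** x)) = x - iter n N x.
  elim: n => [|n IH]; first by rewrite /S big_ord0 subrr.
  have iterN k y z : iter k N (y - z) = iter k N y - iter k N z.
    by elim: k => //= k ->; rewrite (linB Nlin).
  rewrite /S big_ord_recr -/(S n _) IH /= -iterS iterSr.
  have -> : a ** (a ** x) = x - N x by rewrite /N opprB addrC subrK.
  by rewrite iterN addrA subrK.
(* For every b, |S_n(a b)|^2 is the norm of b^* S_n(S_n(a^2 b)). The inner sum telescopes to b - N^n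
   b, of norm at most 2 |b|, and the outer one costs a factor n. *)
have Sa n : nm (S n a) ^+ 2 <= 2 * n%:R.
  have n0 : 0 <= n%:R :> R by exact: ler0n.
  rewrite -[leRHS]sqr_sqrtr ?mulr_ge0// lerXn2r ?nnegrE ?nm_ge0 ?sqrtr_ge0//.
  apply: nm_le_mul; first exact: sqrtr_ge0.
  move=> b; rewrite -[leLHS]ger0_norm ?nm_ge0// -ler_sqr ?nnegrE ?mulr_ge0 ?sqrtr_ge0 ?nm_ge0//.
  rewrite real_normK ?num_real// exprMn sqr_sqrtr ?mulr_ge0// -nm_starM -Smul Ssym.
  have -> : cs_star (a ** b) ** S n (S n (a ** b)) = cs_star b ** S n (S n (a ** (a ** b))).
    rewrite star_a; congr (_ ** _).
    have aS y : a ** S n y = S n (a ** y).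
      rewrite cs_mul_sumr; apply: eq_bigr => k _.
      by elim: (k : nat) => //= j <-; rewrite /N cs_mulBr.
    by rewrite !aS.
  apply: le_trans (nm_mul _ _) _; rewrite nm_star Stel.
  have := Sle n (b - iter n N b); have := nmB b (iter n N b); have := iterle n b.
  have := nm_ge0 b; rewrite expr2; move: (nm (S n _)) => t b0 h1 h2 h3.
  have : nm (b - iter n N b) <= 2 * nm b by lra.
  move=> h4; have : n%:R * nm (b - iter n N b) <= n%:R * (2 * nm b) by rewrite ler_wpM2l.
  by move: n0 h3; move: (n%:R) => m; nra.
have Nv k : exists v, iter k N a = a - a ** v.
  elim: k => [|k [v hv]]; first by exists 0; rewrite cs_mul0r subr0.
  exists (v + a ** (a - a ** v)); rewrite /= hv /N cs_mulDr opprD !addrA.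
  by [].
have Sv n : exists v, S n a = n%:R *: a - a ** v.
  elim: n => [|n [v hv]]; first by exists 0; rewrite /S big_ord0 scale0r cs_mul0r subr0.
  have [w hw] := Nv n; exists (v + w); rewrite /S big_ord_recr -/(S n a) hv /= hw.
  by rewrite -natr1 scalerDl scale1r cs_mulDr opprD addrACA.
have e20 : 0 < eps ^+ 2 by rewrite exprn_gt0.
(* The mean of n + 1 iterates has norm at most the square root of 2/(n+1), and it differs from a by
   an element of a A. *)
have [n hn] : exists n : nat, 2 < n.+1%:R * eps ^+ 2.
  have [n hn] := ltr_add_invr (divr_gt0 e20 (@ltr0n R 2)).
  exists n; move: hn; rewrite add0r ltr_pdivlMr// mulrC ltr_pdivrMr ?ltr0n//.
  by rewrite mulrC.
have [v hv] := Sv n.+1; exists (n.+1%:R^-1 *: v).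
have nn : n.+1%:R != 0 :> K by rewrite pnatr_eq0.
have -> : a - a ** (n.+1%:R^-1 *: v) = n.+1%:R^-1 *: S n.+1 a.
  by rewrite hv scalerBr scalerA mulVf// scale1r cs_mulZr.
have np : 0 < n.+1%:R :> R by rewrite ltr0n.
rewrite nmZ -(rc_nat R) -rcV nm_rc ?invr_ge0// ltr_pdivrMl//.
rewrite -(@ltr_pXn2r _ 2) ?nnegrE ?nm_ge0 ?mulr_ge0 ?(ltW e0)//.
apply: le_lt_trans (Sa _) _; rewrite exprMn [n.+1%:R ^+ 2]expr2 -mulrA mulrC ltr_pM2l//.
Qed.

(** Scaling together with real and imaginary parts reduces to [cs_selfadj_mul]. The result will give
    nondegeneracy of the action of C*(Q) on C*(Q x_c G). *)
Lemma cs_dense_mul : dense_span [set z : A | exists x y, z = x ** y].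
Proof.
have sa1 (a : A) (eps : R) : cs_star a = a -> 0 < eps -> exists x y, nm (a - x ** y) < eps.
  move=> sa e0; pose c := nm a + 1; have c0 : 0 < c by have := nm_ge0 a; rewrite /c; lra.
  have [|||v hv] := @cs_selfadj_mul (rc c^-1 *: a) (c^-1 * eps).
  - by rewrite cs_starZ rc_conj sa.
  - by rewrite nmZ nm_rc ?invr_ge0 ?(ltW c0)// ltr_pdivrMl// mulr1 /c; lra.
  - by rewrite mulr_gt0// invr_gt0.
  exists a, v; move: hv; rewrite cs_mulZl -scalerBr nmZ nm_rc ?invr_ge0 ?(ltW c0)//.
  by rewrite ltr_pM2l// invr_gt0.
apply/dense_nmP => x eps e0.
have h2 : 2^-1 = rc 2^-1 :> K by rewrite rcV rc_nat.
pose u := x + cs_star x; pose w := 'i *: (x - cs_star x).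
have su : cs_star u = u by rewrite /u cs_starD cs_starK addrC.
have sw : cs_star w = w.
  by rewrite /w cs_starZ cs_starB cs_starK conjCi scaleNr -scalerN opprB.
have [x1 [y1 h1]] := sa1 _ _ su (divr_gt0 e0 (@ltr0n R 2)).
have [x2 [y2 h2']] := sa1 _ _ sw (divr_gt0 e0 (@ltr0n R 2)).
exists (2^-1 *: (x1 ** y1) + (- 2^-1 * 'i) *: (x2 ** y2)).
  exists 2%N, (fun i : 'I_2 => if i == 0 then 2^-1 else - 2^-1 * 'i),
    (fun i : 'I_2 => if i == 0 then x1 ** y1 else x2 ** y2); split.
    by move=> i; case: ifP => _; [exists x1, y1|exists x2, y2].
  by rewrite !big_ord_recl big_ord0 /= addr0.
have -> : x = 2^-1 *: u + (- 2^-1 * 'i) *: w.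
  exact: re_im_decomposition.
rewrite opprD addrACA -!scalerBr; apply: le_lt_trans (nmD _ _) _.
rewrite !nmZ nmM nmN h2 nm_rc ?invr_ge0//.
have -> : nm ('i : K) = 1 by rewrite /nm normCi.
by lra.
Qed.
End DenseProducts.

(** * C*-algebras of operators *)

Lemma real_eps (R : realType) (x y C : R) :
  (forall e : R, 0 < e -> e <= 1 -> `|x - y| <= C * e) -> x = y.
Proof.
move=> h; apply/eqP; rewrite -subr_eq0 -normr_eq0 eq_le normr_ge0 andbT.
apply: le_epsP => e e0; rewrite add0r.
have C1 : 0 < `|C| + 1 by rewrite ltr_wpDl.
pose d := Num.min (e / (`|C| + 1)) 1.
have d0 : 0 < d by rewrite lt_min ltr01 andbT divr_gt0.
have d1 : d <= 1 by rewrite ge_min lexx orbT.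
have de : d * (`|C| + 1) <= e by rewrite -ler_pdivlMr// ge_min lexx.
have := h _ d0 d1; have : C * d <= `|C| * d by rewrite ler_wpM2r ?(ltW d0)// ler_norm.
nra.
Qed.

Section CStarCompletion.
Variables (R : realType) (E : lmodType (Cplx R)) (D : set E) (q : E -> R).
Variables (mul : E -> E -> E) (star : E -> E).
Notation K := (Cplx R).
Hypothesis D0 : D 0.
Hypothesis DP : forall (k : K) a b, D a -> D b -> D (k *: a + b).
Hypothesis DM : forall a b, D a -> D b -> D (mul a b).
Hypothesis DS : forall a, D a -> D (star a).
Hypothesis qD : forall a b, D a -> D b -> q (a + b) <= q a + q b.
Hypothesis qZ : forall (k : K) a, D a -> q (k *: a) = nm k * q a.
Hypothesis qM : forall a b, D a -> D b -> q (mul a b) <= q a * q b.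
Hypothesis qS : forall a, D a -> q (star a) = q a.
Hypothesis qC : forall a, D a -> q (mul (star a) a) = q a ^+ 2.
Hypothesis mulA : forall a b c, D a -> D b -> D c -> mul (mul a b) c = mul a (mul b c).
Hypothesis mull : forall (k : K) a b c, D a -> D b -> D c ->
  mul (k *: a + b) c = k *: mul a c + mul b c.
Hypothesis mulr : forall (k : K) a b c, D a -> D b -> D c ->
  mul c (k *: a + b) = k *: mul c a + mul c b.
Hypothesis starK : forall a, D a -> star (star a) = a.
Hypothesis starP : forall (k : K) a b, D a -> D b ->
  star (k *: a + b) = k^* *: star a + star b.
Hypothesis starM : forall a b, D a -> D b -> star (mul a b) = mul (star b) (star a).

(** The product is extended by [bnd_extend] one variable at a time, the involution by [lip_extend]
    since it is not linear; identities then pass to limits. *)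
Theorem cstar_completion : exists (C : cstarAlgebra R) (j : E -> C),
  [/\ forall (k : K) a b, D a -> D b -> j (k *: a + b) = k *: j a + j b,
      forall a b, D a -> D b -> j (mul a b) = cs_mul (j a) (j b),
      forall a, D a -> j (star a) = cs_star (j a),
      forall a, D a -> nm (j a) = q a
    & forall (v : C) (eps : R), 0 < eps -> exists2 a, D a & nm (v - j a) < eps].
Proof.
have [V [j [jl jn /dense_nmP jd]]] := completion_exists (Seminormed D0 DP qD qZ).
simpl in j, jl, jn, jd.
pose X := {a | D a}; pose e (x : X) := j (sval x).
have jd1 (v : V) (eps : R) : 0 < eps -> exists x : X, nm (v - e x) < eps.
  by move=> e0; have [_ [a Da <-] h] := jd v _ e0; exists (exist _ a Da).
have de : densefam e by exact: simple_densefam.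
have j0 : j 0 = 0.
  by have := jl (-1) 0 0 D0 D0; rewrite scaler0 addr0 scaleN1r addNr.
have jB a b : D a -> D b -> j (a - b) = j a - j b.
  by move=> Da Db; rewrite addrC -scaleN1r jl// scaleN1r addrC.
pose lX (s : seq (K * X)) : E := lc (fun x : X => sval x) s.
have DlX s : D (lX s).
  elim: s => [|p s IH]; first by rewrite /lX lc_nil.
  rewrite /lX /lc big_cons; apply: DP => //; exact: (proj2_sig p.2).
have glX (W : lmodType K) (g : E -> W) : (forall (k : K) a b, D a -> D b -> g (k *: a + b) = k *: g a + g b) ->
    forall s, g (lX s) = lc (fun x : X => g (sval x)) s.
  move=> gl; have g0 : g 0 = 0.
    by have := gl (-1) 0 0 D0 D0; rewrite scaler0 addr0 scaleN1r addNr.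
  elim=> [|p s IH]; first by rewrite /lX !lc_nil.
  rewrite /lX /lc !big_cons gl; [|exact: (proj2_sig p.2)|exact: DlX].
  by congr (_ + _); exact: IH.
have elX s : lc e s = j (lX s) by rewrite (glX _ j).
have rP (y : X) : exists r : V -> V,
    [/\ lin r, bnd r (nm (e y)) & forall x, r (e x) = j (mul (sval x) (sval y))].
  have Dy := proj2_sig y; apply: (bnd_extend de (@complete_seq R V)) => s.
  rewrite -(glX _ (fun a => j (mul a (sval y)))) ?elX; last first.
    by move=> k a b Da Db; rewrite mull// jl//; exact: DM.
  by rewrite !jn//; [rewrite mulrC; exact: qM|exact: DM].
have {rP}[r rP] := choice rP.
(* Left multiplication by an arbitrary v is prescribed on the dense subalgebra by the right
   multiplications [r y], already defined on all of V. *)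
have lP (v : V) : exists l : V -> V, [/\ lin l, bnd l (nm v) & forall y, l (e y) = r y v].
  apply: (bnd_extend de (@complete_seq R V)) => s.
  pose y : X := exist _ (lX s) (DlX s).
  have -> : lc (fun y => r y v) s = r y v.
    have [ly by_ hy] := rP y; move: v.
    pose c := \sum_(p <- s) nm p.1 * nm (e p.2).
    apply: (bnd_eq de (C := c) (C' := nm (e y))) => // [k u v|u|x].
    - rewrite /lc scaler_sumr -big_split; apply: eq_bigr => p _ /=.
      by have [lp _ _] := rP p.2; rewrite lp scalerDr !scalerA mulrC.
    - apply: le_trans (nm_sum _ _) _; rewrite mulr_suml ler_sum// => p _.
      rewrite nmZ -mulrA ler_wpM2l ?nm_ge0//; by have [_ + _] := rP p.2; exact.
    - rewrite hy (glX _ (fun a => j (mul (sval x) a))); last first.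
        by move=> k a b Da Db; have Dx := proj2_sig x; rewrite mulr// jl//; exact: DM.
      by apply: eq_bigr => p _; have [_ _ ->] := rP p.2.
  by rewrite elX -[j _]/(e y) mulrC; have [_ + _] := rP y; exact.
have {lP}[m mP] := choice lP.
have me (x y : X) : m (e x) (e y) = j (mul (sval x) (sval y)).
  by have [_ _ ->] := mP (e x); have [_ _ ->] := rP y.
have mr v : lin (m v) by have [] := mP v.
have mb v w : nm (m v w) <= nm v * nm w by have [_ + _] := mP v; exact.
have ml w : lin (m^~ w).
  move=> k u v; move: w; apply: (bnd_eq de (C := nm (k *: u + v)) (C' := nm k * nm u + nm v)).
  - exact: mr.
  - by move=> w; exact: mb.
  - by move=> c x y; rewrite !mr !scalerDr !scalerA mulrC addrACA.
  - move=> x; rewrite (le_trans (nmD _ _))// nmZ mulrDl -mulrA.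
    by rewrite lerD ?mb// ler_wpM2l ?nm_ge0// mb.
  - move=> y; have [ly _ _] := rP y.
    by have [_ _ ->] := mP (k *: u + v); have [_ _ ->] := mP u; have [_ _ ->] := mP v.
have bl w : bnd (m^~ w) (nm w) by move=> v; rewrite mulrC; exact: mb.
have mA : associative m.
  have H (x y : X) w : m (e x) (m (e y) w) = m (m (e x) (e y)) w.
    move: w; apply: (bnd_eq de (C := nm (e x) * nm (e y)) (C' := nm (m (e x) (e y)))).
    - by move=> k u v; rewrite !mr.
    - by move=> u; rewrite -mulrA (le_trans (mb _ _))// ler_wpM2l ?nm_ge0.
    - exact: mr.
    - by move=> u; exact: mb.
    move=> z; have Dx := proj2_sig x; have Dy := proj2_sig y; have Dz := proj2_sig z.
    rewrite !me -[j (mul (sval y) (sval z))]/(e (exist _ _ (DM Dy Dz))).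
    by rewrite -[j (mul (sval x) (sval y))]/(e (exist _ _ (DM Dx Dy))) !me /= mulA.
  move=> u v w; move: u.
  apply: (@bnd_eq _ _ _ _ de _ (fun u => m u (m v w)) (fun u => m (m u v) w)
    (nm (m v w)) (nm v * nm w)) => [||||x].
  - exact: ml.
  - exact: bl.
  - by move=> k a b /=; rewrite !ml.
  - move=> u; by rewrite mulrAC [leRHS]mulrC mulrCA mulrC -mulrA mulrC (le_trans (mb _ _))// ler_wpM2r ?nm_ge0// mulrC mb.
  move: v; apply: (@bnd_eq _ _ _ _ de _ (fun v => m (e x) (m v w)) (fun v => m (m (e x) v) w)
    (nm (e x) * nm w) (nm (e x) * nm w)) => [||||y].
  - by move=> k a b /=; rewrite ml mr.
  - by move=> a; rewrite -mulrA (le_trans (mb _ _))// ler_wpM2l ?nm_ge0// mulrC mb.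
  - by move=> k a b /=; rewrite mr ml.
  - by move=> a; rewrite mulrAC (le_trans (mb _ _))// ler_wpM2r ?nm_ge0// mb.
  exact: H.
have starB a b : D a -> D b -> star (a - b) = star a - star b.
  move=> Da Db; rewrite addrC -scaleN1r starP// rmorphN1 scaleN1r addrC//.
have [x y|st stP] := lip_extend (t := fun x : X => j (star (sval x))) (C := 1) (@complete_seq R V) jd1.
  have Dx := proj2_sig x; have Dy := proj2_sig y.
  have Dxy : D (sval x - sval y) by rewrite addrC -scaleN1r; exact: DP.
  rewrite mul1r -!jB//; [|exact: DS|exact: DS].
  by rewrite -starB// !jn ?qS//; exact: DS.
rewrite normr1 in stP.
have ste (x : X) : st (e x) = j (star (sval x)).
  by apply: (@nm_eps _ _ _ _ 1) => eps e0; have := stP (e x) x; rewrite subrr nm0; lra.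
have stl u v : nm (st u - st v) <= 1 * nm (u - v).
  apply: le_epsP => eps e0; have [x hx] := jd1 u _ (divr_gt0 e0 (@ltr0n R 2)).
  have := stP u x; have := stP v x; have := nm_tri u v (e x).
  have := nm_tri (j (star (sval x))) (st u) (st v).
  by rewrite (nmBC v u) (nmBC (j _) (st v)); lra.
have lce s : exists x, lc e s = e x.
  by exists (exist _ (lX s) (DlX s)); rewrite elX.
have stlin (k : K) u v : st (k *: u + v) = k^* *: st u + st v.
  apply: (@nm_eps _ _ _ _ (2 * nm k + 2)) => eps e0.
  have [x hx] := jd1 u _ e0; have [y hy] := jd1 v _ e0.
  have Dx := proj2_sig x; have Dy := proj2_sig y.
  have DSx := DS Dx; have DSy := DS Dy.
  have := stP (k *: u + v) (exist _ _ (DP k Dx Dy)); rewrite /e /= starP// !jl// => h1.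
  apply: le_trans (nm_tri (k^* *: j (star (sval x)) + j (star (sval y))) _ _) _.
  have -> : k^* *: j (star (sval x)) + j (star (sval y)) - (k^* *: st u + st v)
     = - (k^* *: (st u - j (star (sval x))) + (st v - j (star (sval y)))).
    by rewrite scalerBr [in RHS]opprD !opprB opprD addrACA.
  have := nmD (k^* *: (st u - j (star (sval x)))) (st v - j (star (sval y))).
  have := stP u x; have := stP v y; rewrite nmN nmZ nm_conj.
  have e3 : k *: u + v - (k *: j (sval x) + j (sval y)) = k *: (u - j (sval x)) + (v - j (sval y)).
    by rewrite scalerBr opprD addrACA.
  move: h1; rewrite mul1r e3 => h1.
  have := nmD (k *: (u - j (sval x))) (v - j (sval y)); rewrite nmZ -/(e x) -/(e y).
  move: h1; rewrite -/(e x) -/(e y) => h1 h2 h3 h4 h5; have k0 := nm_ge0 k.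
  have : nm k * nm (st u - j (star (sval x))) <= nm k * eps by rewrite ler_wpM2l//; lra.
  have : nm k * nm (u - e x) <= nm k * eps by rewrite ler_wpM2l//; lra.
  by lra.
have mB u v w : m (u - v) w = m u w - m v w by rewrite (linB (ml w)).
have mBr u v w : m w (u - v) = m w u - m w v by rewrite (linB (mr w)).
have stK : involutive st.
  apply: (lip_eq de (C := 1) (C' := 1)) => [u v|u v|s]; rewrite ?mul1r//.
    by have := stl (st u) (st v); have := stl u v; lra.
  have [x ->] := lce s; have Dx := proj2_sig x.
  by rewrite ste -[j (star _)]/(e (exist _ _ (DS Dx))) ste /= starK.
have stn u : nm (st u) = nm u.
  have st0 : st 0 = 0.
    by have := stlin (-1) 0 0; rewrite scaler0 addr0 rmorphN1 scaleN1r addNr.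
  have H w : nm (st w) <= nm w by have := stl w 0; rewrite st0 !subr0 mul1r.
  by apply/eqP; rewrite eq_le H -{1}(stK u) H.
have stM u v : st (m u v) = m (st v) (st u).
  have H (x : X) w : st (m (e x) w) = m (st w) (st (e x)).
    move: w; apply: (lip_eq de (C := nm (e x)) (C' := nm (e x))) => [a b|a b|s].
    - by apply: le_trans (stl _ _) _; rewrite mul1r -mBr; exact: mb.
    - rewrite -mB (le_trans (mb _ _))// stn mulrC ler_wpM2l ?nm_ge0//.
      by have := stl a b; rewrite mul1r.
    have [y ->] := lce s; have Dx := proj2_sig x; have Dy := proj2_sig y.
    rewrite me -[j (mul _ _)]/(e (exist _ _ (DM Dx Dy))) !ste /= starM//.
    by rewrite -[j (star (sval x))]/(e (exist _ _ (DS Dx))) -[j (star (sval y))]/(e (exist _ _ (DS Dy))) me.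
  move: u; apply: (lip_eq de (C := nm v) (C' := nm v)) => [a b|a b|s].
  - by apply: le_trans (stl _ _) _; rewrite mul1r -mB mulrC; exact: mb.
  - rewrite -mBr (le_trans (mb _ _))// stn ler_wpM2l ?nm_ge0//.
    by have := stl a b; rewrite mul1r.
  by have [y ->] := lce s; exact: H.
have normS u : nm (m (st u) u) = nm u ^+ 2.
  apply: (@real_eps _ _ _ (2 * (2 * nm u + 1))) => d d0 d1.
  have [x hx] := jd1 u _ d0; have Dx := proj2_sig x.
  have e1 : nm (m (st (e x)) (e x)) = nm (e x) ^+ 2.
    rewrite ste -[j (star _)]/(e (exist _ _ (DS Dx))) me /= jn; last exact/DM/Dx/DS.
    by rewrite qC// /e jn.
  have u0 := nm_ge0 u; have x0 := nm_ge0 (e x).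
  have a1 := nm_sub u (e x); have a2 := nm_sub (e x) u; rewrite (nmBC (e x)) in a2.
  have h1 : `|nm (m (st u) u) - nm (m (st (e x)) (e x))| <= nm (u - e x) * (nm u + nm (e x)).
    have H a b : nm a - nm b <= nm (a - b) by exact: nm_sub.
    apply: le_trans (_ : nm (m (st u) u - m (st (e x)) (e x)) <= _).
      by rewrite ler_norml nm_sub andbT lerNl opprB nmBC nm_sub.
    have -> : m (st u) u - m (st (e x)) (e x) = m (st u - st (e x)) u + m (st (e x)) (u - e x).
      by rewrite mB mBr addrA subrK.
    apply: le_trans (nmD _ _) _; rewrite mulrDr lerD//.
      apply: le_trans (mb _ _) _; rewrite ler_wpM2r//.
      by have := stl u (e x); rewrite mul1r.
    by apply: le_trans (mb _ _) _; rewrite stn mulrC.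
  have h2 : `|nm (e x) ^+ 2 - nm u ^+ 2| <= nm (u - e x) * (nm u + nm (e x)).
    rewrite subr_sqr normrM (ger0_norm (addr_ge0 x0 u0)) (addrC (nm (e x)) (nm u)) ler_wpM2r ?addr_ge0//.
    by rewrite ler_norml; apply/andP; split; lra.
  have -> : nm (m (st u) u) - nm u ^+ 2
      = (nm (m (st u) u) - nm (m (st (e x)) (e x))) + (nm (e x) ^+ 2 - nm u ^+ 2).
    by rewrite e1 addrA subrK.
  apply: le_trans (ler_normD _ _) _.
  have : nm (u - e x) * (nm u + nm (e x)) <= d * (2 * nm u + 1).
    by apply: ler_pM; rewrite ?nm_ge0 ?addr_ge0 ?(ltW hx)//; lra.
  lra.
have stD : {morph st : u v / u + v}.
  by move=> u v; have := stlin 1 u v; rewrite scale1r rmorph1 scale1r.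
have stZ (k : K) u : st (k *: u) = k^* *: st u.
  have st0 : st 0 = 0.
    by have := stlin (-1) 0 0; rewrite scaler0 addr0 rmorphN1 scaleN1r addNr.
  by have := stlin k u 0; rewrite st0 !addr0.
have mDl : left_distributive m +%R by move=> u v w; rewrite (linD (ml w)).
have mDr : right_distributive m +%R by move=> u v w; rewrite (linD (mr u)).
have mZl (k : K) u v : m (k *: u) v = k *: m u v by rewrite (linZ (ml v)).
have mZr (k : K) u v : m u (k *: v) = k *: m u v by rewrite (linZ (mr u)).
have nM u v : `|m u v| <= `|u| * `|v| by rewrite !nmE -rcM rc_le.
have nS u : `|m (st u) u| = `|u| ^+ 2 by rewrite !nmE normS rcX.
exists (@CStarAlgebra R V m st mA mDl mDr mZl mZr stK stD stZ stM nM nS), j; split => //.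
- move=> a b Da Db; change (j (mul a b) = m (e (exist _ a Da)) (e (exist _ b Db))).
  by rewrite me.
- by move=> a Da; change (j (star a) = st (e (exist _ a Da))); rewrite ste.
- by move=> v eps e0; have [[a Da] h] := jd1 v eps e0; exists a.
Qed.
End CStarCompletion.

Section OperatorAlgebra.
Variables (R : realType) (L : hilbert R).
Notation K := (Cplx R).
Implicit Types T U : L -> L.

(** The operator norm, meaningful when some bound exists; [Dbnd] supplies one on D. *)
Definition opn T : R := inf [set M | 0 <= M /\ bnd T M].

Lemma opn_bnd T C : 0 <= C -> bnd T C -> bnd T (opn T).
Proof.
move=> C0 TC x; have [x0|x0] := leP (nm x) 0.
  have {}x0 : nm x = 0 by apply/eqP; rewrite eq_le x0 nm_ge0.
  by have := TC x; rewrite x0 !mulr0.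
rewrite -ler_pdivrMr//; apply: lb_le_inf; first by exists C.
by move=> M [M0 TM]; rewrite ler_pdivrMr.
Qed.
Lemma opn_le T M : 0 <= M -> bnd T M -> opn T <= M.
Proof. by move=> M0 TM; apply: ge_inf => //; exists 0 => N []. Qed.
Lemma opn_ge0 T C : 0 <= C -> bnd T C -> 0 <= opn T.
Proof. by move=> C0 TC; apply: lb_le_inf => [|M []//]; exists C. Qed.

Variable D : set (L -> L).
Hypothesis D0 : D 0.
Hypothesis DP : forall (k : K) T U, D T -> D U -> D (k *: T + U).
Hypothesis DM : forall T U, D T -> D U -> D (T \o U).
Hypothesis Dlin : forall T, D T -> lin T.
Hypothesis Dbnd : forall T, D T -> exists2 C, 0 <= C & bnd T C.
Hypothesis Dadj : forall T, D T -> exists2 T', D T' & forall x y, ip (T x) y = ip x (T' y).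

(** This is the norm closure of D, obtained abstractly. Adjoints are unique, so they can be chosen
    as a function; the C*-identity comes from |T x|^2 = <T^* T x, x>. *)
Theorem operator_algebra : exists (C : cstarAlgebra R) (j : (L -> L) -> C),
  [/\ forall (k : K) T U, D T -> D U -> j (k *: T + U) = k *: j T + j U,
      forall T U, D T -> D U -> j (T \o U) = cs_mul (j T) (j U),
      forall T T', D T -> D T' -> (forall x y, ip (T x) y = ip x (T' y)) ->
        j T' = cs_star (j T),
      forall T M, D T -> 0 <= M -> bnd T M <-> nm (j T) <= M
    & forall (v : C) (eps : R), 0 < eps -> exists2 T, D T & nm (v - j T) < eps].
Proof.
have ob T : D T -> bnd T (opn T) by move=> /Dbnd[C C0]; exact: opn_bnd.
have o0 T : D T -> 0 <= opn T by move=> /Dbnd[C C0]; exact: opn_ge0.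
have adjE T T' T'' : (forall x y, ip (T x) y = ip x (T' y)) ->
    (forall x y, ip (T x) y = ip x (T'' y)) -> T' = T''.
  move=> h h'; apply/funext => y; apply: ip_ext => x.
  by rewrite ip_conj -h h' -ip_conj.
pose star T := match pselect (exists T', D T' /\ forall x y, ip (T x) y = ip x (T' y)) with
  | left h => sval (cid h) | right _ => 0 end.
have starP T : D T -> D (star T) /\ forall x y, ip (T x) y = ip x (star T y).
  move=> DT; rewrite /star; case: pselect => [h|]; first exact: (proj2_sig (cid h)).
  by case; have [T' ? ?] := Dadj DT; exists T'.
have starE T T' : D T -> (forall x y, ip (T x) y = ip x (T' y)) -> star T = T'.
  by move=> DT; apply: adjE; have [] := starP T DT.
have adjC T x y : D T -> ip (star T x) y = ip x (T y).
  by move=> DT; rewrite ip_conj -(starP T DT).2 -ip_conj.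
have oM T U : D T -> D U -> opn (T \o U) <= opn T * opn U.
  move=> DT DU; apply: opn_le => [|x]; first by rewrite mulr_ge0 ?o0.
  by apply: le_trans (ob _ DT _) _; rewrite -mulrA ler_wpM2l ?o0 ?ob.
have sqrle T (x : L) : D T -> nm (T x) ^+ 2 <= opn (star T \o T) * nm x ^+ 2.
  move=> DT; have DS := (starP T DT).1.
  have -> : nm (T x) ^+ 2 = cre (ip (star T (T x)) x) by rewrite adjC// ip_nm rcK.
  apply: le_trans (ler_norm _) _; apply: le_trans (cre_le_nm _) _.
  apply: le_trans (ip_CS _ _) _; rewrite expr2 mulrA ler_wpM2r ?nm_ge0//.
  by apply: (ob (star T \o T)); exact: DM.
have oSle T : D T -> opn T ^+ 2 <= opn (star T \o T).
  move=> DT; have DS := (starP T DT).1; have c0 : 0 <= opn (star T \o T) by apply/o0/DM.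
  rewrite -[leRHS]sqr_sqrtr// lerXn2r ?nnegrE ?o0 ?sqrtr_ge0//.
  apply: opn_le => [|x]; first exact: sqrtr_ge0.
  rewrite -ler_sqr ?nnegrE ?mulr_ge0 ?nm_ge0 ?sqrtr_ge0// exprMn sqr_sqrtr//.
  exact: sqrle.
have starK T : D T -> star (star T) = T.
  by move=> DT; apply: starE => [|x y]; [exact: (starP T DT).1|exact: adjC].
have oS1 T : D T -> opn T <= opn (star T).
  move=> DT; have DS := (starP T DT).1; have := oSle T DT; have := oM _ _ DS DT.
  have := o0 _ DT; have := o0 _ DS; move: (opn T) (opn (star T)) => a b b0 a0 h1 h2.
  have [az|az] := leP a 0; first by lra.
  by rewrite -(ler_pM2r az); apply: le_trans h1; rewrite -expr2.
have [||||||||||||C [j [j1 j2 j3 j4 j5]]] := @cstar_completion R (L -> L) D opn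
  (fun T U => T \o U) star D0 DP DM.
- by move=> T /starP[].
- move=> T U DT DU; apply: opn_le => [|x]; first by rewrite addr_ge0 ?o0.
  by rewrite (le_trans (nmD _ _))// mulrDl lerD ?ob.
- move=> k T DT.
  have H (l : K) U : D U -> opn (l *: U) <= nm l * opn U.
    move=> DU; apply: opn_le => [|x]; first by rewrite mulr_ge0 ?nm_ge0 ?o0.
    by rewrite [(l *: U) x]/(l *: U x) nmZ -mulrA ler_wpM2l ?nm_ge0 ?ob.
  apply/eqP; rewrite eq_le H//=; have [->|k0] := eqVneq k 0.
    rewrite nm0 mul0r scale0r; apply: (@opn_ge0 _ 0) => // x.
    by rewrite [(0 : L -> L) x]/(0 : L) nm0 mul0r.
  have DkT : D (k *: T) by rewrite -[_ *: _]addr0; exact: DP.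
  have := H k^-1 _ DkT; rewrite scalerA mulVf// scale1r.
  have nk : 0 < nm k by rewrite lt_neqAle nm_ge0 andbT eq_sym; apply/eqP => /nm_eq0/eqP; rewrite (negPf k0).
  move=> h; rewrite -ler_pdivlMl//; apply: le_trans h _.
  have -> : nm k^-1 = (nm k)^-1 by rewrite /nm normfV; apply: (@rc_inj R); rewrite rcV !creK// invr_ge0.
  by [].
- exact: oM.
- move=> T DT; apply/eqP; rewrite eq_le oS1// andbT -{2}(starK T DT) oS1//.
  exact: (starP T DT).1.
- move=> T DT; have DS := (starP T DT).1; apply/eqP; rewrite eq_le oSle// andbT.
  rewrite (le_trans (oM _ _ DS DT))// expr2 ler_wpM2r ?o0//.
  by rewrite -{2}(starK T DT) oS1.
- by [].
- by [].
- by move=> k T U V DT DU DV; apply/funext => x /=; rewrite [LHS](Dlin DV).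
- exact: starK.
- move=> k T U DT DU; apply: starE => [|x y]; first exact: DP.
  rewrite [(k *: T + U) x]/(k *: T x + U x) [(k^* *: _ + _) y]/(k^* *: star T y + star U y).
  by rewrite ipDl ipDr ipZl ipZr conjCK (starP T DT).2 (starP U DU).2.
- move=> T U DT DU; apply: starE => [|x y]; first exact: DM.
  by rewrite /= (starP T DT).2 (starP U DU).2.
exists C, j; split => //.
- by move=> T T' DT DT' /(starE _ _ DT) <-; exact: j3.
- move=> T M DT M0; rewrite j4//; split=> [TM|h x]; first exact: opn_le.
  by rewrite (le_trans (ob _ DT x))// ler_wpM2r ?nm_ge0.
Qed.
End OperatorAlgebra.

(** * Tensor products of Hilbert spaces *)

Section Gram.
Variable R : realType.
Notation K := (Cplx R).

(* Orthogonalise the first [n] vectors against the last one. *)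
Lemma gram_factor (H : hilbert R) n (v : nat -> H) : exists m (al : nat -> nat -> K),
  forall i j, (i < n)%N -> (j < n)%N -> ip (v i) (v j) = \sum_(l < m) al l i * (al l j)^*.
Proof.
elim: n v => [|n IH] v; first by exists 0%N, (fun _ _ => 0).
pose w := v n; have [w0|w0] := eqVneq w 0.
  have [m [al hal]] := IH v; exists m, (fun l i => if (i < n)%N then al l i else 0).
  move=> i j; rewrite !ltnS (leq_eqVlt i) (leq_eqVlt j) => /orP[/eqP ->|i1] /orP[/eqP ->|j1].
  - by rewrite -/w w0 ip0l ltnn big1// => l _; rewrite mul0r.
  - by rewrite -/w w0 ip0l ltnn big1// => l _; rewrite mul0r.
  - by rewrite -/w w0 ip0r ltnn big1// => l _; rewrite rmorph0 mulr0.
  - by rewrite i1 j1 hal.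
have ww0 : ip w w != 0.
  rewrite ip_nm -(rc0 R) (inj_eq (@rc_inj R)) sqrf_eq0; apply/eqP => /nm_eq0 e.
  by rewrite e eqxx in w0.
have [m [al hal]] := IH (fun i => v i - (ip (v i) w / ip w w) *: w).
pose b i := ip (v i) w / rc (nm w).
have bb i j : b i * (b j)^* = ip (v i) w * ip w (v j) / ip w w.
  rewrite /b rmorphM fmorphV /= rc_conj -(ip_conj (v j)) ip_nm rcX expr2 invfM; ring.
have bn i : b i * (b n)^* = ip (v i) w by rewrite bb mulfK.
have nb j : b n * (b j)^* = ip w (v j) by rewrite bb mulrAC divff// mul1r.
exists m.+1, (fun l i => if l == m then b i else if (i < n)%N then al l i else 0).
have E i j : \sum_(l < m.+1) (fun l i => if l == m then b i else if (i < n)%N then al l i else 0) l i *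
    ((fun l i => if l == m then b i else if (i < n)%N then al l i else 0) l j)^*
  = \sum_(l < m) (if (i < n)%N then al l i else 0) * (if (j < n)%N then al l j else 0)^* + b i * (b j)^*.
  rewrite big_ord_recr /= eqxx; congr (_ + _); apply: eq_bigr => l _.
  by rewrite !(ltn_eqF (ltn_ord l)).
move=> i j; rewrite E !ltnS (leq_eqVlt i) (leq_eqVlt j) => /orP[/eqP ->|i1] /orP[/eqP ->|j1].
- by rewrite ltnn big1 ?add0r ?bn// => l _; rewrite mul0r.
- by rewrite ltnn big1 ?add0r ?nb// => l _; rewrite mul0r.
- by rewrite ltnn big1 ?add0r ?bn// => l _; rewrite rmorph0 mulr0.
- rewrite i1 j1 -hal// bb !ipDl !ipDr !ipNl !ipNr !ipZl !ipZr rmorphM fmorphV /=.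
  rewrite -!ip_conj; field; exact: ww0.
Qed.

(** The coefficients factor the Gram matrix of the second components and do not depend on g. The
    tensor norm thereby becomes a sum of squares in H', and an operator on the first factor is
    estimated term by term. *)
Lemma tensor_gram (H M : hilbert R) (s : seq (H * M)) : exists m (al : nat -> nat -> K),
  forall (H' : hilbert R) (g : H -> H'),
    tensor_normsq [seq (g p.1, p.2) | p <- s] =
    \sum_(l < m) rc (nm (\sum_(i < size s) al l i *: g (nth (0, 0) s i).1) ^+ 2).
Proof.
have [m [al hal]] := @gram_factor M (size s) (fun i => (nth (0, 0) s i).2).
exists m, al => H' g; rewrite /tensor_normsq big_map (big_nth (0, 0)) big_mkord.
under eq_bigr => i _.
  rewrite big_map (big_nth (0, 0)) big_mkord /=.
  under eq_bigr => j _ do rewrite hal// mulr_sumr.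
  rewrite exchange_big; over.
rewrite /= exchange_big; apply: eq_bigr => l _ /=.
rewrite -ip_nm ip_suml; apply: eq_bigr => i _; rewrite ip_sumr; apply: eq_bigr => j _.
by rewrite ipZl ipZr; ring.
Qed.

Lemma tensor_normsq_ge0 (H M : hilbert R) (s : seq (H * M)) : 0 <= tensor_normsq s.
Proof.
have [m [al hal]] := tensor_gram s.
have <- : [seq (p.1, p.2) | p <- s] = s by elim: s {hal} => //= -[a b] s ->.
by rewrite (hal H id) sumr_ge0// => l _; rewrite -(rc0 R) rc_le sqr_ge0.
Qed.

Lemma tensor_normsq_mapl (H M H' : hilbert R) (s : seq (H * M)) (g : H -> H') C :
  lin g -> bnd g C -> 0 <= C ->
  tensor_normsq [seq (g p.1, p.2) | p <- s] <= rc (C ^+ 2) * tensor_normsq s.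
Proof.
move=> lg bg C0; have [m [al hal]] := tensor_gram s.
have {2}<- : [seq (p.1, p.2) | p <- s] = s by elim: s {hal} => //= -[a b] s ->.
rewrite (hal H id) hal mulr_sumr ler_sum// => l _; rewrite -rcM rc_le -exprMn.
rewrite lerXn2r ?nnegrE ?mulr_ge0 ?nm_ge0//.
apply: le_trans (bg _); rewrite (lin_sum lg) le_eqVlt; apply/orP; left; apply/eqP.
by congr nm; apply: eq_bigr => i _; rewrite (linZ lg).
Qed.

Lemma tensor_normsq_swap (H M : hilbert R) (s : seq (H * M)) :
  tensor_normsq [seq (p.2, p.1) | p <- s] = tensor_normsq s.
Proof.
rewrite /tensor_normsq big_map; apply: eq_bigr => p _; rewrite big_map.
by apply: eq_bigr => q _ /=; rewrite mulrC.
Qed.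

Lemma tensor_normsq_mapr (H M M' : hilbert R) (s : seq (H * M)) (g : M -> M') C :
  lin g -> bnd g C -> 0 <= C ->
  tensor_normsq [seq (p.1, g p.2) | p <- s] <= rc (C ^+ 2) * tensor_normsq s.
Proof.
move=> lg bg C0; rewrite -tensor_normsq_swap -map_comp -(tensor_normsq_swap s).
by have := tensor_normsq_mapl [seq (p.2, p.1) | p <- s] lg bg C0; rewrite -map_comp.
Qed.

Theorem tensor_hilbert (H M : hilbert R) : exists (L : hilbert R) (t : H -> M -> L),
  [/\ forall h h' m m', ip (t h m) (t h' m') = ip h h' * ip m m',
      forall m, lin (t^~ m), forall h, lin (t h)
    & densefam (fun x : H * M => t x.1 x.2)].
Proof.
pose k (x y : H * M) : K := ip x.1 y.1 * ip x.2 y.2.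
have [||L [e [ek de]]] := @kernel_hilbert R _ k.
- by move=> x y; rewrite /k rmorphM /= -!ip_conj.
(* Positivity of the product kernel: once the scalars are absorbed into the first components, its
   form is [tensor_normsq]. *)
- move=> s; apply: le_trans (tensor_normsq_ge0 [seq (p.1 *: p.2.1, p.2.2) | p <- s]) _.
  rewrite /tensor_normsq big_map /kform le_eqVlt; apply/orP; left; apply/eqP.
  apply: eq_bigr => p _; rewrite big_map; apply: eq_bigr => q _ /=.
  by rewrite ipZl ipZr /k; ring.
have eext x y : (forall z, ip x (e z) = ip y (e z)) -> x = y.
  move=> h; apply: ip_ext => z; rewrite ip_conj [RHS]ip_conj; congr (_^*); move: z.
  apply: (@bnd_eq _ _ _ _ de (K^o) (fun z => ip z x) (fun z => ip z y) (nm x) (nm y)).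
  - by move=> c u v; rewrite ip_linear.
  - by move=> u; rewrite mulrC ip_CS.
  - by move=> c u v; rewrite ip_linear.
  - by move=> u; rewrite mulrC ip_CS.
  - by move=> z; rewrite ip_conj h -ip_conj.
exists L, (fun h m => e (h, m)); split.
- by move=> h h' m m'; exact: ek.
- move=> m c x y; apply: eext => z; rewrite [RHS]ip_linear !ek /k /= ip_linear; ring.
- move=> h c x y; apply: eext => z; rewrite /= [RHS]ip_linear !ek /k /= ip_linear; ring.
- by move=> v eps /(de v)[s hs]; exists s; rewrite (_ : lc _ s = lc e s)//; apply: eq_bigr => -[c []].
Qed.
End Gram.

(** The bound C only provides continuity; M is the one that matters and is inherited from the dense
    span. *)
Lemma bnd_dense (R : realType) (X : Type) (V W : normedModType (Cplx R)) (e : X -> V)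
    (T : V -> W) C M : densefam e -> lin T -> bnd T C -> 0 <= M ->
  (forall s, nm (T (lc e s)) <= M * nm (lc e s)) -> bnd T M.
Proof.
move=> de lT bT M0 h v; apply: le_epsP => eps e0.
have C1 : 0 < `|C| + M + 1 by have := normr_ge0 C; lra.
have [s hs] := de v _ (divr_gt0 e0 C1).
have := h s; have := bT (v - lc e s); rewrite (linB lT).
have := nm_sub (T v) (T (lc e s)); have := nm_sub (lc e s) v; rewrite (nmBC (lc e s) v).
have := nm_ge0 (v - lc e s); move: hs; rewrite ltr_pdivlMr//.
have : C * nm (v - lc e s) <= `|C| * nm (v - lc e s).
  by rewrite ler_wpM2r ?nm_ge0// ler_norm.
move=> h1 h2 h3 h4 h5 h6 h7.
have : M * (nm (lc e s) - nm v) <= M * nm (v - lc e s) by rewrite ler_wpM2l.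
by rewrite mulrBr; lra.
Qed.

Lemma hilb_dense_ext (R : realType) (H : hilbert R) (X : Type) (e : X -> H) x y :
  densefam e -> (forall z, ip x (e z) = ip y (e z)) -> x = y.
Proof.
move=> de h; apply: ip_ext => z; rewrite ip_conj [RHS]ip_conj; congr (_^*); move: z.
apply: (@bnd_eq _ _ _ _ de ((Cplx R)^o) (fun z => ip z x) (fun z => ip z y) (nm x) (nm y)).
- by move=> c u v; rewrite ip_linear.
- by move=> u; rewrite mulrC ip_CS.
- by move=> c u v; rewrite ip_linear.
- by move=> u; rewrite mulrC ip_CS.
- by move=> z; rewrite ip_conj h -ip_conj.
Qed.

Lemma pythagoras (R : realType) (H : hilbert R) (x y : H) : ip x y = 0 ->
  nm (x + y) ^+ 2 = nm x ^+ 2 + nm y ^+ 2.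
Proof.
move=> h; apply: (@rc_inj R); rewrite rcD -!ip_nm ipDl !ipDr h.
by rewrite (ip_conj x y) h rmorph0 addr0 add0r.
Qed.

Lemma lc_perm_split (R : realType) (X : Type) (V : lmodType (Cplx R)) (e : X -> V)
    (P : pred (Cplx R * X)) s :
  lc e s = lc e (seq.filter P s) + lc e (seq.filter (predC P) s).
Proof. by rewrite /lc !big_filter [LHS](bigID P). Qed.

Lemma all_filterP (T : Type) (P Q : pred T) (s : seq T) :
  (forall x, P x -> Q x) -> all Q (seq.filter P s).
Proof. by move=> h; elim: s => //= x s IH; case: ifP => //= /h ->. Qed.

Section Orthogonal.
Variables (R : realType) (L L' : hilbert R) (X I : Type).
Variables (e : X -> L) (t : X -> L') (gr : X -> I) (C : R).
Hypothesis C0 : 0 <= C.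
Hypothesis oe : forall x y, gr x <> gr y -> ip (e x) (e y) = 0.
Hypothesis ot : forall x y, gr x <> gr y -> ip (t x) (t y) = 0.
Notation K := (Cplx R).
Hypothesis ht : forall i s, all (fun p : K * X => `[< gr p.2 = i >]) s ->
  nm (lc t s) <= C * nm (lc e s).

(** Split off the terms in the grade of the head, apply Pythagoras on both sides, and recurse on the
    remaining shorter list. *)
Lemma orthogonal_le s : nm (lc t s) <= C * nm (lc e s).
Proof.
have [n sn] := ubnP (size s); elim: n => // n IH in s sn *.
case: s sn => [|p s] sn; first by rewrite !lc_nil !nm0 mulr0.
pose P (q : K * X) := `[< gr q.2 = gr p.2 >].
have orth (M : hilbert R) (f : X -> M) : (forall x y, gr x <> gr y -> ip (f x) (f y) = 0) ->
    nm (lc f (p :: s)) ^+ 2 = nm (lc f (seq.filter P (p :: s))) ^+ 2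
      + nm (lc f (seq.filter (predC P) (p :: s))) ^+ 2.
  move=> hf; rewrite (lc_perm_split f P); apply: pythagoras.
  rewrite ip_lc big_filter big1// => q /asboolP Pq; rewrite big_filter big1// => r /asboolPn Pr.
  by rewrite hf ?mulr0// Pq; exact: nesym.
rewrite -ler_sqr ?nnegrE ?mulr_ge0 ?nm_ge0// exprMn (orth _ t ot) (orth _ e oe) mulrDr.
rewrite -!exprMn lerD// lerXn2r ?nnegrE ?mulr_ge0 ?nm_ge0//.
  by apply: (ht (i := gr p.2)); apply: all_filterP.
have Pp : P p by apply/asboolP.
apply: IH; rewrite /= Pp /= size_filter.
by rewrite (leq_ltn_trans (count_size _ _)).
Qed.
End Orthogonal.

Section HilbertSum.
Variables (R : realType) (I : Type) (H : I -> hilbert R).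
Notation K := (Cplx R).
Let X := {i : I & H i}.

(** Component at i of a vector placed at one index: transport along the equality of indices when it
    holds, and 0 otherwise. *)
Definition hcomp i (p : X) : H i :=
  match pselect (projT1 p = i) with
  | left E => eq_rect (projT1 p) (fun i => h_car (H i)) (projT2 p) i E
  | right _ => 0 end.

Lemma hcomp_same i (h : H i) : hcomp i (existT _ i h) = h.
Proof. by rewrite /hcomp; case: pselect => // E; rewrite (Prop_irrelevance E erefl). Qed.

Lemma hcomp_diff i p : projT1 p <> i -> hcomp i p = 0.
Proof. by rewrite /hcomp; case: pselect. Qed.

Theorem hilbert_sum : exists (L : hilbert R) (e : forall i, H i -> L),
  [/\ forall i, lin (e i), forall i x y, ip (e i x) (e i y) = ip x y,
      forall i j x y, i <> j -> ip (e i x) (e j y) = 0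
    & densefam (fun p : X => e (projT1 p) (projT2 p))].
Proof.
pose k (p q : X) : K := ip (hcomp (projT1 q) p) (projT2 q).
have k_same i (p q : X) : projT1 p = i -> projT1 q = i -> k p q = ip (hcomp i p) (hcomp i q).
  by case: p q => [i1 x] [i2 y] /= E1 E2; subst i1 i2; rewrite /k /= (hcomp_same y).
have k_diff (p q : X) : projT1 p <> projT1 q -> k p q = 0.
  by move=> h; rewrite /k hcomp_diff// ip0l.
have kC p q : k q p = (k p q)^*.
  have [E|E] := pselect (projT1 p = projT1 q).
    by rewrite (k_same _ _ _ E erefl) (k_same _ _ _ erefl E) -ip_conj.
  by rewrite !k_diff ?rmorph0//; exact: nesym.
(* Cross terms between different indices vanish, so the terms at the index of the head contribute a
   square norm and the others form a shorter list. *)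
have kpos s : 0 <= kform k s s.
  have [n sn] := ubnP (size s); elim: n => // n IH in s sn *.
  case: s sn => [|p s] sn; first by rewrite /kform big_nil.
  pose i := projT1 p.2; pose P (q : K * X) := `[< projT1 q.2 = i >].
  have cross s1 s2 : kform k (seq.filter P s1) (seq.filter (predC P) s2) = 0.
    rewrite /kform big_filter big1// => q /asboolP Pq; rewrite big_filter big1// => r /asboolPn Pr.
    by rewrite k_diff ?mulr0// Pq; exact: nesym.
  have -> : kform k (p :: s) (p :: s) =
      kform k (seq.filter P (p :: s)) (seq.filter P (p :: s)) +
      kform k (seq.filter (predC P) (p :: s)) (seq.filter (predC P) (p :: s)).
    have E (Q : pred (K * X)) u : \sum_(q <- u | Q q) \sum_(r <- p :: s) q.1 * r.1^* * k q.2 r.2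
       = kform k (seq.filter Q u) (seq.filter P (p :: s))
         + kform k (seq.filter Q u) (seq.filter (predC P) (p :: s)).
      rewrite /kform !big_filter -big_split; apply: eq_bigr => q _.
      by rewrite !big_filter [LHS](bigID P).
    have cross' : kform k (seq.filter (predC P) (p :: s)) (seq.filter P (p :: s)) = 0.
      by rewrite (kformC kC) cross rmorph0.
    have := congr2 +%R (E P (p :: s)) (E (predC P) (p :: s)).
    by rewrite cross cross' addr0 add0r => <-; exact: bigID.
  apply: addr_ge0.
    suff -> : kform k (seq.filter P (p :: s)) (seq.filter P (p :: s)) =
        ip (lc (hcomp i) (seq.filter P (p :: s))) (lc (hcomp i) (seq.filter P (p :: s))).
      by rewrite ip_nm -(rc0 R) rc_le sqr_ge0.
    rewrite ip_lc /kform !big_filter; apply: eq_bigr => q /asboolP Pq.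
    by rewrite !big_filter; apply: eq_bigr => r /asboolP Pr; rewrite (k_same i).
  have Pp : P p by apply/asboolP.
apply: IH; rewrite /= Pp /= size_filter.
  by rewrite (leq_ltn_trans (count_size _ _)).
have [L [e [ek de]]] := kernel_hilbert kC kpos.
have kx i (x y : H i) : k (existT _ i x) (existT _ i y) = ip x y.
  by rewrite /k /= hcomp_same.
exists L, (fun i x => e (existT _ i x)); split.
- move=> i c x y; apply: (hilb_dense_ext de) => -[j z]; rewrite ip_linear !ek.
  have [E|E] := pselect (i = j); first by subst j; rewrite !kx ip_linear.
  by rewrite !k_diff// mulr0 addr0.
- by move=> i x y; rewrite ek kx.
- by move=> i j x y ij; rewrite ek k_diff.
- by move=> v eps /(de v)[s hs]; exists s; rewrite (_ : lc _ s = lc e s)//; apply: eq_bigr => -[c []].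
Qed.
End HilbertSum.

Section RepOfFamily.
Variables (R : realType) (S : starAlgebra R) (L : hilbert R) (X : Type) (e : X -> L).
Notation K := (Cplx R).
Notation dom := (@sa_dom R S).
Hypothesis de : densefam e.
Hypothesis domP : forall (k : K) a b, dom a -> dom b -> dom (k *: a + b).
Hypothesis domM : forall a b, dom a -> dom b -> dom (sa_mul a b).
Hypothesis domS : forall a, dom a -> dom (sa_star a).
Variable t : S -> X -> L.
Hypothesis tb : forall a, dom a -> exists C, forall s, nm (lc (t a) s) <= C * nm (lc e s).
Hypothesis tl : forall (k : K) a b x, dom a -> dom b -> t (k *: a + b) x = k *: t a x + t b x.
Hypothesis ts : forall a x y, dom a -> ip (t a x) (e y) = ip (e x) (t (sa_star a) y).
Hypothesis tm : forall a b x y, dom a -> dom b ->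
  ip (t (sa_mul a b) x) (e y) = ip (t b x) (t (sa_star a) y).

(** Everything is prescribed on generators. Since [t b x] need not be a generator, multiplicativity
    is stated by moving a to the other side of the inner product. *)
Theorem rep_of_family : exists pi : S -> L -> L,
  is_rep pi /\ forall a x, dom a -> pi a (e x) = t a x.
Proof.
have /choice[pi piP] : forall a, exists T : L -> L, dom a ->
    [/\ lin T, exists C, bnd T C & forall x, T (e x) = t a x].
  move=> a; have [da|] := pselect (dom a); last by exists id.
  have [C hC] := tb da; have [T [T1 T2 T3]] := bnd_extend de (@complete_seq R L) hC.
  by exists T => _; split => //; exists C.
have adj a x y : dom a -> ip (pi a x) y = ip x (pi (sa_star a) y).
  move=> da; have [l1 [C1 b1] e1] := piP a da; have [l2 [C2 b2] e2] := piP _ (domS da).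
  have H z : ip (pi a x) (e z) = ip x (pi (sa_star a) (e z)).
    move: x; apply: (@bnd_eq _ _ _ _ de (K^o) (fun x => ip (pi a x) (e z))
      (fun x => ip x (pi (sa_star a) (e z))) (C1 * nm (e z)) (nm (pi (sa_star a) (e z)))).
    - by move=> c u v; rewrite l1 ip_linear.
    - by move=> u; rewrite (le_trans (ip_CS _ _))// mulrAC ler_wpM2r ?nm_ge0.
    - by move=> c u v; rewrite ip_linear.
    - by move=> u; rewrite mulrC ip_CS.
    - by move=> w; rewrite e1 e2 ts.
  rewrite ip_conj [RHS]ip_conj; congr (_^*); move: y.
  apply: (@bnd_eq _ _ _ _ de (K^o) (fun y => ip y (pi a x))
      (fun y => ip (pi (sa_star a) y) x) (nm (pi a x)) (C2 * nm x)).
  - by move=> c u v; rewrite ip_linear.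
  - by move=> u; rewrite mulrC ip_CS.
  - by move=> c u v; rewrite l2 ip_linear.
  - by move=> u; rewrite (le_trans (ip_CS _ _))// mulrAC ler_wpM2r ?nm_ge0.
  - by move=> z; rewrite ip_conj H -ip_conj.
exists pi; split; last by move=> a x da; have [_ _ ->] := piP a da.
split.
- move=> a da; have [l [C b] _] := piP a da; split; last exact: bnd_continuous b.
  by move=> k x y; rewrite l.
- move=> k a b h da db; move: h.
  have [l1 [C1 b1] e1] := piP a da; have [l2 [C2 b2] e2] := piP b db.
  have [l3 [C3 b3] e3] := piP _ (domP k da db).
  apply: (@bnd_eq _ _ _ _ de _ _ (fun h => k *: pi a h + pi b h) C3 (nm k * C1 + C2)) => //.
  - by move=> c u v; rewrite l1 l2 !scalerDr !scalerA mulrC addrACA.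
  - move=> u; rewrite (le_trans (nmD _ _))// nmZ mulrDl -mulrA.
    by rewrite lerD// ler_wpM2l ?nm_ge0.
  - by move=> x; rewrite e1 e2 e3 tl.
- move=> a b h da db; move: h.
  have [l1 [C1 b1] e1] := piP a da; have [l2 [C2 b2] e2] := piP b db.
  have [l3 [C3 b3] e3] := piP _ (domM da db).
  apply: (@bnd_eq _ _ _ _ de _ _ (fun h => pi a (pi b h)) C3 (`|C1| * C2)) => //.
  - by move=> c u v; rewrite l2 l1.
  - move=> u; apply: le_trans (b1 _) _; rewrite -mulrA.
    apply: le_trans (_ : `|C1| * nm (pi b u) <= _).
      by rewrite ler_wpM2r ?nm_ge0// ler_norm.
    by rewrite ler_wpM2l.
  - move=> x; rewrite e3 e2; apply: (hilb_dense_ext de) => z.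
    by have [_ _ e4] := piP _ (domS da); rewrite adj// e4 tm.
- by move=> a x y da; exact: adj.
Qed.
End RepOfFamily.

(** * Existence of spatial tensor products *)

Lemma rep_inj (R : realType) (A : cstarAlgebra R) (H : hilbert R) (rho : A -> H -> H) :
  @is_rep R A H rho -> (forall a, a <> 0 -> exists x, rho a x <> 0) -> injective rho.
Proof.
move=> rhoP h a b ab; apply: contrapT => ne.
have [|x] := h (a - b); first by move=> /eqP; rewrite subr_eq0 => /eqP.
apply; have [_ rl _ _] := rhoP.
have -> : a - b = (-1) *: b + a by rewrite scaleN1r addrC.
by rewrite rl// -ab scaleN1r addNr.
Qed.

Lemma isom_eq0 (R : realType) (H L : hilbert R) (e : H -> L) x :
  (forall x y, ip (e x) (e y) = ip x y) -> e x = 0 -> x = 0.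
Proof.
move=> he ex; apply/nm_eq0/eqP; rewrite -sqrf_eq0; apply/eqP/(@rc_inj R).
by rewrite -ip_nm -he ex ip0l rc0.
Qed.

Section RepSum.
Variables (R : realType) (A : cstarAlgebra R) (I : Type) (H : I -> hilbert R).
Variable pi : forall i, A -> H i -> H i.
Hypothesis pirep : forall i, @is_rep R A (H i) (@pi i).

Theorem rep_sum : exists (L : hilbert R) (rho : A -> L -> L) (e : forall i, H i -> L),
  [/\ @is_rep R A L rho, forall i, lin (e i), forall i x y, ip (e i x) (e i y) = ip x y
    & forall i a x, rho a (e i x) = e i (@pi i a x)].
Proof.
have [L [e [el ei eo de]]] := hilbert_sum H.
have nme i x : nm (e i x) = nm x.
  by apply/eqP; rewrite -(@eqrXn2 _ 2) ?nm_ge0//; apply/eqP/(@rc_inj R); rewrite -!ip_nm ei.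
pose E (p : {i : I & H i}) := e (projT1 p) (projT2 p).
pose t (a : A) (p : {i : I & H i}) := e (projT1 p) (@pi (projT1 p) a (projT2 p)).
have [|||||||rho [hr re]] := @rep_of_family R A L _ E de _ _ _ t.
- by [].
- by [].
- by [].
- move=> a _; exists (nm a) => s.
  apply: (@orthogonal_le _ _ _ _ _ _ _ (@projT1 I (fun i => H i))) => //.
  + exact: nm_ge0.
  + by move=> x y; exact: eo.
  + by move=> x y; exact: eo.
  move=> i u hu.
  have [v [v1 v2]] : exists v : H i, lc E u = e i v /\ lc (t a) u = e i (@pi i a v).
    elim: u hu => [|[c [j x]] u IH] /=.
      by exists 0; rewrite !lc_nil (lin0 (rep_lin a (pirep i))) (lin0 (el i)).
    move=> /andP[/asboolP E1] /IH[v [v1 v2]]; subst j.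
    exists (c *: x + v); rewrite /lc !big_cons -!/(lc _ u) v1 v2 /E /t /=.
    by rewrite (rep_lin a (pirep i)) !(linD (el i)) !(linZ (el i)).
  by rewrite v1 v2 !nme; exact: rep_le.
- move=> k a b [i x] _ _; rewrite /t /=; have [_ h _ _] := pirep i.
  by rewrite h// (linD (el i)) (linZ (el i)).
- move=> a [i x] [j y] _; rewrite /t /E /=.
  have [E1|E1] := pselect (i = j); last by rewrite !eo.
  by subst j; rewrite !ei; have [_ _ _ ->] := pirep i.
- move=> a b [i x] [j y] _ _; rewrite /t /E /=.
  have [E1|E1] := pselect (i = j); last by rewrite !eo.
  by subst j; rewrite !ei; have [_ _ h1 h2] := pirep i; rewrite h1// h2.
exists L, rho, e; split => //.
by move=> i a x; have := re a (existT _ i x) Logic.I.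
Qed.
End RepSum.

Section TensorProduct.
Variables (R : realType) (A B : cstarAlgebra R).
Notation K := (Cplx R).

Record repPair := RepPair {
  rp_H : hilbert R; rp_M : hilbert R;
  rp_pi : A -> rp_H -> rp_H; rp_sigma : B -> rp_M -> rp_M;
  rp_piP : @is_rep R A rp_H rp_pi; rp_sigmaP : @is_rep R B rp_M rp_sigma }.

Record repOf (C : cstarAlgebra R) := RepOf {
  ro_H : hilbert R; ro_pi : C -> ro_H -> ro_H; ro_piP : @is_rep R C ro_H ro_pi }.
Arguments ro_pi {C} r _ _.

(** Stands in for the Gelfand-Naimark theorem; enveloping algebras satisfy it in [env_separated]. *)
Definition rep_separated (C : cstarAlgebra R) := forall a : C, a <> 0 ->
  exists r : repOf C, exists h, ro_pi r a h <> 0.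

Lemma tensor_normsqE (H M L : hilbert R) (t : H -> M -> L) (s : seq (H * M)) :
  (forall h h' m m', ip (t h m) (t h' m') = ip h h' * ip m m') ->
  tensor_normsq s = rc (nm (\sum_(p <- s) t p.1 p.2) ^+ 2).
Proof.
move=> ht; rewrite -ip_nm ip_suml; apply: eq_bigr => p _.
by rewrite ip_sumr; apply: eq_bigr => q _; rewrite ht.
Qed.

Lemma tensor_normsq_isom (H M H' M' : hilbert R) (f : H -> H') (g : M -> M') s :
  (forall x y, ip (f x) (f y) = ip x y) -> (forall x y, ip (g x) (g y) = ip x y) ->
  tensor_normsq [seq (f p.1, g p.2) | p : H * M <- s] = tensor_normsq s.
Proof.
move=> hf hg; rewrite /tensor_normsq big_map; apply: eq_bigr => p _.
by rewrite big_map; apply: eq_bigr => q _; rewrite /= hf hg.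
Qed.

Hypothesis sepA : rep_separated A.
Hypothesis sepB : rep_separated B.

(** The algebra is the closure of the operators rho(a) (x) sig(b) for one pair of faithful
    representations whose norm dominates that of every other pair. The dominating pair is found by
    direct sums, although all pairs of representations are too many to be summed. *)
Theorem tensor_exists : inhabited (tensorProduct A B).
Proof.
(* The index set consists of the sums and bounds that some pair violates. One violating pair for
   each index suffices to reach every supremum of norms. *)
pose J := {sM : seq (A * B) * K | exists r : repPair, ~ tensor_op_le (@rp_pi r) (@rp_sigma r) sM.1 sM.2}.
have /choice[fJ hJ] : forall j : J, exists r : repPair,
    ~ tensor_op_le (@rp_pi r) (@rp_sigma r) (sval j).1 (sval j).2.
  by move=> j; exact: (proj2_sig j).
have /choice[fA hA] : forall a : {a : A | a <> 0}, exists r : repOf A, exists h, ro_pi r (sval a) h <> 0.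
  by move=> a; apply: sepA; exact: (proj2_sig a).
have /choice[fB hB] : forall a : {a : B | a <> 0}, exists r : repOf B, exists h, ro_pi r (sval a) h <> 0.
  by move=> a; apply: sepB; exact: (proj2_sig a).
(* The left summands are shared by the two families, so that each chosen pair occurs inside the
   tensor product; the right ones make the sums faithful. *)
pose famA (i : J + {a : A | a <> 0}) : repOf A :=
  match i with inl j => RepOf (@rp_piP (fJ j)) | inr a => fA a end.
pose famB (i : J + {a : B | a <> 0}) : repOf B :=
  match i with inl j => RepOf (@rp_sigmaP (fJ j)) | inr a => fB a end.
have [H0 [rho [eA [rhoP eAl eAi eAr]]]] := rep_sum (fun i => @ro_piP _ (famA i)).
have [M0 [sig [eB [sigP eBl eBi eBr]]]] := rep_sum (fun i => @ro_piP _ (famB i)).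
have injA : injective rho.
  apply: (rep_inj rhoP) => a ne; have [h hh] := hA (exist _ a ne).
  exists (eA (inr (exist _ a ne)) h); rewrite eAr => /(isom_eq0 (eAi _)); exact: hh.
have injB : injective sig.
  apply: (rep_inj sigP) => a ne; have [h hh] := hB (exist _ a ne).
  exists (eB (inr (exist _ a ne)) h); rewrite eBr => /(isom_eq0 (eBi _)); exact: hh.
have [L [t [tip tl tr td]]] := tensor_hilbert H0 M0.
have tlc (s : seq (K * (H0 * M0))) (f : H0 -> H0) (g : M0 -> M0) : lin f ->
    lc (fun x : H0 * M0 => t (f x.1) (g x.2)) s =
    \sum_(p <- [seq (f q.1, g q.2) | q <- [seq (p.1 *: p.2.1, p.2.2) | p <- s]]) t p.1 p.2.
  move=> lf; rewrite !big_map; apply: eq_bigr => p _ /=.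
  by rewrite (linZ lf) (linZ (tl _)).
(* The operators rho(a) (x) sig(b) on L, bounded by acting on one factor after the other. *)
have /choice[Eo EP] : forall x : A * B, exists T : L -> L,
    [/\ lin T, bnd T (nm x.1 * nm x.2) & forall h m, T (t h m) = t (rho x.1 h) (sig x.2 m)].
  move=> [a b] /=.
  have [|T [T1 T2 T3]] := bnd_extend td (t := fun x => t (rho a x.1) (sig b x.2))
    (C := nm a * nm b) (@complete_seq R L).
    move=> s; rewrite (tlc _ _ _ (rep_lin a rhoP)) (_ : lc _ s = lc (fun x : H0 * M0 => t (id x.1) (id x.2)) s)//.
    rewrite (tlc _ id id)//; set u := map (fun p : K * (H0 * M0) => _) s.
    rewrite -ler_sqr ?nnegrE ?mulr_ge0 ?nm_ge0// -rc_le exprMn [leRHS]rcM.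
    rewrite -!(tensor_normsqE _ tip) exprMn.
    have -> : [seq (id q.1, id q.2) | q <- u] = u by elim: u => //= -[x y] u ->.
    have -> : [seq (rho a q.1, sig b q.2) | q <- u] =
        [seq (rho a q.1, q.2) | q <- [seq (q.1, sig b q.2) | q <- u]].
      by rewrite -[RHS]map_comp.
    apply: le_trans (tensor_normsq_mapl _ (rep_lin a rhoP) (rep_le rhoP a) (nm_ge0 a)) _.
    rewrite [rc (nm a ^+ 2 * _)]rcM -mulrA ler_wpM2l//; first by rewrite -(rc0 R) rc_le sqr_ge0.
    exact: (tensor_normsq_mapr _ (rep_lin b sigP) (rep_le sigP b) (nm_ge0 b)).
  by exists T; split => // h m; rewrite (T3 (h, m)).
have Obl a b : lin (Eo (a, b)) by have [] := EP (a, b).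
have Ob a b : bnd (Eo (a, b)) (nm a * nm b) by have [] := EP (a, b).
have Ot a b h m : Eo (a, b) (t h m) = t (rho a h) (sig b m) by have [_ _ ->] := EP (a, b).
have Oll (k : K) a a' b : Eo (k *: a + a', b) = k *: Eo (a, b) + Eo (a', b).
  apply/funext; apply: (@bnd_eq _ _ _ _ td _ _ _ (nm (k *: a + a') * nm b)
     (nm k * (nm a * nm b) + nm a' * nm b)) => //.
  - by move=> c x y; rewrite ![(_ *: Eo _ + _) _]/(k *: Eo _ _ + Eo _ _) !Obl !scalerDr !scalerA mulrC addrACA.
  - move=> x; rewrite [(_ *: Eo _ + _) _]/(k *: Eo _ _ + Eo _ _) (le_trans (nmD _ _))// nmZ mulrDl.
    by rewrite lerD ?Ob// -!mulrA ler_wpM2l ?nm_ge0// mulrA Ob.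
  - move=> [h m]; rewrite [(_ *: Eo _ + _) _]/(k *: Eo _ _ + Eo _ _) /= !Ot.
    by have [_ h1 _ _] := rhoP; rewrite h1// (linD (tl _)) (linZ (tl _)).
have Olr (k : K) a b b' : Eo (a, k *: b + b') = k *: Eo (a, b) + Eo (a, b').
  apply/funext; apply: (@bnd_eq _ _ _ _ td _ _ _ (nm a * nm (k *: b + b'))
     (nm k * (nm a * nm b) + nm a * nm b')) => //.
  - by move=> c x y; rewrite ![(_ *: Eo _ + _) _]/(k *: Eo _ _ + Eo _ _) !Obl !scalerDr !scalerA mulrC addrACA.
  - move=> x; rewrite [(_ *: Eo _ + _) _]/(k *: Eo _ _ + Eo _ _) (le_trans (nmD _ _))// nmZ mulrDl.
    by rewrite lerD ?Ob// -!mulrA ler_wpM2l ?nm_ge0// mulrA Ob.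
  - move=> [h m]; rewrite [(_ *: Eo _ + _) _]/(k *: Eo _ _ + Eo _ _) /= !Ot.
    by have [_ h1 _ _] := sigP; rewrite h1// (linD (tr _)) (linZ (tr _)).
have OM a a' b b' : Eo (a, b) \o Eo (a', b') = Eo (cs_mul a a', cs_mul b b').
  apply/funext; apply: (@bnd_eq _ _ _ _ td _ _ _ (nm a * nm b * (nm a' * nm b'))
     (nm (cs_mul a a') * nm (cs_mul b b'))) => //.
  - by move=> c x y; rewrite /= !Obl.
  - by move=> x /=; rewrite (le_trans (Ob _ _ _))// -[leRHS]mulrA ler_wpM2l ?mulr_ge0 ?nm_ge0 ?Ob.
  - move=> [h m] /=; rewrite !Ot; have [_ _ h1 _] := rhoP; have [_ _ h2 _] := sigP.
    by rewrite -h1// -h2.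
have Oadj a b x y : ip (Eo (a, b) x) y = ip x (Eo (cs_star a, cs_star b) y).
  move: x; apply: (@bnd_eq _ _ _ _ td (K^o) (fun x => ip (Eo (a, b) x) y)
      (fun x => ip x (Eo (cs_star a, cs_star b) y)) (nm a * nm b * nm y)
      (nm (Eo (cs_star a, cs_star b) y))).
  - by move=> c u v; rewrite Obl ip_linear.
  - by move=> u; rewrite (le_trans (ip_CS _ _))// mulrAC ler_wpM2r ?nm_ge0 ?Ob.
  - by move=> c u v; rewrite ip_linear.
  - by move=> u; rewrite mulrC ip_CS.
  move=> [h m] /=; rewrite ip_conj [RHS]ip_conj; congr (_^*); move: y.
  apply: (@bnd_eq _ _ _ _ td (K^o) (fun y => ip y (Eo (a, b) (t h m)))
      (fun y => ip (Eo (cs_star a, cs_star b) y) (t h m)) (nm (Eo (a, b) (t h m)))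
      (nm (cs_star a) * nm (cs_star b) * nm (t h m))).
  - by move=> c u v; rewrite ip_linear.
  - by move=> u; rewrite mulrC ip_CS.
  - by move=> c u v; rewrite Obl ip_linear.
  - by move=> u; rewrite (le_trans (ip_CS _ _))// mulrAC ler_wpM2r ?nm_ge0 ?Ob.
  move=> [h' m'] /=; rewrite !Ot !tip.
  by rewrite (rep_adj _ _ _ rhoP) (rep_adj _ _ _ sigP).
pose op (s : seq (A * B)) : L -> L := \sum_(p <- s) Eo p.
have opE s x : op s x = \sum_(p <- s) Eo p x by rewrite /op fct_sumE.
have opnil : op [::] = 0 by rewrite /op big_nil.
have opcons p s : op (p :: s) = Eo p + op s by rewrite /op big_cons.
have opP (k : K) s s' : k *: op s + op s' = op ([seq (k *: p.1, p.2) | p <- s] ++ s').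
  rewrite /op big_cat big_map scaler_sumr; congr (_ + _); apply: eq_bigr => -[a b] _ /=.
  have := Oll k a 0 b; rewrite addr0 => ->.
  suff -> : Eo (0, b) = 0 by rewrite addr0.
  by have := Oll (-1) 0 0 b; rewrite scaler0 addr0 scaleN1r addNr.
have oplin s : lin (op s).
  move=> c x y; rewrite !opE scaler_sumr -big_split; apply: eq_bigr => -[a b] _ /=.
  exact: Obl.
have opb s : exists2 C, 0 <= C & bnd (op s) C.
  exists (\sum_(p <- s) nm p.1 * nm p.2).
    by rewrite sumr_ge0// => p _; rewrite mulr_ge0 ?nm_ge0.
  move=> x; rewrite opE mulr_suml (le_trans (nm_sum _ _))// ler_sum// => -[a b] _ /=.
  exact: Ob.
have opM s s' : op s \o op s' = op [seq (cs_mul p.1 q.1, cs_mul p.2 q.2) | p <- s, q <- s'].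
  apply/funext => x; rewrite /= !opE big_allpairs_dep; apply: eq_bigr => -[a b] _.
  rewrite (lin_sum (Obl a b)); apply: eq_bigr => -[a' b'] _ /=.
  by rewrite -OM.
have opadj s x y : ip (op s x) y = ip x (op [seq (cs_star p.1, cs_star p.2) | p <- s] y).
  rewrite !opE big_map ip_suml ip_sumr; apply: eq_bigr => -[a b] _ /=; exact: Oadj.
pose D := range op.
have D0 : D 0 by exists [::].
have DP (k : K) T U : D T -> D U -> D (k *: T + U).
  by move=> [s _ <-] [s' _ <-]; rewrite opP; eexists.
have DM T U : D T -> D U -> D (T \o U).
  by move=> [s _ <-] [s' _ <-]; rewrite opM; eexists.
have [|||C [j [j1 j2 j3 j4 j5]]] := operator_algebra D0 DP DM.
- by move=> _ [s _ <-].
- by move=> _ [s _ <-].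
- by move=> _ [s _ <-]; exists (op [seq (cs_star p.1, cs_star p.2) | p <- s]); [eexists|move=> x y; exact: opadj].
have O1 a b : Eo (a, b) = op [:: (a, b)] by rewrite /op big_seq1.
have DO a b : D (Eo (a, b)) by rewrite O1; eexists.
pose tn a b : C := j (Eo (a, b)).
have jop s : j (op s) = \sum_(p <- s) tn p.1 p.2.
  have j0 : j 0 = 0.
    by have := j1 (-1) 0 0 D0 D0; rewrite scaler0 addr0 scaleN1r addNr.
  elim: s => [|[a b] s IH]; first by rewrite opnil big_nil.
  rewrite opcons big_cons -IH /=; have := j1 1 (Eo (a, b)) (op s) (DO a b).
  by rewrite !scale1r; apply; eexists.
have op_le s M : 0 <= M -> tensor_op_le rho sig s (rc M) <-> bnd (op s) M.
  move=> Mp.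
  have E h : tensor_normsq [seq (rho p.1 q.1, sig p.2 q.2) | p <- s, q <- h] =
      rc (nm (op s (\sum_(q <- h) t q.1 q.2)) ^+ 2).
    rewrite (tensor_normsqE _ tip) big_allpairs_dep opE; congr (rc (nm _ ^+ 2)).
    apply: eq_bigr => -[a b] _; rewrite (lin_sum (Obl a b)); apply: eq_bigr => q _.
    by rewrite Ot.
  have sqE h : (tensor_normsq [seq (rho p.1 q.1, sig p.2 q.2) | p <- s, q <- h]
       <= rc M ^+ 2 * tensor_normsq h) =
     (nm (op s (\sum_(q <- h) t q.1 q.2)) <= M * nm (\sum_(q <- h) t q.1 q.2)).
    rewrite E (tensor_normsqE h tip) -rcX -rcM rc_le -exprMn.
    by rewrite ler_sqr// nnegrE ?mulr_ge0// nm_ge0.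
  split=> [h|h u]; last by rewrite sqE; exact: h.
  have [C' _ bC'] := opb s.
  apply: (bnd_dense td (oplin s) bC' Mp) => u.
  have -> : lc (fun x => t x.1 x.2) u = \sum_(q <- [seq (p.1 *: p.2.1, p.2.2) | p <- u]) t q.1 q.2.
    by rewrite big_map; apply: eq_bigr => p _ /=; rewrite (linZ (tl _)).
  by rewrite -sqE; exact: h.
constructor; apply: (@TensorProduct R A B C tn).
- by move=> k a a' b; rewrite /tn Oll; exact: j1.
- by move=> k a b b'; rewrite /tn Olr; exact: j1.
- by move=> a a' b b'; rewrite /tn -OM j2.
- by move=> a b; apply: (j3 _ _ (DO _ _) (DO _ _)) => x y; exact: Oadj.
- apply/dense_nmP => v eps e0; have [_ [s _ <-] hs] := j5 v eps e0.
  exists (j (op s)) => //=; rewrite jop; exists (size s), (fun=> 1).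
  exists (fun i => tn (tnth (in_tuple s) i).1 (tnth (in_tuple s) i).2); split.
    by move=> i; do 2 eexists.
  by rewrite [LHS]big_tnth; apply: eq_bigr => i _; rewrite scale1r.
(* If a pair violated the bound given by the norm of s, then s with this bound would be an index of
   J, and the pair chosen there, being a summand of rho and sig, would violate a bound that they
   satisfy. *)
- move=> H M pi sigma piP sigmaP s; apply: contrapT => bad.
  pose r := RepPair piP sigmaP.
  pose jj : J := exist _ (s, `|\sum_(p <- s) tn p.1 p.2|) (ex_intro _ r bad).
  have := hJ jj; apply => /= h.
  have : tensor_op_le rho sig s (rc (nm (j (op s)))).
    apply/op_le; first exact: nm_ge0.
    by apply/j4; [eexists|exact: nm_ge0|].
  move=> /(_ [seq (eA (inl jj) p.1, eB (inl jj) p.2) | p <- h]).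
  rewrite tensor_normsq_isom; [|exact: eAi|exact: eBi].
  rewrite nmE -jop -rcX.
  have -> : [seq (rho p.1 q.1, sig p.2 q.2) | p <- s,
        q <- [seq (eA (inl jj) p.1, eB (inl jj) p.2) | p <- h]] =
      [seq (eA (inl jj) p.1, eB (inl jj) p.2) |
        p <- [seq (rp_pi p.1 q.1, rp_sigma p.2 q.2) | p <- s, q <- h]].
    rewrite map_allpairs; elim: (s) => //= p s' ->; congr (_ ++ _).
    by rewrite -map_comp; apply: eq_map => q /=; rewrite eAr eBr.
  by rewrite tensor_normsq_isom; [|exact: eAi|exact: eBi].
- exists H0, M0, rho, sig; split => // s M M0' h.
  have cM : 0 <= cre M by rewrite cre_ge0.
  rewrite -(creK M0') nmE rc_le -jop; apply/j4; [by eexists|by []|].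
  by apply/op_le => //; rewrite creK.
Qed.
End TensorProduct.

(** * Enveloping C*-algebras *)

Section Enveloping.
Variables (R : realType) (S : starAlgebra R) (E : enveloping S).
Notation K := (Cplx R).
Notation dom := (@sa_dom R S).
Notation env := (env_map E).
Hypothesis dom0 : dom 0.
Hypothesis domP : forall (k : K) a b, dom a -> dom b -> dom (k *: a + b).
Hypothesis domM : forall a b, dom a -> dom b -> dom (sa_mul a b).
Hypothesis domS : forall a, dom a -> dom (sa_star a).

Lemma env_lin (k : K) a b : dom a -> dom b -> env (k *: a + b) = k *: env a + env b.
Proof. by have [h _ _] := env_hom E; exact: h. Qed.
Lemma env_mul a b : dom a -> dom b -> env (sa_mul a b) = cs_mul (env a) (env b).
Proof. by have [_ h _] := env_hom E; exact: h. Qed.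
Lemma env_star a : dom a -> env (sa_star a) = cs_star (env a).
Proof. by have [_ _ h] := env_hom E; exact: h. Qed.
Lemma env0 : env 0 = 0.
Proof. by have := env_lin (-1) dom0 dom0; rewrite scaler0 addr0 scaleN1r addNr. Qed.

Lemma env_approx (v : E) (eps : R) : 0 < eps -> exists2 f, dom f & nm (v - env f) < eps.
Proof.
move=> e0; have /dense_nmP/(_ v eps e0)[_ [f df <-] h] := env_dense E.
by exists f.
Qed.

Lemma env_densefam : densefam (fun x : {f | dom f} => env (sval x)).
Proof.
apply: simple_densefam => v eps /(env_approx v)[f df h].
by exists (exist _ f df).
Qed.

(** One and the same f serves all maps g, so images of a combination in different spaces can be
    compared through it. *)
Lemma lc_dom (s : seq (K * {f | dom f})) : exists2 f, dom f &
  forall (W : lmodType K) (g : S -> W),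
    (forall (k : K) a b, dom a -> dom b -> g (k *: a + b) = k *: g a + g b) ->
    lc (fun x : {f | dom f} => g (sval x)) s = g f.
Proof.
elim: s => [|[k [a da]] s [f df hf]].
  exists 0 => // W g gl; rewrite lc_nil.
  by have := gl (-1) 0 0 dom0 dom0; rewrite scaler0 addr0 scaleN1r addNr.
exists (k *: a + f); first exact: domP.
by move=> W g gl; rewrite gl// -hf// /lc big_cons.
Qed.

(** With the vector h fixed, f -> pi(f) h is bounded by |h| times the enveloping norm and extends;
    the algebraic laws follow by density. *)
Lemma env_rep_extend (H : hilbert R) (pi : S -> H -> H) : is_rep pi ->
  exists rho : E -> H -> H, @is_rep R E H rho /\ forall f h, dom f -> rho (env f) h = pi f h.
Proof.
move=> piP; have [pl pa pm ps] := piP; have de := env_densefam.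
have /choice[r rP] : forall h, exists T : E -> H,
    [/\ lin T, bnd T (nm h) & forall f, dom f -> T (env f) = pi f h].
  move=> h.
  have [|T [T1 T2 T3]] := bnd_extend de (t := fun x : {f | dom f} => pi (sval x) h)
      (C := nm h) (@complete_seq R H).
    move=> s; have [f df hf] := lc_dom s.
    have h1 := hf _ (fun f => pi f h) (fun k a b => pa k a b h).
    have h2 := hf _ env env_lin; rewrite /= in h1 h2; rewrite h1 h2.
    by rewrite -rc_le rcM mulrC -!nmE env_ub.
  by exists T; split => // f df; have := T3 (exist _ f df).
have rl h : lin (r h) by have [] := rP h.
have rb h a : nm (r h a) <= nm h * nm a by have [_ + _] := rP h; exact.
have re h f : dom f -> r h (env f) = pi f h by have [_ _ +] := rP h; exact.
have rlh a : lin (r^~ a).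
  move=> k h h'; move: a.
  apply: (@bnd_eq _ _ _ _ de _ _ (fun a => k *: r h a + r h' a) (nm (k *: h + h')) (nm k * nm h + nm h')).
  - exact: rl.
  - exact: rb.
  - by move=> c x y; rewrite !rl !scalerDr !scalerA mulrC addrACA.
  - by move=> x; rewrite (le_trans (nmD _ _))// nmZ mulrDl lerD// -mulrA ler_wpM2l ?nm_ge0.
  - by move=> [f df] /=; rewrite !re//; have [l _] := pl f df; exact: l.
exists (fun a h => r h a); split; last by move=> f h df; exact: re.
split.
- move=> a _; split; first by move=> k x y; exact: rlh.
  by apply: (@bnd_continuous _ _ _ _ (nm a)) => [|h]; [exact: rlh|rewrite mulrC; exact: rb].
- by move=> k a b h _ _; exact: rl.
- move=> a b h _ _; move: a.
  apply: (@bnd_eq _ _ _ _ de _ (fun a => r h (cs_mul a b)) (r (r h b)) (nm h * nm b) (nm (r h b))).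
  - by move=> c x y; rewrite cs_mull_lin rl.
  - by move=> x; rewrite (le_trans (rb _ _))// -mulrA ler_wpM2l ?nm_ge0// mulrC nm_mul.
  - exact: rl.
  - exact: rb.
  move=> [f df] /=; rewrite re//; have [lf [C bC]] : lin (pi f) /\ exists C, bnd (pi f) C.
    split; first by move=> k x y; have [l _] := pl f df; rewrite l.
    by exists (nm (env f)) => x; rewrite -rc_le rcM -!nmE env_ub.
  move: b; apply: (@bnd_eq _ _ _ _ de _ (fun b => r h (cs_mul (env f) b)) (fun b => pi f (r h b))
     (nm h * nm (env f)) (`|C| * nm h)).
  - by move=> c x y; rewrite cs_mulr_lin rl.
  - by move=> x; rewrite (le_trans (rb _ _))// -mulrA ler_wpM2l ?nm_ge0// nm_mul.
  - by move=> c x y; rewrite rl lf.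
  - move=> x; apply: le_trans (bC _) _; rewrite -mulrA.
    apply: le_trans (_ : `|C| * nm (r h x) <= _).
      by rewrite ler_wpM2r ?nm_ge0// ler_norm.
    by rewrite ler_wpM2l.
  by move=> [g dg] /=; rewrite -env_mul// !re//; [exact: pm|exact: domM].
- move=> a h k _; move: a.
  apply: (@bnd_eq _ _ _ _ de (K^o) (fun a => ip (r h a) k) (fun a => ip h (r k (cs_star a)))
    (nm h * nm k) (nm h * nm k)).
  - by move=> c x y; rewrite rl ip_linear.
  - move=> x; rewrite (le_trans (ip_CS _ _))// mulrAC ler_wpM2r ?nm_ge0//.
  - by move=> c x y; rewrite cs_starD cs_starZ rl ipDr ipZr conjCK.
  - move=> x; rewrite (le_trans (ip_CS _ _))// -mulrA ler_wpM2l ?nm_ge0//.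
    by rewrite (le_trans (rb _ _))// nm_star.
  - by move=> [f df] /=; rewrite -env_star// !re//; [exact: ps|exact: domS].
Qed.

Lemma env_le f M : dom f -> 0 <= M ->
  (forall (H : hilbert R) (pi : S -> H -> H), is_rep pi -> forall h, nm (pi f h) <= M * nm h) ->
  nm (env f) <= M.
Proof.
move=> df M0 h; apply: le_epsP => eps e0.
have [|H [pi [x [piP x1 hx]]]] := @env_lub R S E f (rc eps) df.
  by rewrite -(rc0 R) rc_lt.
have {}x1 : nm x <= 1 by rewrite -rc_le -nmE rc1.
have {}hx : nm (env f) - eps < nm (pi f x) by rewrite -rc_lt rcB -!nmE.
have := h H pi piP x; have : M * nm x <= M * 1 by rewrite ler_wpM2l.
lra.
Qed.

(** If every representation killed a, an f within |a|/4 of a would have norm at most |a|/4 in all of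
    them, hence in E, whereas |f| > 3|a|/4. *)
Lemma env_separated : rep_separated E.
Proof.
move=> a a0.
have na : 0 < nm a by rewrite lt_neqAle nm_ge0 andbT eq_sym; apply/eqP => /nm_eq0.
apply: contrapT => bad.
have [f df hf] := env_approx a (divr_gt0 na (@ltr0n R 4)).
suff : nm (env f) <= nm a / 4.
  by have := nm_sub a (env f); lra.
apply: env_le => //; first by rewrite divr_ge0 ?nm_ge0.
move=> H pi piP h; have [rho [rhoP rf]] := env_rep_extend piP.
have ra : rho a h = 0.
  by apply: contrapT => ne; apply: bad; exists (RepOf rhoP), h.
have -> : pi f h = rho (env f - a) h.
  have [_ rl _ _] := rhoP; rewrite addrC -scaleN1r rl// ra scaler0 add0r.
  by rewrite rf.
apply: le_trans (rep_le rhoP _ _) _; rewrite ler_wpM2r ?nm_ge0// nmBC; exact: ltW.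
Qed.
End Enveloping.

Lemma nm_lc_ip (R : realType) (X : Type) (H L : hilbert R) (e : X -> H) (g : X -> L) s :
  (forall x y, ip (e x) (e y) = ip (g x) (g y)) -> nm (lc e s) = nm (lc g s).
Proof.
move=> h; apply/eqP; rewrite -(@eqrXn2 _ 2) ?nm_ge0//; apply/eqP/(@rc_inj R).
rewrite -!ip_nm !ip_lc; apply: eq_bigr => p _; apply: eq_bigr => q _.
by rewrite h.
Qed.

Section MultHomOfAction.
Variables (R : realType) (A B : cstarAlgebra R) (XA XB : Type).
Variables (eA : XA -> A) (eB : XB -> B).
Hypothesis dA : densefam eA.
Hypothesis dB : densefam eB.
Variables (mulX : XA -> XA -> XA) (starX : XA -> XA) (act : XA -> XB -> XB).
Notation K := (Cplx R).
Notation "x ** y" := (cs_mul x y) (at level 40, left associativity).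
Hypothesis eAM : forall x x', eA (mulX x x') = eA x ** eA x'.
Hypothesis eAS : forall x, eA (starX x) = cs_star (eA x).
Hypothesis actM : forall x x' y, eB (act (mulX x x') y) = eB (act x (act x' y)).
Hypothesis actS : forall x y y',
  cs_star (eB (act x y)) ** eB y' = cs_star (eB y) ** eB (act (starX x) y').
Hypothesis act_le : forall (s : seq (K * XA)) (u : seq (K * XB)),
  nm (lc (fun x => lc (fun y => eB (act x y)) u) s) <= nm (lc eA s) * nm (lc eB u).

Theorem mult_hom_of_action : exists Phi : A -> multiplier B,
  [/\ @is_mult_hom R A B Phi, forall x y, Phi (eA x) (eB y) = eB (act x y)
    & forall a, bnd (Phi a) (nm a)].
Proof.
have /choice[Psi PsiP] : forall u : seq (K * XB), exists F : A -> B,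
    [/\ lin F, bnd F (nm (lc eB u)) & forall x, F (eA x) = lc (fun y => eB (act x y)) u].
  by move=> u; apply: (bnd_extend dA (@complete_seq R B)) => s; rewrite mulrC.
pose psi a y := Psi [:: (1, y)] a.
have psil y : lin (psi^~ y) by have [] := PsiP [:: (1, y)].
have psib a y : nm (psi a y) <= nm (eB y) * nm a.
  by have [_ + _] := PsiP [:: (1, y)]; rewrite lc1; exact.
have psie x y : psi (eA x) y = eB (act x y).
  by have [_ _ h] := PsiP [:: (1, y)]; rewrite /psi h lc1.
have psilc a u : lc (psi a) u = Psi u a.
  have [l1 b1 e1] := PsiP u; move: a.
  apply: (@bnd_eq _ _ _ _ dA _ (fun a => lc (psi a) u) (Psi u)
     (\sum_(p <- u) nm p.1 * nm (eB p.2)) (nm (lc eB u))) => //.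
  - move=> c x y; rewrite /lc scaler_sumr -big_split; apply: eq_bigr => p _ /=.
    by rewrite psil scalerDr !scalerA mulrC.
  - move=> x; rewrite (le_trans (nm_sum _ _))// mulr_suml ler_sum// => p _.
    by rewrite nmZ -mulrA ler_wpM2l ?nm_ge0.
  - by move=> x; rewrite e1; apply: eq_bigr => p _; rewrite psie.
have psibd a u : nm (lc (psi a) u) <= nm a * nm (lc eB u).
  by rewrite psilc mulrC; have [_ + _] := PsiP u; exact.
have adj a x y : cs_star (psi a x) ** eB y = cs_star (eB x) ** psi (cs_star a) y.
  rewrite -[LHS]cs_starK -[RHS]cs_starK; congr cs_star.
  rewrite [cs_star (_ ** eB y)]cs_starM [cs_star (_ ** psi _ y)]cs_starM !cs_starK.
  move: a; apply: (@bnd_eq _ _ _ _ dA _ (fun a => cs_star (eB y) ** psi a x)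
    (fun a => cs_star (psi (cs_star a) y) ** eB x)
    (nm (eB y) * nm (eB x)) (nm (eB y) * nm (eB x))).
  - by move=> c u v; rewrite psil cs_mulr_lin.
  - by move=> u; rewrite (le_trans (nm_mul _ _))// nm_star -mulrA ler_wpM2l ?nm_ge0.
  - move=> c u v; rewrite cs_starD cs_starZ psil cs_starD cs_starZ conjCK.
    by rewrite cs_mull_lin.
  - move=> u; rewrite (le_trans (nm_mul _ _))// nm_star mulrAC ler_wpM2r ?nm_ge0//.
    by rewrite -(nm_star u) (le_trans (psib _ _)).
  - move=> z; rewrite -eAS !psie.
    by have := congr1 (@cs_star R B) (actS z x y); rewrite !cs_starM !cs_starK.
have /choice[Phi PhiP] : forall a, exists m : multiplier B,
    [/\ forall x, m (eB x) = psi a x, forall x, mult_adj m (eB x) = psi (cs_star a) x & bnd m (nm a)].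
  by move=> a; exact: (mult_extend dB (adj a) (psibd a)).
have Pe a x : Phi a (eB x) = psi a x by have [h _ _] := PhiP a; exact: h.
have Pb a x : nm (Phi a x) <= nm a * nm x by have [_ _ h] := PhiP a; exact: h.
have Pl x : lin (fun a => Phi a x).
  move=> k a a'; move: x; apply: (@bnd_eq _ _ _ _ dB _ (Phi (k *: a + a'))
    (fun x => k *: Phi a x + Phi a' x) (nm (k *: a + a')) (nm k * nm a + nm a')).
  - exact: mult_lin.
  - exact: Pb.
  - by move=> c x y; rewrite !mult_lin !scalerDr !scalerA mulrC addrACA.
  - by move=> x; rewrite (le_trans (nmD _ _))// nmZ mulrDl lerD// -mulrA ler_wpM2l ?nm_ge0.
  - by move=> x; rewrite !Pe psil.
have Pact x y : Phi (eA x) (eB y) = eB (act x y) by rewrite Pe psie.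
exists Phi; split => //; split.
- by move=> k a a' x _ _; exact: Pl.
- move=> a a' x _ _; move: x; apply: (mult_eq_dense (m' := mult_comp (Phi a) (Phi a')) dB).
  move=> y /=; move: a; apply: (@bnd_eq _ _ _ _ dA _ (fun a => Phi (a ** a') (eB y))
    (fun a => Phi a (Phi a' (eB y))) (nm a' * nm (eB y)) (nm (Phi a' (eB y)))).
  - by move=> c u v; rewrite cs_mull_lin Pl.
  - move=> u; rewrite (le_trans (Pb _ _))// mulrAC ler_wpM2r ?nm_ge0// mulrC nm_mul//.
  - by move=> c u v; rewrite Pl.
  - by move=> u; rewrite mulrC Pb.
  move=> x /=; move: a'; apply: (@bnd_eq _ _ _ _ dA _ (fun a' => Phi (eA x ** a') (eB y))
    (fun a' => Phi (eA x) (Phi a' (eB y))) (nm (eA x) * nm (eB y)) (nm (eA x) * nm (eB y))).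
  - by move=> c u v; rewrite cs_mulr_lin Pl.
  - by move=> u; rewrite (le_trans (Pb _ _))// mulrAC ler_wpM2r ?nm_ge0// nm_mul.
  - by move=> c u v; rewrite Pl mult_lin.
  - by move=> u; rewrite (le_trans (Pb _ _))// -mulrA ler_wpM2l ?nm_ge0// mulrC Pb.
  by move=> x' /=; rewrite -eAM !Pact actM.
- move=> a x _; apply: (mult_eq_dense (m' := mult_star (Phi a)) dB) => y /=.
  by have [_ h _] := PhiP a; rewrite Pe h.
Qed.
End MultHomOfAction.

(** * Multipliers of tensor products *)

Section TensorMultiplier.
Variables (R : realType) (A B C : cstarAlgebra R).
Variables (T : tensorProduct A C) (TB : tensorProduct B C).
Variable pi : A -> multiplier B.
Hypothesis piP : @is_mult_hom R A B pi.
Notation K := (Cplx R).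
Notation "x ** y" := (cs_mul x y) (at level 40, left associativity).

Lemma tens_lin_l (D F : cstarAlgebra R) (U : tensorProduct D F) b : lin ((tens U)^~ b).
Proof. by move=> k x y; exact: tens_linearl. Qed.
Lemma tens_lin_r (D F : cstarAlgebra R) (U : tensorProduct D F) a : lin (tens U a).
Proof. by move=> k x y; exact: tens_linearr. Qed.

Lemma tens_densefam (D F : cstarAlgebra R) (U : tensorProduct D F) :
  densefam (fun x : D * F => tens U x.1 x.2).
Proof.
move=> v eps e0.
have [s hs] := span_densefam (tens_dense U) v e0.
have H (x : {x : U | exists a b, x = tens U a b}) : exists y : D * F, sval x = tens U y.1 y.2.
  by have [a [b ab]] := proj2_sig x; exists (a, b).
have [g hg] := choice H; exists [seq (p.1, g p.2) | p <- s].
rewrite (_ : lc _ _ = lc (fun x => sval x) s)// /lc big_map.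
by apply: eq_bigr => p _ /=; rewrite hg.
Qed.

Lemma lc_tens (D F : cstarAlgebra R) (U : tensorProduct D F) (s : seq (K * (D * F))) :
  lc (fun x : D * F => tens U x.1 x.2) s =
  \sum_(q <- [seq (p.1 *: p.2.1, p.2.2) | p : K * (D * F) <- s]) tens U q.1 q.2.
Proof.
by rewrite big_map; apply: eq_bigr => p _ /=; rewrite (linZ (tens_lin_l _ _)).
Qed.

(** In the attaining pair of faithful representations, the upper bound for the zero tensor forces
    |rho(a) x| |sig(b) y| = 0 for all x and y. *)
Lemma tens_eq0 (D F : cstarAlgebra R) (U : tensorProduct D F) a b :
  tens U a b = 0 -> a = 0 \/ b = 0.
Proof.
move=> ab; have [H [M [rho [sig [[rhoP ri] [sigP si] _]]]]] := tens_norm_attained U.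
have := tens_norm_ub U rhoP sigP [:: (a, b)].
rewrite big_seq1 ab normr0 => h.
have H0 x y : nm (rho a x) * nm (sig b y) = 0.
  have := h [:: (x, y)]; rewrite /= /tensor_normsq !big_seq1 /= expr0n mul0r !ip_nm -rcM -(rc0 R) rc_le.
  rewrite -exprMn => h1; apply/eqP; rewrite -sqrf_eq0 eq_le h1 sqr_ge0//.
have [a0|a0] := pselect (a = 0); [by left|right].
have rho0 : rho 0 = fun=> 0.
  by apply/funext => x; have := rep_le rhoP 0 x; rewrite nm0 mul0r => h1; apply/nm_eq0/eqP; rewrite eq_le h1 nm_ge0.
have sig0 : sig 0 = fun=> 0.
  by apply/funext => x; have := rep_le sigP 0 x; rewrite nm0 mul0r => h1; apply/nm_eq0/eqP; rewrite eq_le h1 nm_ge0.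
have [x hx] : exists x, rho a x <> 0.
  apply: contrapT => ne; apply: a0; apply: ri; rewrite rho0; apply/funext => x.
  by apply: contrapT => h1; apply: ne; exists x.
apply: si; rewrite sig0; apply/funext => y; apply/nm_eq0/eqP.
have /eqP := H0 x y; rewrite mulf_eq0 => /orP[/eqP/nm_eq0//|//].
Qed.

Lemma mult_hom_star a b b' : cs_star (pi a b) ** b' = cs_star b ** pi (cs_star a) b'.
Proof. by have [_ _ h] := piP; rewrite mult_adjP h. Qed.
Lemma mult_homM a a' b : pi (a ** a') b = pi a (pi a' b).
Proof. by have [_ h _] := piP; exact: h. Qed.
Lemma mult_hom_lin b : lin (fun a => pi a b).
Proof. by move=> k x y; have [h _ _] := piP; exact: h. Qed.

(* [pi] extends to a representation on the completion of [B (x) H] for the form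
   induced by [rho], to which the norm bound of [T] applies. *)
Lemma tensor_mult_bound (s : seq (A * C)) (u : seq (B * C)) :
  nm (\sum_(p <- s) \sum_(q <- u) tens TB (pi p.1 q.1) (p.2 ** q.2)) <=
  nm (\sum_(p <- s) tens T p.1 p.2) * nm (\sum_(q <- u) tens TB q.1 q.2).
Proof.
have [H [M [rho [sig [[rhoP _] [sigP _] norm_le]]]]] := tens_norm_attained TB.
pose g (x : B * H) : H := rho x.1 x.2.
have rhoM a b h : rho (a ** b) h = rho a (rho b h) by have [_ _ h1 _] := rhoP; exact: h1.
have [||He [e [ek de]]] := @kernel_hilbert R (B * H)%type (fun x y => ip (g x) (g y)).
- by move=> x y; rewrite -ip_conj.
- by move=> w; rewrite /kform -ip_lc ip_nm -(rc0 R) rc_le sqr_ge0.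
have gT a a' (x x' : B * H) : ip (rho (pi a x.1) x.2) (rho (pi a' x'.1) x'.2) =
    ip (rho (pi (cs_star a' ** a) x.1) x.2) (rho x'.1 x'.2).
  rewrite !(rep_adj _ _ _ rhoP) -!rhoM mult_hom_star.
  by rewrite -mult_homM.
have gT2 a (x x' : B * H) : ip (rho x.1 x.2) (rho (pi a x'.1) x'.2) =
    ip (rho (pi (cs_star a) x.1) x.2) (rho x'.1 x'.2).
  by rewrite !(rep_adj _ _ _ rhoP) -!rhoM mult_hom_star.
have [|||||||rb [rbP rbe]] := @rep_of_family R A He _ e de _ _ _ (fun a x => e (pi a x.1, x.2)).
- by [].
- by [].
- by [].
- move=> a _; exists (nm a) => w.
  rewrite (@nm_lc_ip _ _ _ H _ (fun x => rho (pi a x.1) x.2)); last by move=> x y; rewrite ek.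
  rewrite (@nm_lc_ip _ _ _ H e g); last by move=> x y; rewrite ek.
  apply: (@cs_contraction R A H _ _ (ip_form H) _ g (fun a x => rho (pi a x.1) x.2)).
  + by move=> c d x x'; exact: gT.
  + by move=> d x x'; exact: gT2.
  + by move=> k c d x; rewrite mult_hom_lin; have [_ h _ _] := rhoP; exact: h.
- move=> k a b x _ _; apply: (hilb_dense_ext de) => z; rewrite ip_linear !ek /g /=.
  by rewrite mult_hom_lin; have [_ h _ _] := rhoP; rewrite h// ip_linear.
- by move=> a x y _; rewrite !ek /g /= gT2 cs_starK.
- by move=> a b x y _ _; rewrite !ek /g /= gT cs_starK.
pose s' := [seq (pi p.1 q.1, p.2 ** q.2) | p <- s, q <- u].
have -> : \sum_(p <- s) \sum_(q <- u) tens TB (pi p.1 q.1) (p.2 ** q.2) =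
    \sum_(p <- s') tens TB p.1 p.2 by rewrite big_allpairs_dep.
rewrite -rc_le rcM -!nmE; apply: norm_le; first by rewrite mulr_ge0.
move=> h.
(* The vector obtained from h by applying u, viewed in the tensor product of the completion with M.
   Passing from h to eta costs the norm of u, and applying s through [rb] costs the norm of s in
   T. *)
pose eta := [seq (e (q.1, r.1), sig q.2 r.2) | q <- u, r <- h].
have n1 : tensor_normsq eta <= `|\sum_(q <- u) tens TB q.1 q.2| ^+ 2 * tensor_normsq h.
  have := tens_norm_ub TB rhoP sigP u h; apply: le_trans.
  rewrite le_eqVlt; apply/orP; left; apply/eqP.
  rewrite /tensor_normsq /eta !big_allpairs_dep; apply: eq_bigr => q _; apply: eq_bigr => r _.
  rewrite !big_allpairs_dep; apply: eq_bigr => q' _; apply: eq_bigr => r' _ /=.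
  by rewrite ek.
have n2 := tens_norm_ub T rbP sigP s eta.
rewrite exprMn -mulrA; apply: le_trans (_ : _ <= `|\sum_(p <- s) tens T p.1 p.2| ^+ 2 * tensor_normsq eta) _.
  apply: le_trans n2; rewrite le_eqVlt; apply/orP; left; apply/eqP.
  rewrite /tensor_normsq /eta /s' !big_allpairs_dep; apply: eq_bigr => p _.
  rewrite !big_allpairs_dep; apply: eq_bigr => q _; apply: eq_bigr => r _.
  rewrite !big_allpairs_dep; apply: eq_bigr => p' _.
  rewrite !big_allpairs_dep; apply: eq_bigr => q' _; apply: eq_bigr => r' _ /=.
  rewrite !rbe// ek /g /=; have [_ _ h2 _] := sigP.
  by rewrite !h2.
by rewrite ler_wpM2l// exprn_ge0.
Qed.

Theorem tensor_mult_hom : exists Phi : T -> multiplier TB,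
  [/\ @is_mult_hom R T TB Phi,
      forall a z b y, Phi (tens T a z) (tens TB b y) = tens TB (pi a b) (z ** y)
    & forall t, bnd (Phi t) (nm t)].
Proof.
have [|||||Phi [Ph Pa Pb]] := @mult_hom_of_action R T TB _ _ _ _ (@tens_densefam A C T)
  (@tens_densefam B C TB) (fun x x' => (x.1 ** x'.1, x.2 ** x'.2))
  (fun x => (cs_star x.1, cs_star x.2)) (fun x y => (pi x.1 y.1, x.2 ** y.2)).
- by move=> x x' /=; rewrite tens_mul.
- by move=> x /=; rewrite tens_star.
- by move=> x x' y /=; rewrite mult_homM cs_mulA.
- move=> x y y' /=; rewrite -!tens_star -!tens_mul mult_hom_star.
  by rewrite [cs_star (_ ** y.2)]cs_starM cs_mulA.
- move=> s u; rewrite !lc_tens.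
  have -> : lc (fun x : A * C => lc (fun y : B * C => tens TB (pi x.1 y.1) (x.2 ** y.2)) u) s =
    \sum_(p <- [seq (p.1 *: p.2.1, p.2.2) | p : K * (A * C) <- s])
    \sum_(q <- [seq (p.1 *: p.2.1, p.2.2) | p : K * (B * C) <- u]) tens TB (pi p.1 q.1) (p.2 ** q.2).
    rewrite big_map; apply: eq_bigr => p _; rewrite big_map scaler_sumr; apply: eq_bigr => q _ /=.
    rewrite (linZ (mult_lin _)) (linZ (mult_hom_lin _)) !(linZ (tens_lin_l _ _)).
    by rewrite !scalerA mulrC.
  exact: tensor_mult_bound.
exists Phi; split => // a z b y.
exact: (Pa (a, z) (b, y)).
Qed.

(** This is pi(a) (x) 1, which is not a value of [tensor_mult_hom] since C may lack a unit. *)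
Theorem tensor_mult_one a : exists P : multiplier TB,
  forall b y, P (tens TB b y) = tens TB (pi a b) y.
Proof.
pose eB (x : B * C) := tens TB x.1 x.2.
have [||P [P1 _ _]] := @mult_extend R TB _ eB (fun x => tens TB (pi a x.1) x.2)
    (fun x => tens TB (pi (cs_star a) x.1) x.2) (nm a) (@tens_densefam B C TB).
- by move=> x y; rewrite /eB -!tens_star -!tens_mul mult_hom_star.
- apply: (@cs_contraction R A TB _ _ (cs_form TB) _ eB (fun a x => tens TB (pi a x.1) x.2)).
  + move=> c d x x' /=; rewrite /eB -!tens_star -!tens_mul mult_hom_star.
    by rewrite -mult_homM.
  + by move=> d x x' /=; rewrite /eB -!tens_star -!tens_mul mult_hom_star.
  + by move=> k c d x; rewrite mult_hom_lin tens_linearl.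
by exists P => b y; have := P1 (b, y).
Qed.
End TensorMultiplier.

(** * Group C*-algebras *)

(** Any duplicate-free list between the support and A computes the sum; this freedom lets several
    sums be taken over one list. *)
Lemma fsum_seq (V : nmodType) (I : choiceType) (A : set I) (r : seq I) (F : I -> V) :
  uniq r -> (forall i, i \in r -> A i) -> (forall i, A i -> F i <> 0 -> i \in r) ->
  \sum_(i \in A) F i = \sum_(i <- r) F i.
Proof.
move=> ur rA Ar; rewrite (fsbigE r)//; last first.
  by move=> i Ai; apply: contraNeq => /eqP; exact: Ar.
rewrite big_seq_cond [RHS]big_seq; apply: eq_bigl => i; apply: andb_idr => ir.
exact/mem_set/rA.
Qed.

Definition suppseq (V : nmodType) (I : choiceType) (A : set I) (F : I -> V) : seq I :=
  finite_support 0 A F.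

Lemma mem_suppseq (V : nmodType) (I : choiceType) (A : set I) (F : I -> V) i :
  finite_set (A `&` [set i | F i <> 0]) -> (i \in suppseq A F) <-> A i /\ F i <> 0.
Proof.
move=> fA; rewrite /suppseq in_finite_support//; split=> [/set_mem//|h]; exact: mem_set.
Qed.

Lemma suppseq_uniq (V : nmodType) (I : choiceType) (A : set I) (F : I -> V) :
  uniq (suppseq A F).
Proof. exact: finite_support_uniq. Qed.

Lemma fsum_suppseq (V W : nmodType) (I : choiceType) (A : set I) (F : I -> V) (G : I -> W) :
  finite_set (A `&` [set i | F i <> 0]) -> (forall i, A i -> F i = 0 -> G i = 0) ->
  \sum_(i \in A) G i = \sum_(i <- suppseq A F) G i.
Proof.
move=> fA h; apply: fsum_seq; first exact: suppseq_uniq.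
- by move=> i /(mem_suppseq _ fA)[].
- by move=> i Ai Gi; apply/(mem_suppseq _ fA); split => // Fi; apply: Gi; exact: h.
Qed.

Section GroupAlgebra.
Variables (R : realType) (G : groupType).
Notation K := (Cplx R).
Notation S := (group_algebra R G).
Notation dom := (@sa_dom R S).
Implicit Types (f g : G -> K) (s t u : G).

Let fin f : dom f -> finite_set ([set: G] `&` [set s | f s <> 0]).
Proof.
move=> df; apply: sub_finite_set df => s /= [_ h]; exact/eqP.
Qed.

Lemma ga_dom0 : dom (0 : G -> K).
Proof. by apply: (sub_finite_set _ (finite_set0 G)) => s /=; rewrite eqxx. Qed.

Lemma ga_domP (k : K) f g : dom f -> dom g -> dom (k *: f + g).
Proof.
move=> df dg; have := conj df dg; rewrite -finite_setU; apply: sub_finite_set => s /= h.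
have [fs|] := eqVneq (f s) 0; last by left.
have [gs|] := eqVneq (g s) 0; last by right.
by exfalso; move: h; change (is_true (k * f s + g s != 0) -> False); rewrite fs gs mulr0 addr0 eqxx.
Qed.

Lemma ga_mulE f g x : dom f -> sa_mul (s := S) f g x =
  \sum_(t <- suppseq [set: G] f) f t * g (t^-1 * x)%g.
Proof.
move=> df; apply: fsum_suppseq; first exact: fin.
by move=> i _ ->; rewrite mul0r.
Qed.

Lemma ga_domM f g : dom f -> dom g -> dom (sa_mul (s := S) f g).
Proof.
move=> df dg; apply: (@sub_finite_set _ _ ((fun p : G * G => (p.1 * p.2)%g) @`
  ([set s | f s != 0] `*` [set s | g s != 0]))).
  move=> x; rewrite -/(sa_mul (s := S) f g x != 0) => h; apply: contrapT => ne; move/eqP: h; apply; rewrite ga_mulE//.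
  apply: big1_seq => t _; have [->|ft] := eqVneq (f t) 0; first by rewrite mul0r.
  have [->|gt] := eqVneq (g (t^-1 * x)%g) 0; first by rewrite mulr0.
  by case: ne; exists (t, (t^-1 * x)%g) => //=; rewrite mulVKg.
exact/finite_image/finite_setX.
Qed.

Lemma ga_domS f : dom f -> dom (sa_star (s := S) f).
Proof.
move=> df; apply: (@sub_finite_set _ _ ((fun s : G => (s^-1)%g) @` [set s | f s != 0])).
  move=> x /=; rewrite conjC_eq0 => h; exists (x^-1)%g => //; exact: invgK.
exact: finite_image.
Qed.

Lemma chi_dom s : dom (chi R s).
Proof.
apply: (sub_finite_set _ (finite_set1 s)) => t /=; rewrite /chi.
by case: (t =P s) => // _ /eqP[].
Qed.

Lemma chi_mul s f : sa_mul (s := S) (chi R s) f = fun x => f (s^-1 * x)%g.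
Proof.
apply/funext => x; rewrite [LHS](@fsum_seq _ _ _ [:: s])//.
- by rewrite big_seq1 /chi eqxx mul1r.
- move=> t _; rewrite /chi inE; case: (t == s) => //; by rewrite mul0r.
Qed.

Lemma chi_chi s t : sa_mul (s := S) (chi R s) (chi R t) = chi R (s * t)%g.
Proof.
rewrite chi_mul; apply/funext => x; rewrite /chi; congr (_%:R); congr nat_of_bool.
by apply/eqP/eqP => [<-|->]; rewrite ?mulVKg ?mulKg.
Qed.

Lemma chi_star s : sa_star (s := S) (chi R s) = chi R s^-1%g.
Proof.
apply/funext => x; rewrite /= /chi rmorph_nat; congr (_%:R); congr nat_of_bool.
by apply/eqP/eqP => [<-|->]; rewrite invgK.
Qed.

(** The left regular representation with multiplicity H, on the sum of copies of H indexed by G. It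
    serves to tell the canonical unitaries apart. *)
Theorem regular_rep (H : hilbert R) : exists (L : hilbert R) (e : G -> H -> L) (pi : S -> L -> L),
  [/\ is_rep pi, forall u x y, ip (e u x) (e u y) = ip x y,
      forall u v x y, u <> v -> ip (e u x) (e v y) = 0
    & forall s u x, pi (chi R s) (e u x) = e (s * u)%g x].
Proof.
have [L [e [el ei eo de]]] := hilbert_sum (fun _ : G => H).
pose E (p : {i : G & H}) := e (projT1 p) (projT2 p).
pose t (f : S) (p : {i : G & H}) := \sum_(s \in [set: G]) f s *: e (s * projT1 p)%g (projT2 p).
have ipe u v x y : ip (e u x) (e v y) = (u == v)%:R * ip x y.
  by case: eqP => [->|uv]; rewrite ?ei ?mul1r// eo// mul0r.
have tE f p r : uniq r -> (forall s, f s <> 0 -> s \in r) ->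
    t f p = \sum_(s <- r) f s *: e (s * projT1 p)%g (projT2 p).
  move=> ur hr; apply: fsum_seq => // s _ h; apply: hr => f0; apply: h.
  by rewrite f0 scale0r.
have supp_in f s : dom f -> f s <> 0 -> s \in suppseq [set: G] f.
  by move=> df fs; apply/mem_suppseq; [exact: fin|].
have ipt f p q : dom f -> ip (t f p) (E q) =
    f (projT1 q * (projT1 p)^-1)%g * ip (projT2 p) (projT2 q).
  move=> df; set w := (_ * _)%g.
  rewrite (tE _ _ (suppseq [set: G] f)) ?suppseq_uniq//; last by move=> s; exact: supp_in.
  rewrite ip_suml.
  have wE s : ip (f s *: e (s * projT1 p)%g (projT2 p)) (E q) = (s == w)%:R * (f s * ip (projT2 p) (projT2 q)).
    rewrite ipZl ipe mulrCA; congr (_%:R * _); congr nat_of_bool.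
    by rewrite /w; apply/eqP/eqP => [<-|->]; rewrite ?mulgK ?mulgVK.
  have [fw|fw] := pselect (f w = 0).
    rewrite fw mul0r big1// => s _; rewrite wE; case: eqP => [->|_]; last by rewrite mul0r.
    by rewrite fw mul0r mulr0.
  rewrite (bigD1_seq w) ?suppseq_uniq ?supp_in//= wE eqxx mul1r big1 ?addr0// => s /negPf sw.
  by rewrite wE sw mul0r.
have [||||pi [piP pie]] := @rep_of_family R S L _ E de ga_domP ga_domM ga_domS t.
- move=> f df; exists (\sum_(s <- suppseq [set: G] f) nm (f s)) => u.
  have -> : lc (t f) u = \sum_(s <- suppseq [set: G] f) f s *: lc (fun p : {i : G & H} => e (s * projT1 p)%g (projT2 p)) u.
    rewrite /lc; under [RHS]eq_bigr do rewrite scaler_sumr.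
    rewrite exchange_big; apply: eq_bigr => p _ /=.
    rewrite (tE _ _ (suppseq [set: G] f)) ?suppseq_uniq//; last by move=> s; exact: supp_in.
    by rewrite scaler_sumr; apply: eq_bigr => s _; rewrite !scalerA mulrC.
  rewrite (le_trans (nm_sum _ _))// mulr_suml ler_sum// => s _; rewrite nmZ ler_wpM2l ?nm_ge0//.
  rewrite (@nm_lc_ip _ _ _ _ _ E)// => p q; rewrite !ipe; congr (_%:R * _); congr nat_of_bool.
  by rewrite (inj_eq (mulgI _)).
- move=> k f g p df dg; apply: (hilb_dense_ext de) => q; rewrite ip_linear !ipt//; last exact: ga_domP.
  by rewrite [(_ *: _ + _) _]/(k * f _ + g _) mulrDl mulrA.
- move=> f p q df; rewrite ipt// [RHS]ip_conj ipt; last exact: ga_domS.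
  rewrite rmorphM /= conjCK -ip_conj; congr (f _ * _).
  by rewrite invgM invgK.
- move=> f g p q df dg; rewrite ipt; last exact: ga_domM.
  set w := (_ * _)%g.
  rewrite (tE g _ (suppseq [set: G] g)) ?suppseq_uniq//; last by move=> s; exact: supp_in.
  rewrite ip_suml.
  under eq_bigr => s _.
    rewrite ipZl ip_conj -/(E (existT (fun=> H) (s * projT1 p)%g (projT2 p))) ipt; last exact: ga_domS.
    rewrite rmorphM /= conjCK -ip_conj mulrA invgM invgM invgK mulgA -/w; over.
  rewrite -mulr_suml; congr (_ * _).
  (* The substitution turns the convolution into a sum of f(w s^-1) g(s), supported where g is. *)
  rewrite [LHS](@reindex_fsbig _ _ _ _ _ (fun s => (w * s^-1)%g) setT setT); last first.
    split=> //; first by move=> x y _ _ /mulgI/invg_inj.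
    by move=> x _; exists (x^-1 * w)%g => //; rewrite invgM invgK mulVKg.
  rewrite (fsum_suppseq (F := g)); [|exact: fin|].
    apply: eq_bigr => s _; rewrite mulrC; congr (g _ * f _).
      by rewrite invgM invgK mulgVK.
  by move=> s _ gs; rewrite invgM invgK mulgVK gs mulr0.
exists L, e, pi; split => // s u x.
have := pie (chi R s) (existT _ u x) (chi_dom s); rewrite /E /= => ->.
rewrite (tE _ _ [:: s]) ?big_seq1 /chi ?eqxx ?scale1r//= => v.
by rewrite inE; case: (v == s).
Qed.

Variable CG : groupCstar R G.
Notation un := (unitary CG).

Lemma cg_dense : densefam (fun x : {f | dom f} => env_map CG (sval x)).
Proof. exact: env_densefam. Qed.
Lemma unitaryM s t : cs_mul (un s) (un t) = un (s * t)%g.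
Proof. by rewrite /unitary -env_mul ?chi_chi//; exact: chi_dom. Qed.
Lemma unitaryS s : cs_star (un s) = un s^-1%g.
Proof. by rewrite /unitary -env_star ?chi_star//; exact: chi_dom. Qed.
Lemma unitary1l y : cs_mul (un 1%g) y = y.
Proof.
move: y; apply: (@bnd_eq _ _ _ _ cg_dense _ (cs_mul (un 1%g)) id (nm (un 1%g)) 1).
- exact: cs_mulr_lin.
- by move=> x; exact: nm_mul.
- by [].
- by move=> x; rewrite mul1r.
move=> [f df] /=; rewrite -env_mul//; last exact: chi_dom.
by congr env_map; rewrite chi_mul; apply/funext => x; rewrite invg1 mul1g.
Qed.
Lemma unitary1r y : cs_mul y (un 1%g) = y.
Proof.
rewrite -[LHS]cs_starK cs_starM unitaryS invg1 unitary1l; exact: cs_starK.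
Qed.
Lemma unitaryVK s y : cs_mul (un s^-1%g) (cs_mul (un s) y) = y.
Proof. by rewrite cs_mulA unitaryM mulVg unitary1l. Qed.

(** In the regular representation with one-dimensional multiplicity, distinct s and t send the
    vector at 1 to orthogonal vectors of norm 1. *)
Lemma unitary_inj s t : un s = un t -> s = t.
Proof.
move=> st; apply: contrapT => ne.
have [||H [e1 [ee _]]] := @kernel_hilbert R unit (fun _ _ => 1).
- by move=> x y; rewrite rmorph1.
- move=> u; rewrite /kform.
  have -> : \sum_(p <- u) \sum_(q <- u) p.1 * q.1^* * 1 = (\sum_(p <- u) p.1) * (\sum_(p <- u) p.1)^*.
    rewrite mulr_suml; apply: eq_bigr => p _; rewrite rmorph_sum mulr_sumr.
    by apply: eq_bigr => q _; rewrite mulr1.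
  exact: mul_conjC_ge0.
have [L [e [pi [piP ei eo pie]]]] := regular_rep H.
have := env_ub CG piP (e 1%g (e1 tt)) (ga_domP (-1) (chi_dom t) (chi_dom s)).
rewrite env_lin; [|exact: chi_dom..]; rewrite -/(un s) -/(un t) st (scaleN1r (un t)) addNr normr0 mul0r.
have [_ h _ _] := piP; rewrite h; [|exact: chi_dom..].
rewrite !pie !mulg1 scaleN1r normr_le0 => /eqP h0.
have := congr1 (fun x => ip x (e s (e1 tt))) h0.
by rewrite ipDl ipNl ip0l ei ee eo ?oppr0 ?add0r; [move/eqP; rewrite oner_eq0|exact: nesym].
Qed.
End GroupAlgebra.

(** * Convolution on r-discrete groupoids *)

Section GroupoidAlgebra.
Variables (Q : Type) (D : groupoidData Q).
Hypothesis gD : is_groupoid D.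
Implicit Types x y z : Q.
Notation "x · y" := (g_mul D x y) (at level 40, left associativity).
Notation "x ⁻" := (g_inv D x) (at level 3, left associativity, format "x ⁻").
Notation r := (g_range D).

Lemma g_invK x : x⁻⁻ = x. Proof. by have [h _ _ _ _] := gD; exact: h. Qed.
Lemma g_compVl x : g_comp D (x⁻) x. Proof. by have [_ _ h _ _] := gD; have [] := h x. Qed.
Lemma g_compVr x : g_comp D x (x⁻). Proof. by have [_ _ h _ _] := gD; have [] := h x. Qed.
Lemma g_mulA x y z : g_comp D x y -> g_comp D y z ->
  [/\ g_comp D (x · y) z, g_comp D x (y · z) & x · y · z = x · (y · z)].
Proof. by have [_ h _ _ _] := gD; exact: h. Qed.
Lemma g_mulVK x y : g_comp D x y -> x⁻ · (x · y) = y.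
Proof. by have [_ _ _ h _] := gD; exact: h. Qed.
Lemma g_mulKV x y : g_comp D x y -> x · y · y⁻ = x.
Proof. by have [_ _ _ _ h] := gD; exact: h. Qed.
Lemma g_mulr_source x : x · (x⁻ · x) = x.
Proof.
have [_ _ <-] := g_mulA (g_compVr x) (g_compVl x).
by have := g_mulKV (g_compVr x); rewrite g_invK.
Qed.
Lemma g_range_inv x : r (x⁻) = x⁻ · x. Proof. by rewrite /g_range g_invK. Qed.

(** The range of the inverse is the source x^-1 x, so this is the usual criterion: x and y compose
    exactly when the source of x is the range of y. *)
Lemma g_compP x y : g_comp D x y <-> r y = r (x⁻).
Proof.
rewrite g_range_inv; split=> [xy|e].
  have [c1 _ e1] := g_mulA (g_compVl x) xy.
  have [_ _ e2] := g_mulA c1 (g_compVr y).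
  have [_ _ e3] := g_mulA (g_compVl x) xy.
  move: (g_mulKV c1); rewrite e1 g_mulVK//.
have [_ c1 _] := g_mulA (g_compVr x) (g_compVl x).
have [c2 _ _] := g_mulA (g_compVr y) (g_compVl y).
rewrite -e in c1; have [+ _ _] := g_mulA c1 c2.
by rewrite e g_mulr_source.
Qed.

Lemma g_range_mul x y : g_comp D x y -> r (x · y) = r x.
Proof.
move=> xy; have [_ c _] := g_mulA (g_compVl x) xy.
by have /g_compP := c; rewrite g_invK.
Qed.

Lemma g_invM x y : g_comp D x y -> (x · y)⁻ = y⁻ · x⁻.
Proof.
move=> xy.
have yx : g_comp D (y⁻) (x⁻) by apply/g_compP; rewrite g_invK; symmetry; apply/g_compP.
have [_ c1 _] := g_mulA (g_compVl x) xy.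
have [c2 _ e2] := g_mulA yx c1.
have e3 : y⁻ · x⁻ · (x · y) = y⁻ · y by rewrite e2 g_mulVK.
have [c4 _ _] := g_mulA xy (g_compVr y).
have /g_compP := c4; rewrite !g_range_inv => e4.
rewrite -(g_mulKV c2) e3 e4.
by have := g_mulKV (g_compVl (x · y)).
Qed.

Lemma g_comp_fib x y : r y = r x -> g_comp D (y⁻) x.
Proof. by move=> e; apply/g_compP; rewrite g_invK. Qed.
Lemma g_range_fib x y : r y = r x -> r (y⁻ · x) = r (y⁻).
Proof. by move=> e; rewrite g_range_mul//; exact: g_comp_fib. Qed.
Lemma g_mulK_fib x y : r y = r x -> y · (y⁻ · x) = x.
Proof. by move=> e; rewrite -{1}[y]g_invK g_mulVK//; exact: g_comp_fib. Qed.
Lemma g_comp_mulV x y : r y = r x -> g_comp D y (y⁻ · x).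
Proof. by move=> e; apply/g_compP/g_range_fib. Qed.

Lemma left_translation_bij x :
  set_bij [set y | r y = r (x⁻)] [set z | r z = r x] (g_mul D x).
Proof.
split.
- by move=> y /= e; apply: g_range_mul; apply/g_compP.
- move=> y y' /set_mem/= e /set_mem/= e' exy.
  by rewrite -(@g_mulVK x y) ?exy ?g_mulVK//; apply/g_compP.
- move=> z /= e; exists (x⁻ · z); last exact: g_mulK_fib.
  exact: g_range_fib.
Qed.

Lemma g_div_mul x y z : r y = r x -> r z = r x -> (z⁻ · y)⁻ · (z⁻ · x) = y⁻ · x.
Proof.
move=> yx zx; have cy := @g_comp_fib y z (etrans zx (esym yx)).
rewrite g_invM// g_invK.
have c1 : g_comp D (y⁻) z by apply/g_compP; rewrite g_invK; congruence.
have c2 : g_comp D z (z⁻ · x) by exact: g_comp_mulV.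
have [_ _ ->] := g_mulA c1 c2.
by rewrite g_mulK_fib.
Qed.

Variables (G : groupType) (c : Q -> G).
Hypothesis c_hom : forall x y, g_comp D x y -> c (x · y) = (c x * c y)%g.

Lemma hom_inv x : c (x⁻) = (c x)^-1%g.
Proof.
have c1 : c (r x) = 1%g.
  have e2 : r x · x = x by have := g_mulKV (g_compVr x); rewrite g_invK.
  have [c2 _ _] := g_mulA (g_compVr x) (g_compVl x).
  by have := c_hom c2; rewrite -/(r x) e2 -{1}[c x]mul1g => /mulIg/esym.
by apply: (@mulgI _ (c x)); rewrite mulgV -(c_hom (g_compVr x)).
Qed.
Lemma hom_div x y : r y = r x -> c (y⁻ · x) = ((c y)^-1 * c x)%g.
Proof. by move=> e; rewrite c_hom ?hom_inv//; exact: g_comp_fib. Qed.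
End GroupoidAlgebra.

Section Topology.

(** The sets outside which f takes finitely many values on A and K form a filter. If the image were
    infinite, the filter would be proper, and a cluster point in K would contradict local finiteness
    there. *)
Lemma compact_finite_image (T : topologicalType) (I : choiceType) (A K : set T) (f : T -> I) :
  compact K -> (forall x, K x -> exists2 U, nbhs x U & finite_set (f @` (A `&` U))) ->
  finite_set (f @` (A `&` K)).
Proof.
move=> cK loc; apply: contrapT => inf.
pose F := [set S : set T | finite_set (f @` (A `&` K `\` S))].
have PF : ProperFilter F.
  apply: Build_ProperFilter_ex.
    move=> S FS; apply: contrapT => S0; apply: inf.
    apply: sub_finite_set FS; apply: image_subset => x AKx; split=> // Sx.
    by apply: S0; exists x.
  split.
  - by rewrite /F /= setDT image_set0.
  - move=> S S' FS FS'; rewrite /F /= setDIr image_setU finite_setU; by [].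
  - move=> S S' SS'; apply: sub_finite_set; apply: image_subset => x [h nS']; split=> // /SS'.
    exact: nS'.
have [|x [Kx cx]] := cK F PF.
  rewrite /F /= (_ : _ `\` _ = set0) ?image_set0//.
  by apply/seteqP; split => x // [[_ h] h'].
have [U Ux fU] := loc x Kx.
have [|y [/= nUy Uy]] := cx (~` U) U _ Ux.
  by apply: sub_finite_set fU; apply: image_subset => y [[Ay _] /contrapT].
exact: nUy.
Qed.
End Topology.

Section CompactSupport.
Variables (R : realType) (Q : topologicalType).
Hypothesis hQ : hausdorff_space Q.
Notation K := (Cplx R).
Implicit Types f g : Q -> K.

Lemma supp_in f x : f x <> 0 -> supp f x.
Proof. by move=> h; apply: subset_closure; exact/eqP. Qed.

Lemma supp_out f x : ~ supp f x -> f x = 0.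
Proof. by move=> h; apply: contrapT => /supp_in. Qed.

Lemma supp_compact f (M : set Q) : compact M -> (forall x, f x <> 0 -> M x) -> compact (supp f).
Proof.
move=> cM fM; apply: (@subclosed_compact _ _ M) => //; first exact: closed_closure.
rewrite [X in _ `<=` X](closure_id M).1; last exact: compact_closed.
by apply: closure_subset => x /eqP; exact: fM.
Qed.
End CompactSupport.

Section Conv.
Variables (R : realType) (Q : topologicalType) (D : groupoidData Q).
Hypothesis tD : is_topological_groupoid D.
Hypothesis lD : local_homeo_onto (g_range D) (g_units D).
Hypothesis hQ : hausdorff_space Q.
Notation K := (Cplx R).
Notation A := (Cc R D).
Notation dom := (@sa_dom R A).
Notation conv := (@Defs.conv R Q D).
Implicit Types (f g h : Q -> K) (x y z : Q).
Notation "x · y" := (g_mul D x y) (at level 40, left associativity).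
Notation "x ⁻" := (g_inv D x) (at level 3, left associativity, format "x ⁻").
Notation r := (g_range D).

Let gD : is_groupoid D. Proof. by have [] := tD. Qed.
Let cinv : continuous (g_inv D). Proof. by have [] := tD. Qed.
Let cmul : {within [set p : Q * Q | g_comp D p.1 p.2], continuous (fun p : Q * Q => p.1 · p.2)}.
Proof. by have [] := tD. Qed.
Let cr : continuous r. Proof. by have [] := lD. Qed.

Lemma mul_cvg (T : Type) (F : set_system T) (FF : Filter F) (a b : T -> Q) x y :
  a @ F --> x -> b @ F --> y -> g_comp D x y -> (\forall t \near F, g_comp D (a t) (b t)) ->
  (fun t => a t · b t) @ F --> x · y.
Proof.
move=> ax bY xy ab W /= Wxy.
have /subspace_continuousP/(_ (x, y) xy) h := cmul.
have /= h1 := h W Wxy.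
have h2 : F [set t | g_comp D (a t) (b t) -> W (a t · b t)] by exact: (cvg_pair ax bY h1).
change (F [set t | W (a t · b t)]).
by apply: filterS2 ab h2 => t ct; apply.
Qed.

(** Around y the range map is injective and relatively open on some U; [s x] is the point of U above
    the range of x, and y where there is none. *)
Lemma local_section y x0 : r y = r x0 -> exists s : Q -> Q,
  s @ x0 --> y /\ \forall x \near x0, r (s x) = r x.
Proof.
move=> yx; have [rr _ lh] := lD.
have [U [oU Uy Ui UW]] := lh y.
have /choice[s sP] : forall x, exists z, (exists2 z', U z' & r z' = r x) -> U z /\ r z = r x.
  move=> x; have [[z Uz e]|n] := pselect (exists2 z', U z' & r z' = r x); first by exists z.
  by exists y.
have main W : nbhs y W -> \forall x \near x0, W (s x) /\ r (s x) = r x.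
  rewrite nbhsE => -[W' [oW' W'y] W'W].
  have [||V oV eV] := UW (W' `&` U); [exact: openI|exact: subIsetr|].
  have Vx : V (r x0).
    have : (r @` (W' `&` U)) (r y) by exists y.
    by rewrite eV yx => -[].
  have : \forall x \near x0, V (r x) by apply: cr; exact: open_nbhs_nbhs.
  apply: filterS => x Vrx.
  have : (r @` (W' `&` U)) (r x) by rewrite eV; split => //; rewrite -rr; exists x.
  move=> [z [W'z Uz] e]; have [Us es] := sP x (ex_intro2 _ _ z Uz e).
  have -> : s x = z by apply: Ui; rewrite ?inE// es.
  by split; [exact: W'W|].
exists s; split; first by move=> W /main; apply: filterS => x [].
by apply: filterS (main setT filterT) => x [_ ->].
Qed.

(** Local injectivity of r leaves at most one point of a fibre in a small neighbourhood; compactness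
    of M does the rest. *)
Lemma finite_fibre (M : set Q) u : compact M -> finite_set ([set y | r y = u] `&` M).
Proof.
move=> cM; rewrite -[X in finite_set X]image_id.
apply: compact_finite_image => // x Mx; have [_ _ lh] := lD.
have [U [oU Ux Ui _]] := lh x; exists U; first exact: open_nbhs_nbhs.
rewrite image_id; have [[y [ry Uy]]|n] := pselect (exists y, ([set y | r y = u] `&` U) y).
  apply: (sub_finite_set _ (finite_set1 y)) => z [rz Uz] /=; apply: Ui; rewrite ?inE//.
  by rewrite /= in ry rz; congruence.
by apply: (sub_finite_set _ (@finite_set0 Q)) => z h; apply: n; exists z.
Qed.

Lemma finite_fibre_supp f u : dom f -> finite_set ([set y | r y = u] `&` [set y | f y <> 0]).
Proof.
move=> [_ cf]; apply: sub_finite_set (finite_fibre u cf) => y [ry fy]; split => //.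
exact: supp_in.
Qed.

Lemma conv_seq f g x : dom f ->
  conv f g x = \sum_(y <- suppseq [set y | r y = r x] f) f y * g (y⁻ · x).
Proof.
move=> df; apply: fsum_suppseq; first exact: finite_fibre_supp.
by move=> y _ ->; rewrite mul0r.
Qed.

Lemma fibre_sections f x0 : dom f -> exists (n : nat) (s : 'I_n -> Q -> Q),
  [/\ forall i, s i @ x0 --> s i x0,
      \forall x \near x0, forall i, r (s i x) = r x,
      \forall x \near x0, forall i j, s i x = s j x -> i = j
    & \forall x \near x0, forall y, f y <> 0 -> r y = r x -> exists i, y = s i x].
Proof.
move=> [_ cf]; have [ys eys] := (finite_seqP _).1 (finite_fibre (r x0) cf).
pose zs := undup ys.
have zsP y : (y \in zs) <-> r y = r x0 /\ supp f y.
  rewrite mem_undup; split=> h.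
    have : [set` ys] y by []. by rewrite -eys.
  have : ([set y | r y = r x0] `&` supp f) y by []. by rewrite eys.
have /choice[s sP] : forall i : 'I_(size zs), exists s : Q -> Q,
    s @ x0 --> tnth (in_tuple zs) i /\ \forall x \near x0, r (s x) = r x.
  by move=> i; apply: local_section; have /zsP[] := mem_tnth i (in_tuple zs).
have s0 i : s i x0 = tnth (in_tuple zs) i.
  have [h _] := sP i; apply: hQ => U V nU nV.
  exists (s i x0); split; first exact: nbhs_singleton.
  exact: (nbhs_singleton (h _ nV)).
have sc i : s i @ x0 --> s i x0 by rewrite s0; have [] := sP i.
have sr : \forall x \near x0, forall i, r (s i x) = r x.
  by apply: filter_forall => i; have [] := sP i.
exists (size zs), s; split => //.
  apply: filter_forall => i; apply: filter_forall => j.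
  have [->|ij] := eqVneq i j; first exact: nearW.
  have ne : s i x0 <> s j x0.
    rewrite !s0 !(tnth_nth x0) /= => /eqP; rewrite nth_uniq ?undup_uniq ?ltn_ord// => e.
    by rewrite -val_eqE e in ij.
  have [U [V [nU nV UV]]] : exists U V, [/\ nbhs (s i x0) U, nbhs (s j x0) V & U `&` V = set0].
    apply: contrapT => n; apply: ne; apply: hQ => U V nU nV.
    by apply/set0P/eqP => e; apply: n; exists U, V.
  near=> x => e; exfalso; have : (U `&` V) (s i x).
    split; first by near: x; exact: sc.
    by rewrite e; near: x; exact: sc.
  by rewrite UV.
(* Compactness of the support: near a point over the unit of x0, local injectivity puts the fibre on
   a section; a point over another unit is separated from it, and its neighbours match no x near
   x0. *)
have : \forall x \near x0, supp f `<=` fun y => r y = r x -> exists i, y = s i x.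
  apply: ((compact_near_coveringP (supp f)).1 cf Q (nbhs x0) (fun x y => r y = r x -> exists i, y = s i x)) => y sy.
  have [e|ne] := pselect (r y = r x0).
    have /(nthP y)[i isz yi] : y \in zs by apply/zsP.
    have {}yi : s (Ordinal isz) x0 = y by rewrite s0 (tnth_nth y).
    have [_ _ lh] := lD; have [U [oU Uy Ui _]] := lh y.
    near=> y' x => /= rx; exists (Ordinal isz); apply: Ui; rewrite ?inE.
    - near: y'; exact: open_nbhs_nbhs.
    - near: x; apply: sc; rewrite yi; exact: open_nbhs_nbhs.
    - rewrite rx; symmetry; move: (Ordinal isz); near: x; exact: sr.
  have [U [V [nU nV UV]]] : exists U V, [/\ nbhs (r y) U, nbhs (r x0) V & U `&` V = set0].
    apply: contrapT => n; apply: ne; apply: hQ => U V nU nV.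
    by apply/set0P/eqP => e; apply: n; exists U, V.
  near=> y' x => /= rx; exfalso; have : (U `&` V) (r x).
    split; first by rewrite -rx; near: y'; exact: cr.
    by near: x; exact: cr.
  by rewrite UV.
apply: filterS => x h y fy; apply: h; exact: supp_in.
Unshelve. all: by end_near. Qed.

Lemma conv_continuous f g : dom f -> dom g -> continuous (conv f g).
Proof.
move=> df dg x0; have [n [s [sc sr sd sf]]] := fibre_sections x0 df.
pose F x := \sum_i f (s i x) * g ((s i x)⁻ · x).
have FE : \forall x \near x0, F x = conv f g x.
  near=> x; have h1 : forall i, r (s i x) = r x by near: x.
  have h2 : forall i j, s i x = s j x -> i = j by near: x.
  have h3 : forall y, f y <> 0 -> r y = r x -> exists i, y = s i x by near: x.
  symmetry; rewrite [LHS](@fsum_seq _ _ _ [seq s i x | i <- enum 'I_n]).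
  - by rewrite big_map big_enum.
  - rewrite map_inj_uniq ?enum_uniq// => i j; exact: h2.
  - by move=> y /mapP[i _ ->].
  - move=> y /= ry h; have [|//|i ->] := h3 y; last by apply: map_f; rewrite mem_enum.
    by move=> f0; apply: h; rewrite f0 mul0r.
have Fc : F @ x0 --> F x0.
  rewrite /F; apply: cvg_big => [|i _]; first exact: add_continuous.
  apply: cvgM.
    by apply: cvg_comp (sc i) _; have [cf _] := df; exact: cf.
  have r0 : r (s i x0) = r x0 by move: i; exact: (nbhs_singleton sr).
  apply: (@cvg_comp _ _ _ (fun x => (s i x)⁻ · x) g _ (nbhs ((s i x0)⁻ · x0))).
    apply: mul_cvg => //.
    - by apply: cvg_comp (sc i) _; exact: cinv.
    - exact: g_comp_fib.
    - near=> x; apply: (g_comp_fib gD); move: i {r0}; near: x; exact: sr.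
  by have [cg _] := dg; exact: cg.
rewrite /continuous_at -(nbhs_singleton FE).
apply: cvg_trans Fc; apply: near_eq_cvg; exact: FE.
Unshelve. all: by end_near. Qed.

Lemma closed_comp : closed [set p : Q * Q | g_comp D p.1 p.2].
Proof.
rewrite (_ : mkset _ = [set p : Q * Q | r p.2 = r (p.1⁻)]); last first.
  by apply/seteqP; split => p /=; rewrite g_compP.
move=> [x y] /= h; apply: hQ => U V nU nV.
have nn : nbhs (x, y) [set p : Q * Q | V (r (p.1⁻)) /\ U (r p.2)].
  exists ([set x | V (r (x⁻))], [set y | U (r y)]) => /=; last by [].
  by split; [exact: (@cinv x _ (@cr (x⁻) V nV))|exact: (@cr y U nU)].
have [[x' y'] [/= e [h1 h2]]] := h _ nn.
by exists (r y'); split => //; rewrite e.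
Qed.

(** Composable pairs form a closed set because Q is Hausdorff, so those with entries in the two
    supports form a compact set; M is its image under multiplication. *)
Lemma conv_compact f g : dom f -> dom g -> exists2 M : set Q, compact M &
  forall x y, f x <> 0 -> g y <> 0 -> g_comp D x y -> M (x · y).
Proof.
move=> [_ cf] [_ cg].
pose P := (supp f `*` supp g) `&` [set p : Q * Q | g_comp D p.1 p.2].
exists ((fun p : Q * Q => p.1 · p.2) @` P).
  apply: continuous_compact.
    by apply: continuous_subspaceW cmul; exact: subIsetr.
  apply: compact_closedI; last exact: closed_comp.
  exact: compact_setX.
move=> x y fx gy xy; exists (x, y) => //; split => //; split; exact: supp_in.
Qed.

Lemma Cc_dom0 : dom 0.
Proof.
split; first exact: cst_continuous.
by apply: (@supp_compact R Q hQ _ set0 (@compact0 Q)) => x /(_ erefl).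
Qed.

Lemma Cc_domP (k : K) f g : dom f -> dom g -> dom (k *: f + g).
Proof.
move=> [f1 f2] [g1 g2]; split.
  by move=> x; apply: cvgD; [apply: cvgZr; exact: f1|exact: g1].
have cU : compact (supp f `|` supp g).
  move=> F PF FU; have := compactU f2 g2; exact.
apply: (supp_compact hQ cU) => x h; apply: contrapT => /not_orP[/supp_out fx /supp_out gx].
apply: h; change (k * f x + g x = 0); by rewrite fx gx mulr0 addr0.
Qed.

Lemma Cc_domM f g : dom f -> dom g -> dom (conv f g).
Proof.
move=> df dg; split; first exact: conv_continuous.
have [M cM h] := conv_compact df dg.
apply: (supp_compact hQ cM) => x; apply: contra_notP => nM; apply: fsbig1 => y /= ry.
have [->|fy] := pselect (f y = 0); first by rewrite mul0r.
have [->|gy] := pselect (g (y⁻ · x) = 0); first by rewrite mulr0.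
exfalso; apply: nM; rewrite -(g_mulK_fib gD ry); apply: h => //.
exact: g_comp_mulV.
Qed.

Lemma Cc_domS f : dom f -> dom (sa_star (s := A) f).
Proof.
move=> [cf kf]; split.
  move=> x; apply/cvgrPdist_lt => e e0.
  have : \forall t \near x, `|f (x⁻) - f (t⁻)| < e.
    exact: (@cinv x _ ((@cvgrPdist_lt _ K _ _ _ _ _).1 (cf (x⁻)) e e0)).
  by apply: filterS => t; rewrite /= -rmorphB norm_conjC.
have cM : compact (g_inv D @` supp f).
  by apply: continuous_compact => //; apply: continuous_subspaceT.
apply: (supp_compact hQ cM) => x h; exists (x⁻); last exact: g_invK.
by apply: supp_in => f0; apply: h; rewrite /= f0 rmorph0.
Qed.

Lemma convDl (k : K) f g h : dom f -> dom g ->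
  conv (k *: f + g) h = k *: conv f h + conv g h.
Proof.
move=> df dg; apply/funext => x; change (conv (k *: f + g) h x = k * conv f h x + conv g h x).
set s := undup (suppseq [set y | r y = r x] f ++ suppseq [set y | r y = r x] g).
have sP y : (y \in s) <-> (r y = r x /\ f y <> 0) \/ (r y = r x /\ g y <> 0).
  rewrite mem_undup mem_cat; split=> [/orP[]|].
  - by move/mem_suppseq => /(_ (finite_fibre_supp _ df)); left.
  - by move/mem_suppseq => /(_ (finite_fibre_supp _ dg)); right.
  - move=> [] h1; apply/orP; [left|right]; apply/mem_suppseq => //; exact: finite_fibre_supp.
have E F : (forall y, f y = 0 -> g y = 0 -> F y = 0) ->
    conv F h x = \sum_(y <- s) F y * h (y⁻ · x).
  move=> F0; apply: fsum_seq; first exact: undup_uniq.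
    by move=> y /sP[][].
  move=> y ry; apply: contra_notP => /sP/not_orP[n1 n2].
  rewrite F0 ?mul0r//; apply: contrapT => h1; [apply: n1|apply: n2]; by split.
rewrite !E ?mulr_sumr -?big_split //=.
- apply: eq_bigr => y _; change ((k * f y + g y) * h (y⁻ · x) = k * (f y * h (y⁻ · x)) + g y * h (y⁻ · x)).
  by rewrite mulrDl mulrA.
- by move=> y fy gy; change (k * f y + g y = 0); rewrite fy gy mulr0 addr0.
Qed.

Lemma convDr (k : K) f g h : dom f -> conv f (k *: g + h) = k *: conv f g + conv f h.
Proof.
move=> df; apply/funext => x; change (conv f (k *: g + h) x = k * conv f g x + conv f h x).
rewrite !conv_seq// mulr_sumr -big_split /=; apply: eq_bigr => y _.
change (f y * (k * g (y⁻ · x) + h (y⁻ · x)) = k * (f y * g (y⁻ · x)) + f y * h (y⁻ · x)).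
by rewrite mulrDr mulrCA.
Qed.

(** The fibre of x meets the compact set M of [conv_compact] in a finite list, which carries f * g
    and, after left translation by each z, the sums for g * h. Both sides become finite double sums,
    and the order of summation can be exchanged. *)
Lemma conv_assoc f g h : dom f -> dom g -> conv f (conv g h) = conv (conv f g) h.
Proof.
move=> df dg; apply/funext => x.
have [M cM hM] := conv_compact df dg.
have [ys eys] := (finite_seqP _).1 (finite_fibre (r x) cM).
have uP y : (y \in undup ys) <-> r y = r x /\ M y.
  rewrite mem_undup; split=> h1.
    have : [set` ys] y by []. by rewrite -eys.
  have : ([set y | r y = r x] `&` M) y by []. by rewrite eys.
rewrite conv_seq//; set zs := suppseq _ _.
have zP z : z \in zs -> r z = r x /\ f z <> 0 by move/mem_suppseq; apply; exact: finite_fibre_supp.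
have -> : conv (conv f g) h x = \sum_(y <- undup ys) conv f g y * h (y⁻ · x).
  apply: fsum_seq; [exact: undup_uniq|by move=> y /uP[]|].
  move=> y ry; apply: contra_notP => /uP nM; have -> : conv f g y = 0; last by rewrite mul0r.
  apply: fsbig1 => z /= rz.
  have [->|fz] := pselect (f z = 0); first by rewrite mul0r.
  have [->|gz] := pselect (g (z⁻ · y) = 0); first by rewrite mulr0.
  exfalso; apply: nM; split => //; rewrite -(g_mulK_fib gD rz); apply: hM => //.
  exact: g_comp_mulV.
have E y : y \in undup ys -> conv f g y * h (y⁻ · x) = \sum_(z <- zs) f z * (g (z⁻ · y) * h (y⁻ · x)).
  move=> /uP[ry _]; rewrite conv_seq// mulr_suml; rewrite /zs ry; apply: eq_bigr => z _.
  by rewrite mulrA.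
rewrite [RHS](eq_big_seq _ E) exchange_big /=; apply: eq_big_seq => z /zP[rz fz].
rewrite -mulr_sumr; congr (_ * _).
have e1 : r (z⁻ · x) = r (z⁻) by exact: g_range_fib.
rewrite /Defs.conv e1.
have := left_translation_bij gD (z⁻); rewrite g_invK// rz => bij.
rewrite [LHS](@reindex_fsbig _ _ _ _ _ _ _ _ _ bij).
rewrite [LHS](_ : _ = \sum_(y \in [set y | r y = r x]) (g (z⁻ · y) * h (y⁻ · x))); last first.
  by apply: eq_fsbigr => y /set_mem/= ry; rewrite g_div_mul.
apply: fsum_seq; [exact: undup_uniq|by move=> y /uP[]|].
move=> y /= ry gh; apply/uP; split => //; rewrite -(g_mulK_fib gD (etrans rz (esym ry))).
apply: hM => //; last by apply: g_comp_mulV => //; congruence.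
by move=> g0; apply: gh; rewrite g0 mul0r.
Qed.

Lemma conv_starM f g : dom f ->
  sa_star (s := A) (conv f g) = conv (sa_star (s := A) g) (sa_star (s := A) f).
Proof.
move=> df; apply/funext => x; rewrite /= conv_seq// rmorph_sum /=.
rewrite [RHS](@reindex_fsbig _ _ _ _ _ _ _ _ _ (left_translation_bij gD x)).
symmetry; rewrite (fsum_suppseq (F := f)).
- rewrite big_seq [RHS]big_seq; apply: eq_bigr => y /mem_suppseq [|/= ry _].
    exact: finite_fibre_supp.
  have xy : g_comp D x y by apply/g_compP.
  rewrite rmorphM mulrC /=; congr (_^* * _^*); congr (_ _).
    rewrite (@g_invM _ _ gD ((x · y)⁻))// ?g_invK// ?g_mulVK//.
    by apply: g_comp_fib => //; exact: g_range_mul.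
  by rewrite g_invM.
- exact: finite_fibre_supp.
- move=> y /= ry fy.
  have xy : g_comp D x y by apply/g_compP.
  rewrite (@g_invM _ _ gD ((x · y)⁻))// ?g_invK// ?g_mulVK//.
    by rewrite fy rmorph0 mulr0.
  by apply: g_comp_fib => //; exact: g_range_mul.
Qed.

Lemma Cc_starK f : sa_star (s := A) (sa_star (s := A) f) = f.
Proof. by apply/funext => x; rewrite /= g_invK// conjCK. Qed.

End Conv.

(** Domain hypotheses are asymmetric: convolution sums over the support of the left factor, so right
    linearity and the rule for the star of a product ask nothing of the right factor. *)
Record star_axioms (R : realType) (S : starAlgebra R) : Prop := StarAxioms {
  sx_dom0 : sa_dom (0 : S);
  sx_domP : forall (k : Cplx R) (f g : S), sa_dom f -> sa_dom g -> sa_dom (k *: f + g);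
  sx_domM : forall f g : S, sa_dom f -> sa_dom g -> sa_dom (sa_mul f g);
  sx_domS : forall f : S, sa_dom f -> sa_dom (sa_star f);
  sx_mulDl : forall (k : Cplx R) (f g h : S), sa_dom f -> sa_dom g ->
    sa_mul (k *: f + g) h = k *: sa_mul f h + sa_mul g h;
  sx_mulDr : forall (k : Cplx R) (f g h : S), sa_dom f ->
    sa_mul f (k *: g + h) = k *: sa_mul f g + sa_mul f h;
  sx_mulA : forall f g h : S, sa_dom f -> sa_dom g ->
    sa_mul f (sa_mul g h) = sa_mul (sa_mul f g) h;
  sx_starM : forall f g : S, sa_dom f ->
    sa_star (sa_mul f g) = sa_mul (sa_star g) (sa_star f);
  sx_starK : forall f : S, sa_star (sa_star f) = f;
  sx_starD : forall (k : Cplx R) (f g : S),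
    sa_star (k *: f + g) = k^* *: sa_star f + sa_star g
}.

Lemma Cc_star_axioms (R : realType) (Q : topologicalType) (D : groupoidData Q) :
  is_topological_groupoid D -> local_homeo_onto (g_range D) (g_units D) ->
  hausdorff_space Q -> star_axioms (Cc R D).
Proof.
move=> tD lD hQ; split.
- exact: Cc_dom0.
- exact: Cc_domP.
- exact: Cc_domM.
- exact: Cc_domS.
- exact: convDl.
- exact: convDr.
- exact: conv_assoc.
- exact: conv_starM.
- exact: Cc_starK.
- move=> k f g; apply/funext => x; change ((k * f (g_inv D x) + g (g_inv D x))^* = k^* * (f (g_inv D x))^* + (g (g_inv D x))^*).
  by rewrite rmorphD rmorphM.
Qed.

(** * Topology of the skew-product groupoid *)

Section Skew.
Variables (Q : topologicalType) (D : groupoidData Q).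
Hypothesis tD : is_topological_groupoid D.
Hypothesis lD : local_homeo_onto (g_range D) (g_units D).
Hypothesis hQ : hausdorff_space Q.
Variables (G : groupType) (c : Q -> G).
Hypothesis c_hom : is_groupoid_hom D c.
Hypothesis c_cont : continuous (c : Q -> discrete_topology G).
Notation dG := (discrete_topology G).
Notation SD := (skew_product D c).
Notation r := (g_range D).

Let gD : is_groupoid D. Proof. by have [] := tD. Qed.

Lemma hom_locally_constant (x : Q) : \forall y \near x, c y = c x.
Proof. exact: (@c_cont x _ (@discrete_set1 dG (c x))). Qed.

Lemma nbhs_slice (x : Q) (t : dG) (W : set (Q * dG)) :
  nbhs (x, t) W <-> nbhs x [set y | W (y, t)].
Proof.
split=> [[[U V] [/= nU nV] UV]|nW].
  by apply: filterS nU => y Uy; apply: UV; split => //; exact: nbhs_singleton.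
exists ([set y | W (y, t)], [set t]) => /=; first by split => //; exact: discrete_set1.
by move=> [y s] [/= Wy ->].
Qed.

Lemma skew_hausdorff : hausdorff_space (Q * dG)%type.
Proof.
move=> [x s] [y t] h; have st : s = t.
  have [||[z w] [/= -> ->]//] := h [set p | p.2 = s] [set p | p.2 = t].
  - by apply/nbhs_slice; exact: nearW.
  - by apply/nbhs_slice; exact: nearW.
congr pair => //; apply: hQ => U V nU nV.
have [||[z w] [/= Uz Vz]] := h [set p | U p.1] [set p | V p.1].
- exact/nbhs_slice.
- exact/nbhs_slice.
by exists z.
Qed.

Lemma skew_rangeE (x : Q) (t : dG) : g_range SD (x, t) = (r x, (c x * (t : G))%g).
Proof. by []. Qed.

Lemma skew_groupoid : is_groupoid SD.
Proof.
split.
- by move=> [x t]; rewrite /= g_invK// (hom_inv gD c_hom) mulKg.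
- move=> [x t] [y s] [z u] /= [xy ->] [yz ->].
  have [h1 h2 h3] := g_mulA gD xy yz.
  by rewrite h3 c_hom// mulgA.
- move=> [x t] /=; rewrite (hom_inv gD c_hom) mulKg; split; split => //.
  + exact: g_compVl.
  + exact: g_compVr.
- by move=> [x t] [y s] /= [xy _]; rewrite g_mulVK.
- by move=> [x t] [y s] /= [xy ->]; rewrite g_mulKV.
Qed.

Lemma skew_topological : is_topological_groupoid SD.
Proof.
have [_ ci cm] := tD.
split; first exact: skew_groupoid.
- move=> [x t] W /= nW; apply/nbhs_slice.
  have /nbhs_slice nW' := nW.
  have := @ci x _ nW'; apply: filterS2 (hom_locally_constant x) => y /= -> ; exact.
- apply/subspace_continuousP => -[[x t] [y s]] /= [xy ts] W nW.
  have /nbhs_slice nW' := nW.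
  have /subspace_continuousP/(_ (x, y) xy) := cm => /(_ _ nW') [[U V] /= [nU nV] UV].
  exists ([set p | U p.1], [set p | V p.1 /\ p.2 = s]).
    split; apply/nbhs_slice => //=.
    by apply: filterS nV.
  move=> [[x' t'] [y' s']] /= [Ux' [Vy' ->]] [xy' _].
  exact: (UV (x', y')).
Qed.

Lemma skew_local_homeo : local_homeo_onto (g_range SD) (g_units SD).
Proof.
have [rr cr lh] := lD; split => //.
  move=> [x t] W nW; apply/nbhs_slice; rewrite skew_rangeE in nW.
  have /nbhs_slice nW' := nW.
  have := @cr x _ nW'; apply: filterS2 (hom_locally_constant x) => y e Wy.
  by change (W (r y, (c y * (t : G))%g)); rewrite e.
move=> [x t]; have [U [oU Ux Ui UW]] := lh x.
(* Here c and the second coordinate are constant, so the range map is that of Q with the constant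
   second coordinate c(x) t. *)
exists [set p | [/\ U p.1, c p.1 = c x & p.2 = t]]; split.
- rewrite openE => -[y s] [/= Uy cy ->]; apply/nbhs_slice => /=.
  have := hom_locally_constant y; rewrite cy.
  by apply: filterS2 (open_nbhs_nbhs (conj oU Uy)) => z Uz cz.
- by [].
- move=> [y s] [z u]; rewrite !inE => -[/= Uy _ ->] [/= Uz _ ->] [e _]; congr pair.
  by apply: Ui; rewrite ?inE.
move=> W oW WU; pose W' := [set y | W (y, t)].
have oW' : open W'.
  rewrite openE => y Wy; apply/(nbhs_slice y t W); exact: open_nbhs_nbhs.
have [|V oV eV] := UW W' oW'.
  by move=> y /WU[].
exists [set p | V p.1 /\ p.2 = (c x * (t : G))%g].
  rewrite openE => -[y s] [/= Vy ->]; apply/nbhs_slice => /=.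
  by apply: filterS (open_nbhs_nbhs (conj oV Vy)).
apply/seteqP; split.
- move=> p [[y s] Wy <-]; rewrite skew_rangeE.
  have [/= _ cy st] := WU _ Wy; rewrite st in Wy *.
  have : (r @` W') (r y) by exists y.
  rewrite eV => -[Vy _]; split; first by rewrite /= cy.
  by exists (y, t).
- move=> p [[Vp p2] [[y s] _ e]]; rewrite skew_rangeE in e.
  have : (V `&` g_units D) p.1 by split => //; exists y => //; rewrite -e.
  rewrite -eV => -[z Wz ez]; exists (z, t) => //; rewrite skew_rangeE.
  have [/= _ cz _] := WU _ Wz.
  by rewrite ez cz -p2; case: (p).
Qed.
End Skew.

(** * Skew products as matrices over a graded algebra *)

(* [S] is the algebra of finitely supported [G x G] matrices over the graded
   algebra [A] whose [(r, v)] entry has degree [r v^-1]; [comp s] is the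
   projection on degree [s], [e f v] puts [f] in column [v] and [sl F v] is
   column [v] of [F]. *)
Record graded_skew (R : realType) (G : groupType) (A S : starAlgebra R)
    (comp : G -> A -> A) (e : A -> G -> S) (sl : S -> G -> A) : Prop := GradedSkew {
  gr_A : star_axioms A;
  gr_S : star_axioms S;
  comp_dom : forall s f, sa_dom f -> sa_dom (comp s f);
  comp_lin : forall s, lin (comp s);
  comp_comp : forall s t f, comp s (comp t f) = if s == t then comp t f else 0;
  comp_fin : forall f, sa_dom f -> exists L : seq G,
    [/\ uniq L, f = \sum_(s <- L) comp s f & forall s, s \notin L -> comp s f = 0];
  comp_mul : forall s t f g, sa_dom f -> comp s f = f -> comp t g = g ->
    comp (s * t)%g (sa_mul f g) = sa_mul f g;
  comp_star : forall s f, comp s f = f -> comp s^-1%g (sa_star f) = sa_star f;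
  e_dom : forall f u, sa_dom f -> sa_dom (e f u);
  e_lin : forall u, lin (e^~ u);
  sl_dom : forall F u, sa_dom F -> sa_dom (sl F u);
  sl_lin : forall u, lin (sl^~ u);
  sl_e : forall f u v, sl (e f u) v = if u == v then f else 0;
  sl_fin : forall F, sa_dom F -> exists L : seq G,
    [/\ uniq L, F = \sum_(u <- L) e (sl F u) u & forall u, u \notin L -> sl F u = 0];
  e_mul : forall s f g u v, sa_dom f -> sa_dom g -> comp s g = g ->
    sa_mul (e f u) (e g v) = if u == (s * v)%g then e (sa_mul f g) v else 0;
  e_star : forall s f u, comp s f = f -> sa_star (e f u) = e (sa_star f) (s * u)%g
}.

Lemma compact_finite_values (T : topologicalType) (I : choiceType) (M : set T) (f : T -> I) :
  compact M -> (forall x, \forall y \near x, f y = f x) -> finite_set (f @` M).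
Proof.
move=> cM loc; rewrite -(setTI M); apply: compact_finite_image => // x _.
exists [set y | f y = f x]; first exact: loc.
by apply: (sub_finite_set _ (finite_set1 (f x))) => _ [y [_ /= e] <-].
Qed.

Lemma eq_near_continuous (T U : topologicalType) (f g : T -> U) x :
  (\forall y \near x, f y = g y) -> {for x, continuous f} -> {for x, continuous g}.
Proof.
move=> fg cf W nW; have e : f x = g x := nbhs_singleton fg.
by rewrite -e in nW; have := cf W nW; apply: filterS2 fg => y /= ->.
Qed.

Lemma sum_if_eq (V : nmodType) (I : eqType) (L : seq I) (i : I) (a : V) : uniq L ->
  \sum_(j <- L) (if i == j then a else 0) = if i \in L then a else 0.
Proof.
move=> uL; case: ifP => iL.
  by rewrite (bigD1_seq i)//= eqxx big1 ?addr0// => j; rewrite eq_sym => /negPf->.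
rewrite big1_seq// => j /= jL; case: eqP => // e; by rewrite e jL in iL.
Qed.

(** * The groupoid algebras as graded matrix algebras *)

Section Instance.
Variables (R : realType) (Q : topologicalType) (D : groupoidData Q).
Hypothesis tD : is_topological_groupoid D.
Hypothesis lD : local_homeo_onto (g_range D) (g_units D).
Hypothesis hQ : hausdorff_space Q.
Variables (G : groupType) (c : Q -> G).
Hypothesis c_hom : is_groupoid_hom D c.
Hypothesis c_cont : continuous (c : Q -> discrete_topology G).
Notation dG := (discrete_topology G).
Notation SD := (skew_product D c).
Notation K := (Cplx R).
Notation A := (Cc R D).
Notation S := (Cc R SD).
Notation domA := (@sa_dom R A).
Notation domS := (@sa_dom R S).
Notation r := (g_range D).
Implicit Types (f g : Q -> K) (x y : Q) (s t u v : G).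

Let gD : is_groupoid D. Proof. by have [] := tD. Qed.

Definition component s f : Q -> K := fun x => if c x == s then f x else 0.
Definition column f u : Q * dG -> K := fun p => if (p.2 : G) == u then f p.1 else 0.
Definition slice (F : Q * dG -> K) u : Q -> K := fun x => F (x, u).

Lemma componentP s f : component s f = f <-> forall x, f x <> 0 -> c x = s.
Proof.
split=> [e x|h].
  by rewrite -e /component; case: eqP.
by apply/funext => x; rewrite /component; case: eqP => // n; apply: contrapT => /nesym/h.
Qed.

Lemma component_dom s f : domA f -> domA (component s f).
Proof.
move=> [cf kf]; split.
  move=> x; apply: (@eq_near_continuous _ _ (fun y => if c x == s then f y else 0)).
    by apply: filterS (hom_locally_constant c_cont x) => y e; rewrite /component e.
  by case: (c x == s); [exact: cf|exact: cst_continuous].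
apply: (supp_compact hQ kf) => x h; apply: supp_in => fx; apply: h.
by rewrite /component fx if_same.
Qed.

Lemma column_dom f u : domA f -> domS (column f u).
Proof.
move=> [cf kf]; split.
  move=> [x t] W nW; apply/nbhs_slice.
  rewrite /column /= in nW; have [e|ne] := eqVneq (t : G) u.
    rewrite e eqxx in nW.
    apply: (@filterS _ (nbhs x) _ _ _ _ (@cf x W nW)) => y Wy. rewrite /column /= e eqxx. exact: Wy.
  rewrite (negPf ne) in nW; apply: nearW => y; rewrite /column /= (negPf ne).
  exact: (@nbhs_singleton K 0 W nW).
have cM : compact ((fun x => (x, u : dG)) @` supp f).
  apply: continuous_compact => //; apply: continuous_subspaceT => x W /nbhs_slice nW.
  exact: nW.
apply: (@supp_compact R _ (@skew_hausdorff Q hQ G) (column f u) _ cM) => -[x t]; rewrite /column /=.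
case: eqP => // -> fx; exists x => //; exact: supp_in.
Qed.

Lemma slice_dom F u : domS F -> domA (slice F u).
Proof.
move=> [cF kF]; split.
  move=> x W nW; have /nbhs_slice := @cF (x, u) W nW; exact.
have cM : compact (fst @` supp F).
  apply: continuous_compact => //; apply: continuous_subspaceT => -[x t] W nW.
  exact/nbhs_slice.
by apply: (supp_compact hQ cM) => x h; exists (x, u) => //; exact: supp_in.
Qed.

Lemma component_fin f : domA f -> exists L : seq G,
  [/\ uniq L, f = \sum_(s <- L) component s f & forall s, s \notin L -> component s f = 0].
Proof.
move=> [cf kf].
have [L eL] := (finite_seqP _).1 (compact_finite_values kf (hom_locally_constant c_cont)).
have LP x : f x <> 0 -> c x \in undup L.
  move=> fx; rewrite mem_undup; have : (c @` supp f) (c x) by exists x => //; exact: supp_in.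
  by rewrite eL.
exists (undup L); split; first exact: undup_uniq.
  apply/funext => x; rewrite fct_sumE /component sum_if_eq ?undup_uniq//.
  by case: ifPn => // n; apply: contrapT => /LP h; rewrite h in n.
move=> s n; apply/funext => x; rewrite /component; case: eqP => // e.
by apply: contrapT => /LP; rewrite e (negPf n).
Qed.

Lemma slice_fin F : domS F -> exists L : seq G,
  [/\ uniq L, F = \sum_(u <- L) column (slice F u) u & forall u, u \notin L -> slice F u = 0].
Proof.
move=> [cF kF].
have [|L eL] := (finite_seqP _).1 (@compact_finite_values _ G _ (fun p : (Q * dG)%type => p.2) kF _).
  by move=> [x t]; apply/nbhs_slice; exact: nearW.
have LP x t : F (x, t) <> 0 -> (t : G) \in undup L.
  move=> fx; rewrite mem_undup; have : ((fun p : (Q * dG)%type => p.2 : G) @` supp F) t by exists (x, t) => //; exact: supp_in.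
  by rewrite eL.
exists (undup L); split; first exact: undup_uniq.
  apply/funext => -[x t]; rewrite fct_sumE.
  rewrite (eq_bigr (fun u => if (t : G) == u then F (x, t) else 0)); last first.
    by move=> u _; rewrite /column /slice /=; case: eqP => // ->.
  rewrite sum_if_eq ?undup_uniq//.
  by case: ifPn => // n; apply: contrapT => /LP h; rewrite h in n.
move=> s n; apply/funext => x; apply: contrapT => /LP; by rewrite (negPf n).
Qed.

(** The range of (y, s) is (r(y), c(y) s), so a fibre of the skew product is a fibre of Q with s
    determined by c(y) s = c(x) t. *)
Lemma skew_fibre_bij x (t : dG) :
  set_bij [set y | r y = r x] [set p | g_range SD p = g_range SD (x, t)]
    (fun y => (y, ((c y)^-1 * (c x * (t : G)))%g : dG)).
Proof.
split.
- move=> y ry; change ((r y, (c y * ((c y)^-1 * (c x * (t : G))))%g) = (r x, (c x * (t : G))%g)).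
  by rewrite [r y]ry mulVKg.
- by move=> y z _ _ [].
- move=> [y s] h; have [ry cs] : (r y, (c y * (s : G))%g) = (r x, (c x * (t : G))%g) := h.
  exists y => //.
  by rewrite -cs mulKg.
Qed.

Lemma skew_convE (F H : Q * dG -> K) x (t : dG) : Defs.conv SD F H (x, t) =
  \sum_(y \in [set y | r y = r x])
     F (y, ((c y)^-1 * (c x * (t : G)))%g) * H (g_mul D (g_inv D y) x, t).
Proof. by rewrite /Defs.conv (@reindex_fsbig _ _ _ _ _ _ _ _ _ (skew_fibre_bij x t)). Qed.

(** In [skew_convE] the second factor forces t = v and c(y^-1 x) = s, hence the first one is
    evaluated in column s v. *)
Lemma column_mul s f g u v : component s g = g ->
  Defs.conv SD (column f u) (column g v) =
  if u == (s * v)%g then column (Defs.conv D f g) v else 0.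
Proof.
move=> /componentP hg; apply/funext => -[x t]; rewrite skew_convE.
have [e|ne] := eqVneq u (s * v)%g; last first.
  apply: fsbig1 => y /= ry; rewrite /column /=; case: eqP => [e1|]; last by rewrite mul0r.
  case: eqP => [e2|]; last by rewrite mulr0.
  have [->|gz] := pselect (g (g_mul D (g_inv D y) x) = 0); first by rewrite mulr0.
  exfalso; move: ne; rewrite -e1 -e2 -(hg _ gz) (hom_div gD c_hom ry) mulgA eqxx; by [].
rewrite /column /=; case: eqP => [e2|_]; last by apply: fsbig1 => y _; rewrite mulr0.
rewrite /Defs.conv; apply: eq_fsbigr => y /set_mem/= ry.
have [->|gz] := pselect (g (g_mul D (g_inv D y) x) = 0); first by rewrite !mulr0.
by rewrite mulgA -(hom_div gD c_hom ry) (hg _ gz) e e2 eqxx.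
Qed.

(** An element of degree s in column u sits in row s u, and the involution exchanges rows and
    columns. *)
Lemma column_star s f u : component s f = f ->
  sa_star (s := S) (column f u) = column (sa_star (s := A) f) (s * u)%g.
Proof.
move=> /componentP hf; apply/funext => -[x t]; rewrite /= /column /=.
have [f0|fx] := pselect (f (g_inv D x) = 0).
  by rewrite f0 rmorph0 !if_same rmorph0.
have := hf _ fx; rewrite (hom_inv gD c_hom) => <-.
have -> : ((t : G) == ((c x)^-1 * u)%g) = ((c x * (t : G))%g == u).
  by apply/eqP/eqP => [->|<-]; rewrite ?mulKg ?mulVKg.
by case: ifP => // _; rewrite rmorph0.
Qed.

Lemma skew_graded : @graded_skew R G A S component column slice.
Proof.
split.
- exact: Cc_star_axioms.
- apply: Cc_star_axioms; [exact: skew_topological|exact: skew_local_homeo|exact: skew_hausdorff].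
- exact: component_dom.
- move=> s k f g; apply/funext => x.
  change (component s (k *: f + g) x = k * component s f x + component s g x).
  by rewrite /component; case: ifP => // _; rewrite mulr0 addr0.
- move=> s t f; apply/funext => x; rewrite /component.
  have [->|st] := eqVneq s t; first by case: (c x == t).
  case: eqP => [e|_]; last by [].
  by rewrite e (negPf st).
- exact: component_fin.
- move=> s t f g df /componentP hf /componentP hg; apply/componentP => x h.
  have [y ry fg] : exists2 y, r y = r x & f y * g (g_mul D (g_inv D y) x) <> 0.
    apply: contrapT => n; apply: h; apply: fsbig1 => y /= ry; apply: contrapT => n'; apply: n.
    by exists y.
  have fy : f y <> 0 by move=> f0; apply: fg; rewrite f0 mul0r.
  have gy : g (g_mul D (g_inv D y) x) <> 0 by move=> f0; apply: fg; rewrite f0 mulr0.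
  by rewrite -(hf _ fy) -(hg _ gy) (hom_div gD c_hom ry) mulVKg.
- move=> s f /componentP hf; apply/componentP => x h.
  have fx : f (g_inv D x) <> 0 by move=> f0; apply: h; rewrite /= f0 rmorph0.
  by rewrite -(hf _ fx) (hom_inv gD c_hom) invgK.
- exact: column_dom.
- move=> u k f g; apply/funext => x.
  change (column (k *: f + g) u x = k * column f u x + column g u x).
  by rewrite /column; case: ifP => // _; rewrite mulr0 addr0.
- exact: slice_dom.
- by [].
- move=> f u v; apply/funext => x; rewrite /slice /column /= eq_sym; by case: ifP.
- exact: slice_fin.
- by move=> s f g u v _ _; exact: column_mul.
- exact: column_star.
Qed.
End Instance.

Section StarLinear.
Variables (R : realType) (S : starAlgebra R) (sx : star_axioms S).
Notation K := (Cplx R).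

Definition domlin (W : lmodType K) (phi : S -> W) :=
  forall (k : K) (a b : S), sa_dom a -> sa_dom b -> phi (k *: a + b) = k *: phi a + phi b.

Lemma dom_sum (I : eqType) (L : seq I) (F : I -> S) :
  (forall i, i \in L -> sa_dom (F i)) -> sa_dom (\sum_(i <- L) F i).
Proof.
elim: L => [|i L IH] h; first by rewrite big_nil; exact: sx_dom0.
rewrite big_cons -[F i]scale1r; apply: (sx_domP sx); first by apply: h; rewrite mem_head.
by apply: IH => j jL; apply: h; rewrite in_cons jL orbT.
Qed.

Lemma domlin0 (W : lmodType K) (phi : S -> W) : domlin phi -> phi 0 = 0.
Proof.
move=> h; have := h (-1) 0 0 (sx_dom0 sx) (sx_dom0 sx).
by rewrite scaler0 addr0 scaleN1r addNr.
Qed.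

Lemma domlin_sum (W : lmodType K) (phi : S -> W) (I : eqType) (L : seq I) (F : I -> S) :
  domlin phi -> (forall i, i \in L -> sa_dom (F i)) ->
  phi (\sum_(i <- L) F i) = \sum_(i <- L) phi (F i).
Proof.
move=> hp; elim: L => [|i L IH] h; first by rewrite !big_nil domlin0.
have hL j : j \in L -> sa_dom (F j) by move=> jL; apply: h; rewrite in_cons jL orbT.
rewrite !big_cons -{1}[F i]scale1r hp ?scale1r ?IH//; first by apply: h; rewrite mem_head.
exact: dom_sum.
Qed.

End StarLinear.

Section Graded.
Variables (R : realType) (G : groupType) (A S : starAlgebra R).
Variables (comp : G -> A -> A) (e : A -> G -> S) (sl : S -> G -> A).
Hypothesis gs : graded_skew comp e sl.
Notation K := (Cplx R).
Implicit Types (f g : A) (F H : S) (r s t u v w : G).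

Let sA : star_axioms A := gr_A gs.
Let sS : star_axioms S := gr_S gs.

Definition homog s f := sa_dom f /\ comp s f = f.

Lemma hom_comp s f : sa_dom f -> homog s (comp s f).
Proof. by move=> df; split; [exact: comp_dom gs _ _ df|rewrite (comp_comp gs) eqxx]. Qed.

Lemma hom_mul s t f g : homog s f -> homog t g -> homog (s * t)%g (sa_mul f g).
Proof.
move=> [df cf] [dg cg]; split; first exact: (sx_domM sA).
exact: comp_mul gs _ _ _ _ df cf cg.
Qed.

Lemma hom_star s f : homog s f -> homog s^-1%g (sa_star f).
Proof. by move=> [df cf]; split; [exact: (sx_domS sA)|exact: comp_star gs _ _ cf]. Qed.

Lemma comp_hom s t f : homog t f -> comp s f = if s == t then f else 0.
Proof. by move=> [_ <-]; rewrite (comp_comp gs). Qed.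

(** Reduces statements stable under linear combinations to homogeneous elements, for which the
    product of two columns is a column or zero. *)
Lemma graded_ind (P : A -> Prop) :
  (forall s f, homog s f -> P f) ->
  (forall (k : K) f g, sa_dom f -> sa_dom g -> P f -> P g -> P (k *: f + g)) ->
  forall f, sa_dom f -> P f.
Proof.
move=> Ph Pl f df; have [L [_ -> _]] := comp_fin gs df.
have P0 : P 0.
  by apply: (Ph 1%g); split; [exact: sx_dom0|exact: lin0 (comp_lin gs _)].
elim: L => [|s L IH]; first by rewrite big_nil.
rewrite big_cons -[comp s f]scale1r; apply: Pl => //.
- exact: comp_dom gs _ _ df.
- by apply: dom_sum => // t _; exact: comp_dom gs _ _ df.
- by apply: (Ph s); exact: hom_comp.
Qed.

Lemma skew_ind (P : S -> Prop) :
  (forall s f u, homog s f -> P (e f u)) ->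
  (forall (k : K) F H, sa_dom F -> sa_dom H -> P F -> P H -> P (k *: F + H)) ->
  forall F, sa_dom F -> P F.
Proof.
move=> Ph Pl F dF; have [L [_ -> _]] := sl_fin gs dF.
have Pe f u : sa_dom f -> P (e f u).
  move=> df; move: f df; apply: graded_ind => [s f hf|k f g df dg]; first exact: Ph hf.
  by rewrite (e_lin gs); apply: Pl; exact: e_dom gs _ _ _.
have P0 : P 0.
  have := Pe 0 1%g (sx_dom0 sA); by rewrite (lin0 (e_lin gs _)).
elim: L => [|s L IH]; first by rewrite big_nil.
have ds u : sa_dom (sl F u) by exact: sl_dom gs _ _ dF.
rewrite big_cons -[e _ s]scale1r; apply: Pl => //.
- exact: e_dom gs _ _ (ds _).
- by apply: dom_sum => // t _; exact: e_dom gs _ _ (ds _).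
- exact: Pe.
Qed.

(** Coefficient, degree and column. The degree is recorded because 0 is homogeneous of every degree;
    with it the row [grow] is well defined. *)
Definition hgen := {p : A * G * G | homog p.1.2 p.1.1}.
Definition Hgen s f u (h : homog s f) : hgen := exist _ (f, s, u) h.
Definition gcoef (x : hgen) := (sval x).1.1.
Definition gdeg (x : hgen) := (sval x).1.2.
Definition gcol (x : hgen) := (sval x).2.
Definition grow (x : hgen) := (gdeg x * gcol x)%g.
Lemma gcoef_hom x : homog (gdeg x) (gcoef x). Proof. exact: (svalP x). Qed.
Lemma gcoef_dom x : sa_dom (gcoef x). Proof. by have [] := gcoef_hom x. Qed.

(** The new list does not depend on phi, so an inequality between two evaluations of s can be
    checked on homogeneous generators. *)
Lemma homogenize (T : Type) (s : seq (K * ({f : A | sa_dom f} * G * T))) :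
  exists s' : seq (K * (hgen * T)), forall (W : lmodType K) (phi : A -> G -> T -> W),
    (forall u h, domlin (fun f => phi f u h)) ->
    lc (fun x : {f : A | sa_dom f} * G * T => phi (sval x.1.1) x.1.2 x.2) s =
    lc (fun x : hgen * T => phi (gcoef x.1) (gcol x.1) x.2) s'.
Proof.
elim: s => [|[k [[[f df] u] h]] s [s' IH]]; first by exists [::] => W phi _; rewrite !lc_nil.
have [L [_ eL _]] := comp_fin gs df.
exists ([seq (k, (Hgen u (hom_comp t df), h)) | t <- L] ++ s') => W phi hp.
rewrite lc_cat -IH// /lc big_cons; congr (_ + _); rewrite big_map /=.
rewrite [in LHS]eL (domlin_sum sA (phi := fun f => phi f u h)) ?scaler_sumr//.
by move=> t _; exact: comp_dom gs _ _ df.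
Qed.

Section Env.
Variables (CQ : enveloping A) (CQG : enveloping S).
Notation "x ** y" := (cs_mul x y) (at level 40, left associativity).

Definition ecol f u : CQG := env_map CQG (e f u).

Lemma ecol_lin u : domlin (fun f => ecol f u).
Proof. by move=> k f g df dg; rewrite /ecol (e_lin gs) env_lin//; exact: e_dom gs _ _ _. Qed.

Lemma ecol0 u : ecol 0 u = 0.
Proof. exact: (domlin0 sA (ecol_lin u)). Qed.

Lemma ecol_mul s f g u v : sa_dom f -> homog s g ->
  ecol f u ** ecol g v = if u == (s * v)%g then ecol (sa_mul f g) v else 0.
Proof.
move=> df [dg hg]; rewrite /ecol -env_mul; [|exact: e_dom gs _ _ _..].
rewrite (e_mul gs _ _ df dg hg); case: ifP => // _.
exact: env0 (sx_dom0 sS).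
Qed.

Lemma ecol_star s f u : homog s f -> cs_star (ecol f u) = ecol (sa_star f) (s * u)%g.
Proof.
move=> [df hf]; rewrite /ecol -env_star ?(e_star gs _ hf)//; exact: e_dom gs _ _ df.
Qed.

(** For degrees s and t the product survives only if the rows s u and t v agree, that is s^-1 t = u
    v^-1. Projecting on that degree expresses the condition without homogeneity. *)
Lemma ecol_adj f g u v : sa_dom f -> sa_dom g ->
  cs_star (ecol f u) ** ecol g v = ecol (comp (u * v^-1)%g (sa_mul (sa_star f) g)) v.
Proof.
move=> df dg; move: f df; apply: graded_ind => [s f hf|k f f' df df' IH IH']; last first.
  have ds (h : A) : sa_dom h -> sa_dom (sa_star h) by exact: (sx_domS sA).
  have dc t (h h' : A) : sa_dom h -> sa_dom h' -> sa_dom (comp t (sa_mul h h')).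
    by move=> dh dh'; apply: (comp_dom gs); exact: (sx_domM sA).
  rewrite (ecol_lin _ _ df df') cs_starD cs_starZ cs_mulDl cs_mulZl IH IH'.
  rewrite (sx_starD sA) (sx_mulDl sA) ?(comp_lin gs) ?(ecol_lin _ _ _ _)//; by auto.
move: g dg; apply: graded_ind => [t g hg|k g g' dg dg' IH IH']; last first.
  have [df _] := hf; have ds := sx_domS sA df.
  rewrite (ecol_lin _ _ dg dg') cs_mulDr cs_mulZr IH IH' (sx_mulDr sA)// (comp_lin gs) ecol_lin//.
  - by apply: (comp_dom gs); apply: (sx_domM sA).
  - by apply: (comp_dom gs); apply: (sx_domM sA).
have [dg _] := hg; have [ds _] := hom_star hf.
rewrite (ecol_star _ hf) (ecol_mul _ _ ds hg) (comp_hom _ (hom_mul (hom_star hf) hg)).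
have -> : (s * u == t * v)%g = (u * v^-1 == s^-1 * t)%g.
  apply/eqP/eqP => h.
    by rewrite -(mulgK v t) -h !mulgA mulVg mul1g.
  have -> : u = (s^-1 * t * v)%g by rewrite -h mulgVK.
  by rewrite -mulgA mulVKg.
by case: ifP => // _; rewrite ecol0.
Qed.

Lemma ecol_densefam : densefam (fun x : {f : A | sa_dom f} * G => ecol (sval x.1) x.2).
Proof.
move=> v eps e0; have [F dF hF] := env_approx v e0.
suff [s hs] : exists s : seq (K * ({f : A | sa_dom f} * G)),
    env_map CQG F = lc (fun x => ecol (sval x.1) x.2) s by exists s; rewrite -hs.
move: F dF {hF}; apply: skew_ind => [s f u [df _]|k F H dF dH [s hs] [s' hs']].
  by exists [:: (1, (exist _ f df, u))]; rewrite lc1.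
by exists (lcscale k s ++ s'); rewrite env_lin// hs hs' lc_cat lc_scale.
Qed.

Lemma hcol_densefam : densefam (fun x : hgen => ecol (gcoef x) (gcol x)).
Proof.
move=> v eps e0; have [s hs] := ecol_densefam v e0.
have [s' h'] := homogenize [seq (p.1, (p.2, tt)) | p <- s].
have := h' CQG (fun f u _ => ecol f u) (fun u _ => @ecol_lin u).
rewrite [X in X = _ -> _](_ : _ = lc (fun x => ecol (sval x.1) x.2) s); last by rewrite /lc big_map.
move=> e1; exists [seq (p.1, p.2.1) | p <- s'].
by rewrite [X in _ - X](_ : _ = lc (fun x => ecol (sval x.1) x.2) s)// e1 /lc big_map.
Qed.

Lemma hcol_adj (x y : hgen) : grow x <> grow y ->
  cs_star (ecol (gcoef x) (gcol x)) ** ecol (gcoef y) (gcol y) = 0.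
Proof.
move=> /eqP xy; have [dy _] := gcoef_hom y; have [dx _] := hom_star (gcoef_hom x).
by rewrite (ecol_star _ (gcoef_hom x)) (ecol_mul _ _ dx (gcoef_hom y)) -/(grow x) -/(grow y) (negPf xy).
Qed.
End Env.
End Graded.

(** * Matrices of operators from representations of the coefficients *)

Section Regular.
Variables (R : realType) (G : groupType) (A S : starAlgebra R).
Variables (comp : G -> A -> A) (e : A -> G -> S) (sl : S -> G -> A).
Hypothesis gs : graded_skew comp e sl.
Notation K := (Cplx R).
Notation homog := (homog comp).
Variable CQ : enveloping A.
Implicit Types (f g : A) (F : S) (r s t u v w : G).

Let sA : star_axioms A := gr_A gs.
Let sS : star_axioms S := gr_S gs.

Lemma rep_fun_lin (H : hilbert R) (rho : A -> H -> H) : is_rep rho ->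
  forall f, sa_dom f -> lin (rho f).
Proof. by move=> [h _ _ _] f df k x y; have [l _] := h f df; rewrite l. Qed.

(* The representation of [S] on [(+)_G H] whose matrix entries are [rho] of the
   matrix entries. *)
Theorem skew_regular_rep (H : hilbert R) (rho : A -> H -> H) : is_rep rho ->
  exists (L : hilbert R) (E : G -> H -> L) (la : S -> L -> L),
  [/\ is_rep la, forall u x y, ip (E u x) (E u y) = ip x y
    & forall s f u x, homog s f -> la (e f u) (E u x) = E (s * u)%g (rho f x)].
Proof.
move=> rhoP; have [_ rl rm rs] := rhoP; have rlin := rep_fun_lin rhoP.
have r0 x : rho 0 x = 0.
  by apply: (domlin0 sA (phi := fun f => rho f x)) => k f g df dg; exact: rl.
have [L [E [El Ei Eo dE]]] := hilbert_sum (fun _ : G => H).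
have ipE u v x y : ip (E u x) (E v y) = if u == v then ip x y else 0.
  by case: eqP => [->|uv]; rewrite ?Ei// Eo.
pose EE (p : {i : G & H}) := E (projT1 p) (projT2 p).
(* A vector at index u meets column u of F, and the part of degree s of that column sends it to
   index s u. *)
pose t F (p : {i : G & H}) :=
  \sum_(s \in [set: G]) E (s * projT1 p)%g (rho (comp s (sl F (projT1 p))) (projT2 p)).
have ipt F p w y : sa_dom F -> ip (t F p) (E w y) =
    ip (rho (comp (w * (projT1 p)^-1)%g (sl F (projT1 p))) (projT2 p)) y.
  move=> dF; have [M [uM _ M0]] := comp_fin gs (sl_dom gs (projT1 p) dF).
  rewrite /t (@fsum_seq _ _ _ M)//; last first.
    move=> s _; apply: contra_notT => /M0 ->; rewrite r0; exact: lin0 (El _).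
  rewrite ip_suml (eq_bigr (fun s => if (w * (projT1 p)^-1)%g == s then
     ip (rho (comp (w * (projT1 p)^-1)%g (sl F (projT1 p))) (projT2 p)) y else 0)); last first.
    move=> s _; rewrite ipE.
    have -> : (s * projT1 p == w)%g = (w * (projT1 p)^-1 == s)%g.
      by apply/eqP/eqP => [<-|<-]; rewrite ?mulgK ?mulgVK.
    by case: eqP => // ->.
  rewrite sum_if_eq//; case: ifPn => // /M0 ->.
  by rewrite r0 ip0l.
have tl (k : K) F F' p : sa_dom F -> sa_dom F' -> t (k *: F + F') p = k *: t F p + t F' p.
  move=> dF dF'; apply: (hilb_dense_ext dE) => q; have dFF := sx_domP sS k dF dF'.
  rewrite ip_linear !ipt// (sl_lin gs) (comp_lin gs) rl ?ip_linear//;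
  by apply: (comp_dom gs); apply: (sl_dom gs).
have te s f u p : homog s f ->
    t (e f u) p = if projT1 p == u then E (s * u)%g (rho f (projT2 p)) else 0.
  move=> hf; have [df _] := hf; apply: (hilb_dense_ext dE) => q.
  rewrite ipt; last exact: e_dom gs _ _ df.
  rewrite (sl_e gs) eq_sym; case: eqP => [->|_]; last by rewrite (lin0 (comp_lin gs _)) r0 !ip0l.
  rewrite (comp_hom gs _ hf) ipE.
  have -> : (projT1 q * u^-1 == s)%g = (s * u == projT1 q)%g.
    by apply/eqP/eqP => [<-|<-]; rewrite ?mulgK ?mulgVK.
  by case: ifP => // _; rewrite r0 ip0l.
have dst F : sa_dom F -> sa_dom (sa_star F) by exact: sx_domS.
have [||||la [laP lae]] := @rep_of_family R S L _ EE dE (@sx_domP _ _ sS) (@sx_domM _ _ sS) (@sx_domS _ _ sS) t.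
- apply: (skew_ind gs) => [s f u hf|k F F' dF dF' [C hC] [C' hC']]; last first.
    exists (nm k * C + C') => z.
    have -> : lc (t (k *: F + F')) z = k *: lc (t F) z + lc (t F') z.
      rewrite /lc scaler_sumr -big_split; apply: eq_bigr => p _ /=.
      by rewrite tl// scalerDr !scalerA mulrC.
    by rewrite (le_trans (nmD _ _))// nmZ mulrDl lerD// -mulrA ler_wpM2l ?nm_ge0.
  have [df _] := hf; pose C := nm (env_map CQ f); have C0 : 0 <= C by exact: nm_ge0.
  have hC : bnd (rho f) C by move=> x; rewrite -rc_le rcM -!nmE env_ub.
  exists C => z; pose xi := lc (fun p : {i : G & H} => if projT1 p == u then projT2 p else 0) z.
  have -> : lc (t (e f u)) z = E (s * u)%g (rho f xi).
    rewrite /xi (lin_lc (rlin _ df)) (lin_lc (El _)); apply: eq_bigr => p _ /=.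
    rewrite (te s)//; case: eqP => // _.
    by rewrite (lin0 (rlin _ df)) (lin0 (El _)).
  have nE v x : nm (E v x) = nm x.
    by have := @nm_lc_ip R H L H (E v) id [:: (1, x)]; rewrite !lc1; apply.
  rewrite nE (le_trans (hC _))// ler_wpM2l//.
  have [->|xi0] := eqVneq xi 0; first by rewrite nm0 nm_ge0.
  have xp : 0 < nm xi.
    by rewrite lt_neqAle nm_ge0 andbT eq_sym; apply: contra_neq xi0 => /nm_eq0.
  rewrite -(ler_pM2r xp) -{3}(nE u xi) -expr2.
  apply: le_trans (ip_CS _ _).
  (* xi is the component of the vector at index u; Cauchy-Schwarz then gives |xi| <= |lc EE z|. *)
  have -> : ip (lc EE z) (E u xi) = ip xi xi.
    rewrite {2}/xi /lc !ip_suml; apply: eq_bigr => p _; rewrite !ipZl ipE.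
    by case: ifP => // _; rewrite ip0l.
  by rewrite ip_nm nm_rc ?sqr_ge0.
- exact: tl.
- move=> F p q dF; move: F dF; apply: (skew_ind gs) => [s f u hf|k F F' dF dF' IH IH']; last first.
    by rewrite (sx_starD sS) !tl ?ip_linear ?ipDr ?ipZr ?conjCK ?IH ?IH'//; auto.
  have [df _] := hf.
  rewrite (e_star gs _ (proj2 hf)) (te _ _ _ _ hf) (te _ _ _ _ (hom_star gs hf)) mulKg /EE.
  case: (projT1 p =P u) => pu; case: (projT1 q =P (s * u)%g) => qu; rewrite ?ip0l ?ip0r//.
  - by rewrite pu qu !Ei rs.
  - by rewrite ipE; case: eqP => // e1; case: qu.
  - by rewrite ipE; case: eqP.
- move=> F F' p q dF dF'; move: F dF; apply: (skew_ind gs) => [s f u hf|k F F1 dF dF1 IH IH']; last first.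
    rewrite (sx_mulDl sS)// (sx_starD sS) !tl ?ip_linear ?ipDr ?ipZr ?conjCK ?IH ?IH'//; auto.
    - exact: (sx_domM sS).
    - exact: (sx_domM sS).
  have [df _] := hf; have dfe := e_dom gs u df.
  move: F' dF'; apply: (skew_ind gs) => [s' f' u' hf'|k F F1 dF dF1 IH IH']; last first.
    rewrite (sx_mulDr sS)// !tl ?ip_linear ?IH ?IH'//.
    - exact: (sx_domM sS).
    - exact: (sx_domM sS).
  have [df' cf'] := hf'.
  rewrite (e_mul gs _ _ df df' cf') (te _ _ _ _ hf') (e_star gs _ (proj2 hf)) (te _ _ _ _ (hom_star gs hf)) mulKg.
  have [uu'|uu'] := eqVneq u (s' * u')%g.
    rewrite (te _ _ _ _ (hom_mul gs hf hf')).
    case: (projT1 p =P u') => pu; case: (projT1 q =P (s * u)%g) => qu; rewrite ?ip0l ?ip0r//.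
    - by rewrite /EE qu -mulgA -uu' !Ei rm// rs.
    - by rewrite /EE ipE -mulgA -uu'; case: eqP => // e1; case: qu.
  rewrite (domlin0 sS (phi := fun F => t F p)) ?ip0l; last by move=> k F F1 dF dF1; exact: tl.
  case: eqP => _; rewrite ?ip0l//; case: eqP => _; rewrite ?ip0r//.
  by rewrite ipE eq_sym (negPf uu').
exists L, E, la; split => // s f u x hf; have [df _] := hf.
have := lae (e f u) (existT _ u x) (e_dom gs u df).
by rewrite (te _ _ _ _ hf) /= eqxx.
Qed.

(** Any representation of A occurs in an entry: in [skew_regular_rep], [e f u] sends the copy of h
    at index u to the copy of rho(f) h at index s u. *)
Lemma ecol_ge (CQG : enveloping S) s f u : homog s f ->
  nm (env_map CQ f) <= nm (ecol e CQG f u).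
Proof.
move=> hf; have [df _] := hf; apply: env_le; [exact: df|exact: nm_ge0|].
move=> H rho rhoP h.
have [L [E [la [laP Ei lae]]]] := skew_regular_rep rhoP.
have nE v x : nm (E v x) = nm x.
  by have := @nm_lc_ip R H L H (E v) id [:: (1, x)]; rewrite !lc1; apply.
rewrite -(nE (s * u)%g) -lae// -(nE u h) -rc_le rcM -!nmE.
by apply: env_ub => //; exact: e_dom gs _ _ df.
Qed.
End Regular.

(** * The covariant pair on the skew-product algebra *)

Section ModuleAction.
Variables (R : realType) (G : groupType) (A S : starAlgebra R).
Variables (comp : G -> A -> A) (e : A -> G -> S) (sl : S -> G -> A).
Hypothesis gs : graded_skew comp e sl.
Notation K := (Cplx R).
Notation homog := (homog comp).
Implicit Types (f g : A) (F : S) (r s t u v w : G).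
Variables (CQ : enveloping A) (CQG : enveloping S).
Notation ecol := (ecol e CQG).
(** Will follow from the action beta, which translates columns. It makes the norm of f acting on a
    row independent of the row. *)
Hypothesis ecol_shift : forall f u v, sa_dom f -> nm (ecol f u) = nm (ecol f v).
Notation "x ** y" := (cs_mul x y) (at level 40, left associativity).

Let sA : star_axioms A := gr_A gs.
Let sS : star_axioms S := gr_S gs.
Notation Y := ({f : A | sa_dom f} * G)%type.

Definition col_of (y : Y) : CQG := ecol (sval y.1) y.2.

Definition act_dom f g (df : sa_dom f) (dg : sa_dom g) : {f : A | sa_dom f} :=
  exist _ (sa_mul f g) (sx_domM sA df dg).

(** Left convolutions by f and by its star are adjoint for the form y^* x of C*(Q x_c G). *)
Lemma ecol_mul_adj f g g' u u' : sa_dom f -> sa_dom g -> sa_dom g' ->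
  cs_star (ecol (sa_mul f g) u) ** ecol g' u' =
  cs_star (ecol g u) ** ecol (sa_mul (sa_star f) g') u'.
Proof.
move=> df dg dg'; have := sx_domS sA df; have := sx_domS sA dg => dg1 df1.
rewrite !(ecol_adj gs)//; [|exact: (sx_domM sA)..].
by rewrite (sx_starM sA)// (sx_mulA sA).
Qed.

Section Rep.
Variables (H : hilbert R) (rho : CQG -> H -> H).
Hypothesis rhoP : @is_rep R CQG H rho.

Let rlin x : lin (fun a => rho a x).
Proof. by move=> k a b; have [_ h _ _] := rhoP; exact: h. Qed.

Lemma rep_ecol_ip (a b : CQG) x y : ip (rho a x) (rho b y) = ip (rho (cs_star b ** a) x) y.
Proof.
have [_ _ rm rs] := rhoP; rewrite ip_conj (rs b)// -ip_conj.
by rewrite rm.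
Qed.

(* [f] acts between the orthogonal row spaces, and on row [i] as [ecol f i]. *)
Lemma action_bounded f : sa_dom f -> exists C, forall s : seq (K * (Y * H)),
  nm (lc (fun x : Y * H => rho (ecol (sa_mul f (sval x.1.1)) x.1.2) x.2) s) <=
  C * nm (lc (fun x : Y * H => rho (col_of x.1) x.2) s).
Proof.
move: f; apply: (graded_ind gs) => [p f hf|k f f' df df' [C hC] [C' hC']]; last first.
  exists (nm k * C + C') => s.
  have -> : lc (fun x : Y * H => rho (ecol (sa_mul (k *: f + f') (sval x.1.1)) x.1.2) x.2) s =
      k *: lc (fun x : Y * H => rho (ecol (sa_mul f (sval x.1.1)) x.1.2) x.2) s +
      lc (fun x : Y * H => rho (ecol (sa_mul f' (sval x.1.1)) x.1.2) x.2) s.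
    rewrite /lc scaler_sumr -big_split; apply: eq_bigr => -[c [[[g dg] u] h]] _ /=.
    rewrite (sx_mulDl sA)// (ecol_lin gs); [|exact: (sx_domM sA)..].
    by rewrite rlin scalerDr !scalerA mulrC.
  by rewrite (le_trans (nmD _ _))// nmZ mulrDl lerD// -mulrA ler_wpM2l ?nm_ge0.
have [df _] := hf; exists (nm (ecol f 1%g)) => s.
have [s' hs'] := homogenize gs s.
have l1 u h : domlin (fun g => rho (ecol (sa_mul f g) u) h).
  move=> k g g' dg dg'; rewrite (sx_mulDr sA)// (ecol_lin gs) ?rlin//; exact: (sx_domM sA).
have l2 u h : domlin (fun g => rho (ecol g u) h).
  by move=> k g g' dg dg'; rewrite (ecol_lin gs) ?rlin.
rewrite (hs' H (fun g u h => rho (ecol (sa_mul f g) u) h) l1).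
rewrite (hs' H (fun g u h => rho (ecol g u) h) l2).
have mulg (x : hgen comp) : ecol f (grow x) ** ecol (gcoef x) (gcol x) = ecol (sa_mul f (gcoef x)) (gcol x).
  by rewrite (ecol_mul gs CQG _ _ df (gcoef_hom x)) eqxx.
have ortho (x y : hgen comp) (h h' : H) : grow x <> grow y ->
    ip (rho (ecol (gcoef x) (gcol x)) h) (rho (ecol (gcoef y) (gcol y)) h') = 0.
  move=> xy; rewrite rep_ecol_ip (hcol_adj gs) ?(lin0 (rlin _)) ?ip0l//; exact: nesym.
apply: (@orthogonal_le R H H _ G _ _ (fun x : hgen comp * H => grow x.1)).
- exact: nm_ge0.
- by move=> x y; exact: ortho.
- move=> [x h] [y h'] /= xy.
  (* Left multiplication by degree p moves row i to row p i, so distinct rows remain distinct, hence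
     orthogonal. *)
  have hx : homog (p * gdeg x)%g (sa_mul f (gcoef x)) by exact: hom_mul gs _ _ _ _ hf (gcoef_hom x).
  have hy : homog (p * gdeg y)%g (sa_mul f (gcoef y)) by exact: hom_mul gs _ _ _ _ hf (gcoef_hom y).
  apply: (ortho (Hgen (gcol x) hx) (Hgen (gcol y) hy)); rewrite /grow /= /gdeg /gcol /= -!mulgA => /mulgI.
  exact: xy.
- move=> i z hz; rewrite (ecol_shift _ i df).
  have -> : lc (fun x : hgen comp * H => rho (ecol (sa_mul f (gcoef x.1)) (gcol x.1)) x.2) z =
      rho (ecol f i) (lc (fun x : hgen comp * H => rho (ecol (gcoef x.1) (gcol x.1)) x.2) z).
    have rm a b x : rho (a ** b) x = rho a (rho b x) by have [_ _ h _] := rhoP; exact: h.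
    elim: z hz => [|q z IH] /=; first by rewrite !lc_nil (lin0 (rep_lin _ rhoP)).
    move=> /andP[/asboolP qi hz]; have lcC (phi : hgen comp * H -> H) : lc phi (q :: z) = q.1 *: phi q.2 + lc phi z by rewrite /lc big_cons.
    rewrite !lcC IH// (linD (rep_lin _ rhoP)) (linZ (rep_lin _ rhoP)); congr (_ *: _ + _).
    by rewrite /= in qi; rewrite -qi -rm mulg.
  exact: rep_le.
Qed.

(** The bound of [action_bounded] depends on f in an uncontrolled way, but it suffices for
    [rep_of_family] to make the action a representation of A on the completed span of the vectors
    rho(col) h. Representations are bounded by the norm of C*(Q). *)
Lemma action_rep_le f (s : seq (K * (Y * H))) : sa_dom f ->
  nm (lc (fun x : Y * H => rho (ecol (sa_mul f (sval x.1.1)) x.1.2) x.2) s) <=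
  nm (env_map CQ f) * nm (lc (fun x : Y * H => rho (col_of x.1) x.2) s).
Proof.
move=> df.
pose g (x : Y * H) := rho (col_of x.1) x.2.
have [||He [j [jk dj]]] := @kernel_hilbert R (Y * H)%type (fun x y => ip (g x) (g y)).
- by move=> x y; rewrite -ip_conj.
- by move=> w; rewrite /kform -ip_lc ip_nm -(rc0 R) rc_le sqr_ge0.
pose mulY (a : A) (x : Y * H) : Y * H :=
  match pselect (sa_dom a) with
  | left da => ((act_dom da (svalP x.1.1), x.1.2), x.2)
  | right _ => x
  end.
have gmul a x : sa_dom a -> g (mulY a x) = rho (ecol (sa_mul a (sval x.1.1)) x.1.2) x.2.
  by move=> da; rewrite /mulY; case: pselect.
have lcg a (z : seq (K * (Y * H))) : sa_dom a ->
    nm (lc (fun x => j (mulY a x)) z) = nm (lc (fun x : Y * H => rho (ecol (sa_mul a (sval x.1.1)) x.1.2) x.2) z).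
  move=> da; apply: nm_lc_ip => x y; by rewrite jk !gmul.
have adj a x y : sa_dom a -> ip (g (mulY a x)) (g y) = ip (g x) (g (mulY (sa_star a) y)).
  move=> da; have ds := sx_domS sA da; rewrite !gmul// /g /col_of.
  case: x y => [[[f1 df1] u1] h1] [[[f2 df2] u2] h2] /=.
  rewrite !rep_ecol_ip -[cs_star _ ** _]cs_starK cs_starM cs_starK ecol_mul_adj//.
  by rewrite cs_starM cs_starK.
have [||||pi [piP pij]] := @rep_of_family R A He _ j dj (@sx_domP _ _ sA) (@sx_domM _ _ sA) (@sx_domS _ _ sA) (fun a x => j (mulY a x)).
- move=> a da; have [C hC] := action_bounded da; exists C => w.
  by rewrite lcg// (@nm_lc_ip _ _ _ _ j g).
- move=> k a b x da db; apply: (hilb_dense_ext dj) => z; rewrite ip_linear !jk !gmul//; last exact: (sx_domP sA).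
  rewrite (sx_mulDl sA)// (ecol_lin gs) ?rlin ?ip_linear//; apply: (sx_domM sA) => //; exact: svalP.
- by move=> a x y da; rewrite !jk adj.
- move=> a b x y da db; rewrite !jk -adj//; congr ip.
  rewrite !gmul//; last exact: (sx_domM sA).
  rewrite /mulY; case: pselect => //= db'; rewrite (sx_mulA sA)//.
rewrite -/g -lcg// -(@nm_lc_ip _ _ _ _ j g s)//.
have -> : lc (fun x => j (mulY f x)) s = pi f (lc j s).
  rewrite (lin_lc (rep_fun_lin piP df)); apply: eq_bigr => q _.
  by rewrite /= pij.
by rewrite -rc_le rcM -!nmE; apply: env_ub.
Qed.
End Rep.

(** The left side is the norm of the image of an element of S, so it can be tested in every
    representation of S, where [action_rep_le] applies. *)
Lemma action_le f (s : seq (K * Y)) : sa_dom f ->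
  nm (lc (fun y : Y => ecol (sa_mul f (sval y.1)) y.2) s) <= nm (env_map CQ f) * nm (lc col_of s).
Proof.
move=> df.
have [F dF eF] : exists2 F : S, sa_dom F &
    env_map CQG F = lc (fun y : Y => ecol (sa_mul f (sval y.1)) y.2) s.
  elim: s => [|[k [[g dg] u]] s [F dF eF]].
    by exists 0; [exact: (sx_dom0 sS)|rewrite lc_nil; exact: env0 (sx_dom0 sS)].
  have de : sa_dom (e (sa_mul f g) u) by apply: (e_dom gs); exact: (sx_domM sA).
  exists (k *: e (sa_mul f g) u + F); first exact: (sx_domP sS).
  by rewrite env_lin// eF /lc big_cons.
rewrite -eF; apply: env_le => //; first by rewrite mulr_ge0 ?nm_ge0.
move=> H pi piP h.
have [rho [rhoP rhoE]] := env_rep_extend CQG (sx_dom0 sS) (@sx_domP _ _ sS) (@sx_domM _ _ sS) (@sx_domS _ _ sS) piP.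
have rl : lin (fun a => rho a h).
  by move=> k a b; have [_ rl _ _] := rhoP; exact: rl.
rewrite -rhoE// eF.
have := action_rep_le rhoP [seq (p.1, (p.2, h)) | p <- s] df.
have lcE (phi : Y -> CQG) : lc (fun x : Y * H => rho (phi x.1) x.2) [seq (p.1, (p.2, h)) | p <- s] =
    rho (lc phi s) h.
  by rewrite (lin_lc rl) /lc big_map.
rewrite (lcE (fun y => ecol (sa_mul f (sval y.1)) y.2)) (lcE col_of) => /le_trans; apply.
rewrite -mulrA ler_wpM2l ?nm_ge0//; exact: rep_le.
Qed.

Theorem action_mult_hom : exists pi : CQ -> multiplier CQG,
  @is_mult_hom R CQ CQG pi /\ forall f g u, sa_dom f -> sa_dom g ->
    pi (env_map CQ f) (ecol g u) = ecol (sa_mul f g) u.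
Proof.
pose XA := {f : A | sa_dom f}.
have [|||||pi [ph pa pb]] := @mult_hom_of_action R CQ CQG _ _ _ _
  (@env_densefam R A CQ) (@ecol_densefam R G A S comp e sl gs CQG)
  (fun x x' : XA => act_dom (svalP x) (svalP x')) (fun x : XA => exist _ _ (sx_domS sA (svalP x)))
  (fun (x : XA) (y : Y) => (act_dom (svalP x) (svalP y.1), y.2)).
- by move=> [f df] [g dg]; exact: env_mul.
- by move=> [f df]; exact: env_star.
- by move=> [f df] [g dg] [[h dh] u] /=; rewrite (sx_mulA sA).
- by move=> [f df] [[g dg] u] [[h dh] v] /=; exact: ecol_mul_adj.
- move=> s u; have [f df hf] := lc_dom (sx_dom0 sA) (@sx_domP _ _ sA) s.
  have := hf _ (fun f => lc (fun y : Y => ecol (sa_mul f (sval y.1)) y.2) u).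
  have := hf _ (env_map CQ) (fun k a b => @env_lin _ _ CQ k a b).
  rewrite /= => -> -> ; first exact: action_le.
  move=> k a b da db; rewrite /lc scaler_sumr -big_split; apply: eq_bigr => -[c [[g dg] v]] _ /=.
  by rewrite (sx_mulDl sA)// (ecol_lin gs) ?scalerDr ?scalerA 1?mulrC//; exact: (sx_domM sA).
by exists pi; split => // f g u df dg; exact: (pa (exist _ f df) (exist _ g dg, u)).
Qed.
End ModuleAction.

Lemma densefam_trans (R : realType) (V : normedModType (Cplx R)) (X Y : Type) (e : X -> V) (g : Y -> V) :
  densefam e -> (forall x (eps : R), 0 < eps -> exists s, nm (e x - lc g s) < eps) -> densefam g.
Proof.
move=> de h v eps e0.
have [s hs] := de v _ (divr_gt0 e0 (@ltr0n R 2)).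
suff [s' hs'] : exists s', nm (lc e s - lc g s') < eps / 2.
  exists s'; have := nm_tri (lc e s) v (lc g s'); lra.
elim: s (eps / 2) (divr_gt0 e0 (@ltr0n R 2)) {hs} => [|[k x] s IH] d d0.
  by exists [::]; rewrite !lc_nil subrr nm0.
have k1 : 0 < nm k + 1 by rewrite ltr_wpDl ?nm_ge0.
have [s1 h1] := h x _ (divr_gt0 (divr_gt0 d0 (@ltr0n R 2)) k1).
have [s2 h2] := IH _ (divr_gt0 d0 (@ltr0n R 2)).
exists (lcscale k s1 ++ s2); rewrite lc_cat lc_scale.
have -> : lc e ((k, x) :: s) = k *: e x + lc e s by rewrite /lc big_cons.
rewrite opprD addrACA -scalerBr (le_lt_trans (nmD _ _))// nmZ.
move: h1; rewrite ltr_pdivlMr// => h1.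
have : nm k * nm (e x - lc g s1) <= nm (e x - lc g s1) * (nm k + 1).
  by rewrite mulrDr mulr1 mulrC lerDl nm_ge0.
lra.
Qed.

(** * Actions of scalar functions on G *)

Section ScalarContraction.
Variables (R : realType) (V Z : normedModType (Cplx R)) (f : V -> V -> Z).
Notation K := (Cplx R).
Hypothesis hf : isform f.
Variables (X G : Type) (e : X -> V) (dom : set (G -> K)).
Hypothesis domP : forall (k : K) a b, dom a -> dom b -> dom (k *: a + b).
Hypothesis dom_solid : forall a b C, dom a -> (forall u, nm (b u) <= C * nm (a u)) -> dom b.
Variable T : (G -> K) -> X -> V.
Hypothesis T1 : forall a b x x', dom a -> dom b ->
  f (T a x) (T b x') = f (T (fun u => (b u)^* * a u) x) (e x').
Hypothesis T2 : forall b x x', dom b -> f (e x) (T b x') = f (T (fun u => (b u)^*) x) (e x').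
Hypothesis T3 : forall (k : K) a b x, dom a -> dom b ->
  T (k *: a + b) x = k *: T a x + T b x.

(** Here r = 1 - sqrt(1 - x^2) explicitly. The bound |r| <= |x| keeps the pointwise root of a
    function vanishing at infinity among such functions. *)
Lemma scalar_sqrt (x : K) : x^* = x -> nm x < 1 ->
  exists r : K, [/\ r^* = r, r + r - r * r = x * x & nm r <= nm x].
Proof.
move=> /CrealP/complex_realP[a ->]; rewrite -/(rc a) => x1.
have na : nm (rc a) = `|a|.
  by apply: rc_inj; rewrite -nmE normc_def /= expr0n addr0 sqrtr_sqr.
rewrite na in x1 *; have a1 : a ^+ 2 <= 1.
  by rewrite -real_normK ?num_real// expr_le1// ltW.
pose y := 1 - a ^+ 2; have y0 : 0 <= y by rewrite subr_ge0.
have y1 : y <= 1 by rewrite /y gerBl sqr_ge0.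
have sy : Num.sqrt y ^+ 2 = y by rewrite sqr_sqrtr.
have s1 : Num.sqrt y <= 1 by rewrite -sqrtr1 ler_wsqrtr.
have s0 : 0 <= Num.sqrt y by exact: sqrtr_ge0.
exists (rc (1 - Num.sqrt y)); split; first exact: rc_conj.
  rewrite -!rcM -rcD -rcB; congr rc.
  have -> : a * a = 1 - Num.sqrt y ^+ 2 by rewrite sy /y; ring.
  by ring.
rewrite nm_rc; last by lra.
have : Num.sqrt y ^+ 2 <= Num.sqrt y by rewrite expr2 ler_piMr.
have : a ^+ 2 <= `|a|.
  by rewrite -real_normK ?num_real// expr2 ler_piMr// ltW.
by rewrite sy /y; lra.
Qed.

(** [contraction] for the algebra of bounded functions in [dom]; solidity of [dom] supplies closure
    under products, conjugates and square roots. *)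
Lemma scalar_contraction a C : dom a -> (forall u, nm (a u) <= C) -> 0 <= C ->
  forall s, nm (lc (T a) s) <= C * nm (lc e s).
Proof.
have domS b : dom b -> dom (fun u => (b u)^*).
  by move=> db; apply: (dom_solid (C := 1) db) => u; rewrite nm_conj mul1r.
move=> da aC C0.
apply: (@contraction R V Z f hf X e (G -> K) (fun b => dom b /\ exists M, forall u, nm (b u) <= M)
  (fun b b' u => b u * b' u) (fun b u => (b u)^*) (fun b c => forall u, nm (b u) <= c)
  _ _ _ _ _ _ _ _ T) => //.
- move=> k b b' [db [M hM]] [db' [M' hM']]; split; first exact: domP.
  exists (nm k * M + M') => u; change (nm (k * b u + b' u) <= nm k * M + M').
  by rewrite (le_trans (nmD _ _))// lerD// nmM ler_wpM2l ?nm_ge0.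
- move=> b b' [db [M hM]] [db' [M' hM']].
  have bb' u : nm (b u * b' u) <= M * nm (b' u) by rewrite nmM ler_wpM2r ?nm_ge0.
  split; first exact: dom_solid db' bb'.
  exists (`|M| * M') => u; rewrite (le_trans (bb' u))//.
  rewrite (le_trans (_ : _ <= `|M| * nm (b' u)))//; first by rewrite ler_wpM2r ?nm_ge0// ler_norm.
  by rewrite ler_wpM2l.
- move=> b [db [M hM]]; split; first exact: domS.
  by exists M => u; rewrite nm_conj.
- move=> r b; apply/funext => u; change ((rc r * b u)^* = rc r * (b u)^*).
  by rewrite rmorphM /= rc_conj.
- by move=> b; apply/funext => u; rewrite rmorphM /= conjCK mulrC.
- move=> b r c r0 bC u; change (nm (rc r * b u) <= r * c).
  by rewrite nmM (nm_rc (ltW r0)) ler_pM2l.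
- move=> b c bC u; rewrite nmM nm_conj -expr2 lerXn2r ?nnegrE ?nm_ge0//.
  exact: le_trans (nm_ge0 _) (bC u).
- move=> b q [db _] sb bq q0 q1.
  have /choice[r hr] : forall u, exists r : K, [/\ r^* = r, r + r - r * r = b u * b u & nm r <= nm (b u)].
    move=> u; apply: scalar_sqrt; last exact: le_lt_trans q1.
    by rewrite -[in RHS]sb.
  exists r; split.
  + split; last by exists q => u; have [_ _ h] := hr u; exact: le_trans (bq u).
    by apply: (dom_solid (C := 1) db) => u; rewrite mul1r; have [] := hr u.
  + by apply/funext => u; have [] := hr u.
  + by apply/funext => u; rewrite mulrC.
  + by apply/funext => u; have [_ + _] := hr u; exact.
- by move=> b b' x x' [db _] [db' _]; exact: T1.
- by move=> b x x' [db _]; exact: T2.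
- by move=> k b b' x [db _] [db' _]; exact: T3.
- by split => //; exists C.
Qed.
End ScalarContraction.

Section VanishingFunctions.
Variables (R : realType) (G : groupType).
Notation K := (Cplx R).
Definition vanishing (V : normedModType K) (F : G -> V) :=
  forall eps : R, 0 < eps -> finite_set [set s | eps <= nm (F s)].

Lemma C0_vanishing (V : normedModType K) mul star (F : G -> V) :
  @sa_dom R (C0 G mul star) F <-> vanishing F.
Proof.
split=> h eps e0.
  have := h (rc eps); rewrite -(rc0 R) rc_lt => /(_ e0); apply: sub_finite_set => s /=.
  by rewrite nmE rc_le.
have e1 : 0 < cre eps by rewrite -rc_lt rc0 creK// ltW.
apply: sub_finite_set (h _ e1) => s /=; by rewrite -(creK (ltW e0)) nmE rc_le.
Qed.

Lemma vanishing_dominated (V W : normedModType K) (F : G -> V) (F' : G -> W) C :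
  vanishing F -> (forall s, nm (F' s) <= C * nm (F s)) -> vanishing F'.
Proof.
move=> vF h eps e0; have c0 : 0 < `|C| + 1 by rewrite ltr_wpDl.
apply: sub_finite_set (vF _ (divr_gt0 e0 c0)) => s /= es.
rewrite ler_pdivrMr// (le_trans es)// (le_trans (h s))// mulrC ler_wpM2l ?nm_ge0//.
by rewrite (le_trans (ler_norm _))// lerDl.
Qed.

Lemma vanishing_lin (V : normedModType K) (k : K) (F F' : G -> V) :
  vanishing F -> vanishing F' -> vanishing (k *: F + F').
Proof.
move=> vF vF'; have vk : vanishing (k *: F).
  by apply: (vanishing_dominated (C := nm k) vF) => s; rewrite -nmZ.
move=> eps e0; have e2 := divr_gt0 e0 (@ltr0n R 2).
have := conj (vk _ e2) (vF' _ e2); rewrite -finite_setU; apply: sub_finite_set => s /= es.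
have [h|h] := leP (eps / 2) (nm ((k *: F) s)); [by left|right].
have : nm ((k *: F + F') s) <= nm ((k *: F) s) + nm (F' s) by exact: nmD.
lra.
Qed.

Lemma vanishing_bounded (V : normedModType K) (F : G -> V) : vanishing F ->
  exists C, 0 <= C /\ forall s, nm (F s) <= C.
Proof.
move=> /(_ 1 ltr01)/finite_seqP[L eL]; exists (1 + \sum_(s <- L) nm (F s)); split.
  by rewrite addr_ge0// sumr_ge0// => s _; exact: nm_ge0.
move=> s; have [h|h] := leP 1 (nm (F s)); last first.
  by rewrite (le_trans (ltW h))// lerDl sumr_ge0// => t _; exact: nm_ge0.
have sL : s \in L by have : [set s | 1 <= nm (F s)] s by []; rewrite eL.
rewrite (big_rem s)//= addrCA lerDl addr_ge0// sumr_ge0// => t _; exact: nm_ge0.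
Qed.

Lemma vanishing_finite (V : normedModType K) (F : G -> V) (L : seq G) :
  (forall s, F s <> 0 -> s \in L) -> vanishing F.
Proof.
move=> h eps e0; apply: (sub_finite_set _ (finite_seq L)) => s /= es; apply: h => F0.
by move: es; rewrite F0 nm0 leNgt e0.
Qed.

Lemma chi_vanishing u : vanishing (chi R u : G -> K).
Proof.
apply: (@vanishing_finite _ _ [:: u]) => s; rewrite /chi inE; by case: (s == u).
Qed.
End VanishingFunctions.

Section MultiplierLinear.
Variables (R : realType) (B : cstarAlgebra R).
Notation "x ** y" := (cs_mul x y) (at level 40, left associativity).

Definition mult_lincomb (k : Cplx R) (m m' : multiplier B) : multiplier B.
Proof.
exists (fun b => k *: m b + m' b) (fun b => k^* *: mult_adj m b + mult_adj m' b) => a b.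
by rewrite cs_starD cs_starZ cs_mulDl cs_mulZl !mult_adjP cs_mulDr cs_mulZr.
Defined.

Definition mult_left (a : B) : multiplier B.
Proof.
exists (fun b => a ** b) (fun b => cs_star a ** b) => x y.
by rewrite cs_starM cs_mulA.
Defined.
End MultiplierLinear.

Section MultHomOfFamily.
Variables (R : realType) (S : starAlgebra R) (B : cstarAlgebra R) (X : Type) (eB : X -> B).
Notation K := (Cplx R).
Notation dom := (@sa_dom R S).
Notation "x ** y" := (cs_mul x y) (at level 40, left associativity).
Hypothesis dB : densefam eB.
Hypothesis domP : forall (k : K) a b, dom a -> dom b -> dom (k *: a + b).
Hypothesis domM : forall a b, dom a -> dom b -> dom (sa_mul a b).
Hypothesis domS : forall a, dom a -> dom (sa_star a).
Variable t : S -> X -> B.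
Hypothesis tb : forall a, dom a -> exists C, forall s, nm (lc (t a) s) <= C * nm (lc eB s).
Hypothesis tl : forall (k : K) a b x, dom a -> dom b -> t (k *: a + b) x = k *: t a x + t b x.
Hypothesis ts : forall a x y, dom a -> cs_star (t a x) ** eB y = cs_star (eB x) ** t (sa_star a) y.
Hypothesis tm : forall a b x y, dom a -> dom b ->
  cs_star (t (sa_mul a b) x) ** eB y = cs_star (t b x) ** t (sa_star a) y.

(** The analogue of [rep_of_family] for multipliers; again multiplicativity is stated with a moved
    across the form. *)
Theorem mult_hom_of_family : exists m : S -> multiplier B,
  is_mult_hom m /\ forall a x, dom a -> m a (eB x) = t a x.
Proof.
have /choice[m mP] : forall a, exists m : multiplier B, dom a ->
    (forall x, m (eB x) = t a x) /\ forall x, mult_adj m (eB x) = t (sa_star a) x.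
  move=> a; have [da|nda] := pselect (dom a); last by exists (mult_left 0).
  have [C hC] := tb da; have [m [m1 m2 _]] := mult_extend dB (fun x y => ts x y da) hC.
  by exists m.
exists m; split; last by move=> a x /mP[].
split.
- move=> k a b x da db; move: x.
  apply: (mult_eq_dense (m' := mult_lincomb k (m a) (m b)) dB) => x /=.
  have [ma _] := mP a da; have [mb _] := mP b db; have [mab _] := mP _ (domP k da db).
  by rewrite ma mb mab tl.
- move=> a b x da db; move: x.
  apply: (mult_eq_dense (m' := mult_comp (m a) (m b)) dB) => x /=.
  have [ma ma'] := mP a da; have [mb _] := mP b db; have [mab _] := mP _ (domM da db).
  rewrite mab mb; apply: (cs_dense_ext dB) => y.
  rewrite -mult_adjPl ma' -[LHS]cs_starK -[RHS]cs_starK; congr cs_star.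
  by rewrite cs_starM cs_starK tm// [RHS]cs_starM cs_starK.
- move=> a x da; apply: (mult_eq_dense (m' := mult_star (m a)) dB) => y /=.
  have [_ ->] := mP a da; have [ma _] := mP _ (domS da); exact: ma.
Qed.
End MultHomOfFamily.

Section Diagonal.
Variables (R : realType) (G : groupType) (A S : starAlgebra R).
Variables (comp : G -> A -> A) (e : A -> G -> S) (sl : S -> G -> A).
Hypothesis gs : graded_skew comp e sl.
Notation K := (Cplx R).
Implicit Types (f g : A) (F : S) (r s t u v w : G).
Variables (CQ : enveloping A) (CQG : enveloping S).
Notation ecol := (ecol e CQG).
Notation "x ** y" := (cs_mul x y) (at level 40, left associativity).

Notation hgen := (hgen comp).

Definition hcol (x : hgen) : CQG := ecol (gcoef x) (gcol x).

Lemma hcol_dense : densefam hcol. Proof. exact: (@hcol_densefam _ _ _ _ _ _ _ gs CQG). Qed.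

Lemma hcol_ortho x y : grow x <> grow y -> cs_star (hcol x) ** hcol y = 0.
Proof. exact: (hcol_adj gs). Qed.

Lemma C0_closed (B : cstarAlgebra R) : [/\ forall (k : K) a b, @sa_dom R (C0GB G B) a ->
    @sa_dom R (C0GB G B) b -> @sa_dom R (C0GB G B) (k *: a + b),
  forall a b, @sa_dom R (C0GB G B) a -> @sa_dom R (C0GB G B) b -> @sa_dom R (C0GB G B) (sa_mul a b)
  & forall a, @sa_dom R (C0GB G B) a -> @sa_dom R (C0GB G B) (sa_star a)].
Proof.
split.
- by move=> k a b /C0_vanishing va /C0_vanishing vb; apply/C0_vanishing/vanishing_lin.
- move=> a b /C0_vanishing va /C0_vanishing vb; apply/C0_vanishing.
  have [C [C0 hC]] := vanishing_bounded va.
  by apply: (vanishing_dominated (C := C) vb) => s; rewrite (le_trans (nm_mul _ _))// ler_wpM2r ?nm_ge0.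
- move=> a /C0_vanishing va; apply/C0_vanishing.
  by apply: (vanishing_dominated (C := 1) va) => s; rewrite mul1r nm_star.
Qed.

Lemma C0G_closed : [/\ forall (k : K) a b, @sa_dom R (C0G R G) a ->
    @sa_dom R (C0G R G) b -> @sa_dom R (C0G R G) (k *: a + b),
  forall a b, @sa_dom R (C0G R G) a -> @sa_dom R (C0G R G) b -> @sa_dom R (C0G R G) (sa_mul a b)
  & forall a, @sa_dom R (C0G R G) a -> @sa_dom R (C0G R G) (sa_star a)].
Proof.
split.
- by move=> k a b /C0_vanishing va /C0_vanishing vb; apply/C0_vanishing/vanishing_lin.
- move=> a b /C0_vanishing va /C0_vanishing vb; apply/C0_vanishing.
  have [C [C0 hC]] := vanishing_bounded va.
  by apply: (vanishing_dominated (C := C) vb) => s; rewrite nmM ler_wpM2r ?nm_ge0.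
- move=> a /C0_vanishing va; apply/C0_vanishing.
  by apply: (vanishing_dominated (C := 1) va) => s; rewrite mul1r nm_conj.
Qed.

Lemma chi_C0G u : @sa_dom R (C0G R G) (chi R u).
Proof. by apply/C0_vanishing; exact: chi_vanishing. Qed.

(** Different rows are orthogonal for y^* x, so multiplying each row r by g(r) is bounded by the
    supremum of |g|. *)
Theorem row_mult_hom : exists mu : (G -> K) -> multiplier CQG,
  [/\ @is_mult_hom R (C0G R G) CQG mu, @Defs.nondegenerate R (C0G R G) CQG mu
    & forall (g : G -> K) x, @sa_dom R (C0G R G) g -> mu g (hcol x) = g (grow x) *: hcol x].
Proof.
have [cP cM cS] := C0G_closed.
have [||||mu [muP muE]] := @mult_hom_of_family R (C0G R G) CQG _ hcol hcol_dense cP cM cS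
  (fun (h : G -> K) x => h (grow x) *: hcol x).
- move=> g /C0_vanishing/vanishing_bounded[C [C0 hC]]; exists C => s.
  apply: (@scalar_contraction R CQG CQG _ (cs_form CQG) _ G hcol setT _ _ (fun (h : G -> K) x => h (grow x) *: hcol x)) => //.
  + move=> a b x x' _ _ /=; rewrite !cs_starZ !cs_mulZl !cs_mulZr scalerA.
    have [<-//|xx] := pselect (grow x = grow x').
    by rewrite (@hcol_ortho x' x) ?scaler0//; exact: nesym.
  + move=> b x x' _ /=; rewrite !cs_starZ !cs_mulZl !cs_mulZr.
    have [<-//|xx] := pselect (grow x = grow x').
    by rewrite (@hcol_ortho x' x) ?scaler0//; exact: nesym.
  + move=> k a b x _ _; change ((k * a (grow x) + b (grow x)) *: hcol x = k *: (a (grow x) *: hcol x) + b (grow x) *: hcol x).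
    by rewrite scalerDl scalerA.
- move=> k a b x _ _; change ((k * a (grow x) + b (grow x)) *: hcol x = k *: (a (grow x) *: hcol x) + b (grow x) *: hcol x).
  by rewrite scalerDl scalerA.
- move=> a x y _ /=; rewrite !cs_starZ !cs_mulZl !cs_mulZr.
  have [<-//|xx] := pselect (grow x = grow y).
  by rewrite (hcol_ortho xx) !scaler0.
- move=> a b x y _ _ /=; rewrite !cs_starZ !cs_mulZl !cs_mulZr scalerA rmorphM mulrC.
  have [<-//|xx] := pselect (grow x = grow y).
  by rewrite (hcol_ortho xx) !scaler0.
exists mu; split => //.
apply: (@dense_spanW R CQG (range hcol)); last exact: (densefam_span hcol_dense).
move=> _ [x _ <-]; exists (chi R (grow x)), (hcol x); split; first exact: chi_C0G.
rewrite muE; last exact: chi_C0G.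
by rewrite (_ : chi R _ _ = 1) ?scale1r// /chi eqxx.
Qed.

Section Pair.
Variables (pi : CQ -> multiplier CQG) (mu : (G -> K) -> multiplier CQG).
Hypothesis piE : forall f g u, sa_dom f -> sa_dom g ->
  pi (env_map CQ f) (ecol g u) = ecol (sa_mul f g) u.
Hypothesis muE : forall (g : G -> K) x, @sa_dom R (C0G R G) g -> mu g (hcol x) = g (grow x) *: hcol x.

(** A matrix concentrated in column u reads only row u of its right factor. This is how C*(Q x_c G)
    is recovered from the pair. *)
Lemma ecol_pi_mu f u b : sa_dom f -> ecol f u ** b = pi (env_map CQ f) (mu (chi R u) b).
Proof.
move=> df; move: b; apply: (mult_eq_dense (m := mult_left (ecol f u))
  (m' := mult_comp (pi (env_map CQ f)) (mu (chi R u))) hcol_dense) => x /=.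
rewrite muE; last exact: chi_C0G.
rewrite (linZ (mult_lin (pi (env_map CQ f)))) piE //; last exact: (gcoef_dom x).
rewrite /chi.
rewrite (ecol_mul gs CQG _ _ df (gcoef_hom x)) -/(grow x) eq_sym.
by case: (grow x == u); rewrite ?scale1r ?scale0r.
Qed.

(** Products are dense by [cs_dense_mul], and a product with a generator on the left is a value of
    pi by [ecol_pi_mu]. *)
Lemma action_nondegenerate : @Defs.nondegenerate R CQ CQG pi.
Proof.
have h := span_densefam (@cs_dense_mul R CQG).
suff d : densefam (fun x : {b : CQG | exists a c, @sa_dom R CQ a /\ b = pi a c} => sval x).
  apply: dense_spanW (densefam_span d) => _ [[b hb] _ <-]; exact: hb.
apply: (densefam_trans h) => -[z [x [y xy]]] eps e0 /=; rewrite xy.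
have y1 : 0 < nm y + 1 by rewrite ltr_wpDl ?nm_ge0.
have [s hs] := hcol_dense x (divr_gt0 e0 y1).
have im (p : hgen) : exists a c, @sa_dom R CQ a /\ hcol p ** y = pi a c.
  exists (env_map CQ (gcoef p)), (mu (chi R (gcol p)) y); split => //.
  exact: ecol_pi_mu (gcoef_dom p).
exists [seq (p.1, exist _ (hcol p.2 ** y) (im p.2)) | p <- s].
have -> : lc (fun x : {b : CQG | exists a c, @sa_dom R CQ a /\ b = pi a c} => sval x)
    [seq (p.1, exist _ (hcol p.2 ** y) (im p.2)) | p <- s] = lc hcol s ** y.
  rewrite (lin_lc (cs_mull_lin y)) /lc big_map; by [].
rewrite -cs_mulBl (le_lt_trans (nm_mul _ _))//.
move: hs; rewrite ltr_pdivlMr//; apply: le_lt_trans.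
by rewrite mulrDr mulr1 lerDl nm_ge0.
Qed.
End Pair.
End Diagonal.

(** As C*(G) has a unit, b -> b (x) 1 is a *-homomorphism, hence contractive, and z then acts
    contractively on the family b (x) 1. *)
Lemma tens_norm_le (R : realType) (G : groupType) (CG : groupCstar R G) (B : cstarAlgebra R)
    (TB : tensorProduct B CG) b z : nm (tens TB b z) <= nm b * nm z.
Proof.
pose j (x : B) := tens TB x (unitary CG 1%g).
have jl : forall x, nm (j x) <= nm x.
  apply: (@star_hom_le R B TB j); split.
  - by move=> k x y _ _; exact: tens_linearl.
  - by move=> x y _ _; rewrite /j -tens_mul unitary1l.
  - by move=> x _; rewrite /j -tens_star unitaryS invg1.
have := @cs_contraction R CG TB TB _ (cs_form TB) B j (fun y x => tens TB x y) _ _ _ z [:: (1, b)].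
rewrite !lc1 => h; apply: le_trans (h _ _ _) _.
- by move=> a a' x x'; rewrite /j -!tens_star -!tens_mul unitaryS invg1 unitary1l.
- by move=> a x x'; rewrite /j -!tens_star -!tens_mul unitaryS invg1 unitary1l unitary1r.
- by move=> k a a' x; rewrite tens_linearr.
by rewrite mulrC ler_wpM2r ?nm_ge0.
Qed.

(** * Covariance of the pair on the skew-product algebra *)

Section Covariance.
Variables (R : realType) (G : groupType) (A S : starAlgebra R).
Variables (comp : G -> A -> A) (e : A -> G -> S) (sl : S -> G -> A).
Hypothesis gs : graded_skew comp e sl.
Notation K := (Cplx R).
Notation homog := (homog comp).
Notation hgen := (hgen comp).
Variables (CQ : enveloping A) (CQG : enveloping S).
Notation ecol := (ecol e CQG).
Notation hcol := (@hcol R G A S comp e CQG).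
Notation "x ** y" := (cs_mul x y) (at level 40, left associativity).
Variables (CG : groupCstar R G) (T : tensorProduct CQ CG) (delta : CQ -> T).
Notation un := (unitary CG).
Hypothesis deltaP : @is_star_hom R CQ T delta.
Hypothesis deltaE : forall s f, homog s f -> delta (env_map CQ f) = tens T (env_map CQ f) (un s).
Variables (pi : CQ -> multiplier CQG) (mu : (G -> K) -> multiplier CQG).
Hypothesis piP : @is_mult_hom R CQ CQG pi.
Hypothesis muP : @is_mult_hom R (C0G R G) CQG mu.
Hypothesis muN : @Defs.nondegenerate R (C0G R G) CQG mu.
Hypothesis piE : forall f g u, sa_dom f -> sa_dom g ->
  pi (env_map CQ f) (ecol g u) = ecol (sa_mul f g) u.
Hypothesis muE : forall (g : G -> K) x, @sa_dom R (C0G R G) g -> mu g (hcol x) = g (grow x) *: hcol x.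

Let sS : star_axioms S := gr_S gs.

Section Tensor.
Variable TB : tensorProduct CQG CG.
Definition hcol_tens (p : hgen * CG) : TB := tens TB (hcol p.1) p.2.

Lemma tens0l (y : CG) : tens TB 0 y = 0. Proof. exact: lin0 (tens_lin_l TB y). Qed.

Lemma hcol_tens_dense : densefam hcol_tens.
Proof.
apply: (densefam_trans (@tens_densefam R CQG CG TB)) => -[b y] eps e0 /=.
have y1 : 0 < nm y + 1 by rewrite ltr_wpDl ?nm_ge0.
have [s hs] := @hcol_dense _ _ _ _ _ _ _ gs CQG b _ (divr_gt0 e0 y1).
exists [seq (p.1, (p.2, y)) | p <- s].
have -> : lc hcol_tens [seq (p.1, (p.2, y)) | p <- s] = tens TB (lc hcol s) y.
  by rewrite (lin_lc (tens_lin_l TB y)) /lc big_map.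
rewrite -(linB (tens_lin_l TB y)) (le_lt_trans (tens_norm_le _ _ _))//.
move: hs; rewrite ltr_pdivlMr//; apply: le_lt_trans.
by rewrite mulrDr mulr1 lerDl nm_ge0.
Qed.

Lemma hcol_tens_form (x x' : hgen) (y y' z z' : CG) :
  (grow x = grow x' -> cs_star y ** y' = cs_star z ** z') ->
  cs_star (hcol_tens (x, y)) ** hcol_tens (x', y') = cs_star (hcol_tens (x, z)) ** hcol_tens (x', z').
Proof.
move=> h; rewrite /hcol_tens -!tens_star -!tens_mul /=.
have [/h->//|xx] := pselect (grow x = grow x').
by rewrite (hcol_ortho gs)// !tens0l.
Qed.

(** This is mu (x) id on C_0(G, C*(G)): row r is multiplied by the value of F at r in the second
    factor. *)
Lemma diag_hom : exists Psi : (G -> CG) -> multiplier TB,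
  @is_mult_hom R (C0GB G CG) TB Psi /\
  forall F p, @sa_dom R (C0GB G CG) F -> Psi F (hcol_tens p) = hcol_tens (p.1, F (grow p.1) ** p.2).
Proof.
have [cP cM cS] := C0_closed G CG.
apply: (@mult_hom_of_family R (C0GB G CG) TB _ hcol_tens hcol_tens_dense cP cM cS
  (fun F p => hcol_tens (p.1, F (grow p.1) ** p.2))).
- move=> F /C0_vanishing/vanishing_bounded[C [C0 hC]]; exists C => s.
  apply: (@diag_contraction R CG TB TB _ (cs_form TB) _ hcol_tens _ (fun p : hgen * CG => grow p.1)
    (fun a p => hcol_tens (p.1, a ** p.2))) => //.
  + by move=> a b [x y] [x' y'] /= _; apply: hcol_tens_form; rewrite cs_starM !cs_mulA.
  + by move=> b [x y] [x' y'] /= _; apply: hcol_tens_form; rewrite cs_starM cs_mulA.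
  + move=> a b [x y] [x' y'] /= xx; have xx' := nesym xx.
    have z w w' : cs_star (hcol_tens (x', w)) ** hcol_tens (x, w') = 0.
      by rewrite /hcol_tens -!tens_star -!tens_mul /= (hcol_ortho gs)// tens0l.
    by split; exact: z.
  + by move=> k a b [x y]; rewrite /hcol_tens /= cs_mulDl cs_mulZl tens_linearr.
- move=> k a b [x y] _ _; rewrite /hcol_tens /=.
  change (tens TB (hcol x) ((k *: a (grow x) + b (grow x)) ** y) =
    k *: tens TB (hcol x) (a (grow x) ** y) + tens TB (hcol x) (b (grow x) ** y)).
  by rewrite cs_mulDl cs_mulZl tens_linearr.
- move=> a [x y] [x' y'] _; apply: hcol_tens_form => /= ->; by rewrite cs_starM cs_mulA.
- by move=> a b [x y] [x' y'] _ _; apply: hcol_tens_form => /= ->; rewrite !cs_starM !cs_mulA.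
Qed.

(** The image of w_G: on row r it multiplies the second factor by the unitary of r, so it preserves
    the form on generators. *)
Lemma row_unitary : exists W : multiplier TB,
  [/\ forall p, W (hcol_tens p) = hcol_tens (p.1, un (grow p.1) ** p.2),
      forall p, mult_adj W (hcol_tens p) = hcol_tens (p.1, un (grow p.1)^-1%g ** p.2) & bnd W 1].
Proof.
apply: (@mult_extend R TB _ hcol_tens _ _ 1 hcol_tens_dense).
- by move=> [x y] [x' y']; apply: hcol_tens_form => /= ->; rewrite cs_starM unitaryS cs_mulA.
- move=> s; rewrite mul1r le_eqVlt; apply/orP; left; apply/eqP.
  apply: (nm_family_eq (cs_form TB)) => -[x y] [x' y'] /=; apply: hcol_tens_form => /= ->.
  by rewrite cs_starM unitaryS -cs_mulA unitaryVK.
Qed.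
End Tensor.

Theorem pair_covariant : is_covariant delta pi mu.
Proof.
have sepS : rep_separated CQG.
  exact: env_separated (sx_dom0 sS) (@sx_domP _ _ sS) (@sx_domM _ _ sS) (@sx_domS _ _ sS).
have sepG : rep_separated CG.
  exact: env_separated (@ga_dom0 R G) (@ga_domP R G) (@ga_domM R G) (@ga_domS R G).
(* Covariance asks for some tensor product with C*(G); its existence rests on both factors being
   enveloping algebras. *)
have [TB] := tensor_exists sepS sepG.
have [Phi [PhiP PhiE PhiB]] := tensor_mult_hom T TB piP.
have [P PE] := choice (tensor_mult_one TB piP).
have [Psi [PsiP PsiE]] := diag_hom TB.
have [W [WE WE' WB]] := row_unitary TB.
have [cP cM cS] := C0_closed G CG.
have dT : densefam (hcol_tens TB) by exact: hcol_tens_dense.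
split; [split => //; exact: (@action_nondegenerate _ _ _ _ _ _ _ gs CQ CQG pi mu piE muE)|by []|].
exists TB, Phi, Psi, W, P; split => //.
- split => // g z b y dg.
  have dgz : @sa_dom R (C0GB G CG) (fun s => g s *: z).
    apply/C0_vanishing; apply: (vanishing_dominated (C := nm z) ((C0_vanishing _ _ _).1 dg)) => s.
    by rewrite nmZ mulrC.
  have [_ _ PsiS] := PsiP; have [_ _ muS] := muP; have [_ _ cgS] := C0G_closed R G.
  apply: (cs_dense_ext dT) => -[x y'].
  rewrite -mult_adjPl -PsiS// PsiE; last exact: cS.
  rewrite /hcol_tens /= -!tens_star -!tens_mul -mult_adjPl -muS// muE; last exact: cgS.
  rewrite !cs_starM !cs_starZ !cs_starK conjCK !cs_mulZr !cs_mulZl.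
  rewrite (linZ (tens_lin_r _ _)) (linZ (tens_lin_l _ _)) !cs_mulA.
  by [].
- move=> F x dF.
  have duF : @sa_dom R (C0GB G CG) (fun s => un s ** F s).
    apply/C0_vanishing; apply: (vanishing_dominated (C := 1) ((C0_vanishing _ _ _).1 dF)) => s.
    rewrite mul1r le_eqVlt; apply/orP; left; apply/eqP/eqP.
    rewrite -(@eqrXn2 _ 2) ?nm_ge0// -!nm_starM cs_starM unitaryS -cs_mulA unitaryVK//.
  move: x; apply: (mult_eq_dense (m := mult_comp W (Psi F)) dT) => -[x y] /=.
  by rewrite !PsiE// WE /= cs_mulA.
- move=> a x; move: x.
  apply: (mult_eq_dense (m' := mult_comp W (mult_comp (P a) (mult_star W))) dT) => -[x y].
  rewrite /= WE' /= /hcol_tens /= PE; move: a.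
  have dl := deltaP; have pl := mult_hom_le piP.
  apply: (@bnd_eq _ _ _ _ (@env_densefam R A CQ) _ (fun a => Phi (delta a) (tens TB (hcol x) y))
    (fun a => W (tens TB (pi a (hcol x)) (un (grow x)^-1%g ** y)))
    (nm (tens TB (hcol x) y)) (nm (hcol x) * nm (un (grow x)^-1%g ** y))).
  + have [Pl _ _] := PhiP; move=> k a b; rewrite (star_hom_lin deltaP) Pl//.
  + move=> a; rewrite (le_trans (PhiB _ _))// mulrC ler_wpM2l ?nm_ge0//; exact: star_hom_le deltaP a.
  + by move=> k a b; have [pil _ _] := piP; rewrite pil// tens_linearl (mult_lin W).
  + move=> a; rewrite (le_trans (WB _))// mul1r (le_trans (tens_norm_le _ _ _))// mulrAC ler_wpM2r ?nm_ge0//.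
    by rewrite mulrC.
  move=> [f df] /=; move: f df; apply: (graded_ind gs) => [s f hf|k f f' df df' IH IH']; last first.
    have [Pl _ _] := PhiP; have [pil _ _] := piP.
    rewrite env_lin// (star_hom_lin deltaP) Pl// IH IH' pil// tens_linearl (mult_lin W).
    by [].
  (* For f of degree s and x in row r, the right side carries the unitaries of s r and of r^-1,
     whose product is that of s. *)
  have [df _] := hf; have [dx _] := gcoef_hom x.
  rewrite (deltaE hf) PhiE piE//.
  have h1 := hom_mul gs hf (gcoef_hom x).
  have := WE (Hgen (gcol x) h1, un (grow x)^-1%g ** y); rewrite /hcol_tens /= => ->.
  congr tens; rewrite cs_mulA unitaryM; congr (un _ ** _).
by rewrite [grow (Hgen _ _)](_ : _ = (s * grow x)%g) ?mulgK// /grow mulgA.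
Qed.
End Covariance.

(** * Consequences of covariance *)

Section C0Action.
Variables (R : realType) (G : groupType) (B : cstarAlgebra R).
Notation K := (Cplx R).
Notation "x ** y" := (cs_mul x y) (at level 40, left associativity).
Notation dom := (@sa_dom R (C0G R G)).
Variable mu : (G -> K) -> multiplier B.
Hypothesis muP : @is_mult_hom R (C0G R G) B mu.
Hypothesis muN : @Defs.nondegenerate R (C0G R G) B mu.
Implicit Types (g : G -> K) (u v w s : G) (b : B).

Lemma C0_action_le g C b : dom g -> (forall u, nm (g u) <= C) -> 0 <= C ->
  nm (mu g b) <= C * nm b.
Proof.
have [ml mm ms] := muP; have [cP cM cS] := C0G_closed R G => dg gC C0.
have := @scalar_contraction R B B _ (cs_form B) B G id dom cP _ (fun g b => mu g b) _ _ _ g C dg gC C0 [:: (1, b)].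
rewrite !lc1; apply.
- move=> a a' M /C0_vanishing va h; apply/C0_vanishing; exact: vanishing_dominated va h.
- move=> a a' x x' da da'; rewrite mult_adjP -ms// -mm//; exact: cS.
- by move=> a x x' da; rewrite mult_adjP -ms.
- by move=> k a a' x da da'; exact: ml.
Qed.

Definition row_proj u : multiplier B := mu (chi R u).
Notation q := row_proj.

Lemma row_proj_mul u v b : q u (q v b) = if u == v then q v b else 0.
Proof.
have [ml mm ms] := muP; rewrite /row_proj -mm; [|exact: chi_C0G..].
rewrite [sa_mul _ _](_ : _ = if u == v then chi R v else 0).
  case: ifP => // _; have d0 : dom 0.
    by apply/C0_vanishing; apply: (@vanishing_finite _ _ _ _ [::]) => s /(_ erefl).
  by have := ml (-1) 0 0 b d0 d0; rewrite scaler0 addr0 scaleN1r addNr.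
apply/funext => s; rewrite /= /chi; have [->|uv] := eqVneq u v.
  by case: (s == v); rewrite ?mulr1 ?mulr0.
have [->|su] := eqVneq s u; last by rewrite mul0r.
by rewrite (negPf uv) mulr0.
Qed.

Lemma row_proj_adj u b b' : cs_star (q u b) ** b' = cs_star b ** q u b'.
Proof.
have [ml mm ms] := muP; rewrite mult_adjP -ms; last exact: chi_C0G.
congr (_ ** _); congr (mu _ _); apply/funext => s; rewrite /= /chi; exact: rmorph_nat.
Qed.

(** Truncating g to the finite set where |g| >= eps leaves a function bounded by eps, so the error
    is uniform in b. *)
Lemma C0_action_approx g (eps : R) : dom g -> 0 < eps -> exists z : seq (K * G),
  forall b, nm (mu g b - lc (fun u => q u b) z) <= eps * nm b.
Proof.
have [ml mm ms] := muP => dg e0; have vg := (C0_vanishing _ _ _).1 dg.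
have /finite_seqP[L0 eL] := vg _ e0; pose L := undup L0.
pose h (M : seq G) : G -> K := fun s => if s \in M then g s else 0.
have dh M : dom (h M).
  apply/C0_vanishing; apply: (@vanishing_finite _ _ _ _ M) => s; rewrite /h.
  by case: ifP.
have hE (M : seq G) b : uniq M -> mu (h M) b = lc (fun u => q u b) [seq (g u, u) | u <- M].
  elim: M => [_|u M IH /= /andP[uM unM]].
    rewrite lc_nil; have := ml (-1) (h [::]) (h [::]) b (dh _) (dh _).
    by rewrite (_ : -1 *: _ + _ = h [::]) ?scaleN1r ?addNr//; apply/funext => s; exact: addNr.
  have -> : lc (fun u => q u b) [seq (g v, v) | v <- u :: M] =
      g u *: q u b + lc (fun u => q u b) [seq (g v, v) | v <- M].
    by rewrite /lc /= big_cons.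
  rewrite -IH// -ml; [|exact: chi_C0G|exact: dh]; congr (mult_fun (mu _) _).
  apply/funext => s; change (h (u :: M) s = g u * chi R u s + h M s).
  rewrite /h /chi inE; have [->|su] := eqVneq s u; last by rewrite mulr0 add0r.
  by rewrite (negPf uM) mulr1 addr0.
exists [seq (g u, u) | u <- L] => b; rewrite -hE ?undup_uniq//.
have -> : mu g b - mu (h L) b = mu (-1 *: h L + g) b.
  by rewrite ml// scaleN1r addrC.
have [cP _ _] := C0G_closed R G.
apply: C0_action_le (ltW e0); first exact: cP.
move=> u; change (nm (-1 * h L u + g u) <= eps).
rewrite /h; case: ifPn => uL; first by rewrite mulN1r addNr nm0 ltW.
rewrite mulr0 add0r leNgt; apply: contra uL => /ltW hu; rewrite mem_undup.
by have : [set s | eps <= nm (g s)] u by []; rewrite eL.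
Qed.

Lemma row_proj_dense : densefam (fun p : G * B => q p.1 p.2).
Proof.
apply: (densefam_trans (span_densefam muN)) => -[z [g [b [dg zE]]]] eps e0 /=; rewrite zE.
have b1 : 0 < nm b + 1 by rewrite ltr_wpDl ?nm_ge0.
have [w hw] := C0_action_approx dg (divr_gt0 e0 b1).
exists [seq (p.1, (p.2, b)) | p <- w].
have -> : lc (fun p : G * B => q p.1 p.2) [seq (p.1, (p.2, b)) | p <- w] = lc (fun u => q u b) w.
  by rewrite /lc big_map.
apply: le_lt_trans (hw b) _.
rewrite mulrAC ltr_pdivrMr// ltr_pM2l//; lra.
Qed.
End C0Action.

Section CovariantPair.
Variables (R : realType) (G : groupType) (A : starAlgebra R) (comp : G -> A -> A).
Notation K := (Cplx R).
Notation "x ** y" := (cs_mul x y) (at level 40, left associativity).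
Notation homog := (homog comp).
Variables (CQ : enveloping A) (CG : groupCstar R G) (T : tensorProduct CQ CG) (delta : CQ -> T).
Notation un := (unitary CG).
Hypothesis deltaE : forall s f, homog s f -> delta (env_map CQ f) = tens T (env_map CQ f) (un s).
Variables (B : cstarAlgebra R) (j : CQ -> multiplier B) (mu : (G -> K) -> multiplier B).
Hypothesis cov : is_covariant delta j mu.
Notation q := (row_proj mu).

Let muP : @is_mult_hom R (C0G R G) B mu. Proof. by have [_ []] := cov. Qed.
Let muN : @Defs.nondegenerate R (C0G R G) B mu. Proof. by have [_ []] := cov. Qed.

(** Let z be the element claimed to vanish. Covariance yields z (x) s = z (x) u w^-1, and the two
    unitaries differ, so z = 0 by [tens_eq0]. *)
Lemma cov_row s f u w b : homog s f -> u <> (s * w)%g -> q u (j (env_map CQ f) (q w b)) = 0.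
Proof.
move=> hf usw.
have [_ _ [TB [Phi [Psi [W [P [[PhiP PhiE] [PsiP PsiE] WPsi PE cv]]]]]]] := cov.
pose eq3 (p : G * B * CG) := tens TB (q p.1.1 p.1.2) p.2.
have deq : densefam eq3.
  apply: (densefam_trans (@tens_densefam R B CG TB)) => -[c y] eps e0 /=.
  have y1 : 0 < nm y + 1 by rewrite ltr_wpDl ?nm_ge0.
  have [z hz] := row_proj_dense muP muN c (divr_gt0 e0 y1).
  exists [seq (p.1, (p.2, y)) | p <- z].
  have -> : lc eq3 [seq (p.1, (p.2, y)) | p <- z] = tens TB (lc (fun p : G * B => q p.1 p.2) z) y.
    by rewrite (lin_lc (tens_lin_l TB y)) /lc big_map.
  rewrite -(linB (tens_lin_l TB y)) (le_lt_trans (tens_norm_le _ _ _))//.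
  move: hz; rewrite ltr_pdivlMr//; apply: le_lt_trans.
  by rewrite mulrDr mulr1 lerDl nm_ge0.
have t0 (y : CG) : tens TB 0 y = 0 by exact: lin0 (tens_lin_l TB y).
(* Psi of this function is q_v (x) z. The relation between W and w_G then shows that W multiplies
   row v by the unitary of v. *)
pose X v z : G -> CG := fun t => chi R v t *: z.
have dX v z : @sa_dom R (C0GB G CG) (X v z).
  apply/C0_vanishing; apply: (vanishing_dominated (C := nm z) (@chi_vanishing R G v)) => t.
  by rewrite nmZ mulrC.
have WX v x : W (Psi (X v (un 1%g)) x) = Psi (X v (un v)) x.
  rewrite WPsi//; congr (Psi _ x); apply/funext => t; rewrite /X /chi cs_mulZr unitaryM mulg1.
  by case: eqP => [->//|_]; rewrite !scale0r.
have X1 v b' y : Psi (X v (un 1%g)) (tens TB b' y) = tens TB (q v b') y.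
  by rewrite PsiE; [rewrite unitary1l|exact: chi_C0G].
have Xv v b' y : Psi (X v (un v)) (tens TB b' y) = tens TB (q v b') (un v ** y).
  rewrite PsiE; [by []|exact: chi_C0G].
have Wq v b' y : W (tens TB (q v b') y) = tens TB (q v b') (un v ** y).
  by rewrite -X1 WX Xv.
have Wq' v b' y : mult_adj W (tens TB (q v b') y) = tens TB (q v b') (un v^-1%g ** y).
  apply: (cs_dense_ext deq) => -[[v' b''] y']; rewrite /eq3 /= -mult_adjP Wq.
  rewrite -!tens_star -!tens_mul cs_starM unitaryS (row_proj_adj muP) (row_proj_mul muP).
  case: eqP => [->|_]; last by rewrite cs_mul0r !t0.
  by rewrite cs_mulA.
have comm v x : Psi (X v (un 1%g)) (W x) = W (Psi (X v (un 1%g)) x).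
  move: x; apply: (mult_eq_dense (m := mult_comp (Psi (X v (un 1%g))) W)
    (m' := mult_comp W (Psi (X v (un 1%g)))) deq) => -[[v' b'] y] /=.
  rewrite /eq3 /= Wq !X1 (row_proj_mul muP); case: eqP => [_|_]; first by rewrite Wq.
  by rewrite !t0 (lin0 (mult_lin W)).
(* The covariance identity is applied to q_w(b) (x) 1 and then cut down to row u: W^* contributes
   w^-1 and W contributes u. *)
have main : tens TB (q u (j (env_map CQ f) (q w b))) (un s) =
    tens TB (q u (j (env_map CQ f) (q w b))) (un (u * w^-1)%g).
  have := cv (env_map CQ f) (tens TB (q w b) (un 1%g)).
  rewrite (deltaE hf) PhiE Wq' PE !unitary1r => /(congr1 (Psi (X u (un 1%g)))).
  by rewrite X1 comm WX Xv unitaryM.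
have h0 : tens TB (q u (j (env_map CQ f) (q w b))) (un s - un (u * w^-1)%g) = 0.
  by rewrite (linB (tens_lin_r TB _)) main subrr.
have [//|/eqP] := tens_eq0 h0.
rewrite subr_eq0 => /eqP/unitary_inj e; exfalso; apply: usw.
by rewrite e mulgVK.
Qed.

(** By [cov_row], j(f) maps row w into row s w; the row projections of all b span a dense
    subspace. *)
Lemma cov_commute s f u b : homog s f ->
  q u (j (env_map CQ f) b) = j (env_map CQ f) (q (s^-1 * u)%g b).
Proof.
move=> hf; have dq := row_proj_dense muP muN.
have e1 w c : q (s * w)%g (j (env_map CQ f) (q w c)) = j (env_map CQ f) (q w c).
  apply: (cs_dense_ext dq) => -[v b'] /=; rewrite !(row_proj_adj muP) (row_proj_mul muP).
  by case: eqP => [->//|vsw]; rewrite (cov_row _ hf vsw).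
move: b; apply: (mult_eq_dense (m := mult_comp (q u) (j (env_map CQ f)))
  (m' := mult_comp (j (env_map CQ f)) (q (s^-1 * u)%g)) dq) => -[w b] /=.
rewrite (row_proj_mul muP); case: eqP => [<-|usw].
  by have := e1 (s^-1 * u)%g b; rewrite mulVKg.
rewrite (lin0 (mult_lin (j (env_map CQ f)))) (cov_row _ hf)// => e; apply: usw.
by rewrite e mulKg.
Qed.
End CovariantPair.

(** If y < x, the powers of y/x would tend to 0 and could not stay above 1/N. *)
Lemma power_trick (R : realType) (x y N : R) : 0 <= x -> 0 <= y ->
  (forall n, x ^+ (2 ^ n)%N <= N * y ^+ (2 ^ n)%N) -> x <= y.
Proof.
move=> x0 y0 h; rewrite leNgt; apply/negP => yx.
have xp : 0 < x by exact: le_lt_trans yx.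
pose r := y / x; have r0 : 0 <= r by rewrite divr_ge0.
have r1 : r < 1 by rewrite ltr_pdivrMr// mul1r.
have N1 : 0 < `|N| + 1 by rewrite ltr_wpDl.
have hr n : 1 <= N * r ^+ (2 ^ n)%N.
  by rewrite /r expr_div_n mulrA ler_pdivlMr ?exprn_gt0// mul1r.
have [n hn] : exists n, r ^+ n < (`|N| + 1)^-1.
  have [||n hn] := @exprn_small R r (`|N| + 1)^-1; [by rewrite r0|by rewrite invr_gt0|].
  by exists n; exact: hn.
have := hr n; apply/negP; rewrite -ltNge.
have rn : r ^+ (2 ^ n)%N <= r ^+ n.
  by apply: ler_wiXn2l => //; [exact: ltW|rewrite ltnW// ltn_expl].
apply: le_lt_trans (_ : _ <= (`|N| + 1) * r ^+ n) _; last by rewrite -ltr_pdivlMl// mulr1.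
apply: le_trans (_ : _ <= (`|N| + 1) * r ^+ (2 ^ n)%N) _; last by rewrite ler_wpM2l// ltW.
by rewrite ler_wpM2r ?exprn_ge0// (le_trans (ler_norm _))// lerDl.
Qed.

(** * The matrix algebra inside the crossed product *)

Section Comparison.
Variables (R : realType) (G : groupType) (A S : starAlgebra R).
Variables (comp : G -> A -> A) (e : A -> G -> S) (sl : S -> G -> A).
Hypothesis gs : graded_skew comp e sl.
Notation homog := (homog comp).
Variable CQ : enveloping A.
Notation "x ** y" := (cs_mul x y) (at level 40, left associativity).
Notation envQ := (env_map CQ).
Variables (CG : groupCstar R G) (T : tensorProduct CQ CG) (delta : CQ -> T).
Hypothesis deltaE : forall s f, homog s f -> delta (env_map CQ f) = tens T (env_map CQ f) (unitary CG s).
Variable X : crossedProduct delta.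
Implicit Types (f g : A) (F H : S) (r s t u v w : G) (x y : X).

Let sA : star_axioms A := gr_A gs.
Let sS : star_axioms S := gr_S gs.
Notation j := (cp_A X).
Notation q := (row_proj (cp_G X)).

Let cov := cp_covariant X.
Let jP : @is_mult_hom R CQ X j. Proof. by have [[]] := cov. Qed.
Let muP : @is_mult_hom R (C0G R G) X (cp_G X). Proof. by have [_ []] := cov. Qed.

Let cp_genex : exists cp_gen : CQ -> G -> X, forall a u x, j a (q u x) = cp_gen a u ** x.
Proof.
have /choice[d hd] : forall p : CQ * G, exists d : X, forall x, j p.1 (q p.2 x) = d ** x.
  by move=> [a u]; have [d hd] := cp_in X a (@chi_C0G R G u); exists d.
by exists (fun a u => d (a, u)) => a u x; exact: (hd (a, u)).
Qed.

(** j_A(a) j_G(chi_u) is a product of multipliers that belongs to the algebra; this is the element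
    itself. *)
Definition cp_gen : CQ -> G -> X := sval (cid cp_genex).
Lemma cp_genE a u x : j a (q u x) = cp_gen a u ** x.
Proof. exact: (svalP (cid cp_genex)). Qed.

Lemma cp_gen_lin u : lin (cp_gen^~ u).
Proof.
move=> k a b; apply: cs_ext => x; have [jl _ _] := jP.
by rewrite cs_mulDl cs_mulZl -!cp_genE jl.
Qed.

Lemma row_proj_le u x : nm (q u x) <= nm x.
Proof.
rewrite -[leRHS]mul1r; apply: (C0_action_le muP) => //; first exact: chi_C0G.
by move=> v; rewrite /chi; case: eqP => _; rewrite ?nm1 ?nm0.
Qed.

Lemma cp_gen_le a u : nm (cp_gen a u) <= nm a.
Proof.
apply: nm_le_mul; first exact: nm_ge0.
by move=> x; rewrite -cp_genE (le_trans (mult_hom_le jP _ _))// ler_wpM2l ?nm_ge0// row_proj_le.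
Qed.

Lemma cp_gen_mul t f g u v : sa_dom f -> homog t g ->
  cp_gen (envQ f) u ** cp_gen (envQ g) v = if u == (t * v)%g then cp_gen (envQ (sa_mul f g)) v else 0.
Proof.
move=> df hg; have [dg _] := hg; have [jl jm _] := jP.
apply: cs_ext => x; rewrite -cs_mulA -!cp_genE (cov_commute deltaE cov _ _ hg) (row_proj_mul muP).
have -> : (t^-1 * u == v)%g = (u == t * v)%g.
  by apply/eqP/eqP => [<-|->]; rewrite ?mulVKg ?mulKg.
case: eqP => _; last by rewrite !(lin0 (mult_lin _)) cs_mul0l.
by rewrite -cp_genE env_mul// jm.
Qed.

Lemma cp_gen_star s f u : homog s f -> cs_star (cp_gen (envQ f) u) = cp_gen (envQ (sa_star f)) (s * u)%g.
Proof.
move=> hf; have [df _] := hf; have [_ _ js] := jP.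
apply: cs_ext => x; apply: cs_star_ext => y.
have js' a b : mult_adj (j a) b = j (cs_star a) b by rewrite -js.
rewrite cs_mulA -cs_starM -[cp_gen _ u ** y]cp_genE mult_adjP js' (row_proj_adj muP) -env_star//.
rewrite (cov_commute deltaE cov _ _ (hom_star gs hf)) invgK.
by rewrite cp_genE.
Qed.

(** The homomorphism called D in the overview, given column by column. *)
Definition skew_to_cp F : X := \sum_(u \in [set: G]) cp_gen (envQ (sl F u)) u.

Lemma skew_to_cp_seq F (L : seq G) : uniq L -> (forall u, u \notin L -> sl F u = 0) ->
  skew_to_cp F = \sum_(u <- L) cp_gen (envQ (sl F u)) u.
Proof.
move=> uL h; apply: fsum_seq => // u _; apply: contra_notT => /h ->.
by rewrite (env0 CQ (sx_dom0 sA)) (lin0 (cp_gen_lin u)).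
Qed.

Lemma skew_to_cp_lin : domlin skew_to_cp.
Proof.
move=> k F H dF dH.
have [L [uL _ hL]] := sl_fin gs dF; have [M [uM _ hM]] := sl_fin gs dH.
pose N := undup (L ++ M).
have NL u : u \notin N -> u \notin L /\ u \notin M.
  by rewrite mem_undup mem_cat negb_or => /andP.
rewrite !(@skew_to_cp_seq _ N) ?undup_uniq//;
  try by move=> u /NL[/hL h1 /hM h2]; rewrite ?(sl_lin gs) ?h1 ?h2 ?scaler0 ?addr0.
rewrite scaler_sumr -big_split; apply: eq_bigr => u _ /=.
by rewrite (sl_lin gs) env_lin ?cp_gen_lin//; apply: (sl_dom gs).
Qed.

Lemma skew_to_cp_e f u : skew_to_cp (e f u) = cp_gen (envQ f) u.
Proof.
rewrite (@skew_to_cp_seq _ [:: u])//; first by rewrite big_seq1 (sl_e gs) eqxx.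
by move=> v; rewrite inE (sl_e gs) eq_sym => /negPf ->.
Qed.

Lemma skew_to_cp_mul F H : sa_dom F -> sa_dom H -> skew_to_cp (sa_mul F H) = skew_to_cp F ** skew_to_cp H.
Proof.
move=> dF dH; move: F dF; apply: (skew_ind gs) => [s f u hf|k F F' dF dF' IH IH']; last first.
  rewrite (sx_mulDl sS)// !skew_to_cp_lin ?cs_mulDl ?cs_mulZl ?IH ?IH'//; exact: (sx_domM sS).
have [df _] := hf; have de := e_dom gs u df.
move: H dH; apply: (skew_ind gs) => [t g v hg|k F F' dF dF' IH IH']; last first.
  rewrite (sx_mulDr sS)// !skew_to_cp_lin ?cs_mulDr ?cs_mulZr ?IH ?IH'//; exact: (sx_domM sS).
have [dg cg] := hg; rewrite !skew_to_cp_e (cp_gen_mul _ _ df hg) (e_mul gs _ _ df dg cg).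
by case: ifP => _; rewrite ?skew_to_cp_e// (domlin0 sS skew_to_cp_lin).
Qed.

Lemma skew_to_cp_star F : sa_dom F -> skew_to_cp (sa_star F) = cs_star (skew_to_cp F).
Proof.
move: F; apply: (skew_ind gs) => [s f u hf|k F F' dF dF' IH IH']; last first.
  by rewrite (sx_starD sS) !skew_to_cp_lin ?IH ?IH' ?cs_starD ?cs_starZ//; exact: (sx_domS sS).
by rewrite (e_star gs _ (proj2 hf)) !skew_to_cp_e (cp_gen_star _ hf).
Qed.
End Comparison.

(** * The isomorphism *)

Section Isomorphism.
Variables (R : realType) (G : groupType) (A S : starAlgebra R).
Variables (comp : G -> A -> A) (e : A -> G -> S) (sl : S -> G -> A).
Hypothesis gs : graded_skew comp e sl.
Notation K := (Cplx R).
Notation homog := (homog comp).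
Notation hgen := (hgen comp).
Variables (CQ : enveloping A) (CQG : enveloping S).
Notation ecol := (ecol e CQG).
Notation hcol := (@hcol R G A S comp e CQG).
Notation envQ := (env_map CQ).
Notation envS := (env_map CQG).
Variables (CG : groupCstar R G) (T : tensorProduct CQ CG) (delta : CQ -> T).
Hypothesis deltaE : forall s f, homog s f -> delta (env_map CQ f) = tens T (env_map CQ f) (unitary CG s).
Variable X : crossedProduct delta.
Implicit Types (f g : A) (F H : S) (r s t u v w : G) (x y : X).

Let sA : star_axioms A := gr_A gs.
Let sS : star_axioms S := gr_S gs.
Notation cp_gen := (cp_gen X).
Notation skew_to_cp := (@skew_to_cp R G A S sl CQ CG T delta X).

Definition entry F r v : A := comp (r * v^-1)%g (sl F v).

Lemma entry_lin r v (k : K) F H : entry (k *: F + H) r v = k *: entry F r v + entry H r v.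
Proof. by rewrite /entry (sl_lin gs) (comp_lin gs). Qed.

Lemma entry_homog F r v : sa_dom F -> homog (r * v^-1)%g (entry F r v).
Proof. by move=> dF; apply: hom_comp gs _ _ _; apply: (sl_dom gs). Qed.

Lemma entry_e s f u r v : homog s f ->
  entry (e f u) r v = if (s * u)%g == r then (if u == v then f else 0) else 0.
Proof.
move=> hf; rewrite /entry (sl_e gs) eq_sym; have [->|uv] := eqVneq v u; last first.
  by rewrite (lin0 (comp_lin gs _)) if_same.
rewrite (comp_hom gs _ hf); have -> // : (r * u^-1 == s)%g = (s * u == r)%g.
by apply/eqP/eqP => [<-|<-]; rewrite ?mulgK ?mulgVK.
Qed.

(** Stated for all sufficiently large lists W, so that the lists of two matrices can be merged in
    the induction. *)
Lemma skew_to_cp_entries H : sa_dom H -> exists W0 : seq G, forall W, uniq W -> {subset W0 <= W} ->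
  skew_to_cp H = \sum_(r <- W) \sum_(v <- W) cp_gen (envQ (entry H r v)) v.
Proof.
move: H; apply: (skew_ind gs) => [s f u hf|k F F' dF dF' [W1 h1] [W2 h2]]; last first.
  exists (W1 ++ W2) => W uW WW; rewrite (skew_to_cp_lin gs)// (h1 W) ?(h2 W)//; last first.
  - by move=> r rW; apply: WW; rewrite mem_cat rW.
  - by move=> r rW; apply: WW; rewrite mem_cat rW orbT.
  rewrite scaler_sumr -big_split; apply: eq_bigr => r _ /=.
  rewrite scaler_sumr -big_split; apply: eq_bigr => v _ /=.
  by rewrite entry_lin env_lin ?(cp_gen_lin X)//; [have [] := entry_homog r v dF|have [] := entry_homog r v dF'].
exists [:: (s * u)%g; u] => W uW WW; rewrite (skew_to_cp_e gs).
have sW : (s * u)%g \in W by apply: WW; rewrite mem_head.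
have uW' : u \in W by apply: WW; rewrite !inE eqxx orbT.
have dX0 v : cp_gen (envQ 0) v = 0 by rewrite (env0 CQ (sx_dom0 sA)) (lin0 (cp_gen_lin X v)).
rewrite (eq_bigr (fun r => if (s * u)%g == r then cp_gen (envQ f) u else 0)); last first.
  move=> r _; under eq_bigr => v _ do rewrite (entry_e _ _ _ hf).
  case: eqP => _; last by rewrite big1// => v _; exact: dX0.
  rewrite (eq_bigr (fun v => if u == v then cp_gen (envQ f) u else 0)) ?sum_if_eq ?uW'//.
  by move=> v _; case: eqP => [->|_].
by rewrite sum_if_eq// sW.
Qed.

Section Rows.
Variable mu : (G -> K) -> multiplier CQG.
Hypothesis muP : @is_mult_hom R (C0G R G) CQG mu.
Hypothesis muE : forall (g : G -> K) (x : hgen), @sa_dom R (C0G R G) g -> mu g (hcol x) = g (grow x) *: hcol x.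
Notation p := (row_proj mu).

Lemma p_ecol s f u r : homog s f -> p r (ecol f u) = if (s * u)%g == r then ecol f u else 0.
Proof.
move=> hf; have := muE (Hgen u hf) (@chi_C0G R G r); rewrite /hcol /= => e1.
rewrite /row_proj [LHS]e1 /chi -[grow _]/(s * u)%g.
by case: eqP => _; rewrite ?scale1r ?scale0r.
Qed.

Lemma p_le r (a : CQG) : nm (p r a) <= nm a.
Proof.
rewrite -[leRHS]mul1r; apply: (C0_action_le muP) => //; first exact: chi_C0G.
by move=> v; rewrite /chi; case: eqP => _; rewrite ?nm1 ?nm0.
Qed.

(** This is p_r a p_v: the right multiplication by p_v is expressed through the involution because
    p_v acts on the left. *)
Definition compress r v (a : CQG) : CQG := cs_star (p v (cs_star (p r a))).

Lemma compress_le r v a : nm (compress r v a) <= nm a.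
Proof. by rewrite /compress nm_star (le_trans (p_le _ _))// nm_star p_le. Qed.

Lemma compress_lin r v : lin (compress r v).
Proof.
move=> k a b; rewrite /compress (mult_lin (p r)) cs_starD cs_starZ (mult_lin (p v)).
by rewrite cs_starD cs_starZ conjCK.
Qed.

Lemma compressE H r v : sa_dom H -> compress r v (envS H) = ecol (entry H r v) v.
Proof.
move: H; apply: (skew_ind gs) => [s f u hf|k F F' dF dF' h1 h2]; last first.
  rewrite env_lin// compress_lin h1 h2 entry_lin (ecol_lin gs)//.
  - by have [] := entry_homog r v dF.
  - by have [] := entry_homog r v dF'.
have [df _] := hf; rewrite (entry_e _ _ _ hf) /compress -/(ecol f u) (p_ecol _ _ hf).
case: eqP => [e1|_]; last by rewrite cs_star0 (lin0 (mult_lin (p v))) cs_star0 (ecol0 gs).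
rewrite (ecol_star gs CQG _ hf) (p_ecol _ _ (hom_star gs hf)) mulKg.
case: eqP => [<-|_]; last by rewrite cs_star0 (ecol0 gs).
by rewrite -(ecol_star gs CQG _ hf) cs_starK.
Qed.

(** Rows of the adjoint are columns, so both conditions together confine a to the U x U block. *)
Definition row_supported (U : seq G) (a : CQG) :=
  forall r, r \notin U -> p r a = 0 /\ p r (cs_star a) = 0.

Lemma row_supported_ex F : sa_dom F -> exists U, row_supported U (envS F).
Proof.
move: F; apply: (skew_ind gs) => [s f u hf|k F F' dF dF' [U1 h1] [U2 h2]]; last first.
  exists (U1 ++ U2) => r; rewrite mem_cat negb_or => /andP[/h1[a1 a2] /h2[b1 b2]].
  rewrite env_lin// cs_starD cs_starZ !(mult_lin (p r)) a1 a2 b1 b2.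
  by rewrite !scaler0 addr0.
exists [:: (s * u)%g; u] => r; rewrite !inE negb_or => /andP[r1 r2].
rewrite -/(ecol f u) (ecol_star gs CQG _ hf) (p_ecol _ _ hf) (p_ecol _ _ (hom_star gs hf)) mulKg.
by rewrite [_ == r]eq_sym (negPf r1) [u == r]eq_sym (negPf r2).
Qed.

(** Entries outside U x U contribute nothing. For each other entry f, in column v, |j_A(f)
    j_G(chi_v)| <= |f| <= |ecol f v| by [ecol_ge], and [ecol f v] is a compression of H. *)
Lemma skew_to_cp_crude H U : sa_dom H -> row_supported U (envS H) ->
  nm (skew_to_cp H) <= (size U)%:R ^+ 2 * nm (envS H).
Proof.
move=> dH sU; have [W0 hW] := skew_to_cp_entries dH.
pose W := undup W0; have uW : uniq W by exact: undup_uniq.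
rewrite (hW W)//; last by move=> r; rewrite mem_undup.
pose b r : R := if r \in U then 1 else 0.
have b0 r : 0 <= b r by rewrite /b; case: ifP.
have term r v : nm (cp_gen (envQ (entry H r v)) v) <= b r * (b v * nm (envS H)).
  have [dent _] := entry_homog r v dH.
  apply: le_trans (cp_gen_le X _ _) _.
  apply: le_trans (ecol_ge gs CQ CQG v (entry_homog r v dH)) _.
  rewrite -compressE// /b; case: ifPn => [rU|/sU[h1 _]]; last first.
    by rewrite /compress h1 cs_star0 (lin0 (mult_lin (p v))) cs_star0 nm0 mul0r.
  rewrite mul1r; case: ifPn => [vU|/sU[_ h2]]; first by rewrite mul1r compress_le.
  rewrite mul0r; have -> : compress r v (envS H) = 0; last by rewrite nm0.
  apply: cs_star_ext => c; rewrite cs_mul0r /compress -cs_starM.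
  suff -> : p v (cs_star (p r (envS H))) = 0 by rewrite cs_mul0l cs_star0.
  apply: cs_ext => d; rewrite cs_mul0l -(mult_mul (p v)) (row_proj_adj muP).
  by rewrite mult_mul h2 cs_mul0l.
have sumb : \sum_(r <- W) b r <= (size U)%:R.
  rewrite -big_mkcond /= big_const_seq iter_addr_0 ler_nat -size_filter.
  apply: uniq_leq_size; first exact: filter_uniq.
  by move=> r; rewrite mem_filter => /andP[].
apply: le_trans (nm_sum _ _) _.
apply: le_trans (_ : _ <= \sum_(r <- W) b r * ((size U)%:R * nm (envS H))) _.
  apply: ler_sum => r _; apply: le_trans (nm_sum _ _) _.
  apply: le_trans (_ : _ <= \sum_(v <- W) b r * (b v * nm (envS H))) _.
    by apply: ler_sum => v _; exact: term.
  rewrite -mulr_sumr -mulr_suml ler_wpM2l// ler_wpM2r ?nm_ge0//.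
rewrite -mulr_suml expr2 -mulrA ler_wpM2r//.
by rewrite mulr_ge0 ?nm_ge0.
Qed.

Theorem skew_to_cp_norm_le F : sa_dom F -> nm (skew_to_cp F) <= nm (envS F).
Proof.
move=> dF; have [U sU] := row_supported_ex dF.
have dS := sx_domS sS dF.
(* F^* F raised to the power 2^n. All these are self-adjoint, so the C*-identity computes their
   norms on both sides, and they remain supported in the block of F. *)
pose Fn n := iter n (fun H => sa_mul H H) (sa_mul (sa_star F) F).
have Fn1 n : [/\ sa_dom (Fn n), cs_star (envS (Fn n)) = envS (Fn n),
    cs_star (skew_to_cp (Fn n)) = skew_to_cp (Fn n) & row_supported U (envS (Fn n))].
  elim: n => [|n [h1 h2 h3 h4]] /=.
    have d0 := sx_domM sS dS dF; split => //.
    - by rewrite env_mul// env_star// cs_starM cs_starK.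
    - by rewrite (skew_to_cp_mul gs deltaE)// (skew_to_cp_star gs deltaE)// cs_starM cs_starK.
    - move=> r /sU[a1 a2]; rewrite env_mul// env_star// cs_starM cs_starK mult_mul a2 cs_mul0l.
      by [].
  split; first exact: (sx_domM sS).
  - by rewrite env_mul// cs_starM h2.
  - by rewrite (skew_to_cp_mul gs deltaE)// cs_starM h3.
  - by move=> r /h4[a1 _]; rewrite env_mul// cs_starM h2 mult_mul a1 cs_mul0l.
have nE n : nm (envS (Fn n)) = nm (envS F) ^+ 2 ^+ (2 ^ n).
  elim: n => [|n IH] /=.
    by rewrite env_mul// env_star// nm_starM expr1.
  have [h1 h2 _ _] := Fn1 n; rewrite env_mul// -{1}h2 nm_starM IH -exprM expnS mulnC//.
have nD n : nm (skew_to_cp (Fn n)) = nm (skew_to_cp F) ^+ 2 ^+ (2 ^ n).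
  elim: n => [|n IH] /=.
    by rewrite (skew_to_cp_mul gs deltaE)// (skew_to_cp_star gs deltaE)// nm_starM expr1.
  have [h1 _ h2 _] := Fn1 n; rewrite (skew_to_cp_mul gs deltaE)// -{1}h2 nm_starM IH -exprM expnS mulnC//.
rewrite -ler_sqr ?nnegrE ?nm_ge0//.
apply: (@power_trick R _ _ ((size U)%:R ^+ 2)); [exact: sqr_ge0|exact: sqr_ge0|].
move=> n; rewrite -nE -nD; have [h1 _ _ h4] := Fn1 n; exact: skew_to_cp_crude.
Qed.
End Rows.
End Isomorphism.

(** * Assembly of the equivariant isomorphism *)

Section Equivariance.
Variables (R : realType) (G : groupType) (A S : starAlgebra R).
Variables (comp : G -> A -> A) (e : A -> G -> S) (sl : S -> G -> A).
Hypothesis gs : graded_skew comp e sl.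
Notation K := (Cplx R).
Notation homog := (homog comp).
Notation hgen := (hgen comp).
Variables (CQ : enveloping A) (CQG : enveloping S).
Notation ecol := (ecol e CQG).
Notation "x ** y" := (cs_mul x y) (at level 40, left associativity).
Notation envQ := (env_map CQ).
Notation envS := (env_map CQG).
Variables (CG : groupCstar R G) (T : tensorProduct CQ CG) (delta : CQ -> T).
Hypothesis deltaP : @is_star_hom R CQ T delta.
Hypothesis deltaE : forall s f, homog s f -> delta (env_map CQ f) = tens T (env_map CQ f) (unitary CG s).
Variable X : crossedProduct delta.
Variables (dual : G -> X -> X) (beta : G -> CQG -> CQG).
Hypothesis dualP : is_dual_action dual.
Hypothesis betaP : is_action beta.
Hypothesis betaE : forall s f u, sa_dom f -> beta s (ecol f u) = ecol f (u * s^-1)%g.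
Implicit Types (f g : A) (F H : S) (r s t u v w : G) (x y : X).

Let sS : star_axioms S := gr_S gs.
Notation cp_gen := (cp_gen X).
Notation skew_to_cp := (@skew_to_cp R G A S sl CQ CG T delta X).
Notation SF := {F : S | sa_dom F}.

Let cov := cp_covariant X.
Let jP : @is_mult_hom R CQ X (cp_A X). Proof. by have [[]] := cov. Qed.
Let qP : @is_mult_hom R (C0G R G) X (cp_G X). Proof. by have [_ []] := cov. Qed.

(** Each beta_s is a *-homomorphism, hence contractive, and a suitable one carries any column to any
    other. *)
Lemma ecol_shift f u v : sa_dom f -> nm (ecol f u) = nm (ecol f v).
Proof.
move=> df; have le w z : nm (ecol f z) <= nm (ecol f w).
  have -> : ecol f z = beta (z^-1 * w)%g (ecol f w).
    by rewrite betaE// invgM invgK mulgA mulgV mul1g.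
  by have [h _ _] := betaP; exact: star_hom_le (h _) _.
by apply/eqP; rewrite eq_le !le.
Qed.

(** In a spanning product j_A(a) j_G(g), a is approximated by an image of A and g by a finitely
    supported function. Each error is at most eps/3, which leaves room for the strict inequality. *)
Lemma skew_to_cp_dense : densefam (fun F : SF => skew_to_cp (sval F)).
Proof.
apply: (densefam_trans (span_densefam (cp_dense X))) => -[d [a [g [dg dE]]]] eps e0 /=.
have vg := (C0_vanishing _ _ _).1 dg; have [C [C0 hC]] := vanishing_bounded vg.
have C1 : 0 < C + 1 by rewrite ltr_wpDl.
have [f df hf] := env_approx a (divr_gt0 (divr_gt0 e0 (@ltr0n R 3)) C1).
have n1 : 0 < nm (envQ f) + 1 by rewrite ltr_wpDl ?nm_ge0.
have [z hz] := C0_action_approx qP dg (divr_gt0 (divr_gt0 e0 (@ltr0n R 3)) n1).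
exists [seq (p.1, exist _ (e f p.2) (e_dom gs p.2 df) : SF) | p <- z].
set d' := lc _ _.
have d'E x : d' ** x = cp_A X (envQ f) (lc (fun u => row_proj (cp_G X) u x) z).
  rewrite /d' (lin_lc (cs_mull_lin x)) (lin_lc (mult_lin _)) /lc big_map.
  by apply: eq_bigr => p _ /=; rewrite (skew_to_cp_e gs) -cp_genE.
have [jl _ _] := jP.
apply: le_lt_trans (_ : _ <= eps / 3 + eps / 3) _; last by lra.
apply: nm_le_mul => [|x]; first by rewrite addr_ge0// divr_ge0 ?ltW.
rewrite cs_mulBl d'E -dE.
have -> : cp_A X a (cp_G X g x) = cp_A X (a - envQ f) (cp_G X g x) + cp_A X (envQ f) (cp_G X g x).
  rewrite (_ : a - envQ f = -1 *: envQ f + a); last by rewrite scaleN1r addrC.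
  by rewrite jl// scaleN1r addrAC addNr add0r.
rewrite -addrA -(linB (mult_lin (cp_A X (envQ f)))) mulrDl (le_trans (nmD _ _))// lerD//.
- apply: le_trans (mult_hom_le jP _ _) _.
  apply: le_trans (_ : _ <= nm (a - envQ f) * (C * nm x)) _.
    by rewrite ler_wpM2l ?nm_ge0//; exact: (C0_action_le qP).
  rewrite mulrA ler_wpM2r ?nm_ge0//.
  move: hf; rewrite ltr_pdivlMr// => /ltW; apply: le_trans.
  by rewrite ler_wpM2l ?nm_ge0// lerDl.
- apply: le_trans (mult_hom_le jP _ _) _.
  apply: le_trans (_ : _ <= nm (envQ f) * (eps / 3 / (nm (envQ f) + 1) * nm x)) _.
    by rewrite ler_wpM2l ?nm_ge0.
  rewrite mulrA ler_wpM2r ?nm_ge0// mulrA ler_pdivrMr// mulrC ler_wpM2l//.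
    by rewrite divr_ge0 ?ltW.
  by rewrite lerDl.
Qed.

Theorem skew_equivariantly_isomorphic : equivariantly_isomorphic dual beta.
Proof.
have [pi [piP piE]] := action_mult_hom gs CQ ecol_shift.
have [mu [muP muN muE]] := row_mult_hom gs CQG.
have [Phi [PhiP PhiN PhiA PhiG]] :=
  @cp_universal _ _ _ _ _ _ X _ _ _ (pair_covariant gs deltaP deltaE piP muP muN piE muE).
have [Pl Pm Ps] := PhiP.
(* The universal property describes Phi only on vectors Phi(x) c; nondegeneracy makes these span a
   dense subspace. *)
have PhidX a v b : Phi (cp_gen a v) b = pi a (mu (chi R v) b).
  move: b; apply: (mult_eq_dense (m' := mult_comp (pi a) (mu (chi R v))) (span_densefam PhiN)).
  move=> [z [x [c [_ zE]]]] /=; rewrite zE -Pm// -PhiG; last exact: chi_C0G.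
  by rewrite -PhiA cp_genE.
have PhiD F b : sa_dom F -> Phi (skew_to_cp F) b = envS F ** b.
  move=> dF; move: F dF; apply: (skew_ind gs) => [s f u hf|k F F' dF dF' h1 h2]; last first.
    by rewrite (skew_to_cp_lin gs)// Pl// h1 h2 env_lin// cs_mulDl cs_mulZl.
  have [df _] := hf.
  by rewrite (skew_to_cp_e gs) PhidX -(@ecol_pi_mu _ _ _ _ _ _ _ gs CQ CQG pi mu piE muE).
have normD F : sa_dom F -> nm (skew_to_cp F) = nm (envS F).
  move=> dF; apply/eqP; rewrite eq_le (skew_to_cp_norm_le gs deltaE X muP muE)//=.
  apply: nm_le_mul => [|b]; first exact: nm_ge0.
  by rewrite -PhiD// (mult_hom_le PhiP).
have lcD (s : seq (K * SF)) : exists2 F, sa_dom F & lc (fun F : SF => skew_to_cp (sval F)) s = skew_to_cp F /\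
    lc (fun F : SF => envS (sval F)) s = envS F.
  have [F dF hF] := lc_dom (sx_dom0 sS) (@sx_domP _ _ sS) s; exists F => //.
  rewrite (hF _ skew_to_cp) ?(hF _ envS)//; last by move=> k a b da db; rewrite (skew_to_cp_lin gs).
  by move=> k a b; exact: env_lin.
have [|th [thl thb thE]] := bnd_extend skew_to_cp_dense (t := fun F : SF => envS (sval F)) (C := 1) (@complete_seq R CQG).
  by move=> s; have [F dF [-> ->]] := lcD s; rewrite normD// mul1r.
have [|th' [thl' thb' thE']] := bnd_extend (@env_densefam R S CQG) (t := fun F : SF => skew_to_cp (sval F)) (C := 1) (@complete_seq R X).
  by move=> s; have [F dF [-> ->]] := lcD s; rewrite normD// mul1r.
(* Phi takes values in left multiplications by elements, so the algebraic laws of [th] are read off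
   from those of Phi. *)
have thPhi x b : Phi x b = th x ** b.
  move: x; apply: (@bnd_eq _ _ _ _ skew_to_cp_dense _ (fun x => Phi x b) (fun x => th x ** b) (nm b) (1 * nm b)).
  - by move=> k x y; rewrite Pl.
  - by move=> x; rewrite mulrC mult_hom_le.
  - by move=> k x y; rewrite thl cs_mull_lin.
  - move=> x; rewrite (le_trans (nm_mul _ _))// mulrAC ler_wpM2r ?nm_ge0//; exact: thb.
  - by move=> [F dF] /=; rewrite PhiD// -(thE (exist _ F dF)).
exists th; split.
- split.
  + by move=> k x y _ _; exact: thl.
  + by move=> x y _ _; apply: cs_ext => b; rewrite -thPhi Pm// !thPhi cs_mulA.
  + move=> x _; apply: cs_ext => b; rewrite -thPhi Ps//; apply: cs_star_ext => c.
    by rewrite -mult_adjP thPhi cs_starM cs_mulA.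
- exists th'.
  + apply: (@bnd_eq _ _ _ _ skew_to_cp_dense _ (fun x => th' (th x)) id 1 1).
    * by move=> k x y; rewrite thl thl'.
    * by move=> x; rewrite (le_trans (thb' _))// ler_wpM2l// (le_trans (thb _))// mul1r.
    * by [].
    * by move=> x; rewrite mul1r.
    * by move=> F; rewrite thE thE'.
  + apply: (@bnd_eq _ _ _ _ (@env_densefam R S CQG) _ (fun b : CQG => th (th' b)) id 1 1).
    * by move=> k x y; rewrite thl' thl.
    * by move=> x; rewrite (le_trans (thb _))// ler_wpM2l// (le_trans (thb' _))// mul1r.
    * by [].
    * by move=> x; rewrite mul1r.
    * by move=> F; rewrite thE' thE.
- move=> s; have [[dh _ _] dualE] := dualP; have [bh _ _] := betaP.
  apply: (@bnd_eq _ _ _ _ skew_to_cp_dense _ (fun x => th (dual s x)) (fun x => beta s (th x)) 1 1).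
  + by move=> k x y; rewrite (star_hom_lin (dh s)) thl.
  + by move=> x; rewrite (le_trans (thb _))// ler_wpM2l// (star_hom_le (dh s)).
  + by move=> k x y; rewrite thl (star_hom_lin (bh s)).
  + by move=> x; rewrite (le_trans (star_hom_le (bh s) _))//; exact: thb.
  move=> [F dF]; rewrite thE /=; move: F dF.
  apply: (skew_ind gs) => [t f u hf|k F F' dF dF' h1 h2]; last first.
    rewrite (skew_to_cp_lin gs)// (star_hom_lin (dh s)) thl h1 h2 env_lin// (star_hom_lin (bh s)).
    by [].
  have [df _] := hf; rewrite (skew_to_cp_e gs).
  rewrite (dualE s u (envQ f) _ (cp_gen (envQ f) (u * s^-1)%g)); [|by move=> x; rewrite -cp_genE..].
  rewrite -/(ecol f u) betaE// -(skew_to_cp_e gs).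
  exact: (thE (exist _ (e f (u * s^-1)%g) (e_dom gs _ df))).
Qed.
End Equivariance.

Theorem theorem4p3 (R : realType) (Q : topologicalType) (D : groupoidData Q)
  (G : groupType) (c : Q -> G)
  (Q_r_discrete : r_discrete D) (Q_hausdorff : hausdorff_space Q)
  (c_hom : is_groupoid_hom D c)
  (c_continuous : continuous (c : Q -> discrete_topology G))
  (CQ : groupoidCstar R D)
  (CN : groupoidCstar R (subgroupoid D [set x | c x = 1%g]))
  (CQG : groupoidCstar R (skew_product D c))
  (CG : groupCstar R G)
  (T : tensorProduct CQ CG)
  (delta : CQ -> T) (delta_coaction : is_coaction delta)
  (delta_val : forall (s : G) (f : Q -> Cplx R),
     @sa_dom R (Cc R D) f -> supp f `<=` c @^-1` [set s] ->
     delta (env_map CQ f) = tens T (env_map CQ f) (unitary CG s))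
  (i : CN -> CQ) (i_hom : @is_star_hom R CN CQ i)
  (i_ext : forall f : [set x | c x = 1%g] -> Cplx R,
     @sa_dom R (Cc R (subgroupoid D [set x | c x = 1%g])) f ->
     i (env_map CN f) = env_map CQ (extend0 f))
  (i_faithful : injective i)
  (X : crossedProduct delta)
  (dual : G -> X -> X) (dual_action : is_dual_action dual)
  (beta : G -> CQG -> CQG) (beta_action : is_action beta)
  (beta_val : forall (s : G) (f : Q * discrete_topology G -> Cplx R),
     @sa_dom R (Cc R (skew_product D c)) f ->
     beta s (env_map CQG f) =
     env_map CQG (fun p => f (p.1, ((p.2 : G) * s)%g))) :
  equivariantly_isomorphic dual beta.
Proof.
have [tD _ lD] := Q_r_discrete.
have gs := @skew_graded R Q D tD lD Q_hausdorff G c c_hom c_continuous.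
have [deltaP _ _ _] := delta_coaction.
apply: (skew_equivariantly_isomorphic gs deltaP _ dual_action beta_action).
(* The support is a closure, but c is locally constant, so the value s persists on it. *)
- move=> s f [df /componentP hf]; apply: delta_val => // x fx.
  have [y [/= /eqP/hf ys yx]] := fx _ (hom_locally_constant c_continuous x).
  by rewrite /= -yx.
(* t s = u exactly when t = u s^-1, so the translate of column u is column u s^-1. *)
- move=> s f u df; rewrite beta_val; last exact: column_dom.
  congr env_map; apply/funext => p; rewrite /column /=.
  by congr (if _ then _ else _); apply/eqP/eqP => [<-|->]; rewrite ?mulgK ?mulgVK.
Qed.
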